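(* Let $n\ge1$ be an integer, let $p\ge1$, let $u_0\in C^0(\mathbb{R}^n)\cap L^\infty(\mathbb{R}^n)$ be positive, and let $u$ denote the minimal solution of $u_t=u^p\Delta u$ in $\mathbb{R}^n\times(0,\infty)$, $u(\cdot,0)=u_0$. (i) If $$u_0(x)\ge C_0(1+|x|)^{-\gamma}\qquad\text{for all }x\in\mathbb{R}^n$$ with some $C_0>0$ and $\gamma>0$, then for any $q\in(\frac n\gamma,\infty]$ there exists $C>0$ such that $$\|u(\cdot,t)\|_{L^q(\mathbb{R}^n)}\ge C\,t^{-\left(\gamma-\frac nq\right)/(p\gamma+2)}\qquad\text{for all }t>1.$$ (ii) If $p>1$ and there exist $\gamma>0$ and $C_1>0$ such that $$u_0(x)\le C_1(1+|x|)^{-\gamma}\qquad\text{for all }x\in\mathbb{R}^n,$$ then for any $q\in(\frac n\gamma,\infty]$ one can find $C>0$ such that $$\|u(\cdot,t)\|_{L^q(\mathbb{R}^n)}\le C\,t^{-\left(\gamma-\frac nq\right)/(p\gamma+2)}\qquad\text{for all }t>0.$$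
   Context: For $q=\infty$ the quotient $n/q$ is read as $0$. For $0<q<\infty$ (including $q<1$), $\|\varphi\|_{L^q(\mathbb{R}^n)}=\left(\int_{\mathbb{R}^n}|\varphi|^q\right)^{1/q}$ (possibly $+\infty$). For $T\in(0,\infty]$, a positive classical solution on $[0,T)$ of $u_t=u^p\Delta u$, $u(\cdot,0)=u_0$ is a positive function in $C^0(\mathbb{R}^n\times[0,T))\cap C^{2,1}(\mathbb{R}^n\times(0,T))$ satisfying the equation in $\mathbb{R}^n\times(0,T)$ and the initial condition. The minimal solution $u$ is the (unique) global positive classical solution ($T=\infty$) such that $u\le\tilde u$ in $\mathbb{R}^n\times(0,T)$ for every $T\in(0,\infty]$ and every positive classical solution $\tilde u$ on $[0,T)$; it exists for every positive $u_0\in C^0(\mathbb{R}^n)\cap L^\infty(\mathbb{R}^n)$ and satisfies $0<u\le\|u_0\|_{L^\infty(\mathbb{R}^n)}$. *)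

(* Defs.v *)
From HB Require Import structures.
From mathcomp Require Import all_boot all_order all_algebra.
From mathcomp Require Import all_classical all_reals all_analysis.

Set Implicit Arguments.
Unset Strict Implicit.
Unset Printing Implicit Defensive.
Import Order.TTheory GRing.Theory Num.Theory.
Import numFieldNormedType.Exports.
Local Open Scope classical_set_scope.
Local Open Scope ring_scope.

(* Points of R^n are row vectors 'rV[R]_n, which carry the topology and the
   normed-module structure used for limits and derivatives. The library has no
   Lebesgue measure on them, but it has the product sigma-algebra on n-tuples;
   Lebesgue measure is built there as the n-fold product of the
   one-dimensional one, and row vectors are identified with tuples. *)
Section lebesgue_measure_cons.
Context {R : realType} {n : nat}.
Variable mu : {sigma_finite_measure set (n.-tuple (measurableTypeR R)) -> \bar R}.

Definition cons_pair (a : measurableTypeR R * n.-tuple (measurableTypeR R)) :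
  n.+1.-tuple (measurableTypeR R) := [tuple of a.1 :: a.2].

Lemma measurable_cons_pair : measurable_fun setT cons_pair.
Proof. exact: (measurable_cons measurable_fst measurable_snd). Qed.

Definition lebesgue_measure_cons :
    set (n.+1.-tuple (measurableTypeR R)) -> \bar R :=
  pushforward (@lebesgue_measure R \x mu)%E cons_pair.

Let lebesgue_measure_cons0 : lebesgue_measure_cons set0 = 0%E.
Proof. by rewrite /lebesgue_measure_cons /pushforward preimage_set0 measure0. Qed.

Let lebesgue_measure_cons_ge0 A : (0 <= lebesgue_measure_cons A)%E.
Proof. by rewrite /lebesgue_measure_cons /pushforward; apply: measure_ge0. Qed.

Let lebesgue_measure_cons_sigma_additive :
  semi_sigma_additive lebesgue_measure_cons.
Proof.
move=> F mF tF mUF; rewrite /lebesgue_measure_cons /pushforward.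
rewrite preimage_bigcup; apply: measure_semi_sigma_additive.
- by move=> k; rewrite -[X in measurable X]setTI; exact: measurable_cons_pair.
- apply/trivIsetP => /= i j _ _ ij; rewrite -preimage_setI.
  by move/trivIsetP : tF => /(_ _ _ _ _ ij) ->//; rewrite preimage_set0.
- rewrite -preimage_bigcup -[X in measurable X]setTI.
  exact: measurable_cons_pair.
Qed.

HB.instance Definition _ := isMeasure.Build _ _ _ lebesgue_measure_cons
  lebesgue_measure_cons0 lebesgue_measure_cons_ge0
  lebesgue_measure_cons_sigma_additive.

Let lebesgue_measure_cons_sigma_finite : sigma_finite setT lebesgue_measure_cons.
Proof.
have [F FT mF] : sigma_finite setT (@lebesgue_measure R \x mu)%E.
  have /sigma_finiteP[F [TF ndF Foo]] := sigma_finiteT (@lebesgue_measure R).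
  have /sigma_finiteP[G [TG ndG Goo]] := sigma_finiteT mu.
  exists (fun k => F k `*` G k).
    rewrite -setXTT TF TG predeqE => -[x y]; split.
      move=> [/= [k _ Fkx] [l _ Gly]]; exists (maxn k l) => //; split.
      - by move: x Fkx; exact/subsetPset/ndF/leq_maxl.
      - by move: y Gly; exact/subsetPset/ndG/leq_maxr.
    by move=> [k _ []/= ? ?]; split; exists k.
  move=> k; have [? ?] := Foo k; have [? ?] := Goo k.
  split; first exact: measurableX.
  by rewrite product_measure1E// lte_mul_pinfty// ge0_fin_numE.
pose g (t : n.+1.-tuple (measurableTypeR R)) := (thead t, [tuple of behead t]).
have mg : measurable_fun setT g.
  apply/measurable_fun_pair => /=; first exact: measurable_tnth.
  exact: measurable_behead.
have gK : cancel cons_pair g.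
  by move=> [a t]; rewrite /g /=; congr pair; apply/val_inj.
exists (fun i => g @^-1` (F i)).
  by rewrite -preimage_bigcup -FT preimage_setT.
move=> i; have [mFi Fioo] := mF i; split.
  by rewrite -[X in measurable X]setTI; exact: mg.
rewrite /lebesgue_measure_cons /pushforward -comp_preimage.
by rewrite (_ : g \o cons_pair = id)//; apply/funext => a; exact: gK.
Qed.

HB.instance Definition _ := Measure_isSigmaFinite.Build _ _ _
  lebesgue_measure_cons lebesgue_measure_cons_sigma_finite.

End lebesgue_measure_cons.

Fixpoint lebesgue_tuple (R : realType) (n : nat) :
    {sigma_finite_measure set (n.-tuple (measurableTypeR R)) -> \bar R} :=
  match n with
  | 0 => \d_([tuple] : 0.-tuple (measurableTypeR R))
  | m.+1 => lebesgue_measure_cons (lebesgue_tuple R m)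
  end.

Lemma lebesgue_tuple_box (R : realType) (n : nat)
    (A : 'I_n -> set (measurableTypeR R)) :
  (forall i, measurable (A i)) ->
  lebesgue_tuple R n [set t | forall i, A i (tnth t i)] =
  (\prod_(i < n) lebesgue_measure (A i))%E.
Proof.
elim: n A => [|n IHn] A mA.
  by rewrite big_ord0 /= diracE mem_set//= => -[].
rewrite big_ord_recl -(IHn (fun i => A (lift ord0 i)))//.
rewrite -(@product_measure1E _ _ _ _ _ lebesgue_measure (lebesgue_tuple R n))//.
  rewrite /= /lebesgue_measure_cons /pushforward; congr product_measure1.
  apply/seteqP; split => -[a t] /= => [H|[H0 H1] i].
    split=> [|i]; first by have := H ord0; rewrite tnth0.
    by have := H (lift ord0 i); rewrite tnthS.
  by case: (unliftP ord0 i) => [j|] ->; rewrite ?tnthS ?tnth0.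
rewrite (_ : mkset _ = \bigcap_(i in [set: 'I_n])
    ((fun t : n.-tuple (measurableTypeR R) => tnth t i) @^-1` A (lift ord0 i))).
  apply: fin_bigcap_measurable => // i _.
  by rewrite -[X in measurable X]setTI; exact: measurable_tnth.
by apply/seteqP; split => t /= H i => [_|]; exact: H.
Qed.

(* For q finite this is (\int |phi|^q)^(1/q), also when q < 1, and for q = +oo
   the essential supremum of |phi|. *)
Definition Lq_norm (R : realType) (n : nat) (q : \bar R) (phi : 'rV[R]_n -> R) :
    \bar R :=
  Lnorm (lebesgue_tuple R n) q (fun t => (phi (\row_i tnth t i))%:E).

(* The library's norm on 'rV[R]_n is the maximum norm. *)
Definition euclidean_norm (R : realType) (n : nat) (x : 'rV[R]_n) : R :=
  Num.sqrt (\sum_(i < n) x 0 i ^+ 2).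

(* n / q, read as 0 for q = +oo. *)
Definition dim_div (R : realType) (n : nat) (q : \bar R) : R :=
  if q is r%:E then n%:R / r else 0.

Section classical_solutions.
Context {R : realType} {n : nat}.
Implicit Types (u : 'rV[R]_n -> R -> R) (T : \bar R).

Definition time_deriv u (x : 'rV[R]_n) (t : R) : R := derive1 (u x) t.

Definition space_deriv (i : 'I_n) u (x : 'rV[R]_n) (t : R) : R :=
  'D_(delta_mx 0 i) (u ^~ t) x.

Definition laplacian u (x : 'rV[R]_n) (t : R) : R :=
  \sum_(i < n) space_deriv i (space_deriv i u) x t.

Definition closed_start T : set ('rV[R]_n * R) :=
  [set z | 0 <= z.2 /\ (z.2%:E < T)%E].

Definition open_start T : set ('rV[R]_n * R) :=
  [set z | 0 < z.2 /\ (z.2%:E < T)%E].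

Definition continuous_on (D : set ('rV[R]_n * R)) u : Prop :=
  {within D, continuous (fun z => u z.1 z.2)}.

(* derive and derive1 return junk values where the derivative does not exist, hence
   the separate derivability clauses. *)
Definition C21_on (D : set ('rV[R]_n * R)) u : Prop :=
  [/\ forall x t, D (x, t) ->
        [/\ derivable (u x) t 1,
            forall i, derivable (u ^~ t) x (delta_mx 0 i) &
            forall i j, derivable (space_deriv i u ^~ t) x (delta_mx 0 j)],
      continuous_on D u,
      continuous_on D (time_deriv u),
      forall i, continuous_on D (space_deriv i u) &
      forall i j, continuous_on D (space_deriv j (space_deriv i u))].

(* A function on R^n x [0, T) is represented by a total one, whose values at
   other times are irrelevant. *)
Definition positive_classical_solution (p : R) (u0 : 'rV[R]_n -> R) T u : Prop :=
  [/\ forall x t, 0 <= t -> (t%:E < T)%E -> 0 < u x t,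
      continuous_on (closed_start T) u,
      C21_on (open_start T) u,
      forall x t, 0 < t -> (t%:E < T)%E ->
        time_deriv u x t = u x t `^ p * laplacian u x t &
      forall x, u x 0 = u0 x].

Definition minimal_solution (p : R) (u0 : 'rV[R]_n -> R) u : Prop :=
  positive_classical_solution p u0 +oo%E u /\
  forall T (v : 'rV[R]_n -> R -> R), (0 < T)%E ->
    positive_classical_solution p u0 T v ->
    forall x t, 0 < t -> (t%:E < T)%E -> u x t <= v x t.

End classical_solutions.

(* Main.v *)
Require Import Defs.
From HB Require Import structures.
From mathcomp Require Import all_boot all_order all_algebra.
From mathcomp Require Import all_classical all_reals all_analysis.
From mathcomp Require Import ring lra zify.

Import Order.TTheory GRing.Theory Num.Theory.
Import numFieldNormedType.Exports.
Local Open Scope classical_set_scope.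
Local Open Scope ring_scope.

(* (i) The solution stays above the subsolution d e^(-K t) (rho^2 - |x|^2)_+ with
   rho = 2 t^(1/(p gamma + 2)) and d of order rho^(- gamma - 2), for which K t stays
   bounded; hence u(., t) >= c t^(- gamma/(p gamma + 2)) on a ball of radius
   t^(1/(p gamma + 2)), and integrating over a cube in that ball gives the bound.

   (ii) For p > 1 the equation has a self-similar supersolution W which is a concave
   function of |x|^2 near the origin and decays like |x|^(- gamma) outside. Comparing
   u with W requires decay of u as |x| -> oo, which is not clear for the
   minimal solution. By minimality it suffices to produce one solution that decays
   uniformly on bounded time intervals. It is obtained as the limit, along an
   ultrafilter of mesh sizes h -> 0, of an explicit finite difference scheme on h Z^n;
   C^{2,1} compactness comes from discrete interior estimates: a Benilan-Crandall
   inequality, an oscillation decay at small scales, and Bernstein's method for the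
   differences of order up to three. The resulting bound
   u <= C min(t^(- gamma/(p gamma + 2)), |x|^(- gamma)) is integrated over dyadic cubes. *)

(** * Functions on the integer lattice *)

(** The obstacle in (ii) is regularity: the equation is quasilinear, not in divergence form, and
    degenerate where [u] vanishes. A truncated paraboloid keeps the scheme above a positive constant
    on compact sets, uniformly in [h], so it is locally uniformly parabolic. Differencing the
    coefficient creates a term quartic in the gradient, so Bernstein's gradient estimate closes only
    when the oscillation is small. Small oscillation comes from the Benilan-Crandall inequality:
    time slices are almost subharmonic, and averaging in time also controls the positive part of the
    Laplacian, so that the spreading of smallness reduces to an elliptic comparison. For second and
    third differences the mesh size is the small parameter. An ultrafilter makes all locally bounded
    quantities converge at every point at once, and a limit over all grid points near [(x, t)] is
    automatically continuous. The condition [p > 1] enters through the barrier, whose outer branch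
    is singular at [q = P]: its corner at [q = (1 + dl) P] is concave once [dl^(p - 1)] is small. *)

Lemma sqr_sum_le {R : realType} {T : finType} (v : T -> R) :
  (\sum_i v i) ^+ 2 <= #|T|%:R * \sum_i v i ^+ 2.
Proof.
rewrite expr2 mulr_suml.
have -> : \sum_i v i * \sum_j v j = \sum_i \sum_j v i * v j.
  by apply: eq_bigr => i _; rewrite mulr_sumr.
have E : #|T|%:R * \sum_i v i ^+ 2 = \sum_i \sum_j (v i ^+ 2 + v j ^+ 2) / 2.
  transitivity (\sum_i (#|T|%:R * v i ^+ 2 / 2 + (\sum_j v j ^+ 2) / 2)).
    rewrite big_split /= sumr_const -mulr_suml -mulr_sumr -mulr_natl; lra.
  apply: eq_bigr => i _; rewrite -mulr_suml big_split /= sumr_const.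
  by rewrite -[X in (X + _) / 2]mulr_natl mulrDl.
rewrite E; apply: ler_sum => i _; apply: ler_sum => j _.
have := sqr_ge0 (v i - v j); lra.
Qed.

Section Lattice.
Context {R : realType} {n : nat}.
Local Notation I := ('rV[int]_n).
Implicit Types (f g : I -> R) (x y c : I) (a r : R).

Definition unitv (j : 'I_n) : I := delta_mx 0 j.
Definition lap f x : R :=
  \sum_j (f (x + unitv j) + f (x - unitv j) - 2 * f x).
(** The square field (carre du champ) of the lattice Laplacian: by [lap_sqr] it is
    [lap (f^2) - 2 f lap f]. It is the dissipation in the energy estimates below. *)
Definition gam f x : R :=
  \sum_j ((f (x + unitv j) - f x) ^+ 2 + (f (x - unitv j) - f x) ^+ 2).
(** One explicit Euler step with Courant number [a]. For [0 <= a] and [2 n a <= 1] it is an average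
    over [x] and its neighbours with weight [1 - 2 n a] at the centre, hence monotone; all maximum
    principles rest on this. *)
Definition avg a f x : R := f x + a * lap f x.
Definition crd x c j : R := (x 0 j - c 0 j)%:~R.
Definition sqd c x : R := \sum_j crd x c j ^+ 2.
Definition box c r x := forall j, `|crd x c j| <= r.

Lemma crdDu x c i j : crd (x + unitv j) c i = crd x c i + (i == j)%:R.
Proof.
rewrite /crd !mxE eqxx /= addrAC [LHS]intrD; congr (_ + _).
by case: (i == j).
Qed.

Lemma crdBu x c i j : crd (x - unitv j) c i = crd x c i - (i == j)%:R.
Proof.
rewrite /crd !mxE eqxx /= addrAC [LHS]intrB; congr (_ - _).
by case: (i == j).
Qed.

Lemma crdxx x i : crd x x i = 0.
Proof. by rewrite /crd subrr. Qed.

Lemma crdC x y i : crd x y i = - crd y x i.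
Proof. by rewrite /crd -mulrNz opprB. Qed.

Lemma crd_tri x y z i : crd x z i = crd x y i + crd y z i.
Proof. by rewrite /crd -intrD; congr (_ %:~R); ring. Qed.

Lemma sqdDu x c j : sqd c (x + unitv j) = sqd c x + 2 * crd x c j + 1.
Proof.
rewrite /sqd (bigD1 j) //= [in RHS](bigD1 j) //= crdDu eqxx.
rewrite (eq_bigr (fun i => crd x c i ^+ 2)); first by rewrite /=; ring.
by move=> i /negbTE ij; rewrite crdDu ij addr0.
Qed.

Lemma sqdBu x c j : sqd c (x - unitv j) = sqd c x - 2 * crd x c j + 1.
Proof.
rewrite /sqd (bigD1 j) //= [in RHS](bigD1 j) //= crdBu eqxx.
rewrite (eq_bigr (fun i => crd x c i ^+ 2)); first by rewrite /=; ring.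
by move=> i /negbTE ij; rewrite crdBu ij subr0.
Qed.

Lemma sqd_ge0 c x : 0 <= sqd c x.
Proof. by apply: sumr_ge0 => j _; exact: sqr_ge0. Qed.

Lemma sqdxx x : sqd x x = 0.
Proof. by apply: big1 => j _; rewrite crdxx expr0n. Qed.

Lemma crd_sqd c x j : crd x c j ^+ 2 <= sqd c x.
Proof.
by rewrite /sqd (bigD1 j) //= lerDl; apply: sumr_ge0 => i _; exact: sqr_ge0.
Qed.

Lemma sqd_box c x r : 0 <= r -> sqd c x <= r ^+ 2 -> box c r x.
Proof.
move=> r0 h j; rewrite -(@ler_pXn2r _ 2) ?nnegrE// real_normK ?num_real//.
exact: le_trans (crd_sqd _ _ _) h.
Qed.

Lemma box_sqd c x r : 0 <= r -> box c r x -> sqd c x <= n%:R * r ^+ 2.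
Proof.
move=> r0 h; rewrite /sqd -[n in n%:R]card_ord -sum1_card natr_sum mulr_suml.
apply: ler_sum => j _; rewrite mul1r -[leLHS]real_normK ?num_real//.
by rewrite ler_pXn2r ?nnegrE.
Qed.

Lemma notbox_sqd c x r : 0 <= r -> ~ box c r x -> r ^+ 2 <= sqd c x.
Proof.
move=> r0 /existsNP[j /negP]; rewrite -ltNge => h.
apply: le_trans (crd_sqd c x j); rewrite -[leRHS]real_normK ?num_real//.
by rewrite ler_pXn2r ?nnegrE// ltW.
Qed.

Lemma boxxx c r : 0 <= r -> box c r c.
Proof. by move=> r0 j; rewrite crdxx normr0. Qed.

Lemma box_sym c r x : box c r x -> box x r c.
Proof. by move=> h j; rewrite crdC normrN. Qed.

Lemma box_tri c x y r s : box c r x -> box x s y -> box c (r + s) y.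
Proof.
move=> h k j; rewrite (crd_tri y x c) addrC.
by apply: le_trans (ler_normD _ _) _; exact: lerD.
Qed.

Lemma box_le c x r s : r <= s -> box c r x -> box c s x.
Proof. by move=> rs h j; exact: le_trans (h j) rs. Qed.

Lemma box_trile c x y r s (t : R) : r + s <= t -> box c r x -> box x s y -> box c t y.
Proof. by move=> rst h k; exact: (box_le _ _ _ _ rst (box_tri _ _ _ _ _ h k)). Qed.

Lemma boxDu x j : box x 1 (x + unitv j).
Proof. by move=> i; rewrite crdDu crdxx add0r; case: (i == j); rewrite ?normr1 ?normr0. Qed.

Lemma boxBu x j : box x 1 (x - unitv j).
Proof.
by move=> i; rewrite crdBu crdxx add0r normrN; case: (i == j); rewrite ?normr1 ?normr0.
Qed.

Lemma eq_lap f g x : (forall y, box x 1 y -> f y = g y) -> lap f x = lap g x.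
Proof.
move=> h; apply: eq_bigr => j _; rewrite (h _ (boxDu _ _)) (h _ (boxBu _ _)) h//.
exact: boxxx.
Qed.

Lemma lapD f g x : lap (fun y => f y + g y) x = lap f x + lap g x.
Proof. by rewrite /lap -big_split /=; apply: eq_bigr => j _; ring. Qed.

Lemma lapB f g x : lap (fun y => f y - g y) x = lap f x - lap g x.
Proof. by rewrite /lap -sumrB /=; apply: eq_bigr => j _; ring. Qed.

Lemma lapZ a f x : lap (fun y => a * f y) x = a * lap f x.
Proof. by rewrite /lap mulr_sumr /=; apply: eq_bigr => j _; ring. Qed.

Lemma lap_cst a x : lap (fun=> a) x = 0.
Proof. by apply: big1 => j _; ring. Qed.

Lemma lap_sum {T : finType} (F : T -> I -> R) x :
  lap (fun y => \sum_t F t y) x = \sum_t lap (F t) x.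
Proof.
rewrite /lap exchange_big /=; apply: eq_bigr => j _.
by rewrite mulr_sumr -big_split -sumrB.
Qed.

Lemma lap_shift f x y : lap (fun z => f (z + y)) x = lap f (x + y).
Proof.
by apply: eq_bigr => j _; rewrite (addrAC x (unitv j)) (addrAC x (- unitv j)).
Qed.

Lemma lap_sqd c x : lap (sqd c) x = 2 * n%:R.
Proof.
rewrite /lap (eq_bigr (fun=> 2)) => [|j _]; last by rewrite sqdDu sqdBu; ring.
by rewrite sumr_const card_ord mulr_natr.
Qed.

Lemma lap_ge f x : - (2 * n%:R * f x) + \sum_j (f (x + unitv j) + f (x - unitv j)) = lap f x.
Proof.
rewrite /lap [in RHS]big_split /= sumr_const card_ord -mulr_natr addrC.
by congr (_ + _); ring.
Qed.

Lemma lap_le f g x : f x = g x -> (forall y, box x 1 y -> f y <= g y) ->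
  lap f x <= lap g x.
Proof.
move=> e h; apply: ler_sum => j _; rewrite e lerD2r.
by apply: lerD; apply: h; [exact: boxDu|exact: boxBu].
Qed.

Lemma lap_maxle f x m : f x = m -> (forall y, box x 1 y -> f y <= m) -> lap f x <= 0.
Proof. by move=> e h; rewrite -(lap_cst m x); apply: lap_le. Qed.

Lemma lap_minge f x m : f x = m -> (forall y, box x 1 y -> m <= f y) -> 0 <= lap f x.
Proof. by move=> e h; rewrite -(lap_cst m x); apply: lap_le. Qed.

(** The gap at [x] survives with the full weight of the centre. This is the slack that later
    arguments spend when the coefficient is not small compared with a barrier. *)
Lemma avg_le_strong a f g x : 0 <= a -> 2 * n%:R * a <= 1 ->
  (forall y, box x 1 y -> f y <= g y) ->
  avg a f x + (1 - 2 * n%:R * a) * (g x - f x) <= avg a g x.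
Proof.
move=> a0 na h; rewrite /avg -!lap_ge.
have H : \sum_j (f (x + unitv j) + f (x - unitv j)) <=
         \sum_j (g (x + unitv j) + g (x - unitv j)).
  by apply: ler_sum => j _; apply: lerD; apply: h; [exact: boxDu|exact: boxBu].
have := ler_wpM2l a0 H; lra.
Qed.

Lemma avg_le a f g x : 0 <= a -> 2 * n%:R * a <= 1 ->
  (forall y, box x 1 y -> f y <= g y) -> avg a f x <= avg a g x.
Proof.
move=> a0 na h; have := avg_le_strong a f g x a0 na h.
have : 0 <= (1 - 2 * n%:R * a) * (g x - f x).
  by rewrite mulr_ge0 ?subr_ge0// h//; exact: boxxx.
lra.
Qed.

Lemma avg_cst a b x : avg a (fun=> b) x = b.
Proof. by rewrite /avg lap_cst mulr0 addr0. Qed.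

Lemma avgD a f g x : avg a (fun y => f y + g y) x = avg a f x + avg a g x.
Proof. by rewrite /avg lapD; ring. Qed.

Lemma avgB a f g x : avg a (fun y => f y - g y) x = avg a f x - avg a g x.
Proof. by rewrite /avg lapB; ring. Qed.

Lemma avgZ a b f x : avg a (fun y => b * f y) x = b * avg a f x.
Proof. by rewrite /avg lapZ; ring. Qed.

Lemma avg_sqd a c x : avg a (sqd c) x = sqd c x + 2 * n%:R * a.
Proof. by rewrite /avg lap_sqd; ring. Qed.

Lemma avg_sum {T : finType} a (F : T -> I -> R) x :
  avg a (fun y => \sum_t F t y) x = \sum_t avg a (F t) x.
Proof. by rewrite /avg lap_sum mulr_sumr -big_split. Qed.

Lemma avg_le_cst a f b x : 0 <= a -> 2 * n%:R * a <= 1 ->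
  (forall y, box x 1 y -> f y <= b) -> avg a f x <= b.
Proof. by move=> a0 na h; rewrite -[leRHS](avg_cst a b x); exact: avg_le. Qed.

Lemma avg_ge_cst a f b x : 0 <= a -> 2 * n%:R * a <= 1 ->
  (forall y, box x 1 y -> b <= f y) -> b <= avg a f x.
Proof. by move=> a0 na h; rewrite -[leLHS](avg_cst a b x); exact: avg_le. Qed.

Lemma gam_ge0 f x : 0 <= gam f x.
Proof. by apply: sumr_ge0 => j _; rewrite addr_ge0 ?sqr_ge0. Qed.

Lemma lap_sq_le f x : lap f x ^+ 2 <= 2 * n%:R * gam f x.
Proof.
apply: le_trans (sqr_sum_le _) _; rewrite card_ord -mulrA mulrCA.
apply: ler_wpM2l => //; rewrite mulr_sumr; apply: ler_sum => j _.
have := sqr_ge0 ((f (x + unitv j) - f x) - (f (x - unitv j) - f x)).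
set p := f (x + _); set q := f (x - _); nra.
Qed.

Lemma lap_sqr f x : lap (fun y => f y ^+ 2) x = 2 * f x * lap f x + gam f x.
Proof.
rewrite /lap /gam mulr_sumr -big_split /=; apply: eq_bigr => j _; ring.
Qed.

(** Jensen's inequality with its defect kept. The defect is [a gam - a^2 lap^2], and
    [lap^2 <= 2 n gam], so halving the admissible Courant number leaves [a / 2] times [gam]. *)
Lemma avg_sqr a f x : 0 <= a -> 4 * n%:R * a <= 1 ->
  avg a f x ^+ 2 <= avg a (fun y => f y ^+ 2) x - a / 2 * gam f x.
Proof.
move=> a0 na; rewrite /avg lap_sqr.
have H := lap_sq_le f x; have g0 := gam_ge0 f x.
have : a ^+ 2 * lap f x ^+ 2 <= a / 2 * gam f x.
  apply: le_trans (ler_wpM2l (sqr_ge0 a) H) _.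
  have -> : a ^+ 2 * (2 * n%:R * gam f x) = (4 * n%:R * a) * (a / 2 * gam f x) by field.
  by rewrite ler_piMl// mulr_ge0// divr_ge0.
lra.
Qed.

End Lattice.

(** * The explicit scheme *)

Lemma powR1D_le {R : realType} (w q : R) : 0 <= w -> 0 <= q ->
  (1 + w) `^ q <= expR (q * w).
Proof.
move=> w0 q0; rewrite /powR ifF; last by apply/negbTE; rewrite gt_eqF// ltr_pwDl.
rewrite ler_expR ler_wpM2l// le_ln1Dx//; lra.
Qed.

Lemma expR_le_inv {R : realType} (x : R) : x < 1 -> expR x <= (1 - x)^-1.
Proof.
move=> x1; rewrite -[x in expR x]opprK expRN lef_pV2 ?posrE ?expR_gt0 ?subr_gt0//.
exact: expR_ge1Dx.
Qed.

Lemma powR_mono {R : realType} (q x y : R) : 0 <= q -> 0 <= x -> x <= y ->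
  x `^ q <= y `^ q.
Proof. by move=> q0 x0 xy; apply: ge0_ler_powR; rewrite ?nnegrE// (le_trans x0). Qed.

Section Scheme.
Context {R : realType} {n : nat}.
Local Notation I := ('rV[int]_n).
Variables (p theta M : R) (u : nat -> I -> R).
(** The Courant number [theta u^p] stays below [1 / (8 n p)]. The part [1 / (8 n)] gives
    monotonicity with slack; the factor [p] serves [scheme_BC], where [u^(p - 1)] at two successive
    times must be comparable. *)
Hypotheses (p1 : 1 <= p) (theta0 : 0 < theta)
  (cfl : 8 * n%:R * p * theta * M `^ p <= 1)
  (uS : forall k x, u k.+1 x = avg (theta * u k x `^ p) (u k) x)
  (u0M : forall x, 0 < u 0 x <= M).

Let p_gt0 : 0 < p. Proof. exact: lt_le_trans p1. Qed.
Let p_ge0 : 0 <= p := ltW p_gt0.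
Let pm1_ge0 : 0 <= p - 1. Proof. by rewrite subr_ge0. Qed.

Lemma courant_bound (v : R) : 0 <= v -> v <= M ->
  0 <= theta * v `^ p /\ 8 * n%:R * p * (theta * v `^ p) <= 1.
Proof.
move=> v0 vM; split; first by rewrite mulr_ge0 ?powR_ge0// ltW.
apply: le_trans cfl; rewrite -[leRHS]mulrA ler_wpM2l//.
  by rewrite !mulr_ge0.
by rewrite ler_pM2l//; exact: powR_mono.
Qed.

Lemma courant_bound1 (v : R) : 0 <= v -> v <= M ->
  0 <= theta * v `^ p /\ 8 * n%:R * (theta * v `^ p) <= 1.
Proof.
move=> v0 vM; have [h1 h2] := courant_bound v v0 vM; split => //.
have : 0 <= 8 * n%:R * (theta * v `^ p) * (p - 1).
  by rewrite mulr_ge0 ?subr_ge0// mulr_ge0// mulr_ge0.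
lra.
Qed.

Lemma scheme_bounds k x : 0 < u k x <= M.
Proof.
elim: k x => [//|k IH] x; rewrite uS.
have /andP[v0 vM] := IH x.
have [a0 a1] := courant_bound1 _ (ltW v0) vM.
have a2 : 2 * n%:R * (theta * u k x `^ p) <= 4^-1 by lra.
have a3 : 2 * n%:R * (theta * u k x `^ p) <= 1 by lra.
apply/andP; split; last by apply: avg_le_cst => // y _; case/andP: (IH y).
have := @avg_le_strong R n _ (fun=> 0) (u k) x a0 a3.
rewrite avg_cst => /(_ (fun y _ => ltW (proj1 (andP (IH y))))).
have : 0 < (1 - 2 * n%:R * (theta * u k x `^ p)) * (u k x - 0).
  by rewrite mulr_gt0//; lra.
lra.
Qed.

Lemma scheme_courant k x : 0 <= theta * u k x `^ p /\
  8 * n%:R * (theta * u k x `^ p) <= 1.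
Proof. by have /andP[/ltW ? ?] := scheme_bounds k x; exact: courant_bound1. Qed.

(* Benilan-Crandall: the homogeneity of the equation forces u_t >= - u / t,
   whatever the initial datum. *)
Lemma scheme_BC k x : (1 - (k%:R + 4)^-1) * u k x <= u k.+1 x.
Proof.
elim: k x => [|k IH] x.
  have /andP[v0 vM] := scheme_bounds 0 x.
  have [a0 a1] := scheme_courant 0 x.
  rewrite uS; have := @avg_le_strong R n _ (fun=> 0) (u 0) x a0.
  rewrite avg_cst => /(_ ltac:(lra) (fun y _ => ltW (proj1 (andP (scheme_bounds 0 y))))).
  rewrite add0r subr0 add0r; apply: le_trans.
  rewrite ler_pM2r//; lra.
have /andP[v0 vM] := scheme_bounds k x.
have /andP[w0 wM] := scheme_bounds k.+1 x.
set v := u k x in v0 vM *; set w := u k.+1 x in w0 wM *.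
(* The shift 4 makes the base case a consequence of the Courant bound, since one step loses at most
   the fraction [2 n a <= 1/4], and it keeps [mu <= 1/4] for the absorptions below. *)
pose mu : R := (k%:R + 4)^-1.
have k0 : 0 <= k%:R :> R by [].
have mu0 : 0 < mu by rewrite invr_gt0; lra.
have mu4 : mu <= 4^-1 by rewrite lef_pV2 ?posrE; lra.
have muE : mu * (k%:R + 4) = 1 by rewrite mulVf// gt_eqF//; lra.
have IH' y : (1 - mu) * u k y <= u k.+1 y by exact: IH.
pose P := v `^ (p - 1); pose Q := w `^ (p - 1).
have P0 : 0 <= P by exact: powR_ge0.
have Q0 : 0 <= Q by exact: powR_ge0.
have vp : v `^ p = v * P by rewrite mulr_powRB1// ltW.
have wp : w `^ p = w * Q by rewrite mulr_powRB1// ltW.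
have [Th0 Thp] := courant_bound v (ltW v0) vM.
have [_ Th1] := courant_bound1 v (ltW v0) vM.
pose l := lap (u k) x.
have wE : w = v + theta * (v * P) * l by rewrite /w uS /avg -/v vp.
pose om := theta * P * l.
pose Th := 2 * n%:R * (theta * (v * P)).
have wvom : w = v * (1 + om) by rewrite wE /om; ring.
rewrite vp in Th0 Thp Th1.
have Th_ge0 : 0 <= Th by rewrite /Th !mulr_ge0// ltW.
have Th4 : Th <= 4^-1 by rewrite /Th; lra.
have omge : - mu <= om.
  have := IH' x; rewrite -/v -/w wvom [leLHS]mulrC ler_pM2l//; lra.
(* A lower bound for the new Laplacian: the induction hypothesis is applied at the neighbours only,
   and the centre keeps its exact value [w]. *)
pose Br := (1 - mu) * (l + 2 * n%:R * v) - 2 * n%:R * w.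
have lapge : Br <= lap (u k.+1) x.
  rewrite -lap_ge -/w /Br /l -lap_ge -/v.
  have H : (1 - mu) * \sum_j (u k (x + unitv j) + u k (x - unitv j)) <=
    \sum_j (u k.+1 (x + unitv j) + u k.+1 (x - unitv j)).
    by rewrite mulr_sumr; apply: ler_sum => j _; rewrite mulrDr lerD.
  lra.
have PBr : theta * P * Br = (1 - mu - Th) * om - Th * mu.
  by rewrite /Br wE /om /Th; ring.
have PBrge : - ((1 - mu) * mu) <= theta * P * Br.
  rewrite PBr; have : 0 <= (1 - mu - Th) * (om + mu) by rewrite mulr_ge0; lra.
  lra.
(* This is [(k + 3) (k + 5) <= (k + 4)^2]. *)
have mu'E : (1 - mu) * mu <= (k.+1%:R + 4)^-1.
  rewrite -[leRHS]mul1r ler_pdivlMr; last by rewrite -natr1; lra.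
  rewrite -natr1.
  have -> : (1 - mu) * mu * (k%:R + 1 + 4) = (1 - mu) * (mu * (k%:R + 4) + mu) by ring.
  rewrite muE.
  have := sqr_ge0 mu; lra.
(* [PBrge] carries the old factor [P = v^(p-1)], whereas the scheme uses the new one [Q = w^(p-1)].
   Only [Br < 0] matters. If [om <= 0] then [Q <= P]. If [om > 0], then [Br < 0] forces
   [om <= 2 Th mu], so [w / v] is so close to 1 that [Q <= 8/7 P]; here the factor [p] of the
   Courant condition is spent. *)
have key : - ((1 - mu) * mu) <= theta * Q * Br.
  have [Br0|Br0] := leP 0 Br.
    have : 0 <= theta * Q * Br by rewrite !mulr_ge0// ltW.
    have : 0 <= (1 - mu) * mu by rewrite mulr_ge0; lra.
    lra.
  have [om0|om0] := leP om 0.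
    have QP : Q <= P.
      have wv : w <= v by rewrite wvom -[leRHS]mulr1 ler_pM2l//; lra.
      exact: (powR_mono _ _ _ pm1_ge0 (ltW w0) wv).
    apply: le_trans PBrge _; rewrite -!mulrA ler_pM2l//.
    have := mulr_ge0 (ltW (ltac:(lra) : 0 < - Br)) (ltac:(lra) : 0 <= P - Q); lra.
  have om2 : om <= 2 * (Th * mu).
    have : theta * P * Br <= 0.
      have := mulr_ge0 (mulr_ge0 (ltW theta0) P0) (ltac:(lra) : 0 <= - Br); lra.
    rewrite PBr.
    have := mulr_ge0 (ltac:(lra) : 0 <= 1 - mu - Th - 2^-1) (ltW om0); lra.
  have pTh : (p - 1) * om <= 8^-1.
    have h1 : (p - 1) * om <= (p - 1) * (2 * (Th * mu)).
      exact: (ler_wpM2l pm1_ge0 om2).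
    have h2 : Th * mu <= Th * 4^-1 by exact: ler_wpM2l.
    have h3 : (p - 1) * (2 * (Th * mu)) <= (p - 1) * (2 * (Th * 4^-1)).
      by apply: (ler_wpM2l pm1_ge0); lra.
    have h4 : 4 * p * Th <= 1 by rewrite /Th; lra.
    lra.
  have QP : Q <= (8 / 7) * P.
    rewrite /Q wvom powRM; [|lra..].
    rewrite mulrC ler_wpM2r//.
    apply: le_trans (powR1D_le _ _ (ltW om0) pm1_ge0) _.
    apply: le_trans (_ : expR 8^-1 <= _); first by rewrite ler_expR.
    apply: le_trans (expR_le_inv _ _) _; first lra.
    by rewrite (_ : 1 - 8^-1 = 7 / 8); [rewrite invf_div|field].
  have h5 : - (Th * mu) <= theta * P * Br.
    rewrite PBr; have := mulr_ge0 (ltac:(lra) : 0 <= 1 - mu - Th) (ltW om0); lra.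
  have h6 : theta * ((8 / 7) * P) * Br <= theta * Q * Br.
    rewrite -!mulrA ler_pM2l//.
    have := mulr_ge0 (ltac:(lra) : 0 <= - Br) (ltac:(lra) : 0 <= 8 / 7 * P - Q); lra.
  apply: le_trans h6.
  have h7 : Th * mu <= 4^-1 * mu by rewrite ler_pM2r.
  have h8 : mu * mu <= 4^-1 * mu by rewrite ler_pM2r.
  lra.
have vE : u k.+2 x = w + theta * (w * Q) * lap (u k.+1) x by rewrite uS /avg -/w wp.
rewrite vE.
have : w * (theta * Q * Br) <= w * (theta * Q * lap (u k.+1) x).
  by rewrite ler_pM2l// ler_wpM2l// mulr_ge0// ltW.
have : w * (- (k.+1%:R + 4)^-1) <= w * (theta * Q * Br).
  by rewrite ler_pM2l//; lra.
lra.
Qed.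

Lemma scheme_BC_abs k x : (0 < k)%N -> u k x - M / k%:R <= u k.+1 x.
Proof.
move=> k0; have := scheme_BC k x; have /andP[v0 vM] := scheme_bounds k x.
have k0' : 0 < k%:R :> R by rewrite ltr0n.
have : (k%:R + 4)^-1 * u k x <= M / k%:R.
  have i0 : 0 <= (k%:R + 4)^-1 :> R by rewrite invr_ge0; lra.
  have i1 : (k%:R + 4)^-1 <= k%:R^-1 :> R by rewrite lef_pV2 ?posrE//; lra.
  by rewrite mulrC; apply: (ler_pM (ltW v0) i0 vM i1).
lra.
Qed.

(** A paraboloid grows by [2 n a A <= A] in one step whatever the coefficient, so this barrier needs
    no parabolicity. It serves for the initial values and for decay at infinity. *)
Lemma scheme_upper c (b A : R) : 0 <= A ->
  (forall x, u 0 x <= b + A * sqd c x) ->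
  forall k x, u k x <= b + A * sqd c x + A * k%:R.
Proof.
move=> A0 h; elim=> [|k IH] x; first by rewrite mulr0 addr0.
have [a0 a1] := scheme_courant k x.
rewrite uS; apply: le_trans (@avg_le _ _ _ _
  (fun y => (b + A * k%:R) + A * sqd c y) _ a0 _ _) _.
- by lra.
- by move=> y _; have := IH y; lra.
- rewrite avgD avg_cst avgZ avg_sqd -natr1.
  have := ler_wpM2l A0 (ltac:(lra) : 2 * n%:R * (theta * u k x `^ p) <= 1); lra.
Qed.

Lemma scheme_lower c (b A : R) : 0 <= A ->
  (forall x, b - A * sqd c x <= u 0 x) ->
  forall k x, b - A * sqd c x - A * k%:R <= u k x.
Proof.
move=> A0 h; elim=> [|k IH] x; first by rewrite mulr0 subr0.
have [a0 a1] := scheme_courant k x.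
rewrite uS; apply: le_trans (@avg_le _ _ _
  (fun y => (b - A * k%:R) - A * sqd c y) _ _ a0 _ _); last 2 first.
- by lra.
- by move=> y _; have := IH y; lra.
- rewrite avgB avg_cst avgZ avg_sqd -natr1.
  have := ler_wpM2l A0 (ltac:(lra) : 2 * n%:R * (theta * u k x `^ p) <= 1); lra.
Qed.

Lemma scheme_positive c (m r kap : R) : 0 < m -> 1 <= r -> m <= M ->
  2 * n%:R * theta * 2 `^ p * m `^ p / r ^+ 2 <= kap -> kap <= 1 ->
  (forall x, m / r ^+ 2 * Num.max (r ^+ 2 - sqd c x) 0 <= u 0 x) ->
  forall k x, m / r ^+ 2 * (1 - kap) ^+ k * Num.max (r ^+ 2 - sqd c x) 0 <= u k x.
Proof.
move=> m0 r1 mM kapge kap1 h.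
have r2 : 1 <= r ^+ 2 by rewrite exprn_ege1.
have r20 : 0 < r ^+ 2 by lra.
have kap0 : 0 <= kap.
  by apply: le_trans kapge; rewrite !mulr_ge0 ?powR_ge0 ?invr_ge0// ltW.
elim=> [|k IH] x; first by rewrite expr0 mulr1.
have [qx|qx] := leP (r ^+ 2 - sqd c x) 0.
  by rewrite mulr0; case/andP: (scheme_bounds k.+1 x) => /ltW.
have /andP[v0 vM] := scheme_bounds k x.
have [a0 a1] := scheme_courant k x.
have a2 : 2 * n%:R * (theta * u k x `^ p) <= 4^-1 by lra.
rewrite uS; set v := u k x in v0 vM a0 a1 a2 *.
pose d := m / r ^+ 2 * (1 - kap) ^+ k.
have d0 : 0 <= d by rewrite mulr_ge0 ?divr_ge0 ?exprn_ge0//; lra.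
have dm : d <= m / r ^+ 2.
  rewrite -[leRHS]mulr1 ler_wpM2l// ?exprn_ile1//; [|lra..].
  by rewrite divr_ge0//; lra.
have H := @avg_le_strong _ _ _ (fun y => d * Num.max (r ^+ 2 - sqd c y) 0) (u k) x a0
  (ltac:(lra)) (fun y _ => IH y).
have lapq : - (2 * n%:R) <= lap (fun y => Num.max (r ^+ 2 - sqd c y) 0) x.
  have -> : - (2 * n%:R) = lap (fun y => r ^+ 2 - sqd c y) x.
    by rewrite lapB lap_cst lap_sqd sub0r.
  apply: lap_le => [|y _]; last by rewrite le_max lexx.
  by rewrite max_l// ltW.
move: H; rewrite avgZ /avg -/v max_l ?(ltW qx)//.
set q := r ^+ 2 - sqd c x in qx *; set L := lap _ x in lapq *.
set a := theta * v `^ p in a0 a1 a2 *.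
have qr : q <= r ^+ 2 by rewrite /q; have := @sqd_ge0 R n c x; lra.
have IHx : d * q <= v by have := IH x; rewrite max_l ?(ltW qx).
move=> H; rewrite [_ ^+ k.+1]exprS.
have -> : m / r ^+ 2 * ((1 - kap) * (1 - kap) ^+ k) * q = d * q - kap * (d * q).
  by rewrite /d; ring.
have daL : - (2 * n%:R * a * d) <= d * (a * L).
  have := ler_wpM2l (mulr_ge0 d0 a0) lapq; lra.
suff : 2 * n%:R * a * d <= kap * (d * q) + (1 - 2 * n%:R * a) * (v - d * q).
  lra.
(* If [v] is at most twice the barrier, [v^p] is at most the barrier times [2^p m^(p-1)], so the
   loss is proportional to the barrier and [kap] pays for it. Otherwise the slack [v - d q > v / 2]
   at the centre does. *)
have [v2|v2] := leP v (2 * (d * q)).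
  have e1 : 0 <= (1 - 2 * n%:R * a) * (v - d * q) by rewrite mulr_ge0; lra.
  suff : 2 * n%:R * a * d <= kap * (d * q) by lra.
  have dqm : d * q <= m.
    apply: le_trans (ler_wpM2l d0 qr) _.
    by have := ler_wpM2r (ltW r20) dm; rewrite divfK// gt_eqF.
  have dq0 : 0 <= d * q := mulr_ge0 d0 (ltW qx).
  have e2 : v `^ p <= 2 `^ p * ((d * q) * m `^ (p - 1)).
    apply: le_trans (powR_mono p v _ p_ge0 (ltW v0) v2) _.
    rewrite powRM//; apply: ler_wpM2l; first exact: powR_ge0.
    rewrite -mulr_powRB1//.
    apply: ler_wpM2l => //; exact: (powR_mono _ _ _ pm1_ge0 dq0 dqm).
  have e3 : a * d <= theta * (2 `^ p * ((d * q) * m `^ (p - 1))) * (m / r ^+ 2).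
    apply: ler_pM => //; rewrite /a; apply: ler_wpM2l => //; exact: ltW.
  have e4 := ler_wpM2l (ltac:(by rewrite mulr_ge0) : 0 <= 2 * n%:R :> R) e3.
  have e5 := ler_wpM2r dq0 kapge.
  have mE : m `^ p = m * m `^ (p - 1) by rewrite mulr_powRB1// ltW.
  rewrite mE in e5; lra.
have e1 : v / 4 <= (1 - 2 * n%:R * a) * (v - d * q).
  have := mulr_ge0 (ltac:(lra) : 0 <= 4^-1 - 2 * n%:R * a) (ltac:(lra) : 0 <= v - d * q).
  lra.
have e2 : 0 <= kap * (d * q) := mulr_ge0 kap0 (mulr_ge0 d0 (ltW qx)).
suff : 2 * n%:R * a * d <= v / 4 by lra.
have -> : a = theta * (v * v `^ (p - 1)) by rewrite mulr_powRB1// ltW.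
have dM : d <= M.
  apply: le_trans dm _; apply: le_trans mM; rewrite ler_pdivrMr//.
  by rewrite -[leLHS]mulr1 ler_pM2l.
have e3 : v `^ (p - 1) * d <= M `^ p.
  have M0 : 0 <= M by lra.
  rewrite -[leRHS]mulr_powRB1//.
  by rewrite mulrC; apply: ler_pM => //; [exact: powR_ge0|exact: (powR_mono _ _ _ pm1_ge0 (ltW v0) vM)].
have e4 : 8 * n%:R * theta * (v `^ (p - 1) * d) <= 1.
  have tn : 0 <= 8 * n%:R * theta :> R by rewrite !mulr_ge0// ltW.
  have := ler_wpM2l tn e3.
  have := mulr_ge0 (mulr_ge0 tn (powR_ge0 M p)) pm1_ge0.
  have := cfl; lra.
have := ler_wpM2l (ltW v0) e4; lra.
Qed.

End Scheme.

(** * Discrete heat flow and test functions *)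

Section HeatFlow.
Context {R : realType} {n : nat}.
Local Notation I := ('rV[int]_n).
Implicit Types (f g : I -> R) (x y c : I).

Definition diffu (j : 'I_n) f x : R := f (x + unitv j) - f x.
Definition grad2 f x : R := \sum_j diffu j f x ^+ 2.

Lemma grad2_ge0 f x : 0 <= grad2 f x.
Proof. by apply: sumr_ge0 => j _; exact: sqr_ge0. Qed.

Lemma grad2_gam f x : grad2 f x <= gam f x.
Proof. by apply: ler_sum => j _; rewrite lerDl sqr_ge0. Qed.

Lemma lap_diffu j f x : lap (diffu j f) x = lap f (x + unitv j) - lap f x.
Proof. by rewrite [LHS]lapB lap_shift. Qed.

(** The lazy simple random walk, which stays put with probability 1/2: the largest Courant number
    that [avg_sqr] allows. *)
Definition lazy_walk f x : R := avg (4 * n%:R)^-1 f x.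

Hypothesis n0 : (0 < n)%N.

Let n0' : 0 < n%:R :> R. Proof. by rewrite ltr0n. Qed.
Let k0 : 0 <= (4 * n%:R)^-1 :> R. Proof. by rewrite invr_ge0 mulr_ge0. Qed.
Let k1 : 4 * n%:R * (4 * n%:R)^-1 = 1 :> R.
Proof. by rewrite mulfV// mulf_neq0// gt_eqF. Qed.
Let k2 : 2 * n%:R * (4 * n%:R)^-1 <= 1 :> R. Proof. have := k1; lra. Qed.

Lemma lazy_walk_le f g x : (forall y, f y <= g y) -> lazy_walk f x <= lazy_walk g x.
Proof. by move=> h; apply: avg_le => // y _; exact: h. Qed.

Lemma iter_walk_le N f g : (forall y, f y <= g y) ->
  forall x, iter N lazy_walk f x <= iter N lazy_walk g x.
Proof.
by move=> h; elim: N => [//|N IH] x /=; apply: lazy_walk_le.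
Qed.

Lemma diffu_walk j f x : diffu j (lazy_walk f) x = lazy_walk (diffu j f) x.
Proof. by rewrite /diffu /lazy_walk avgB /avg lap_shift. Qed.

Lemma lazy_walkD f g x :
  lazy_walk (fun y => f y + g y) x = lazy_walk f x + lazy_walk g x.
Proof. exact: avgD. Qed.

Lemma lazy_walkB f g x :
  lazy_walk (fun y => f y - g y) x = lazy_walk f x - lazy_walk g x.
Proof. exact: avgB. Qed.

Lemma lazy_walkZ b f x : lazy_walk (fun y => b * f y) x = b * lazy_walk f x.
Proof. exact: avgZ. Qed.

Lemma lazy_walk_sqr f x : lazy_walk f x ^+ 2 <=
  lazy_walk (fun y => f y ^+ 2) x - (8 * n%:R)^-1 * grad2 f x.
Proof.
have k3 : (8 * n%:R)^-1 = (4 * n%:R)^-1 / 2 :> R by field; rewrite gt_eqF.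
apply: le_trans (avg_sqr _ _ _ k0 _) _; first by rewrite k1.
rewrite lerD2l lerN2 k3; apply: ler_wpM2l; last exact: grad2_gam.
by rewrite divr_ge0.
Qed.

Lemma grad2_walk f x : grad2 (lazy_walk f) x <= lazy_walk (grad2 f) x.
Proof.
rewrite /lazy_walk /grad2 avg_sum; apply: ler_sum => j _.
rewrite diffu_walk; apply: le_trans (lazy_walk_sqr _ _) _.
by rewrite lerBlDr lerDl mulr_ge0 ?grad2_ge0// invr_ge0 mulr_ge0.
Qed.

(* Bernstein's argument: [N |D f_N|^2 / (8n) + f_N^2] obeys a maximum principle;
   one extra averaging puts the gradient at the neighbouring sites. *)
Lemma walk_gradient f (S : R) N x : (forall y, `|f y| <= S) ->
  N%:R * grad2 (iter N lazy_walk f) x <= 8 * n%:R * S ^+ 2.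
Proof.
move=> fS.
have fS2 y : f y ^+ 2 <= S ^+ 2.
  rewrite -[leLHS]real_normK ?num_real// ler_pXn2r ?nnegrE//.
  exact: le_trans (fS y).
pose xi : R := (8 * n%:R)^-1.
have xi0 : 0 < xi by rewrite invr_gt0 mulr_gt0.
suff H y : N%:R * xi * grad2 (iter N lazy_walk f) y +
    lazy_walk (fun z => iter N lazy_walk f z ^+ 2) y <= S ^+ 2.
  have w0 : 0 <= lazy_walk (fun z => iter N lazy_walk f z ^+ 2) x.
    by apply: avg_ge_cst => // z _; exact: sqr_ge0.
  have xiE : xi * (8 * n%:R) = 1 by rewrite mulVf// mulf_neq0// gt_eqF.
  have -> : N%:R * grad2 (iter N lazy_walk f) x =
            N%:R * xi * grad2 (iter N lazy_walk f) x * (8 * n%:R).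
    have E (G : R) : N%:R * xi * G * (8 * n%:R) = N%:R * G * (xi * (8 * n%:R)) by ring.
    by rewrite E xiE mulr1.
  rewrite [leRHS]mulrC; apply: ler_wpM2r; first by rewrite mulr_ge0.
  have := H x; lra.
elim: N y => [|N IH] y.
  by rewrite mul0r mul0r add0r; apply: avg_le_cst => // z _; exact: fS2.
set fN := iter N lazy_walk f in IH *; rewrite iterS -/fN.
have h1 := grad2_walk fN y.
have h2 : lazy_walk (fun z => lazy_walk fN z ^+ 2) y <=
    lazy_walk (fun z => lazy_walk (fun t => fN t ^+ 2) z - xi * grad2 fN z) y.
  by apply: lazy_walk_le => z; exact: lazy_walk_sqr.
have h3 : lazy_walk (fun z => N%:R * xi * grad2 fN z + lazy_walk (fun t => fN t ^+ 2) z) y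
    <= S ^+ 2.
  by apply: avg_le_cst => // z _; exact: IH.
rewrite lazy_walkB lazy_walkZ in h2; rewrite lazy_walkD lazy_walkZ in h3.
have h4 : N.+1%:R * xi * grad2 (lazy_walk fN) y <= N.+1%:R * xi * lazy_walk (grad2 fN) y.
  by apply: ler_wpM2l => //; rewrite mulr_ge0// ltW.
rewrite -(natr1 N) in h4 *; lra.
Qed.

Lemma walk_superharmonic f K N : (forall y, lap f y <= K) -> 
  forall x, iter N lazy_walk f x <= f x + (4 * n%:R)^-1 * K * N%:R.
Proof.
move=> h; elim: N => [|N IH] x; first by rewrite mulr0 addr0.
rewrite iterS; apply: le_trans (lazy_walk_le _ _ _ IH) _.
rewrite /lazy_walk avgD avg_cst /avg -(natr1 N).
have := ler_wpM2l k0 (h x); lra.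
Qed.

Lemma walk_subharmonic f K N : (forall y, - K <= lap f y) ->
  forall x, f x <= iter N lazy_walk f x + (4 * n%:R)^-1 * K * N%:R.
Proof.
move=> h; elim: N => [|N IH] x; first by rewrite mulr0 addr0.
have := @avg_le R n (4 * n%:R)^-1 f
  (fun y => iter N lazy_walk f y + (4 * n%:R)^-1 * K * N%:R) x k0 k2 (fun y _ => IH y).
rewrite iterS /lazy_walk avgD avg_cst {1}/avg -(natr1 N).
have := ler_wpM2l k0 (h x); lra.
Qed.

End HeatFlow.

(** * Lipschitz bounds along lattice paths *)

Section Paths.
Context {R : realType} {n : nat}.
Local Notation I := ('rV[int]_n).

Definition l1dist (x c : I) : nat := (\sum_i absz (x 0%R i - c 0%R i)%R)%N.

Lemma step_toward (x c : I) j : x 0 j != c 0 j ->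
  exists y, [/\ l1dist y c = (l1dist x c).-1, (0 < l1dist x c)%N,
     (y = x - unitv j \/ x = y - unitv j) &
     forall i, `|y 0 i - c 0 i| <= `|x 0 i - c 0 i| ].
Proof.
move=> ne; pose s : int := if (c 0 j < x 0 j) then -1 else 1.
pose y : I := x + s *: unitv j.
have yE i : y 0 i = if i == j then x 0 j + s else x 0 i.
  rewrite !mxE eqxx /=; have [->|ij] := eqVneq i j; first by rewrite mulr1.
  by rewrite mulr0 addr0.
exists y; rewrite /l1dist (bigD1 j) //= [in X in X.-1](bigD1 j) //= yE eqxx.
have -> : (\sum_(i < n | i != j) absz (y 0%R i - c 0%R i)%R =
           \sum_(i < n | i != j) absz (x 0%R i - c 0%R i)%R)%N.
  by apply: eq_bigr => i /negbTE ij; rewrite yE ij.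
split.
- have : absz (x 0 j + s - c 0 j)%R = (absz (x 0 j - c 0 j)%R).-1 /\
         (0 < absz (x 0 j - c 0 j)%R)%N.
    by move: ne; rewrite /s; move: (x 0 j) (c 0 j) => a b ne; case: (ltrP b a); lia.
  by case=> -> ?; rewrite -!subn1 addnBAC.
- by rewrite (bigD1 j) //= addn_gt0; apply/orP; left; rewrite absz_gt0 subr_eq0.
- rewrite /y /s; case: ifP => h; [left; by rewrite scaleN1r|right].
  by rewrite scale1r addrK.
- move=> i; rewrite yE; case: eqVneq => // ->; move: ne; rewrite /s.
  by move: (x 0 j) (c 0 j) => a b ne; case: (ltrP b a); lia.
Qed.

(** Induction on the [l1] distance along a path that brings one coordinate closer to [c] at each
    step. Such a path stays in any set [P] closed under decreasing the coordinate distances, such as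
    a box around [c]. *)
Lemma lattice_path (P : I -> Prop) (g : I -> R) (D : R) (c : I) :
  (forall x y : I, P x -> (forall i, `|y 0 i - c 0 i| <= `|x 0 i - c 0 i|) -> P y) ->
  (forall z j, P z -> P (z + unitv j) -> `|g (z + unitv j) - g z| <= D) ->
  forall x, P x -> `|g x - g c| <= D * \sum_j `|crd x c j|.
Proof.
move=> Pc h.
have crdN x : \sum_j `|crd x c j| = (l1dist x c)%:R :> R.
  rewrite natr_sum; apply: eq_bigr => j _; rewrite /crd.
  by rewrite natr_absz intr_norm.
move=> x; rewrite crdN.
move: {2}(l1dist x c) (erefl (l1dist x c)) => m.
elim: m x => [|m IH] x e Px.
  suff xc : x = c by rewrite e xc subrr normr0 mulr0.
  apply/matrixP => i j; rewrite ord1; move: e => /eqP; rewrite sum_nat_eq0.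
  move=> /forallP /(_ j); lia.
have [/forallP H|/forallPn[j ne]] := boolP [forall j, x 0 j == c 0 j].
  by exfalso; move: e; rewrite /l1dist big1// => i _; rewrite (eqP (H i)) subrr.
have [y [ey _ xy le]] := step_toward x c j ne.
have Py : P y by exact: Pc le.
have := IH y _ Py; rewrite ey e /= => /(_ erefl) IHy.
have xyD : `|g x - g y| <= D.
  case: xy => E.
    rewrite E in Py *.
    by have := h (x - unitv j) j Py; rewrite subrK; apply.
  by rewrite E distrC; have := h x j; rewrite {2 3}E subrK => /(_ Px Py); rewrite E.
rewrite -(natr1 m) mulrDr mulr1 [leRHS]addrC.
have -> : g x - g c = (g x - g y) + (g y - g c) by ring.
by apply: le_trans (ler_normD _ _) _; exact: lerD.
Qed.

Lemma lattice_path_box (g : I -> R) (D r : R) (c : I) :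
  (forall z j, box c r z -> box c r (z + unitv j) -> `|g (z + unitv j) - g z| <= D) ->
  forall x, box c r x -> `|g x - g c| <= D * \sum_j `|crd x c j|.
Proof.
move=> h; apply: lattice_path => // x y bx le j.
apply: le_trans (bx j); rewrite /crd -!intr_norm ler_int; exact: le.
Qed.

Lemma sum_crd_le (c x : I) (r : R) : box c r x -> \sum_j `|crd x c j| <= n%:R * r.
Proof.
move=> h; rewrite -[n in n%:R]card_ord -sum1_card natr_sum mulr_suml.
by apply: ler_sum => j _; rewrite mul1r.
Qed.

End Paths.

(** * A bump with Laplacian bounded below by a negative multiple of itself *)

Section Bump.
Context {R : realType} {n : nat}.
Local Notation I := ('rV[int]_n).

Lemma pos_sqr_convex (q d : R) : 0 <= q ->
  2 * q ^+ 2 + d ^+ 2 <= Num.max (q + d) 0 ^+ 2 + Num.max (q - d) 0 ^+ 2.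
Proof.
move=> q0; have [h1|h1] := leP (q + d) 0; have [h2|h2] := leP (q - d) 0; nra.
Qed.

Lemma pos_sqr_edge (q d : R) : - 1 <= q ->
  d ^+ 2 / 2 - 1 <= Num.max (q + d) 0 ^+ 2 + Num.max (q - d) 0 ^+ 2.
Proof.
move=> q0; have [q1|q1] := leP q 1; have := sqr_ge0 (d + 2 * q);
  have := sqr_ge0 (d - 2 * q);
  have [h1|h1] := leP (q + d) 0; have [h2|h2] := leP (q - d) 0; nra.
Qed.

Definition bump (c : I) (r : R) (x : I) : R := Num.max (r ^+ 2 - sqd c x) 0 ^+ 2.

(** Squaring makes the truncated paraboloid C^1 across its edge. Near the edge ([q < 1]) the terms
    [crd^2], whose sum is almost [r^2], dominate. Further inside, the Laplacian is at least
    [4 r^2 - 4 (n + 1) q], and completing a square bounds this below by [- ((n + 1) q)^2 / r^2]. So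
    the bump loses only in proportion to itself. *)
Lemma lap_bump (c : I) (r : R) x : 3 * n%:R + 2 <= 2 * r ^+ 2 ->
  - ((n%:R + 1) ^+ 2 / r ^+ 2 * bump c r x) <= lap (bump c r) x.
Proof.
move=> rn; have n0 : 0 <= n%:R :> R by [].
have r20 : 0 < r ^+ 2 by lra.
have rN0 : r != 0 by apply: contraTneq r20 => ->; rewrite expr0n ltxx.
rewrite /bump; set q := r ^+ 2 - sqd c x.
have [q0|q0] := leP q 0.
  rewrite expr0n mulr0 oppr0; apply: lap_minge => [|y _]; last exact: sqr_ge0.
  by rewrite max_r// expr0n.
have E : lap (fun y => Num.max (r ^+ 2 - sqd c y) 0 ^+ 2) x =
  \sum_j (Num.max ((q - 1) + 2 * crd x c j) 0 ^+ 2 +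
          Num.max ((q - 1) - 2 * crd x c j) 0 ^+ 2 - 2 * q ^+ 2).
  apply: eq_bigr => j _; rewrite sqdDu sqdBu -/q (max_l (ltW q0)).
  have -> : r ^+ 2 - (sqd c x + 2 * crd x c j + 1) = q - 1 - 2 * crd x c j.
    by rewrite /q; ring.
  have -> : r ^+ 2 - (sqd c x - 2 * crd x c j + 1) = q - 1 + 2 * crd x c j.
    by rewrite /q; ring.
  by rewrite [X in X - _]addrC.
rewrite E {E}.
have S : \sum_j crd x c j ^+ 2 = r ^+ 2 - q by rewrite /q opprB addrC subrK.
have [q1|q1] := leP 1 q.
  apply: (@le_trans _ _ (\sum_(j < n) (4 * crd x c j ^+ 2 - 4 * q))).
    rewrite sumrB -mulr_sumr S sumr_const card_ord -[_ * q *+ n]mulr_natr.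
    have -> : (n%:R + 1) ^+ 2 / r ^+ 2 * q ^+ 2 = ((n%:R + 1) * q) ^+ 2 / r ^+ 2.
      by field.
    rewrite -subr_ge0.
    have -> : 4 * (r ^+ 2 - q) - 4 * q * n%:R - - (((n%:R + 1) * q) ^+ 2 / r ^+ 2)
       = ((n%:R + 1) * q - 2 * r ^+ 2) ^+ 2 / r ^+ 2 by field.
    by rewrite divr_ge0 ?sqr_ge0// ltW.
  apply: ler_sum => j _; have := pos_sqr_convex (q - 1) (2 * crd x c j) ltac:(lra).
  nra.
apply: (@le_trans _ _ 0).
  by rewrite oppr_le0 mulr_ge0 ?divr_ge0 ?sqr_ge0.
apply: (@le_trans _ _ (\sum_(j < n) (2 * crd x c j ^+ 2 - 3))).
  rewrite sumrB -mulr_sumr S sumr_const card_ord -[3 *+ n]mulr_natr; lra.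
apply: ler_sum => j _; have := pos_sqr_edge (q - 1) (2 * crd x c j) ltac:(lra).
nra.
Qed.

End Bump.

(** * Oscillation decay *)

(* [lra] slows down with the size of the context: forget what it cannot use. *)
Ltac lrac :=
  repeat match goal with
  | H : ?T |- _ => match type of T with Prop => match T with
      | forall _, _ => clear H | exists _, _ => clear H end end
  end;
  repeat match goal with x := _ |- _ => clearbody x end; lra.

Section Oscillation.
Context {R : realType} {n : nat}.
Local Notation I := ('rV[int]_n).
Implicit Types (x y c : I).

Lemma iter_walk_addc (n0 : (0 < n)%N) N (f : I -> R) (e : R) x :
  iter N lazy_walk (fun z => f z + e) x = iter N lazy_walk f x + e.
Proof.
elim: N x => [//|N IH] x; rewrite !iterS -[e in RHS](avg_cst (4 * n%:R)^-1 e x).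
rewrite -avgD; congr (_ + _ * _); first exact: IH.
by apply: eq_lap => y _; exact: IH.
Qed.

(* A subsolution of Poisson's equation lying below a supersolution is compared
   with it at another point by letting both run along the heat flow. *)
Lemma elliptic_transfer (n0 : (0 < n)%N) (F1 F2 : I -> R) (S K e D : R) N x0 y :
  (forall z, `|F1 z| <= S) -> (forall z, lap F1 z <= K) ->
  (forall z, - K <= lap F2 z) -> (forall z, F2 z <= F1 z + e) ->
  (0 < N)%N -> 0 <= D -> 8 * n%:R * S ^+ 2 <= N%:R * D ^+ 2 ->
  F2 y <= F1 x0 + e + 2 * ((4 * n%:R)^-1 * K * N%:R) + D * \sum_j `|crd y x0 j|.
Proof.
move=> FS F1K F2K F12 N0 D0 SD.
have h1 := walk_subharmonic n0 F2 K N F2K y.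
have h2 := iter_walk_le n0 N _ _ F12 y; rewrite iter_walk_addc// in h2.
have h3 := walk_superharmonic n0 F1 K N F1K x0.
have h4 : `|iter N lazy_walk F1 y - iter N lazy_walk F1 x0| <= D * \sum_j `|crd y x0 j|.
  apply: (@lattice_path _ _ (fun=> True)) => // z j _ _.
  rewrite -(@ler_pXn2r _ 2) ?nnegrE// real_normK ?num_real//.
  apply: (@le_trans _ _ (grad2 (iter N lazy_walk F1) z)).
    by rewrite /grad2 (bigD1 j) //= lerDl; apply: sumr_ge0 => i _; exact: sqr_ge0.
  rewrite -(@ler_pM2l _ N%:R) ?ltr0n//.
  exact: le_trans (walk_gradient n0 F1 S N z FS) SD.
have := ler_norm (iter N lazy_walk F1 y - iter N lazy_walk F1 x0); lra.
Qed.

(** By [lap_bump] a bump multiplied by [(1 - kap)^i] is a subsolution for every coefficient allowed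
    by the Courant condition, so a lower bound [b] at time [k1] persists for times of order
    [rho^2]. *)
Lemma spread_lower (w a : nat -> I -> R) (c : I) (rho b kap : R) (k1 m : nat) :
  0 < rho -> 3 * n%:R + 2 <= 2 * rho ^+ 2 -> 0 <= b ->
  (n%:R + 1) ^+ 2 / rho ^+ 2 <= 8 * n%:R * kap -> kap <= 1 -> 0 <= kap ->
  (forall k x, w k.+1 x = avg (a k x) (w k) x) ->
  (forall k x, 0 <= a k x /\ 8 * n%:R * a k x <= 1) ->
  (forall k x, (k1 <= k <= k1 + m)%N -> box c (rho + 1) x -> 0 <= w k x) ->
  (forall x, box c rho x -> b <= w k1 x) ->
  forall i x, (i <= m)%N -> box c (rho + 1) x ->
    b / rho ^+ 4 * (1 - kap) ^+ i * bump c rho x <= w (k1 + i)%N x.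
Proof.
move=> rho0 rhon b0 kapn kap1 kap0 wS wa w0 wb.
have r40 : 0 < rho ^+ 4 by rewrite exprn_gt0.
have bumpE x : bump c rho x = 0 \/ box c rho x.
  rewrite /bump; have [|h] := leP (rho ^+ 2 - sqd c x) 0; first by left; rewrite expr0n.
  by right; apply: sqd_box; [exact: ltW|lra].
have bump0 x : 0 <= bump c rho x by exact: sqr_ge0.
elim=> [|i IH] x im bx.
  have [->|bx'] := bumpE x; first by rewrite mulr0 addn0 w0// leqnn leq_addr.
  rewrite addn0 expr0 mulr1; apply: le_trans (wb x bx').
  rewrite mulrAC ler_pdivrMr// ler_wpM2l//.
  rewrite /bump (_ : rho ^+ 4 = (rho ^+ 2) ^+ 2); last by rewrite -exprM.
  rewrite ler_pXn2r ?nnegrE ?le_max ?lexx ?orbT ?sqr_ge0// ge_max sqr_ge0 andbT.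
  by rewrite gerBl sqd_ge0.
have [->|bx'] := bumpE x.
  by rewrite mulr0 w0// leq_add2l im leq_addr.
rewrite addnS wS; have [a0 a1] := wa (k1 + i)%N x.
set d := b / rho ^+ 4 * (1 - kap) ^+ i in IH.
have d0 : 0 <= d by rewrite mulr_ge0 ?divr_ge0 ?exprn_ge0// ?subr_ge0// ltW.
apply: le_trans (@avg_le _ _ _ (fun y => d * bump c rho y) _ _ a0 _ _); last 2 first.
- by have n0 : 0 <= n%:R * a (k1 + i)%N x by [rewrite mulr_ge0]; lra.
- by move=> y bxy; apply: IH; [exact: ltnW|exact: box_tri bxy].
rewrite avgZ /avg [_ ^+ i.+1]exprS.
have -> : b / rho ^+ 4 * ((1 - kap) * (1 - kap) ^+ i) * bump c rho x =
  d * (bump c rho x - kap * bump c rho x) by rewrite /d; ring.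
apply: ler_wpM2l => //; rewrite lerD2l.
have h := lap_bump c rho x rhon.
have := ler_wpM2l a0 h.
suff : a (k1 + i)%N x * ((n%:R + 1) ^+ 2 / rho ^+ 2 * bump c rho x) <= kap * bump c rho x by lra.
rewrite mulrA ler_wpM2r//.
apply: le_trans (ler_wpM2l a0 kapn) _.
have := ler_wpM2r kap0 a1; lra.
Qed.

(** A one-sided bound on the time increment [a l] yields a lower bound on the Laplacian [l], and an
    upper bound by the increment itself, which telescopes when summed over time. *)
Lemma lap_cases (u a a0 C1 d : R) (l : R) : 0 < a0 -> a0 <= a -> - C1 <= a * l -> 0 <= C1 ->
  - (C1 / a0) <= l /\ l <= (a * l + C1) / a0.
Proof.
move=> a00 aa h C10; split.
  rewrite -mulNr ler_pdivrMr//; have [l0|l0] := leP 0 l.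
    by apply: (@le_trans _ _ 0); [lra|rewrite mulr_ge0// ltW].
  have := mulr_ge0 (ltW (ltac:(lra) : 0 < - l)) (ltac:(lra) : 0 <= a - a0); lra.
rewrite ler_pdivlMr//; have [l0|l0] := leP 0 l.
  have := mulr_ge0 l0 (ltac:(lra) : 0 <= a - a0); lra.
have : l * a0 <= 0 by rewrite nmulr_rle0// ltW.
lra.
Qed.

(** Smallness of [w = N2 - u >= 0] spreads from the point [(k1, x0)] to the later time [k2]. By the
    Benilan-Crandall hypothesis [w k1] is almost superharmonic, while the time average of [w] is
    almost subharmonic and lies, up to [C1 r^2], above [w k2] and below [w k1]. [elliptic_transfer]
    then carries the smallness from [x0] to [y]. *)
Lemma spread_upper (n0 : (0 < n)%N) (u a : nat -> I -> R) (c : I)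
  (k1 k2 N : nat) (r rho a0 C1 om N2 : R) x0 y :
  0 < a0 -> 0 < r -> 0 < rho -> rho + 1 <= r -> 0 <= C1 -> 0 < om ->
  (k1 < k2)%N -> (k2 - k1)%:R <= r ^+ 2 -> r ^+ 2 / 2 <= (k2 - k1)%:R ->
  C1 * r ^+ 2 <= om / 16 ->
  (forall k x, u k.+1 x = avg (a k x) (u k) x) ->
  (forall k x, (k1 <= k <= k2)%N -> box c (2 * r) x ->
     a0 <= a k x /\ N2 - om <= u k x <= N2) ->
  (forall k x, (k1 <= k)%N -> u k x - C1 <= u k.+1 x) ->
  (0 < N)%N -> (6 * n%:R + 3 / a0) * N%:R <= n%:R / 8 * r ^+ 2 ->
  32 * n%:R * (32 * n%:R * rho) ^+ 2 <= N%:R -> 12 * rho ^+ 2 * 16 * n%:R <= r ^+ 2 ->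
  box c rho x0 -> N2 - u k1 x0 <= om / 16 -> box c rho y ->
  N2 - u k2 y <= om / 2.
Proof.
move=> a00 r0 rho0 rhor C10 om0 k12 sr rs C1r uS ua uC N0 Nle Nge rrho bx0 ux0 by0.
pose s := (k2 - k1)%N; pose w k x := N2 - u k x.
have n0' : 0 < n%:R :> R by rewrite ltr0n.
have r20 : 0 < r ^+ 2 by rewrite exprn_gt0.
have s0 : 0 < s%:R :> R by rewrite ltr0n subn_gt0.
have wC k x : (k1 <= k)%N -> w k.+1 x <= w k x + C1 by move=> h; have := uC k x h; rewrite /w; lrac.
have wCi i x : w (k1 + i)%N x <= w k1 x + C1 * i%:R.
  elim: i => [|i IH]; first by rewrite addn0 mulr0 addr0.
  rewrite addnS -natr1; have := wC (k1 + i)%N x (leq_addr _ _); lrac.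
have wCt i : (i <= s)%N -> forall x, w k2 x <= w (k1 + i)%N x + C1 * (s - i)%:R.
  move=> is_ x; rewrite -[k2](subnKC (ltnW k12)) -/s -[s in w (k1 + s)%N x](subnKC is_).
  elim: (s - i)%N => [|j IH]; first by rewrite addn0 mulr0 addr0.
  rewrite !addnS -natr1; have := wC (k1 + (i + j))%N x (leq_addr _ _); lrac.
have lapu k x : (k1 <= k < k2)%N -> box c (2 * r) x ->
    - (C1 / a0) <= lap (u k) x /\ lap (u k) x <= (u k.+1 x - u k x + C1) / a0.
  move=> /andP[kk1 kk2] bx; have [aa _] := ua k x (ltac:(by rewrite kk1 ltnW)) bx.
  have e : u k.+1 x - u k x = a k x * lap (u k) x by rewrite uS /avg; ring.
  by rewrite e; apply: lap_cases => //; rewrite -e; have := uC k x kk1; lrac.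
(* A single slice of [w] has no useful lower bound on its Laplacian. In the average the time
   increments telescope, which leaves [om / s] with [s] of order [r^2]. *)
pose w2 x := s%:R^-1 * \sum_(i < s) w (k1 + i)%N x.
have wbd k x : (k1 <= k <= k2)%N -> box c (2 * r) x -> 0 <= w k x <= om.
  by move=> hk bx; have [_ ?] := ua k x hk bx; rewrite /w; lrac.
have ik2 (i : 'I_s) : (k1 <= k1 + i <= k2)%N.
  by rewrite leq_addr/= -[k2](subnKC (ltnW k12)) leq_add2l ltnW.
have ik2' (i : 'I_s) : (k1 <= k1 + i < k2)%N.
  by rewrite leq_addr/= -[k2](subnKC (ltnW k12)) ltn_add2l.
have avgle (f : 'I_s -> R) b : (forall i, f i <= b) -> s%:R^-1 * \sum_i f i <= b.
  move=> h; rewrite mulrC ler_pdivrMr//; apply: le_trans (ler_sum _ (fun i _ => h i)) _.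
  by rewrite sumr_const card_ord -[b *+ s]mulr_natr.
have avgge (f : 'I_s -> R) b : (forall i, b <= f i) -> b <= s%:R^-1 * \sum_i f i.
  move=> h; rewrite mulrC ler_pdivlMr//; apply: le_trans (ler_sum _ (fun i _ => h i)).
  by rewrite sumr_const card_ord -[b *+ s]mulr_natr.
have w2bd x : box c (2 * r) x -> 0 <= w2 x <= om.
  by move=> bx; rewrite avgle ?avgge// => i; case/andP: (wbd _ x (ik2 i) bx).
have w2le x : w2 x <= w k1 x + C1 * s%:R.
  apply: avgle => i; apply: le_trans (wCi i x) _; rewrite lerD2l ler_wpM2l// ler_nat.
  exact: ltnW.
have w2ge x : w k2 x <= w2 x + C1 * s%:R.
  rewrite -lerBlDr; apply: avgge => i; rewrite lerBlDr.
  apply: le_trans (wCt i (ltnW (ltn_ord i)) x) _.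
  by rewrite lerD2l ler_wpM2l// ler_nat leq_subr.
have lapw1 x : box c (2 * r) x -> lap (w k1) x <= C1 / a0.
  move=> bx; have [h _] := lapu k1 x (ltac:(by rewrite leqnn k12)) bx.
  rewrite [lap _ _]lapB lap_cst; lrac.
have lapw2 x : box c (2 * r) x -> - ((om + C1 * s%:R) / a0 / s%:R) <= lap w2 x.
  move=> bx; rewrite lapZ lap_sum -mulNr [leRHS]mulrC; apply: ler_wpM2r.
    by rewrite invr_ge0 ltW.
  apply: (@le_trans _ _ (\sum_(i < s) (- ((u (k1 + i).+1 x - u (k1 + i)%N x + C1) / a0)))).
    rewrite sumrN lerN2 -mulr_suml; apply: ler_wpM2r; first by rewrite invr_ge0 ltW.
    rewrite big_split /= sumr_const card_ord -[C1 *+ s]mulr_natr lerD2r.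
    have -> : \sum_(i < s) (u (k1 + i).+1 x - u (k1 + i)%N x) = u k2 x - u k1 x.
      under eq_bigr do rewrite -addnS.
      rewrite -(big_mkord xpredT (fun i => u (k1 + i.+1)%N x - u (k1 + i)%N x)).
      by rewrite telescope_sumr// addn0 subnKC// ltnW.
    have /andP[] := wbd k2 x (ltac:(by rewrite leqnn ltnW)) bx.
    have /andP[] := wbd k1 x (ltac:(by rewrite leqnn ltnW)) bx.
    rewrite /w; lrac.
  apply: ler_sum => i _; have [_ h] := lapu _ x (ik2' i) bx.
  rewrite [lap _ _]lapB lap_cst; lrac.
have near x : sqd x0 x < r ^+ 2 -> box c (2 * r) x /\ forall z, box x (1 : R) z -> box c (2 * r) z.
  move=> /ltW h; have bx : box x0 r x by apply: sqd_box => //; exact: ltW.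
  by split => [|z bz]; [apply: box_trile bx0 bx; lrac|
     apply: (box_trile c x z (rho + r) 1 _ _ (box_tri _ _ _ _ _ bx0 bx) bz); lrac].
(* At distance [r] from [x0] the paraboloid reaches [3 om], beyond the range [[0, om]] of [w] and
   [w2], so the truncations at [2 om] and [- 2 om] take over before that. [F1] and [F2] thus extend
   [w k1 + P] and [w2 - P] to the whole lattice, where the walk lives, as a minimum of
   supersolutions and a maximum of subsolutions. *)
pose P x := 3 * om / r ^+ 2 * sqd x0 x.
have Pin x : ~~ (sqd x0 x < r ^+ 2) -> 3 * om <= P x.
  rewrite -leNgt => h; rewrite /P mulrAC ler_pdivlMr// ler_wpM2l//; lrac.
have P0 x : 0 <= P x by rewrite mulr_ge0 ?sqd_ge0// divr_ge0 ?ltW//; lrac.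
have lapP x : lap P x = 6 * n%:R * om / r ^+ 2 by rewrite lapZ lap_sqd; field; rewrite gt_eqF.
pose F1 x := if sqd x0 x < r ^+ 2 then Num.min (w k1 x + P x) (2 * om) else 2 * om.
pose F2 x := if sqd x0 x < r ^+ 2 then Num.max (w2 x - P x) (- (2 * om)) else - (2 * om).
pose K := (6 * n%:R + 3 / a0) * om / r ^+ 2.
have ia0 : 0 < a0^-1 by rewrite invr_gt0.
have ir2 : 0 < (r ^+ 2)^-1 by rewrite invr_gt0.
have KE : K = 6 * n%:R * om / r ^+ 2 + 3 * (om / r ^+ 2 / a0) by rewrite /K; ring.
have C1K : C1 / a0 <= om / r ^+ 2 / a0.
  by rewrite ler_pM2r// ler_pdivlMr//; lrac.
have omr0 : 0 <= om / r ^+ 2 / a0 by rewrite !divr_ge0// ltW.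
have nomr0 : 0 <= 6 * n%:R * om / r ^+ 2 by rewrite divr_ge0 ?mulr_ge0// ltW.
have F1le x : F1 x <= 2 * om by rewrite /F1; case: ifP => // _; rewrite ge_min lexx orbT.
have F2ge x : - (2 * om) <= F2 x by rewrite /F2; case: ifP => // _; rewrite le_max lexx orbT.
have F1w x z : sqd x0 x < r ^+ 2 -> box x (1 : R) z -> F1 z <= w k1 z + P z.
  move=> hx bz; rewrite /F1; case: ifPn => hz; first by rewrite ge_min lexx.
  have /andP[] := wbd k1 z (ltac:(by rewrite leqnn ltnW)) ((near x hx).2 z bz).
  have := Pin z hz; lrac.
have F2w x z : sqd x0 x < r ^+ 2 -> box x (1 : R) z -> w2 z - P z <= F2 z.
  move=> hx bz; rewrite /F2; case: ifPn => hz; first by rewrite le_max lexx.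
  have /andP[] := w2bd z ((near x hx).2 z bz).
  have := Pin z hz; lrac.
have lapF1 x : lap F1 x <= K.
  have K0 : 0 <= K by rewrite KE; lrac.
  case: (ltP (F1 x) (2 * om)) => h; last first.
    apply: le_trans (_ : 0 <= _) => //; apply: lap_maxle (erefl _) _ => y' _.
    exact: le_trans (F1le y') h.
  have [hx|hx] := boolP (sqd x0 x < r ^+ 2); last by rewrite /F1 (negbTE hx) ltxx in h.
  have e : F1 x = w k1 x + P x.
    by move: h; rewrite /F1 hx minEle; case: ifP => // _; rewrite ltxx.
  apply: le_trans (lap_le F1 (fun z => w k1 z + P z) x e (F1w x ^~ hx)) _.
  rewrite lapD lapP KE; have := lapw1 x (near x hx).1; lrac.
have lapF2 x : - K <= lap F2 x.
  have K0 : 0 <= K by rewrite KE; lrac.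
  case: (ltP (- (2 * om)) (F2 x)) => h; last first.
    apply: le_trans (_ : 0 <= _); first lrac.
    apply: lap_minge (erefl _) _ => y' _; exact: le_trans h (F2ge y').
  have [hx|hx] := boolP (sqd x0 x < r ^+ 2); last by rewrite /F2 (negbTE hx) ltxx in h.
  have e : F2 x = w2 x - P x.
    by move: h; rewrite /F2 hx maxEle; case: ifP => // _; rewrite ltxx.
  apply: le_trans (lap_le (fun z => w2 z - P z) F2 x (esym e) (F2w x ^~ hx)).
  rewrite lapB lapP KE; have := lapw2 x (near x hx).1.
  have -> : (om + C1 * s%:R) / a0 / s%:R = om / s%:R / a0 + C1 / a0.
    by field; rewrite !gt_eqF.
  have : om / s%:R / a0 <= 2 * (om / r ^+ 2 / a0).
    rewrite mulrA ler_pM2r// ler_pdivrMr//.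
    have -> : 2 * (om / r ^+ 2) * s%:R = om * (2 * s%:R / r ^+ 2) by ring.
    rewrite -{1}[om]mulr1 ler_pM2l// ler_pdivlMr//; rewrite -/s in rs; lrac.
  lrac.
have F12 x : F2 x <= F1 x + C1 * s%:R.
  have Cs : 0 <= C1 * s%:R by rewrite mulr_ge0.
  rewrite /F1 /F2; case: ifPn => hx; last by move: om0 Cs; clear; lrac.
  have /andP[w0 wom] := w2bd x (near x hx).1; have := P0 x.
  have Px := P0 x; have wx := w2le x.
  rewrite ge_max -!lerBlDr !le_min.
  move: w0 wom Px wx Cs om0; clear => *; rewrite -andbA; apply/and4P; split; lrac.
have F1S x : `|F1 x| <= 2 * om.
  rewrite ler_norml F1le andbT /F1; case: ifPn => hx; last lrac.
  have /andP[w0 _] := wbd k1 x (ltac:(by rewrite leqnn ltnW)) (near x hx).1.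
  have Px := P0 x; rewrite le_min; apply/andP; split; move: w0 Px om0; clear; lrac.
pose D := om / (32 * n%:R * rho).
have nr0 : 0 < 32 * n%:R * rho by rewrite !mulr_gt0.
have D0 : 0 <= D by rewrite divr_ge0 ?ltW.
have SD : 8 * n%:R * (2 * om) ^+ 2 <= N%:R * D ^+ 2.
  have -> : N%:R * D ^+ 2 = N%:R * om ^+ 2 / (32 * n%:R * rho) ^+ 2.
    by rewrite /D; field; rewrite !gt_eqF.
  rewrite ler_pdivlMr ?exprn_gt0//.
  have := ler_wpM2r (sqr_ge0 om) Nge; lrac.
(* Six errors of at most [om / 16] add up to less than [om / 2]: the value at [x0], [C1 s] twice
   (from [w k1] to [w2] and from [w2] to [w k2]), the drift of the walk, its gradient, and [P y]. *)
have := elliptic_transfer n0 F1 F2 (2 * om) K (C1 * s%:R) D N x0 y F1S lapF1 lapF2 F12 N0 D0 SD.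
have bxy : box x0 (2 * rho) y by apply: box_trile (box_sym _ _ _ bx0) by0; lrac.
have e1 : D * \sum_j `|crd y x0 j| <= om / 16.
  apply: le_trans (ler_wpM2l D0 (sum_crd_le _ _ _ bxy)) _.
  by rewrite /D le_eqVlt; apply/orP; left; apply/eqP; field; rewrite !gt_eqF.
have e2 : 2 * ((4 * n%:R)^-1 * K * N%:R) <= om / 16.
  have -> : 2 * ((4 * n%:R)^-1 * K * N%:R) =
     (om / r ^+ 2 / (2 * n%:R)) * ((6 * n%:R + 3 / a0) * N%:R).
    by rewrite /K; field; rewrite !gt_eqF.
  apply: le_trans (ler_wpM2l _ Nle) _; first by rewrite !divr_ge0 ?mulr_ge0// ltW.
  by rewrite le_eqVlt; apply/orP; left; apply/eqP; field; rewrite !gt_eqF.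
have yx0 : sqd x0 y <= n%:R * (2 * rho) ^+ 2 by apply: box_sqd bxy; lrac.
have r2n : n%:R * (2 * rho) ^+ 2 < r ^+ 2.
  have : 0 < n%:R * rho ^+ 2 by rewrite mulr_gt0 ?exprn_gt0.
  lrac.
have yx0' := le_lt_trans yx0 r2n.
have e3 : P y <= om / 16.
  rewrite /P; have -> : 3 * om / r ^+ 2 * sqd x0 y = om * (3 * sqd x0 y / r ^+ 2) by ring.
  apply: ler_wpM2l; first exact: ltW.
  rewrite ler_pdivrMr//; lrac.
have Cs : C1 * s%:R <= om / 16 by apply: le_trans C1r; apply: ler_wpM2l.
have := F2w y y yx0' (boxxx _ _ ler01); have := w2ge y.
have : F1 x0 <= om / 16.
  rewrite /F1 sqdxx r20 ge_min /P sqdxx mulr0 addr0; apply/orP; left; exact: ux0.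
rewrite -/(w k2 y); lrac.
Qed.

End Oscillation.

Lemma expRN2_le {R : realType} (x : R) : 0 <= x -> x <= 2^-1 -> expR (- (2 * x)) <= 1 - x.
Proof.
move=> x0 x1; rewrite expRN -[leRHS]invrK lef_pV2 ?posrE ?expR_gt0 ?invr_gt0 ?expR_gt0//; last lra.
apply: le_trans (expR_ge1Dx (2 * x)); rewrite -div1r ler_pdivrMr; last lra.
by have := mulr_ge0 x0 (ltac:(lra) : 0 <= 1 - 2 * x); lra.
Qed.

Lemma expr_contract {R : realType} (s W w : R) : 0 < s -> s < 1 -> 0 < w ->
  exists J, (1 - s) ^+ J * W <= w.
Proof.
move=> s0 s1 w0.
have H J : (1 - s) ^+ J * (1 + J%:R * s) <= 1.
  elim: J => [|J IH]; first by rewrite expr0 mul0r addr0 mulr1.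
  apply: le_trans IH; rewrite exprS [(1 - s) * _]mulrC -mulrA ler_wpM2l//.
    by rewrite exprn_ge0//; lra.
  rewrite -natr1; have := mulr_ge0 (ler0n R J) (sqr_ge0 s); have := sqr_ge0 s; lra.
have [W0|W0] := leP W 0.
  exists 0%N; rewrite expr0 mul1r; exact: le_trans W0 (ltW w0).
pose J := Num.bound (W / (w * s)); exists J.
have hJ : W / (w * s) < J%:R.
  by apply: archi_boundP; rewrite divr_ge0// ?mulr_ge0// ltW.
have J0 : 0 < 1 + J%:R * s by rewrite ltr_pwDl// mulr_ge0// ltW.
rewrite -(ler_pM2r J0) mulrAC; apply: (@le_trans _ _ (1 * W)).
  by rewrite ler_wpM2r// ltW.
have : W <= J%:R * (w * s) by rewrite -ler_pdivrMr ?mulr_gt0// ltW.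
lra.
Qed.

Section OscillationDecay.
Context {R : realType} {n : nat}.
Local Notation I := ('rV[int]_n).
Implicit Types (x y c : I).

Definition lattice_solution (u a : nat -> I -> R) (C1 : R) (k0 : nat) : Prop :=
  [/\ forall k x, u k.+1 x = avg (a k x) (u k) x,
      forall k x, 0 <= a k x /\ 8 * n%:R * a k x <= 1 &
      forall k x, (k0 <= k)%N -> u k x - C1 <= u k.+1 x].

(** At a time [k1] about [r^2] before [K], either [u] comes within [om / 16] of its upper bound
    somewhere in a small box, and [spread_upper] raises the lower bound, or [N2 - u] is at least
    [om / 16] on that whole box, and [spread_lower] reduces the upper bound. *)
Lemma osc_step (n0 : (0 < n)%N) (a0 : R) : 0 < a0 ->
  exists q s rs : R, [/\ 0 < q <= 2^-1, 0 < s < 1, 1 <= rs &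
  forall (u a : nat -> I -> R) (c : I) (K k0 : nat) (r N1 N2 C1 : R),
  rs <= r -> r ^+ 2 <= K%:R - k0%:R -> lattice_solution u a C1 k0 ->
  (forall k x, box c (2 * r) x -> K%:R - r ^+ 2 <= k%:R -> (k <= K)%N ->
     a0 <= a k x /\ N1 <= u k x <= N2) ->
  0 <= C1 -> N1 < N2 -> C1 * r ^+ 2 <= (N2 - N1) / 16 ->
  exists N1' N2', N2' - N1' <= (1 - s) * (N2 - N1) /\
   forall k x, box c (2 * (q * r)) x -> K%:R - (q * r) ^+ 2 <= k%:R -> (k <= K)%N ->
     N1' <= u k x <= N2'].
Proof.
move=> a00.
have n0' : 0 < n%:R :> R by rewrite ltr0n.
have n1 : 1 <= n%:R :> R by rewrite ler1n.
have n3 : n%:R <= n%:R ^+ 3 :> R by rewrite -[leLHS]expr1 ler_weXn2l.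
(* Defining equations of constants are stated under [Some], out of reach of linear arithmetic, and
   released where they are used. *)
have [Ca [Ca0 Cale CaE]] : exists Ca : R, [/\ 0 < Ca, 6 * n%:R <= Ca &
    Some Ca = Some (6 * n%:R + 3 / a0)].
  have ia0 : 0 < 3 / a0 by rewrite divr_gt0.
  by exists (6 * n%:R + 3 / a0); split => //; lra.
(* The walk runs for about [eta r^2] steps: [Ca eta = n / 8] is the longest run whose drift
   [spread_upper] tolerates. The ratio [q0] of the next constant makes the box radius [rho = q0 r]
   so small that a walk of this length forgets where in the box it started. *)
have [eta [eta0 etaC eta1]] : exists eta : R, [/\ 0 < eta, Some (Ca * eta) = Some (n%:R / 8) & eta <= 1].
  exists (n%:R / (8 * Ca)); split; first by rewrite divr_gt0// mulr_gt0.
    by congr Some; field; rewrite gt_eqF.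
  by rewrite ler_pdivrMr ?mulr_gt0//; lra.
have n32 : 1 <= n%:R ^+ 3 :> R by rewrite exprn_ege1.
have [q0 [q00 q0E nq2 q0n]] : exists q0 : R, [/\ 0 < q0,
    (32 * n%:R * (32 * n%:R) ^+ 2 * (q0 * q0) <= eta / 2) \/ False, 192 * (n%:R * q0) <= 1 &
    q0 <= n%:R * q0].
  have [B [B0 BE]] : exists B : R, 0 < B /\ B = 32 * (32 * 32).
    by exists (32 * (32 * 32)); rewrite !mulr_gt0.
  have n30 : 0 < 2 * B * n%:R ^+ 3 by rewrite !mulr_gt0// exprn_gt0.
  pose q0 := eta / (2 * B * n%:R ^+ 3).
  have q00 : 0 < q0 by rewrite divr_gt0.
  have q0E : 2 * B * n%:R ^+ 3 * q0 = eta by rewrite /q0 mulrC divfK// gt_eqF.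
  clearbody q0; exists q0; split => //; last by rewrite ler_peMl// ltW.
    left; have -> : 32 * n%:R * (32 * n%:R) ^+ 2 * (q0 * q0) = eta / 2 * q0.
      by rewrite -q0E BE; field.
    rewrite ger_pMr ?divr_gt0//.
    have : 1 * q0 <= 2 * B * n%:R ^+ 3 * q0.
      rewrite ler_pM2r//; apply: (@le_trans _ _ (2 * B * 1)); first by rewrite BE; lra.
      by apply: ler_wpM2l => //; rewrite mulr_ge0// ltW.
    by rewrite q0E; lra.
  apply: le_trans eta1; rewrite -q0E.
  have nq : n%:R * q0 <= n%:R ^+ 3 * q0 by rewrite ler_pM2r.
  have : 192 * (n%:R ^+ 3 * q0) <= 2 * B * (n%:R ^+ 3 * q0).
    by rewrite ler_pM2r ?mulr_gt0 ?exprn_gt0//; rewrite BE; lra.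
  move: nq; lra.
have [q [q_0 q_1 qE]] : exists q : R, [/\ 0 < q, 2 * q <= q0 & Some q = Some (q0 / (4 * n%:R))].
  exists (q0 / (4 * n%:R)); split => //; first by rewrite divr_gt0// mulr_gt0.
  rewrite mulrA ler_pdivrMr ?mulr_gt0//; have := ler_peMr (ltW q00) n1; lra.
have np1 : 0 < n%:R + 1 :> R by lra.
have [Z [Z0 ZE]] : exists Z : R, 0 < Z /\ Some Z = Some ((n%:R + 1) ^+ 2 / (8 * n%:R * q0 ^+ 2)).
  exists ((n%:R + 1) ^+ 2 / (8 * n%:R * q0 ^+ 2)); split => //.
  by apply: divr_gt0; [exact: exprn_gt0|rewrite !mulr_gt0// exprn_gt0].
(* In the second alternative [om / 16] is the bound at time [k1], [9/16] the relative height of the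
   bump on the final box, and [expR (- (2 * Z))] the loss over [r^2] steps at the rate
   [kap = Z / r^2]. *)
have [s [s0 s1 sE]] : exists s : R, [/\ 0 < s, s <= 2^-1 &
    Some s = Some (9 / 16 / 16 * expR (- (2 * Z)))].
  have c0 : 0 < 9 / 16 / 16 :> R by lra.
  exists (9 / 16 / 16 * expR (- (2 * Z))); split => //; first exact: mulr_gt0 c0 (expR_gt0 _).
  apply: (@le_trans _ _ (9 / 16 / 16 * 1)); last lra.
  by apply: (ler_wpM2l (ltW c0)); rewrite expR_le1; lra.
have q02 : 0 < q0 ^+ 2 by rewrite exprn_gt0.
have [rs [rs2 rseta rsq rsZ]] : exists rs : R, [/\ 2 <= rs, 2 / eta <= rs,
    (3 * n%:R + 2) / q0 ^+ 2 <= rs & 2 * Z <= rs].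
  exists (2 + 2 / eta + (3 * n%:R + 2) / q0 ^+ 2 + 2 * Z).
  have e1 : 0 < 2 / eta by rewrite divr_gt0.
  have e2 : 0 < (3 * n%:R + 2) / q0 ^+ 2 by rewrite divr_gt0//; lra.
  by split; lra.
have q02' : q0 <= 2^-1 by move: nq2 q0n q00; clear; lra.
exists q, s, rs; split.
- by apply/andP; split => //; move: q_1 q02' q00; clear; lra.
- by apply/andP; split => //; move: s1; clear; lra.
- by move: rs2; clear; lra.
move=> u a c K k0 r N1 N2 C1 rrs rK [uS ua uC] hu C10 N12 C1r.
have r2 : 2 <= r by exact: le_trans rrs.
have rseta' := le_trans rseta rrs; have rsq' := le_trans rsq rrs.
have rsZ' := le_trans rsZ rrs.
have r0 : 0 < r by exact: lt_le_trans r2.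
have r_ge0 := ltW r0.
have r22 : 2 * r <= r ^+ 2 by rewrite expr2 ler_wpM2r.
have rr2 : r <= r ^+ 2 by move: r22 r0; clear; lra.
have r20 : 0 < r ^+ 2 by exact: lt_le_trans rr2.
have etar : 2 <= eta * r ^+ 2.
  by rewrite mulrC -ler_pdivrMr//; exact: le_trans rr2.
pose rho := q0 * r.
have rho0 : 0 < rho by exact: mulr_gt0.
have rho2 : 3 * n%:R + 2 <= rho ^+ 2.
  by rewrite /rho exprMn [leRHS]mulrC -ler_pdivrMr//; exact: le_trans rr2.
pose m := Num.truncn (r ^+ 2); pose N := Num.truncn (eta * r ^+ 2).
have /andP[m1 m2] : m%:R <= r ^+ 2 < m.+1%:R by apply: truncn_itv; exact: ltW.
have /andP[N1' N2'] : N%:R <= eta * r ^+ 2 < N.+1%:R.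
  by apply: truncn_itv; rewrite mulr_ge0// ltW.
rewrite -natr1 in m2; rewrite -(natr1 N) in N2'.
have mK : (m + k0 <= K)%N by rewrite -(ler_nat R) natrD; move: m1 rK; clear; lra.
have mK' : (m <= K)%N by exact: leq_trans (leq_addr _ _) mK.
pose k1 := (K - m)%N.
have k1E : k1%:R = K%:R - m%:R :> R by rewrite natrB.
have k01 : (k0 <= k1)%N by rewrite leq_subRL.
have rhor : rho <= r / 2.
  by have := ler_wpM2r r_ge0 q02'; rewrite /rho; clear; lra.
have qbox : 2 * (q * r) <= rho.
  by have := ler_wpM2r r_ge0 q_1; rewrite /rho; clear; lra.
have qr2 : (q * r) ^+ 2 <= r ^+ 2 / 4.
  have h : q * r <= r / 2 by move: qbox rhor r0; clear; lra.
  apply: (@le_trans _ _ ((r / 2) ^+ 2)); last by clear; lra.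
  by rewrite ler_pXn2r ?nnegrE ?mulr_ge0// ltW.
have hu' k x : (k1 <= k <= K)%N -> box c (2 * r) x -> a0 <= a k x /\ N1 <= u k x <= N2.
  move=> /andP[h1 h2] bx; apply: hu => //.
  by move: h1 m1; rewrite -(ler_nat R) k1E; clear; lra.
pose om := N2 - N1.
have om0 : 0 < om by rewrite subr_gt0.
have q0q0 : q0 * q0 <= q0 by rewrite ger_pMl//; move: q02'; clear; lra.
have rho_r : rho + 1 <= r by move: rhor r2; clear; lra.
have rho12 : rho + 1 <= 2 * r by move: rho_r r0; clear; lra.
have qbox2 : 2 * (q * r) <= 2 * r by move: qbox rho_r r0; clear; lra.
have qbox1 : 2 * (q * r) <= rho + 1 by move: qbox; clear; lra.
have kk (k : nat) : K%:R - (q * r) ^+ 2 <= k%:R -> r ^+ 2 / 2 <= k%:R - k1%:R :> R.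
  by rewrite k1E; move: qr2 m2 r22 r2; clear; lra.
case: (pselect (exists2 x0, box c rho x0 & N2 - u k1 x0 <= om / 16)) => [[x0 bx0 ux0]|H].
  exists (N2 - om / 2), N2; split.
    have h2 : 0 <= 2^-1 - s by move: s1; clear; lra.
    by have := mulr_ge0 h2 (ltW om0); rewrite -/om; clear; lra.
  move=> k x bx hk kK.
  have hk' := kk k hk.
  have k1k : (k1 < k)%N by rewrite -(ltr_nat R); move: hk' r20; clear; lra.
  have [|_ /andP[_ ->]] := hu' k x _ (box_le _ _ _ _ qbox2 bx); first by rewrite ltnW.
  rewrite andbT lerBlDr -lerBlDl.
  apply: (@spread_upper R n n0 u a c k1 k N r rho a0 C1 om N2 x0 x) => //.
  - rewrite natrB ?(ltnW k1k)//; move: kK m1; rewrite -(ler_nat R) k1E; clear; lra.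
  - by rewrite natrB ?(ltnW k1k).
  - move=> k' x' /andP[h1 h2] bx'; rewrite /om opprB addrC subrK.
    by apply: hu' => //; rewrite h1 (leq_trans h2).
  - by move=> k' x' h; apply: uC; exact: leq_trans h.
  - by rewrite -(ltr_nat R); move: N2' etar; clear; lra.
  - case: CaE => <-; apply: le_trans (ler_wpM2l (ltW Ca0) N1') _.
    by case: etaC => etaC'; rewrite mulrA etaC'.
  - apply: (@le_trans _ _ (eta * r ^+ 2 / 2)); last by move: N2' etar; clear; lra.
    have -> : 32 * n%:R * (32 * n%:R * rho) ^+ 2 =
        32 * n%:R * (32 * n%:R) ^+ 2 * (q0 * q0) * r ^+ 2 by rewrite /rho; ring.
    by rewrite [leRHS]mulrAC ler_wpM2r//; [exact: ltW|case: q0E].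
  - have -> : 12 * rho ^+ 2 * 16 * n%:R = (192 * n%:R * (q0 * q0)) * r ^+ 2.
      by rewrite /rho; ring.
    rewrite ger_pMl//; have := ler_wpM2l (ltW n0') q0q0; move: nq2; clear; lra.
  - exact: box_le bx.
exists N1, (N2 - s * om); split; first by rewrite -/om /om; clear; lra.
move=> k x bx hk kK.
have hk' := kk k hk.
have k1k : (k1 <= k)%N by rewrite -(ler_nat R); move: hk' r20; clear; lra.
have [|_ /andP[-> _]] := hu' k x _ (box_le _ _ _ _ qbox2 bx); first by rewrite k1k.
rewrite /= lerBrDl -lerBrDr.
pose kap := Z / r ^+ 2.
have kap0 : 0 <= kap by rewrite divr_ge0 ?ltW.
have kap2 : kap <= 2^-1.
  by rewrite ler_pdivrMr//; move: rsZ' rr2; clear; lra.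
have L := @spread_lower R n (fun k x => N2 - u k x) a c rho (om / 16) kap k1 m rho0.
have {L} := L _ _ _ _ _ _ _ _ _ (k - k1)%N x _ _.
rewrite subnKC// => L; apply: le_trans (L _ _ _ _ _ _ _ _ _ _ _) => {L}; last first.
- exact: box_le bx.
- by rewrite leq_subLR /k1 subnK.
- move=> y by0; rewrite leNgt; apply/negP => hy; apply: H; exists y => //; exact: ltW.
- move=> k' y /andP[h1 h2] by0; rewrite subr_ge0.
  have [|_ /andP[_ ->]//] := hu' k' y _ (box_le _ _ _ _ rho12 by0).
  by rewrite h1 (leq_trans h2)// /k1 subnK.
- exact: ua.
- by move=> k' y; rewrite uS avgB avg_cst.
- exact: kap0.
- by move: kap2; clear; lra.
- case: ZE => ZE'; rewrite /kap ZE' /rho exprMn le_eqVlt; apply/orP; left; apply/eqP.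
  by field; rewrite !gt_eqF.
- by rewrite divr_ge0// ltW.
- by move: rho2 n1; clear; lra.
have rho40 : 0 < rho ^+ 4 by rewrite exprn_gt0.
have rho20 := sqr_ge0 rho.
have hb : 9 / 16 * rho ^+ 4 <= bump c rho x.
  have sx : sqd c x <= rho ^+ 2 / 4.
    apply: le_trans (box_sqd _ _ _ _ bx) _; first by rewrite !mulr_ge0// ltW.
    have -> : n%:R * (2 * (q * r)) ^+ 2 = rho ^+ 2 / (4 * n%:R).
      by case: qE => qE'; rewrite qE' /rho; field; rewrite gt_eqF.
    rewrite ler_wpM2l// lef_pV2 ?posrE ?mulr_gt0//; move: n1; clear; lra.
  rewrite /bump max_l; last by move: sx rho20; clear; lra.
  have -> : 9 / 16 * rho ^+ 4 = (3 / 4 * rho ^+ 2) ^+ 2 by field.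
  have h1 : 0 <= 3 / 4 * rho ^+ 2 by move: rho20; clear; lra.
  have h2 : 3 / 4 * rho ^+ 2 <= rho ^+ 2 - sqd c x by move: sx; clear; lra.
  by rewrite ler_pXn2r ?nnegrE// (le_trans h1).
have hp : expR (- (2 * Z)) <= (1 - kap) ^+ (k - k1).
  have e3 := expRN2_le kap kap0 kap2.
  have : expR (- (2 * kap)) ^+ (k - k1) <= (1 - kap) ^+ (k - k1).
    by rewrite lerXn2r ?nnegrE ?expR_ge0//; move: kap2; clear; lra.
  apply: le_trans; rewrite -expRM_natl ler_expR.
  have -> : (k - k1)%:R * - (2 * kap) = - (2 * (Z * ((k - k1)%:R / r ^+ 2))).
    by rewrite /kap; ring.
  rewrite lerN2 ler_pM2l// ger_pMr// ler_pdivrMr// mul1r natrB// k1E.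
  by move: kK m1; rewrite -(ler_nat R); clear; lra.
have -> : s * om = om / 16 / rho ^+ 4 * expR (- (2 * Z)) * (9 / 16 * rho ^+ 4).
  by case: sE => ->; field; rewrite gt_eqF.
have h16 : 0 <= om / 16 / rho ^+ 4 by rewrite !divr_ge0// ltW.
apply: ler_pM => //.
- by rewrite mulr_ge0 ?expR_ge0.
- by rewrite mulr_ge0// ltW.
- exact: ler_wpM2l.
Qed.

(** [osc_step] iterated until the oscillation is below a prescribed [w]. No Holder exponent is
    recorded: Bernstein's method only asks for small oscillation on a fixed fraction of the
    cylinder. *)
Lemma osc_small (n0 : (0 < n)%N) (a0 W w : R) : 0 < a0 -> 0 < w ->
  exists q rs : R, [/\ 0 < q <= 1, 1 <= rs &
  forall (u a : nat -> I -> R) (c : I) (K k0 : nat) (r N1 N2 C1 : R),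
  rs <= r -> r ^+ 2 <= K%:R - k0%:R -> lattice_solution u a C1 k0 ->
  (forall k x, box c (2 * r) x -> K%:R - r ^+ 2 <= k%:R -> (k <= K)%N ->
     a0 <= a k x /\ N1 <= u k x <= N2) ->
  0 <= C1 -> N2 - N1 <= W -> C1 * r ^+ 2 <= w / 16 ->
  exists N1' N2', N2' - N1' <= w /\
   forall k x, box c (2 * (q * r)) x -> K%:R - (q * r) ^+ 2 <= k%:R -> (k <= K)%N ->
     N1' <= u k x <= N2'].
Proof.
move=> a00 w0.
have [q [s [rs [/andP[q0 q1] /andP[s0 s1] rs1 step]]]] := osc_step n0 a0 a00.
have [J hJ] := expr_contract s W w s0 s1 w0.
have qJ j : 0 < q ^+ j <= 1 by rewrite exprn_gt0// exprn_ile1// ?ltW//; lra.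
exists (q ^+ J), (rs / q ^+ J); split; first exact: qJ.
  have /andP[h1 h2] := qJ J.
  by rewrite ler_pdivlMr// mul1r (le_trans h2).
move=> u a c K k0 r N1 N2 C1 rsr rK sol hu C10 NW C1r.
have r0 : 0 < r.
  by apply: lt_le_trans rsr; rewrite divr_gt0//; [lra|case/andP: (qJ J)].
suff [N1' [N2' [hle hb]]] : exists N1' N2', N2' - N1' <= Num.max w ((1 - s) ^+ J * W) /\
   forall k x, box c (2 * (q ^+ J * r)) x -> K%:R - (q ^+ J * r) ^+ 2 <= k%:R -> (k <= K)%N ->
     N1' <= u k x <= N2'.
  by exists N1', N2'; split => //; rewrite max_l in hle.
move: (leqnn J); move: {-2}J => j; elim: j => [|j IH] jJ.
  exists N1, N2; split; first by rewrite expr0 mul1r le_max NW orbT.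
  by move=> k x; rewrite expr0 mul1r => h1 h2 h3; have [] := hu k x h1 h2 h3.
have [N1' [N2' [hle hb]]] := IH (ltnW jJ).
have /andP[qj0 qj1] := qJ j.
have shrink : q ^+ j.+1 * r <= q ^+ j * r.
  by rewrite ler_pM2r// exprS ger_pMl//; lra.
have qjr : q ^+ j * r <= r by rewrite ger_pMl.
have qjr0 : 0 < q ^+ j * r by rewrite mulr_gt0.
have qSr0 : 0 < q ^+ j.+1 * r by rewrite mulr_gt0// exprn_gt0.
have sq (x y : R) : 0 < x -> x <= y -> x ^+ 2 <= y ^+ 2.
  by move=> x0 xy; rewrite ler_pXn2r ?nnegrE//; lra.
have sq1 := sq _ _ qSr0 shrink; have sq2 := sq _ _ qjr0 qjr.
(* The iteration stops once the oscillation is at most [w], since from then on [C1 r^2] need not be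
   small compared with it. *)
have [small|big] := leP (N2' - N1') w.
  exists N1', N2'; split; first by rewrite le_max small.
  move=> k x bx hk kK; apply: hb => //; [by apply: box_le bx; lra|lra].
have [] := step u a c K k0 (q ^+ j * r) N1' N2' C1 _ _ sol _ C10 _ _.
- rewrite mulrC -ler_pdivrMr//; apply: le_trans rsr.
  rewrite ler_pM2l; last lra.
  rewrite lef_pV2 ?posrE ?exprn_gt0//; apply: ler_wiXn2l; [lra|lra|exact: ltnW].
- lra.
- move=> k x bx hk kK; split; last exact: hb.
  by have [] := hu k x (ltac:(apply: box_le bx; lra)) (ltac:(lra)) kK.
- lra.
- have := ler_wpM2l C10 sq2; lra.
move=> M1 [M2 [hM hMb]]; exists M1, M2; split.
  apply: le_trans hM _; have s10 : 0 <= 1 - s by lra.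
  apply: le_trans (ler_wpM2l s10 hle) _.
  have [h|h] := leP w ((1 - s) ^+ j * W).
    by rewrite exprS le_max -mulrA lexx orbT.
  by rewrite le_max; apply/orP; left; have := mulr_gt0 s0 w0; lra.
by rewrite exprS -mulrA; exact: hMb.
Qed.

End OscillationDecay.

(** * Bernstein's method on the lattice *)

Lemma sqr_le {R : realType} (x y : R) : 0 <= x -> x <= y -> x ^+ 2 <= y ^+ 2.
Proof. by move=> x0 xy; rewrite ler_pXn2r ?nnegrE// (le_trans x0). Qed.

Section Bernstein.
Context {R : realType} {n : nat}.
Local Notation I := ('rV[int]_n).
Implicit Types (x y c : I) (r : R).

Definition cyl c (K : nat) r x (k : nat) : Prop :=
  [/\ box c r x, K%:R - r ^+ 2 <= k%:R & (k <= K)%N].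

(** Common form of the estimates for first, second and third differences: [G] collects squared
    differences of one order more than [H]. A step of [H] dissipates [cc G]; a step of [G] may
    create an error quadratic in the local maximum [S], claimed only above the threshold [Ss]. The
    factor [cc / (64 * (80 * B))] is what the dissipation of a multiple of [H] can absorb when [S]
    is at most 8 times the value of [G] at the reference point. *)
Record bernstein_hyp (a G H : nat -> I -> R) c (K : nat) (r B Kc cc Ss Z : R) : Prop :=
  BernsteinHyp {
  _ : (0 < n)%N; _ : 0 < cc; _ : cc * n%:R <= 1; _ : 0 < B; _ : 0 <= Kc; _ : 0 < r;
  _ : r ^+ 2 <= K%:R;
  _ : forall k x, 0 <= a k x /\ 8 * n%:R * a k x <= 1;
  _ : forall x k, cyl c K r x k -> 0 <= G k x <= 4 * n%:R * B /\ 0 <= H k x <= B;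
  _ : forall x k, cyl c K r x k -> (k < K)%N ->
     H k.+1 x <= avg (a k x) (H k) x + Kc - cc * G k x;
  _ : forall x k S, cyl c K r x k -> (k < K)%N -> Ss <= S ->
     (forall y, box x (4 : R) y -> G k y <= S) ->
     G k.+1 x <= avg (a k x) (G k) x + cc / (64 * (80 * B)) * S ^+ 2;
  _ : 40 * 40 * B / cc <= Z; _ : Ss * r ^+ 2 <= Z; _ : 8 * Kc * r ^+ 2 / cc <= Z }.

(* Maximum principle for [G + N H - b] with [b] a paraboloid based at the point
   where [G] is essentially maximal; [N] is chosen according to that maximum. *)
Lemma bernstein_core a G H c K r B Kc cc Ss Z c' K' (r' : R) :
  bernstein_hyp a G H c K r B Kc cc Ss Z -> 0 < r' -> r' <= r -> 16 * r' ^+ 2 <= K'%:R ->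
  (forall x k, cyl c' K' (2 * r') x k -> cyl c K r x k) -> Z < G K' c' * r' ^+ 2 ->
  (forall x k, cyl c' K' (2 * r') x k -> G k x <= 8 * G K' c') -> False.
Proof.
case=> n0 cc0 ccn B0 Kc0 r0 rK ha h1 h2 h3 Z1 Z2 Z3.
move=> r'0 r'r rK' sub ZG G8.
set G0 := G K' c' in ZG G8 *.
have n0' : 0 < n%:R :> R by rewrite ltr0n.
have r'2 : 0 < r' ^+ 2 by rewrite exprn_gt0.
have Z0 : 0 < Z by apply: lt_le_trans Z1; rewrite divr_gt0// mulr_gt0.
have G00 : 0 < G0 by rewrite -(pmulr_lgt0 _ r'2); exact: lt_trans ZG.
have cself : cyl c' K' (2 * r') c' K'.
  split=> //; first by apply: boxxx; rewrite mulr_ge0// ltW.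
  by rewrite gerBl sqr_ge0.
have [/andP[_ GB] _] := h1 _ _ (sub _ _ cself); rewrite -/G0 in GB.
have rr2 : r' ^+ 2 <= r ^+ 2 := sqr_le _ _ (ltW r'0) r'r.
(* Below this scale the crude bound [G <= 4 n B] contradicts [Z < G0 r'^2]. Hence the larger
   cylinder contains the boxes of radius 4 that occur in the error term. *)
have r'4 : 4 <= r'.
  rewrite leNgt; apply/negP => r'4.
  have r16 : r' ^+ 2 <= 16.
    by rewrite (_ : 16 = 4 ^+ 2); [exact: sqr_le (ltW r'0) (ltW r'4)|ring].
  have e1 : G0 * r' ^+ 2 <= 4 * n%:R * B * 16.
    by apply: ler_pM => //; exact: ltW.
  have e2 : 64 * n%:R * B <= 40 * 40 * B / cc.
    rewrite ler_pdivlMr//; have := ler_wpM2l (ltW B0) ccn.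
    by move: B0; clear; lra.
  by move: e1 e2 ZG Z1; clear; lra.
have r16 : 16 <= r' ^+ 2.
  by rewrite (_ : 16 = 4 ^+ 2); [exact: sqr_le r'4|ring].
(* [Nn H <= G0 / 10], and on the boundary the paraboloid is close to [10 G0], above
   [8 G0 + G0 / 10]. Where [G >= G0 / 2] the dissipation [8 e G0 G >= 4 e G0^2] beats three errors
   of at most [e G0^2]; elsewhere [Phi <= 6/10 G0] and no dissipation is called for. *)
pose e := cc / (80 * B); pose Nn := G0 / (10 * B); pose bq := 10 * G0 / r' ^+ 2.
have e0 : 0 < e by rewrite divr_gt0// mulr_gt0.
have eB : e * B * 80 = cc by rewrite /e; field; rewrite gt_eqF.
have NB : Nn * (10 * B) = G0 by rewrite divfK// gt_eqF// mulr_gt0.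
have N0 : 0 <= Nn by rewrite divr_ge0 ?mulr_ge0// ltW.
have Ncc : Nn * cc = 8 * e * G0 by rewrite /Nn /e; field; rewrite gt_eqF.
have eG0 : 0 < e * G0 ^+ 2 by rewrite mulr_gt0// exprn_gt0.
have bq0 : 0 < bq by rewrite divr_gt0// mulr_gt0.
have bqr : bq * r' ^+ 2 = 10 * G0 by rewrite divfK// gt_eqF.
have bqe : 2 * bq <= e * G0 ^+ 2.
  have h : 20 <= e * (G0 * r' ^+ 2).
    have := ler_wpM2l (ltW e0) (ltW (le_lt_trans Z1 ZG)).
    by rewrite (_ : e * (40 * 40 * B / cc) = 20)//; rewrite /e; field; rewrite !gt_eqF.
  rewrite -(ler_pM2r r'2) -mulrA bqr.
  by have := ler_wpM2r (ltW G00) h; clear; lra.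
have NK : Nn * Kc <= e * G0 ^+ 2.
  have h : 8 * Kc / cc <= G0.
    rewrite -(ler_pM2r r'2); apply: ltW; apply: le_lt_trans ZG; apply: le_trans Z3.
    rewrite [leRHS]mulrAC; apply: ler_wpM2l => //.
    by rewrite divr_ge0 ?mulr_ge0// ltW.
  have -> : Nn * Kc = e * G0 * (8 * Kc / cc).
    by rewrite /Nn /e; field; rewrite !gt_eqF.
  by have := ler_wpM2l (mulr_ge0 (ltW e0) (ltW G00)) h; clear; lra.
have eG : e * G0 <= 20^-1.
  apply: (@le_trans _ _ (e * (4 * n%:R * B))); first by rewrite ler_pM2l.
  by have := ccn; rewrite -eB; clear; lra.
have SsG : Ss <= 8 * G0.
  suff : Ss <= G0 by move: G00; clear; lra.
  rewrite -(ler_pM2r (_ : 0 < r ^+ 2)) ?exprn_gt0//.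
  apply: le_trans Z2 _; apply: ltW; apply: lt_le_trans ZG _.
  by rewrite ler_pM2l.
pose Phi k x := G k x + Nn * H k x - bq * (sqd c' x + (K'%:R - k%:R)).
have cyl12 x k : cyl c' K' r' x k -> cyl c' K' (2 * r') x k.
  move=> [b1 b2 b3]; split => //; first by apply: box_le b1; move: r'0; clear; lra.
  by apply: le_trans b2; rewrite exprMn; move: r'2; clear; lra.
have cylS x k y : cyl c' K' r' x k -> box x (4 : R) y -> cyl c' K' (2 * r') y k.
  move=> [b1 b2 b3] bxy; split => //.
    by apply: box_le (box_tri _ _ _ _ _ b1 bxy); move: r'4; clear; lra.
  by apply: le_trans b2; rewrite exprMn; move: r'2; clear; lra.
have Hbd x k : cyl c' K' (2 * r') x k -> 0 <= G k x <= 8 * G0 /\ 0 <= Nn * H k x <= G0 / 10.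
  move=> hc; have [/andP[g0 _] /andP[q0 qB]] := h1 _ _ (sub _ _ hc).
  split; first by rewrite g0 G8.
  rewrite mulr_ge0//=; have := ler_wpM2l N0 qB; rewrite -NB; clear; lra.
have PhiA k x : K'%:R - r' ^+ 2 <= k%:R -> (k <= K')%N -> box c' r' x -> Phi k x < G0.
  elim: k x => [|k IH] x hk kK bx.
    have hc : cyl c' K' r' x 0 by [].
    have [/andP[_ g8] /andP[_ h10]] := Hbd _ _ (cyl12 _ _ hc).
    have := mulr_ge0 (ltW bq0) (sqd_ge0 c' x).
    have : 16 * (bq * r' ^+ 2) <= bq * K'%:R.
      by have := ler_wpM2l (ltW bq0) rK'; clear; lra.
    rewrite bqr /Phi; move: g8 h10 G00; clear; lra.
  have [hk'|hk'] := ltP (k%:R : R) (K'%:R - r' ^+ 2).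
    have hc : cyl c' K' r' x k.+1 by [].
    have [/andP[_ g8] /andP[_ h10]] := Hbd _ _ (cyl12 _ _ hc).
    have := mulr_ge0 (ltW bq0) (sqd_ge0 c' x).
    have h : r' ^+ 2 - 1 <= K'%:R - k.+1%:R by rewrite -natr1; move: hk'; clear; lra.
    have := ler_wpM2l (ltW bq0) h; have := ler_wpM2l (ltW bq0) r16.
    rewrite mulrBr bqr /Phi; move: g8 h10 G00; clear; lra.
  have hc : cyl c' K' r' x k by split => //; exact: ltnW.
  have hcr := sub _ _ (cyl12 _ _ hc).
  have kK1 : (k < K)%N.
    have [_ _ kK2] := sub x k.+1 (cyl12 x k.+1 (And3 bx hk kK)); exact: kK2.
  have [a0 a1] := ha k x.
  have a2 : 2 * n%:R * a k x <= 4^-1 by move: a1; clear; lra.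
  have na0 : 0 <= n%:R * a k x by rewrite mulr_ge0.
  have a3 : 2 * n%:R * a k x <= 1 by move: a2; clear; lra.
  have gS := h3 _ _ _ hcr kK1 SsG (fun y by_ => G8 _ _ (cylS _ _ _ hc by_)).
  have hS := ler_wpM2l N0 (h2 _ _ hcr kK1).
  have PhiN y : box x (1 : R) y -> Phi k y <= G0.
    move=> by_; have [/(IH y hk' (ltnW kK))/ltW//|nb] := pselect (box c' r' y).
    have hcy : cyl c' K' (2 * r') y k.
      by apply: cylS hc _; apply: box_le by_; clear; lra.
    have [/andP[_ g8] /andP[_ h10]] := Hbd _ _ hcy.
    have := ler_wpM2l (ltW bq0) (notbox_sqd _ _ _ (ltW r'0) nb); rewrite bqr.
    have : 0 <= bq * (K'%:R - k%:R) by rewrite mulr_ge0 ?(ltW bq0)// subr_ge0 ler_nat ltnW.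
    rewrite /Phi; move: g8 h10 G00; clear; lra.
  have avgPhi : avg (a k x) (Phi k) x = avg (a k x) (G k) x + Nn * avg (a k x) (H k) x
      - bq * (sqd c' x + (K'%:R - k%:R)) - bq * (2 * n%:R * a k x).
    by rewrite /Phi avgB avgD !avgZ avgD avg_cst avg_sqd; ring.
  have strong := avg_le_strong _ (Phi k) (fun=> G0) x a0 a3 PhiN.
  rewrite avg_cst in strong.
  have Px : Phi k x <= G0 by apply: PhiN; apply: boxxx.
  have e64 : cc / (64 * (80 * B)) * (8 * G0) ^+ 2 = e * G0 ^+ 2.
    by rewrite /e; field; rewrite gt_eqF.
  rewrite e64 in gS.
  have bqa : bq * (2 * n%:R * a k x) <= bq * 4^-1 by rewrite ler_pM2l.
  have key : Phi k.+1 x <= avg (a k x) (Phi k) x + 3 * (e * G0 ^+ 2) - 8 * e * G0 * G k x.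
    rewrite avgPhi /Phi -natr1.
    have NccG : Nn * (cc * G k x) = 8 * e * G0 * G k x by rewrite mulrA Ncc.
    rewrite mulrBr mulrDr NccG in hS.
    move: gS hS NK bqe bqa bq0; clear; lra.
  have [/andP[g0 _] /andP[hh0 h10]] := Hbd _ _ (cyl12 _ _ hc).
  have [big|small] := leP (G0 / 2) (G k x).
    have : e * G0 * (G0 / 2) <= e * G0 * G k x by apply: ler_wpM2l => //; rewrite mulr_ge0 ?ltW.
    have : 0 <= (1 - 2 * n%:R * a k x) * (G0 - Phi k x).
      by rewrite mulr_ge0 ?subr_ge0.
    move: key strong eG0; clear; lra.
  have Px' : Phi k x <= 6 / 10 * G0.
    have : 0 <= bq * (sqd c' x + (K'%:R - k%:R)).
      by rewrite mulr_ge0 ?(ltW bq0)// addr_ge0 ?sqd_ge0// subr_ge0 ler_nat ltnW.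
    rewrite /Phi; move: small h10; clear; lra.
  have s1 : 4^-1 * 3 * (G0 - Phi k x) <= (1 - 2 * n%:R * a k x) * (G0 - Phi k x).
    by apply: ler_wpM2r; rewrite ?subr_ge0//; move: a2; clear; lra.
  have s2 : e * G0 ^+ 2 <= 20^-1 * G0 by rewrite expr2 mulrA ler_wpM2r// ltW.
  have s3 : 0 <= e * G0 * G k x := mulr_ge0 (mulr_ge0 (ltW e0) (ltW G00)) g0.
  move: key strong s1 s2 s3 Px' G00; clear; lra.
have := PhiA K' c' _ (leqnn _) (boxxx _ _ (ltW r'0)).
rewrite /Phi sqdxx subrr addr0 mulr0 subr0 -/G0 => /(_ _).
have [_ /andP[hh0 _]] := Hbd _ _ cself.
move=> h; have := h ltac:(by rewrite gerBl sqr_ge0).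
by move: hh0; clear; lra.
Qed.

(* Point picking: a point where [G] is large is replaced by one where [G] is also
   almost maximal on a comparatively large cylinder. *)
Lemma bernstein_bound a G H c K r B Kc cc Ss Z :
  bernstein_hyp a G H c K r B Kc cc Ss Z -> G K c * r ^+ 2 <= 16 * Z.
Proof.
move=> hyp; case: (hyp) => n0 cc0 ccn B0 Kc0 r0 rK ha h1 h2 h3 Z1 Z2 Z3.
rewrite leNgt; apply/negP => big.
have n0' : 0 < n%:R :> R by rewrite ltr0n.
have r2 : 0 < r ^+ 2 by rewrite exprn_gt0.
have Z0 : 0 < Z by apply: lt_le_trans Z1; rewrite divr_gt0// mulr_gt0.
(* If [G] is not almost maximal on the cylinder, a point with 8 times the value is taken at half the
   radius: [G r'^2] doubles, so it stays above [Z]. The bound [4 n B] ends this after finitely many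
   steps, counted by [N]. *)
have claim N : forall c' K' r', 0 < r' -> r' <= r -> 16 * r' ^+ 2 <= K'%:R ->
  (forall x k, cyl c' K' (4 * r') x k -> cyl c K r x k) -> Z < G K' c' * r' ^+ 2 ->
  8^-1 ^+ N * (4 * n%:R * B) < G K' c' -> False.
  elim: N => [|N IH] c' K' r' r'0 r'r rK' sub ZG GN.
    have [|/andP[_]] := @h1 c' K'.
      apply: sub; split=> //; first by apply: boxxx; rewrite mulr_ge0// ltW.
      by rewrite gerBl sqr_ge0.
    by rewrite leNgt -[_ * B]mul1r GN.
  have [[y [k [cy Gy]]]|no] := pselect (exists y k, cyl c' K' (2 * r') y k /\ 8 * G K' c' < G k y).
    have [b1 b2 b3] := cy.
    have r'2 : 0 < r' ^+ 2 by rewrite exprn_gt0.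
    apply: (IH y k (r' / 2)).
    - by rewrite divr_gt0.
    - by move: r'r r'0; clear; lra.
    - rewrite expr_div_n; rewrite exprMn in b2; move: b2 rK' r'2; clear; lra.
    - move=> z l [d1 d2 d3]; apply: sub; split.
      + by apply: box_le (box_tri _ _ _ _ _ b1 d1); move: r'0; clear; lra.
      + move: b2 d2 r'2; clear; lra.
      + exact: leq_trans b3.
    - have : 8 * G K' c' * r' ^+ 2 < G k y * r' ^+ 2 by rewrite ltr_pM2r.
      have : 0 < G K' c' * r' ^+ 2 by exact: lt_trans ZG.
      rewrite expr_div_n; move: ZG; clear; lra.
    - move: GN Gy; rewrite exprS; clear; lra.
  apply: (bernstein_core _ _ _ _ _ _ _ _ _ _ _ c' K' r' hyp) => //.
    move=> x k [d1 d2 d3]; apply: sub; split => //; first by apply: box_le d1; move: r'0; clear; lra.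
    apply: le_trans d2; rewrite !exprMn; have : 0 < r' ^+ 2 by rewrite exprn_gt0.
    clear; lra.
  move=> x k hc; rewrite leNgt; apply/negP => hg; apply: no; by exists x, k.
have Gpos : 0 < G K c.
  by rewrite -(pmulr_lgt0 _ r2); apply: lt_trans big; rewrite mulr_gt0.
have s1 : 7 / 8 < 1 :> R by clear; lra.
have s0 : 0 < 7 / 8 :> R by clear; lra.
have G2 : 0 < G K c / 2 by rewrite divr_gt0.
have [N hN] := expr_contract (7 / 8) (4 * n%:R * B) (G K c / 2) s0 s1 G2.
rewrite (_ : 1 - 7 / 8 = 8^-1) in hN; last by field.
apply: (claim N c K (r / 4)).
- by rewrite divr_gt0.
- by move: r0; clear; lra.
- by rewrite expr_div_n; move: rK; clear; lra.
- by move=> x k; rewrite (_ : 4 * (r / 4) = r)//; field.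
- by rewrite expr_div_n; move: big; clear; lra.
- by apply: le_lt_trans hN _; move: Gpos; clear; lra.
Qed.

End Bernstein.

(** * Energy inequalities for first, second and third differences *)

Section Energy.
Context {R : realType} {n : nat}.
Local Notation I := ('rV[int]_n).
Implicit Types (u v a : I -> R) (x y : I) (i j k : 'I_n).

Lemma term_le_sum {T : finType} (F : T -> R) t : (forall s, 0 <= F s) -> F t <= \sum_s F s.
Proof. by move=> h; rewrite [leRHS](bigD1 t) //= lerDl; apply: sumr_ge0. Qed.

Lemma cauchy_sum_le {T : finType} (E g : T -> R) (X Y : R) : 0 <= X -> 0 <= Y ->
  \sum_t E t ^+ 2 <= X ^+ 2 -> \sum_t g t ^+ 2 <= Y ^+ 2 -> \sum_t E t * g t <= X * Y.
Proof.
move=> X0 Y0 EX gY.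
have zero (f : T -> R) : \sum_t f t ^+ 2 <= 0 -> forall t, f t = 0.
  move=> h t; apply/eqP; rewrite -sqrf_eq0 eq_le sqr_ge0 andbT.
  apply: le_trans h; rewrite (bigD1 t) //= lerDl; apply: sumr_ge0 => s _; exact: sqr_ge0.
have [X00|Xn] := eqVneq X 0.
  rewrite X00 mul0r big1// => t _; rewrite (zero E) ?mul0r//.
  by move: EX; rewrite X00 expr0n.
have [Y00|Yn] := eqVneq Y 0.
  rewrite Y00 mulr0 big1// => t _; rewrite (zero g) ?mulr0//.
  by move: gY; rewrite Y00 expr0n.
have Xp : 0 < X by rewrite lt_neqAle eq_sym Xn.
have Yp : 0 < Y by rewrite lt_neqAle eq_sym Yn.
have h : 2 * (X * Y) * \sum_t E t * g t <= Y ^+ 2 * \sum_t E t ^+ 2 + X ^+ 2 * \sum_t g t ^+ 2.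
  rewrite !mulr_sumr -big_split; apply: ler_sum => t _ /=.
  have := sqr_ge0 (Y * E t - X * g t); lra.
have h1 := ler_wpM2l (sqr_ge0 Y) EX; have h2 := ler_wpM2l (sqr_ge0 X) gY.
have XY : 0 < 2 * (X * Y) by rewrite !mulr_gt0.
rewrite -(ler_pM2l XY); move: h h1 h2; clear; lra.
Qed.

(** [g1] collects the commutators controlled by the dissipation with a small constant, [g2] those
    that are merely bounded. Of the gain [a / 2] from [avg_sqr], Young's inequality with parameter
    [8 C1 / a0] takes [a0 / 8] and the square of [g1] another [a0 / 8], which leaves [a0 / 4]. *)
Lemma energy_step {T : finType} (F : T -> I -> R) (g1 g2 : T -> R) (a0 a C1 X Y : R) x :
  0 < a0 -> a0 <= a -> 8 * n%:R * a <= 1 -> 0 < C1 -> C1 <= a0 / 16 ->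
  0 <= X -> 0 <= Y ->
  (forall y, box x (1 : R) y -> \sum_t F t y ^+ 2 <= X ^+ 2) ->
  \sum_t g1 t ^+ 2 <= C1 * \sum_t gam (F t) x -> \sum_t g2 t ^+ 2 <= Y ^+ 2 ->
  \sum_t (avg a (F t) x + (g1 t + g2 t)) ^+ 2 <=
    avg a (fun y => \sum_t F t y ^+ 2) x - a0 / 4 * \sum_t gam (F t) x +
    (8 * C1 / a0 * X ^+ 2 + 2 * (X * Y) + 2 * Y ^+ 2).
Proof.
move=> a00 aa a1 C10 Ca X0 Y0 FX gC gY.
have na : 4 * n%:R * a <= 1.
  have : 0 <= n%:R * a by rewrite mulr_ge0// (le_trans (ltW a00)).
  by move: a1; clear; lra.
have age0 : 0 <= a by exact: le_trans (ltW a00) aa.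
set Gam := \sum_t gam (F t) x in gC *.
have Gam0 : 0 <= Gam by apply: sumr_ge0 => t _; exact: gam_ge0.
pose E t := avg a (F t) x.
have EE : \sum_t E t ^+ 2 <= avg a (fun y => \sum_t F t y ^+ 2) x - a / 2 * Gam.
  rewrite avg_sum /Gam mulr_sumr -sumrB; apply: ler_sum => t _; exact: avg_sqr.
have EX : \sum_t E t ^+ 2 <= X ^+ 2.
  apply: le_trans EE _.
  have : avg a (fun y => \sum_t F t y ^+ 2) x <= X ^+ 2.
    by apply: avg_le_cst => //; rewrite -mulrA; move: na; have : 0 <= n%:R * a; [rewrite mulr_ge0|clear; lra].
  have : 0 <= a / 2 * Gam by rewrite mulr_ge0// divr_ge0.
  by clear; lra.
have split_ : \sum_t (E t + (g1 t + g2 t)) ^+ 2 <= \sum_t E t ^+ 2 +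
    (8 * C1 / a0 * \sum_t E t ^+ 2 + a0 / (8 * C1) * \sum_t g1 t ^+ 2) +
    2 * \sum_t E t * g2 t + (2 * \sum_t g1 t ^+ 2 + 2 * \sum_t g2 t ^+ 2).
  rewrite !mulr_sumr -!big_split /=; apply: ler_sum => t _.
  have yo : 2 * (E t * g1 t) <= 8 * C1 / a0 * E t ^+ 2 + a0 / (8 * C1) * g1 t ^+ 2.
    pose m := 8 * C1 / a0; have m0 : 0 < m by rewrite divr_gt0// mulr_gt0.
    rewrite -/m (_ : a0 / (8 * C1) = m^-1); last by rewrite invf_div.
    rewrite -(ler_pM2l m0) mulrDr [m * (m^-1 * _)]mulrA divff ?gt_eqF// mul1r.
    have := sqr_ge0 (m * E t - g1 t); clear; lra.
  have := sqr_ge0 (g1 t - g2 t); move: yo; clear; lra.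
apply: le_trans split_ _.
have h1 : 8 * C1 / a0 * \sum_t E t ^+ 2 <= 8 * C1 / a0 * X ^+ 2.
  by apply: ler_wpM2l EX; rewrite divr_ge0 ?mulr_ge0// ltW.
have h2 : a0 / (8 * C1) * \sum_t g1 t ^+ 2 <= a0 / 8 * Gam.
  apply: le_trans (ler_wpM2l _ gC) _; first by rewrite divr_ge0 ?mulr_ge0// ltW.
  by rewrite mulrA (_ : a0 / (8 * C1) * C1 = a0 / 8)//; field; rewrite gt_eqF.
have h3 := cauchy_sum_le E g2 X Y X0 Y0 EX gY.
have h4 : C1 * Gam <= a0 / 16 * Gam by rewrite ler_wpM2r.
have h5 : a0 / 2 * Gam <= a / 2 * Gam by rewrite ler_wpM2r//; move: aa; clear; lra.
move: EE h1 h2 h3 h4 h5 gC gY; clear; lra.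
Qed.

Lemma diffuC i j u x : diffu i (diffu j u) x = diffu j (diffu i u) x.
Proof. by rewrite /diffu (addrAC x); ring. Qed.

Lemma lap_diffu_back u x : lap u x = \sum_j (diffu j u x - diffu j u (x - unitv j)).
Proof. by apply: eq_bigr => j _; rewrite /diffu subrK; ring. Qed.

Definition hess2 u x : R := \sum_i grad2 (diffu i u) x.
Definition third2 u x : R := \sum_i hess2 (diffu i u) x.

Lemma grad2_le u x (X : R) : 0 <= X -> grad2 u x <= X ^+ 2 -> forall i, `|diffu i u x| <= X.
Proof.
move=> X0 h i; rewrite -(@ler_pXn2r _ 2) ?nnegrE// real_normK ?num_real//.
apply: le_trans h; rewrite /grad2 (bigD1 i) //= lerDl.
by apply: sumr_ge0 => j _; exact: sqr_ge0.
Qed.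

Lemma hess2_le u x (X : R) : 0 <= X -> hess2 u x <= X ^+ 2 ->
  forall i j, `|diffu j (diffu i u) x| <= X.
Proof.
move=> X0 h i j; apply: (grad2_le _ _ _ X0); apply: le_trans h.
by rewrite /hess2 (bigD1 i) //= lerDl; apply: sumr_ge0 => l _; exact: grad2_ge0.
Qed.

Lemma hess2_ge0 u x : 0 <= hess2 u x.
Proof. by apply: sumr_ge0 => i _; exact: grad2_ge0. Qed.

Lemma third2_ge0 u x : 0 <= third2 u x.
Proof. by apply: sumr_ge0 => i _; exact: hess2_ge0. Qed.

Lemma third2_le u x (X : R) : 0 <= X -> third2 u x <= X ^+ 2 ->
  forall i j k, `|diffu k (diffu j (diffu i u)) x| <= X.
Proof.
move=> X0 h i j k; apply: (hess2_le _ _ _ X0); apply: le_trans h.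
by rewrite /third2 (bigD1 i) //= lerDl; apply: sumr_ge0 => l _; exact: hess2_ge0.
Qed.

(* The shift costs [D_i (lap u) = lap (D_i u)], which is controlled by the same
   quadratic form at the unshifted site. *)
Lemma lap_shift_le u x i :
  lap u (x + unitv i) ^+ 2 <= 6 * n%:R * \sum_j gam (diffu j u) x.
Proof.
set Gam := \sum_j _.
have g1 : gam (diffu i u) x <= Gam.
  by rewrite /Gam (bigD1 i) //= lerDl; apply: sumr_ge0 => j _; exact: gam_ge0.
have h1 : lap u x ^+ 2 <= n%:R * Gam.
  rewrite lap_diffu_back; apply: le_trans (sqr_sum_le _) _.
  rewrite card_ord; apply: ler_wpM2l => //; apply: ler_sum => j _.
  rewrite /gam (bigD1 j) //= -[leLHS]addr0; apply: lerD; last first.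
    by apply: sumr_ge0 => l _; rewrite addr_ge0 ?sqr_ge0.
  by rewrite -sqrrN opprB lerDr sqr_ge0.
have h2 : lap (diffu i u) x ^+ 2 <= 2 * n%:R * Gam.
  by apply: le_trans (lap_sq_le _ _) _; rewrite ler_wpM2l// mulr_ge0.
have -> : lap u (x + unitv i) = lap u x + lap (diffu i u) x by rewrite lap_diffu; ring.
have := sqr_ge0 (lap u x - lap (diffu i u) x); move: h1 h2; clear; lra.
Qed.

(** A centred second difference at [x] is the twofold forward difference at [x - unitv i]. *)
Lemma lap_le_hess u x (X : R) : (forall i, `|diffu i (diffu i u) (x - unitv i)| <= X) ->
  `|lap u x| <= n%:R * X.
Proof.
move=> h; rewrite /lap; apply: le_trans (ler_norm_sum _ _ _) _.
have -> : n%:R * X = \sum_(j < n) X by rewrite sumr_const card_ord mulr_natl.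
apply: ler_sum => j _; apply: le_trans (h j); rewrite le_eqVlt; apply/orP; left; apply/eqP.
by congr `|_|; rewrite /diffu subrK; ring.
Qed.

Lemma sum_sqr_const {T : finType} (g : T -> R) (b : R) :
  (forall t, g t ^+ 2 <= b) -> \sum_t g t ^+ 2 <= #|T|%:R * b.
Proof.
move=> h; rewrite -sum1_card natr_sum mulr_suml; apply: ler_sum => t _.
by rewrite mul1r.
Qed.

Lemma sqr_le_norm (b m : R) : `|b| <= m -> b ^+ 2 <= m ^+ 2.
Proof. by move=> h; rewrite -[leLHS]real_normK ?num_real//; exact: sqr_le. Qed.

Lemma mul_le_norm (b c m q : R) : `|b| <= m -> `|c| <= q -> `|b * c| <= m * q.
Proof. by move=> h1 h2; rewrite normrM; exact: ler_pM. Qed.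

Lemma sqrM_le (b c m q : R) : `|b| <= m -> c ^+ 2 <= q -> (b * c) ^+ 2 <= m ^+ 2 * q.
Proof.
by move=> h1 h2; rewrite exprMn; apply: ler_pM => //; rewrite ?sqr_ge0//; exact: sqr_le_norm.
Qed.

Definition avgf a u : I -> R := fun y => avg (a y) u y.

(** Discrete Leibniz rule: when the coefficient is differenced, the Laplacian is evaluated at the
    shifted site. This is why [lap_shift_le] is needed to absorb the commutators. *)
Lemma diffu_avg1 a u i y : diffu i (avgf a u) y =
  avg (a y) (diffu i u) y + diffu i a y * lap u (y + unitv i).
Proof. by rewrite /diffu /avgf /avg lapB lap_shift; ring. Qed.

Lemma diffu_avg2 a u i j y : diffu j (diffu i (avgf a u)) y =
  avg (a y) (diffu j (diffu i u)) y +
  (diffu i a y * lap (diffu j u) (y + unitv i) + diffu j a y * lap (diffu i u) (y + unitv j) +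
   diffu j (diffu i a) y * lap u (y + unitv i + unitv j)).
Proof.
rewrite {1}/diffu !diffu_avg1.
rewrite /avg !lap_diffu /diffu (addrAC y (unitv j) (unitv i)); ring.
Qed.

Lemma diffu_avg3 a u i j k x : diffu k (diffu j (diffu i (avgf a u))) x =
  avg (a x) (diffu k (diffu j (diffu i u))) x +
  ((diffu k a x * lap (diffu j (diffu i u)) (x + unitv k) +
    diffu i a x * lap (diffu k (diffu j u)) (x + unitv i) +
    diffu j a x * lap (diffu k (diffu i u)) (x + unitv j)) +
   (diffu k (diffu i a) x * lap (diffu j u) (x + unitv i + unitv k) +
    diffu k (diffu j a) x * lap (diffu i u) (x + unitv j + unitv k) +
    diffu j (diffu i a) x * lap (diffu k u) (x + unitv i + unitv j) +
    diffu k (diffu j (diffu i a)) x * lap u (x + unitv i + unitv j + unitv k))).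
Proof.
rewrite {1}/diffu !diffu_avg2.
rewrite /avg !lap_diffu /diffu !(addrAC _ (unitv k)) !(addrAC _ (unitv j) (unitv i)); ring.
Qed.

(** The constant [C1] of [energy_step]: [La X] bounds the first differences of the coefficient, and
    [54 n^4 = 9 * 6 n * n^3] covers the worst case, three commutators for each of [n^3] triples of
    directions, each estimated by [lap_shift_le]. *)
Definition lip_small (a0 La X : R) : R := 54 * n%:R ^+ 4 * (La * X) ^+ 2.

Lemma lip_small_gt0 (La X a0 : R) : (0 < n)%N -> 0 < La -> 0 < X -> 0 < lip_small a0 La X.
Proof. by move=> n0 l0 x0; rewrite /lip_small !mulr_gt0// ?exprn_gt0// ?mulr_gt0// ltr0n. Qed.

Lemma level1 a u x (a0 La X : R) : (0 < n)%N -> 0 < a0 -> a0 <= a x -> 8 * n%:R * a x <= 1 ->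
  0 < La -> 0 < X -> (forall y, box x (1 : R) y -> grad2 u y <= X ^+ 2) ->
  (forall i, `|diffu i a x| <= La * X) -> lip_small a0 La X <= a0 / 16 ->
  grad2 (avgf a u) x <= avg (a x) (grad2 u) x - a0 / 4 * \sum_i gam (diffu i u) x +
    8 * lip_small a0 La X / a0 * X ^+ 2.
Proof.
move=> n0 a00 aa a1 La0 X0 gX daX small.
have := @energy_step 'I_n (fun i => diffu i u) (fun i => diffu i a x * lap u (x + unitv i))
  (fun=> 0) a0 (a x) (lip_small a0 La X) X 0 x a00 aa a1.
have -> : grad2 (avgf a u) x =
    \sum_i (avg (a x) (diffu i u) x + (diffu i a x * lap u (x + unitv i) + 0)) ^+ 2.
  by apply: eq_bigr => i _; rewrite diffu_avg1 addr0.
rewrite mulr0 expr0n /= mulr0 !addr0; apply => //.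
- exact: lip_small_gt0.
- exact: ltW.
- set Gam := \sum_i gam _ _; have Gam0 : 0 <= Gam by apply: sumr_ge0 => i _; exact: gam_ge0.
  apply: le_trans (sum_sqr_const _ ((La * X) ^+ 2 * (6 * n%:R * Gam)) _) _.
    by move=> i; apply: sqrM_le; [exact: daX|exact: lap_shift_le].
  rewrite card_ord /lip_small.
  have nR : 1 <= n%:R :> R by rewrite ler1n.
  have n2 : 6 * n%:R ^+ 2 <= 54 * n%:R ^+ 4 :> R.
    have : n%:R ^+ 2 <= n%:R ^+ 4 :> R by rewrite ler_weXn2l.
    have : 0 <= n%:R ^+ 2 :> R by rewrite exprn_ge0.
    clear; lra.
  have := ler_wpM2r (mulr_ge0 (sqr_ge0 (La * X)) Gam0) n2; clear; lra.
- by rewrite big1// => i _; rewrite expr0n.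
Qed.

Lemma sqr3_le (b c d m : R) : b ^+ 2 <= m -> c ^+ 2 <= m -> d ^+ 2 <= m -> (b + c + d) ^+ 2 <= 9 * m.
Proof.
move=> h1 h2 h3; have := sqr_ge0 (b - c); have := sqr_ge0 (b - d); have := sqr_ge0 (c - d).
move: h1 h2 h3; clear; lra.
Qed.

Lemma box_unit2 x i j : box x (2 : R) (x + unitv i + unitv j).
Proof. by apply: box_trile (boxDu x i) (boxDu _ j); clear; lra. Qed.

Lemma box_unit3 x i j k : box x (3 : R) (x + unitv i + unitv j + unitv k).
Proof. by apply: box_trile (box_unit2 x i j) (boxDu _ k); clear; lra. Qed.

Lemma lap_le_hess2 u x y (X s : R) : 0 <= X -> (forall z, box x (4 : R) z -> hess2 u z <= X ^+ 2) ->
  s <= 3 -> box x s y -> `|lap u y| <= n%:R * X.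
Proof.
move=> X0 h s3 by_; apply: lap_le_hess => i; apply: (hess2_le _ _ _ X0); apply: h.
by apply: box_trile by_ (boxBu _ _); move: s3; clear; lra.
Qed.

(** A first difference of the coefficient meets the Laplacian of a first difference of [u], which
    the dissipation absorbs. A second difference of the coefficient meets [lap u]; this part is the
    forcing [Y], quadratic in the Hessian bound [X]. *)
Lemma level2 a u x (a0 La X1 X Y : R) : (0 < n)%N -> 0 < a0 -> a0 <= a x -> 8 * n%:R * a x <= 1 ->
  0 < La -> 0 < X1 -> 0 <= X -> (forall y, box x (4 : R) y -> hess2 u y <= X ^+ 2) ->
  (forall i, `|diffu i a x| <= La * X1) ->
  (forall i j, `|diffu j (diffu i a) x| <= La * (X + X1 ^+ 2)) ->
  lip_small a0 La X1 <= a0 / 16 ->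
  Y = n%:R ^+ 2 * La * (X + X1 ^+ 2) * X ->
  hess2 (avgf a u) x <= avg (a x) (hess2 u) x - a0 / 4 * \sum_i \sum_j gam (diffu j (diffu i u)) x +
    (8 * lip_small a0 La X1 / a0 * X ^+ 2 + 2 * (X * Y) + 2 * Y ^+ 2).
Proof.
move=> n0 a00 aa a1 La0 X10 X0 hX da dda small YE.
have sumE f : hess2 f = (fun y => \sum_(t : 'I_n * 'I_n) diffu t.2 (diffu t.1 f) y ^+ 2).
  by apply/funext => y; rewrite -(pair_bigA _ (fun i j => diffu j (diffu i f) y ^+ 2)).
have Y0 : 0 <= Y.
  by rewrite YE mulr_ge0// mulr_ge0 ?addr_ge0 ?sqr_ge0// mulr_ge0 ?exprn_ge0// ltW.
have := @energy_step _ (fun t : 'I_n * 'I_n => diffu t.2 (diffu t.1 u))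
  (fun t => diffu t.1 a x * lap (diffu t.2 u) (x + unitv t.1) +
     diffu t.2 a x * lap (diffu t.1 u) (x + unitv t.2) + 0)
  (fun t => diffu t.2 (diffu t.1 a) x * lap u (x + unitv t.1 + unitv t.2))
  a0 (a x) (lip_small a0 La X1) X Y x a00 aa a1.
rewrite !sumE (pair_bigA _ (fun i j => gam (diffu j (diffu i u)) x)) /=.
under [X in _ -> X <= _]eq_bigr => t _ do [].
set Gam := \sum_(t : 'I_n * 'I_n) gam _ _.
have Gam0 : 0 <= Gam by apply: sumr_ge0 => i _; exact: gam_ge0.
have GamE i : \sum_j gam (diffu j (diffu i u)) x <= Gam.
  rewrite /Gam -(pair_bigA _ (fun i j => gam (diffu j (diffu i u)) x)) /=.
  apply: (term_le_sum (fun i => \sum_j gam (diffu j (diffu i u)) x)) => s.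
  by apply: sumr_ge0 => l _; exact: gam_ge0.
move=> H; apply: le_trans (H _ _ _ _ _ _ _).
- rewrite le_eqVlt; apply/orP; left; apply/eqP; apply: eq_bigr => t _.
  by rewrite diffu_avg2 addr0.
- exact: lip_small_gt0.
- exact: small.
- exact: X0.
- exact: Y0.
- move=> y hy; have := hX y; rewrite sumE; apply.
  by apply: box_le hy; clear; lra.
- apply: le_trans (sum_sqr_const _ (9 * ((La * X1) ^+ 2 * (6 * n%:R * Gam))) _) _.
    move=> t; apply: sqr3_le.
    + apply: sqrM_le; first exact: da.
      by apply: le_trans (lap_shift_le _ _ _) _; rewrite ler_wpM2l ?mulr_ge0.
    + apply: sqrM_le; first exact: da.
      by apply: le_trans (lap_shift_le _ _ _) _; rewrite ler_wpM2l ?mulr_ge0.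
    + by rewrite expr0n mulr_ge0 ?sqr_ge0// !mulr_ge0.
  rewrite card_prod card_ord natrM /lip_small.
  have nR : 1 <= n%:R :> R by rewrite ler1n.
  have n2 : n%:R ^+ 3 <= n%:R ^+ 4 :> R by rewrite ler_weXn2l.
  have := ler_wpM2r (mulr_ge0 (sqr_ge0 (La * X1)) Gam0) n2; clear; lra.
- apply: le_trans (sum_sqr_const _ ((La * (X + X1 ^+ 2) * (n%:R * X)) ^+ 2) _) _.
    move=> t; apply: sqr_le_norm; apply: mul_le_norm; first exact: dda.
    by apply: (lap_le_hess2 u x _ X 2 X0 hX) => //; [clear; lra|exact: box_unit2].
  by rewrite card_prod card_ord natrM YE le_eqVlt; apply/orP; left; apply/eqP; ring.
Qed.

(** As in [level2], but the forcing [Y] is affine in the bound [X] on third differences once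
    gradient and Hessian are bounded, so this level has no superlinear self-interaction. *)
Lemma level3 a u x (a0 La X1 X2 X Y : R) : (0 < n)%N -> 0 < a0 -> a0 <= a x -> 8 * n%:R * a x <= 1 ->
  0 < La -> 0 < X1 -> 0 <= X2 -> 0 <= X ->
  (forall y, box x (4 : R) y -> hess2 u y <= X2 ^+ 2) ->
  (forall y, box x (4 : R) y -> third2 u y <= X ^+ 2) ->
  (forall i, `|diffu i a x| <= La * X1) ->
  (forall i j, `|diffu j (diffu i a) x| <= La * (X2 + X1 ^+ 2)) ->
  (forall i j k, `|diffu k (diffu j (diffu i a)) x| <= La * (X + 3 * X1 * X2 + X1 ^+ 3)) ->
  lip_small a0 La X1 <= a0 / 16 ->
  Y = n%:R ^+ 3 * La * (3 * (X2 + X1 ^+ 2) * X + (X + 3 * X1 * X2 + X1 ^+ 3) * X2) ->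
  third2 (avgf a u) x <= avg (a x) (third2 u) x
    - a0 / 4 * \sum_i \sum_j \sum_k gam (diffu k (diffu j (diffu i u))) x +
    (8 * lip_small a0 La X1 / a0 * X ^+ 2 + 2 * (X * Y) + 2 * Y ^+ 2).
Proof.
move=> n0 a00 aa a1 La0 X10 X20 X0 hX2 hX da dda ddda small YE.
have sumE f : third2 f = (fun y => \sum_(t : 'I_n * 'I_n * 'I_n)
    diffu t.2 (diffu t.1.2 (diffu t.1.1 f)) y ^+ 2).
  apply/funext => y.
  rewrite -(pair_bigA _ (fun p k => diffu k (diffu p.2 (diffu p.1 f)) y ^+ 2)) /=.
  by rewrite -(pair_bigA _ (fun i j => \sum_k diffu k (diffu j (diffu i f)) y ^+ 2)).
have GamE0 : \sum_i \sum_j \sum_k gam (diffu k (diffu j (diffu i u))) x =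
    \sum_(t : 'I_n * 'I_n * 'I_n) gam (diffu t.2 (diffu t.1.2 (diffu t.1.1 u))) x.
  rewrite -(pair_bigA _ (fun p k => gam (diffu k (diffu p.2 (diffu p.1 u))) x)) /=.
  by rewrite -(pair_bigA _ (fun i j => \sum_k gam (diffu k (diffu j (diffu i u))) x)).
have XX : 0 <= X2 + X1 ^+ 2 by rewrite addr_ge0 ?sqr_ge0.
have XXX : 0 <= X + 3 * X1 * X2 + X1 ^+ 3.
  by rewrite !addr_ge0 ?mulr_ge0 ?exprn_ge0// ltW.
have Y0 : 0 <= Y.
  rewrite YE mulr_ge0//; first by rewrite mulr_ge0 ?exprn_ge0// ltW.
  by rewrite addr_ge0// !mulr_ge0.
have := @energy_step _ (fun t : 'I_n * 'I_n * 'I_n => diffu t.2 (diffu t.1.2 (diffu t.1.1 u)))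
  (fun t => diffu t.2 a x * lap (diffu t.1.2 (diffu t.1.1 u)) (x + unitv t.2) +
    diffu t.1.1 a x * lap (diffu t.2 (diffu t.1.2 u)) (x + unitv t.1.1) +
    diffu t.1.2 a x * lap (diffu t.2 (diffu t.1.1 u)) (x + unitv t.1.2))
  (fun t => diffu t.2 (diffu t.1.1 a) x * lap (diffu t.1.2 u) (x + unitv t.1.1 + unitv t.2) +
    diffu t.2 (diffu t.1.2 a) x * lap (diffu t.1.1 u) (x + unitv t.1.2 + unitv t.2) +
    diffu t.1.2 (diffu t.1.1 a) x * lap (diffu t.2 u) (x + unitv t.1.1 + unitv t.1.2) +
    diffu t.2 (diffu t.1.2 (diffu t.1.1 a)) x *
      lap u (x + unitv t.1.1 + unitv t.1.2 + unitv t.2))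
  a0 (a x) (lip_small a0 La X1) X Y x a00 aa a1.
rewrite !sumE GamE0.
set Gam := \sum_(t : 'I_n * 'I_n * 'I_n) gam _ _.
have Gam0 : 0 <= Gam by apply: sumr_ge0 => i _; exact: gam_ge0.
have GamE i j : \sum_k gam (diffu k (diffu j (diffu i u))) x <= Gam.
  rewrite /Gam -GamE0.
  apply: (le_trans (term_le_sum (fun j => \sum_k gam (diffu k (diffu j (diffu i u))) x) j _)).
    by move=> l; apply: sumr_ge0 => k _; exact: gam_ge0.
  apply: (term_le_sum (fun i => \sum_j \sum_k gam (diffu k (diffu j (diffu i u))) x)) => l.
  by apply: sumr_ge0 => k _; apply: sumr_ge0 => m _; exact: gam_ge0.
move=> H; apply: le_trans (H _ _ _ _ _ _ _).
- rewrite le_eqVlt; apply/orP; left; apply/eqP; apply: eq_bigr => t _.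
  by rewrite diffu_avg3.
- exact: lip_small_gt0.
- exact: small.
- exact: X0.
- exact: Y0.
- move=> y hy; have := hX y; rewrite sumE; apply.
  by apply: box_le hy; clear; lra.
- apply: le_trans (sum_sqr_const _ (9 * ((La * X1) ^+ 2 * (6 * n%:R * Gam))) _) _.
    move=> t; apply: sqr3_le; (apply: sqrM_le; [exact: da|
      by apply: le_trans (lap_shift_le _ _ _) _; rewrite ler_wpM2l ?mulr_ge0]).
  rewrite !card_prod card_ord !natrM /lip_small.
  have := mulr_ge0 (sqr_ge0 (La * X1)) Gam0; clear; lra.
- have lapd i y (s : R) : s <= 2 -> box x s y -> `|lap (diffu i u) y| <= n%:R * X.
    move=> s3 by_; apply: lap_le_hess => j; apply: (third2_le _ _ _ X0); apply: hX.
    by apply: box_trile by_ (boxBu _ _); move: s3; clear; lra.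
  have lap2 i j l : `|lap (diffu i u) (x + unitv j + unitv l)| <= n%:R * X.
    by apply: (lapd _ _ 2) => //; exact: box_unit2.
  apply: le_trans (sum_sqr_const _
    ((n%:R * La * (3 * (X2 + X1 ^+ 2) * X + (X + 3 * X1 * X2 + X1 ^+ 3) * X2)) ^+ 2) _) _.
    move=> t; apply: sqr_le_norm.
    have e1 := mul_le_norm _ _ _ _ (dda t.1.1 t.2) (lap2 t.1.2 t.1.1 t.2).
    have e2 := mul_le_norm _ _ _ _ (dda t.1.2 t.2) (lap2 t.1.1 t.1.2 t.2).
    have e3 := mul_le_norm _ _ _ _ (dda t.1.1 t.1.2) (lap2 t.2 t.1.1 t.1.2).
    have lu : `|lap u (x + unitv t.1.1 + unitv t.1.2 + unitv t.2)| <= n%:R * X2.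
      by apply: (lap_le_hess2 u x _ X2 3 X20 hX2) => //; exact: box_unit3.
    have e4 := mul_le_norm _ _ _ _ (ddda t.1.1 t.1.2 t.2) lu.
    apply: le_trans (ler_normD _ _) _; apply: le_trans (lerD (ler_normD _ _) e4) _.
    apply: le_trans (lerD (lerD (ler_normD _ _) e3) (lexx _)) _.
    move: (lerD e1 e2); clear; lra.
  rewrite !card_prod card_ord !natrM YE.
  have nR : 1 <= n%:R :> R by rewrite ler1n.
  set w := 3 * _ * X + _.
  have -> : n%:R * n%:R * n%:R * (n%:R * La * w) ^+ 2 = n%:R ^+ 5 * (La * w) ^+ 2 by ring.
  have -> : (n%:R ^+ 3 * La * w) ^+ 2 = n%:R ^+ 6 * (La * w) ^+ 2 by ring.
  by apply: ler_wpM2r; [exact: sqr_ge0|rewrite ler_weXn2l].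
Qed.

End Energy.

(** * Differences of a nonlinear coefficient *)

Section CompositionDifferences.
Context {R : realType}.
Implicit Types (f g h : R -> R) (m M L : R).

Lemma is_derive_line (c k t : R) : is_derive t 1 (fun s => c + s * k) k.
Proof.
have -> : (fun s : R => c + s * k) = (cst c + (id * cst k))%R.
  by apply/funext => s.
apply: is_derive_eq; rewrite /cst /= scaler0 add0r add0r.
by rewrite /GRing.scale /= mulr1.
Qed.

Lemma unit_mvt (F F' : R -> R) (K : R) :
  (forall t : R, 0 <= t <= 1 -> is_derive t 1 F (F' t)) ->
  (forall t : R, 0 <= t <= 1 -> `|F' t| <= K) -> `|F 1 - F 0| <= K.
Proof.
move=> dF bF.
have dF' (t : R) : t \in `]0, 1[%R -> is_derive t 1 F (F' t).
  by rewrite in_itv /= => /andP[t0 t1]; apply: dF; rewrite !ltW.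
have cF : {within `[0, 1], continuous F}.
  apply: derivable_within_continuous => t; rewrite in_itv /= => ht.
  by have := dF t ht => -[].
have [c + ->] := MVT_segment ler01 dF' cF.
by rewrite in_itv /= => hc; rewrite subr0 mulr1; exact: bF.
Qed.

Definition c1_on m M f g := forall s : R, m <= s <= M -> is_derive s 1 f (g s).
Definition bnd_on m M L g := forall s : R, m <= s <= M -> `|g s| <= L.

Lemma convex_itv m M (a b t : R) : m <= a <= M -> m <= b <= M -> 0 <= t <= 1 ->
  m <= a + t * (b - a) <= M.
Proof.
move=> /andP[a1 a2] /andP[b1 b2] /andP[t0 t1].
have t1' : 0 <= 1 - t by rewrite subr_ge0.
rewrite -subr_ge0 in a1; rewrite -subr_ge0 in a2; rewrite -subr_ge0 in b1; rewrite -subr_ge0 in b2.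
have := mulr_ge0 t0 b1; have := mulr_ge0 t0 b2; have := mulr_ge0 t1' a1; have := mulr_ge0 t1' a2.
by clear => *; apply/andP; split; lra.
Qed.

Lemma convex_norm (a b K t : R) : `|a| <= K -> `|b| <= K -> 0 <= t <= 1 -> `|a + t * (b - a)| <= K.
Proof. by rewrite !ler_norml; exact: convex_itv. Qed.

Lemma lipschitz_on m M L f g : c1_on m M f g -> bnd_on m M L g ->
  forall a b : R, m <= a <= M -> m <= b <= M -> `|f b - f a| <= L * `|b - a|.
Proof.
move=> df bg a b ha hb.
have := @unit_mvt (fun t => f (a + t * (b - a))) (fun t => g (a + t * (b - a)) * (b - a))
   (L * `|b - a|).
rewrite mul1r mul0r addr0 [a + _]addrC subrK; apply=> t ht.
  apply: (@is_derive1_comp R f (fun t => a + t * (b - a))); last exact: is_derive_line.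
  by apply: df; exact: convex_itv.
by rewrite normrM ler_wpM2r//; apply: bg; exact: convex_itv.
Qed.

(** The mean value theorem is applied while moving simultaneously from [a] to [b] and from [c] to
    [d]. The four values need not form a parallelogram; the mixed difference [dd] measures the
    failure and enters linearly. *)
Lemma second_difference_le m M L (d1 d2 dd : R) f g h : 0 <= L ->
  c1_on m M f g -> c1_on m M g h -> bnd_on m M L g -> bnd_on m M L h ->
  forall a b c d : R, m <= a <= M -> m <= b <= M -> m <= c <= M -> m <= d <= M ->
  `|b - a| <= d1 -> `|c - a| <= d2 -> `|d - b| <= d2 -> `|d - c - b + a| <= dd ->
  `|f d - f c - f b + f a| <= L * (dd + d1 * d2).
Proof.
move=> L0 df dg bg bh a b c d ha hb hc hd ba ca db dcba.
pose P t := a + t * (b - a); pose Q t := c + t * (d - c).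
have := @unit_mvt (fun t => f (Q t) - f (P t)) (fun t => g (Q t) * (d - c) - g (P t) * (b - a))
   (L * (dd + d1 * d2)).
have -> : f (Q 1) - f (P 1) - (f (Q 0) - f (P 0)) = f d - f c - f b + f a.
  by rewrite /P /Q !mul1r !mul0r !addr0 [a + _]addrC [c + _]addrC !subrK; ring.
apply=> t ht.
  apply: (@is_deriveB _ _ _ (f \o Q) (f \o P)).
    apply: is_derive1_comp; last exact: is_derive_line.
    by apply: df; exact: convex_itv.
  apply: is_derive1_comp; last exact: is_derive_line.
  by apply: df; exact: convex_itv.
have hP := convex_itv _ _ _ _ _ ha hb ht; have hQ := convex_itv _ _ _ _ _ hc hd ht.
have -> : g (Q t) * (d - c) - g (P t) * (b - a) =
  g (Q t) * (d - c - b + a) + (g (Q t) - g (P t)) * (b - a) by ring.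
apply: le_trans (ler_normD _ _) _; rewrite !normrM mulrDr; apply: lerD.
  by apply: ler_pM => //; exact: bg.
rewrite [d1 * d2]mulrC mulrA; apply: ler_pM => //.
apply: le_trans (lipschitz_on _ _ _ _ _ dg bh _ _ hP hQ) _; apply: ler_wpM2l => //.
have -> : Q t - P t = (c - a) + t * ((d - b) - (c - a)) by rewrite /P /Q; ring.
exact: convex_norm.
Qed.

(** The four unprimed values move to the primed ones. The derivative of the mixed difference of [f]
    splits into [g] times the third difference, three products of lower differences, and the
    second-order case applied to [g] instead of [f]. *)
Lemma third_difference_le m M L (d1 s dd : R) f g h k : 0 <= L -> 0 <= d1 ->
  c1_on m M f g -> c1_on m M g h -> c1_on m M h k ->
  bnd_on m M L g -> bnd_on m M L h -> bnd_on m M L k ->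
  forall a b c d a' b' c' d' : R,
  m <= a <= M -> m <= b <= M -> m <= c <= M -> m <= d <= M ->
  m <= a' <= M -> m <= b' <= M -> m <= c' <= M -> m <= d' <= M ->
  [/\ `|b - a| <= d1, `|c - a| <= d1, `|d - b| <= d1 & `|d - c| <= d1] ->
  [/\ `|b' - a'| <= d1, `|c' - a'| <= d1, `|d' - b'| <= d1 & `|d' - c'| <= d1] ->
  `|a' - a| <= d1 ->
  `|d - c - b + a| <= s -> `|d' - c' - b' + a'| <= s ->
  `|b' - b - a' + a| <= s -> `|c' - c - a' + a| <= s ->
  `|(d' - c' - b' + a') - (d - c - b + a)| <= dd ->
  `|(f d' - f c' - f b' + f a') - (f d - f c - f b + f a)| <= L * (dd + 3 * d1 * s + d1 ^+ 3).
Proof.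
move=> L0 d10 df dg dh bg bh bk a b c d a' b' c' d' ha hb hc hd ha' hb' hc' hd'.
move=> [ba ca db dc] [ba' ca' db' dc'] aa s1 s2 s3 s4 hdd.
pose PA t := a + t * (a' - a); pose PB t := b + t * (b' - b).
pose PC t := c + t * (c' - c); pose PD t := d + t * (d' - d).
have := @unit_mvt (fun t => f (PD t) - f (PC t) - f (PB t) + f (PA t))
  (fun t => g (PD t) * (d' - d) - g (PC t) * (c' - c) - g (PB t) * (b' - b) + g (PA t) * (a' - a))
  (L * (dd + 3 * d1 * s + d1 ^+ 3)).
have -> : f (PD 1) - f (PC 1) - f (PB 1) + f (PA 1) - (f (PD 0) - f (PC 0) - f (PB 0) + f (PA 0))
  = (f d' - f c' - f b' + f a') - (f d - f c - f b + f a).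
  have E (x y : R) : x + 1 * (y - x) = y by rewrite mul1r addrC subrK.
  have E0 (x y : R) : x + 0 * (y - x) = x by rewrite mul0r addr0.
  by rewrite /PA /PB /PC /PD !E !E0.
apply=> t ht.
  have comp x y : m <= x <= M -> m <= y <= M ->
      is_derive t 1 (f \o (fun t => x + t * (y - x))) (g (x + t * (y - x)) * (y - x)).
    move=> hx hy; apply: is_derive1_comp; last exact: is_derive_line.
    by apply: df; exact: convex_itv.
  apply: (@is_deriveD _ _ _ (((f \o PD) - (f \o PC)) - (f \o PB))%R (f \o PA)); last exact: comp.
  apply: (@is_deriveB _ _ _ ((f \o PD) - (f \o PC))%R (f \o PB)); last exact: comp.
  by apply: (@is_deriveB _ _ _ (f \o PD) (f \o PC)); exact: comp.
have hA := convex_itv _ _ _ _ _ ha ha' ht; have hB := convex_itv _ _ _ _ _ hb hb' ht.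
have hC := convex_itv _ _ _ _ _ hc hc' ht; have hD := convex_itv _ _ _ _ _ hd hd' ht.
have cvx (w w' z z' K : R) : `|z - w| <= K -> `|z' - w'| <= K ->
    `|(z + t * (z' - z)) - (w + t * (w' - w))| <= K.
  move=> h1 h2.
  have -> : (z + t * (z' - z)) - (w + t * (w' - w)) = (z - w) + t * ((z' - w') - (z - w)) by ring.
  exact: convex_norm.
have GG : `|g (PD t) - g (PC t) - g (PB t) + g (PA t)| <= L * (s + d1 * d1).
  apply: (second_difference_le _ _ _ _ _ _ _ _ _ L0 dg dh bh bk) => //.
  - exact: cvx.
  - exact: cvx.
  - exact: cvx.
  - have -> : PD t - PC t - PB t + PA t = (d - c - b + a) +
        t * ((d' - c' - b' + a') - (d - c - b + a)) by rewrite /PA /PB /PC /PD; ring.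
    exact: convex_norm.
have GB : `|g (PD t) - g (PC t)| <= L * d1.
  apply: le_trans (lipschitz_on _ _ _ _ _ dg bh _ _ hC hD) _; apply: ler_wpM2l => //; exact: cvx.
have GC : `|g (PD t) - g (PB t)| <= L * d1.
  apply: le_trans (lipschitz_on _ _ _ _ _ dg bh _ _ hB hD) _; apply: ler_wpM2l => //; exact: cvx.
have -> : g (PD t) * (d' - d) - g (PC t) * (c' - c) - g (PB t) * (b' - b) + g (PA t) * (a' - a) =
  g (PD t) * ((d' - c' - b' + a') - (d - c - b + a)) +
  (g (PD t) - g (PC t) - g (PB t) + g (PA t)) * (a' - a) +
  (g (PD t) - g (PC t)) * (c' - c - a' + a) + (g (PD t) - g (PB t)) * (b' - b - a' + a) by ring.
apply: le_trans (ler_normD _ _) _.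
apply: le_trans (lerD (ler_normD _ _) (mul_le_norm _ _ _ _ GC s3)) _.
apply: le_trans (lerD (lerD (ler_normD _ _) (mul_le_norm _ _ _ _ GB s4)) (lexx _)) _.
have e1 := mul_le_norm _ _ _ _ (bg _ hD) hdd.
have e2 := mul_le_norm _ _ _ _ GG aa.
by move: (lerD e1 e2); clear; lra.
Qed.

End CompositionDifferences.

Section LatticeComposition.
Context {R : realType} {n : nat}.
Local Notation I := ('rV[int]_n).
Implicit Types (u : I -> R) (x y : I) (i j k : 'I_n).

Record smooth_coeff (m M L : R) (A A1 A2 A3 : R -> R) : Prop := SmoothCoeff {
  _ : 0 < L; _ : c1_on m M A A1; _ : c1_on m M A1 A2; _ : c1_on m M A2 A3;
  _ : bnd_on m M L A1; _ : bnd_on m M L A2; _ : bnd_on m M L A3 }.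

Lemma comp_diff1 (m M L : R) A A1 A2 A3 u x (X1 : R) : smooth_coeff m M L A A1 A2 A3 ->
  (forall y, box x (3 : R) y -> m <= u y <= M) ->
  (forall i, `|diffu i u x| <= X1) -> forall i, `|diffu i (fun y => A (u y)) x| <= L * X1.
Proof.
move=> [L0 c1 _ _ b1 _ _] hu h1 i; apply: le_trans (lipschitz_on _ _ _ _ _ c1 b1 _ _ _ _) _.
- by apply: hu; apply: boxxx.
- by apply: hu; apply: box_le (boxDu _ _); clear; lra.
- by rewrite ler_pM2l//; exact: h1.
Qed.

Lemma comp_diff2 (m M L : R) A A1 A2 A3 u x (X1 X2 : R) : smooth_coeff m M L A A1 A2 A3 ->
  (forall y, box x (3 : R) y -> m <= u y <= M) ->
  (forall y i, box x (1 : R) y -> `|diffu i u y| <= X1) ->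
  (forall i j, `|diffu j (diffu i u) x| <= X2) ->
  forall i j, `|diffu j (diffu i (fun y => A (u y))) x| <= L * (X2 + X1 ^+ 2).
Proof.
move=> [L0 c1 c2 _ b1 b2 _] hu h1 h2 i j.
have hx : m <= u x <= M by apply: hu; apply: boxxx.
have hx1 l : m <= u (x + unitv l) <= M by apply: hu; apply: box_le (boxDu _ _); clear; lra.
have hx2 : m <= u (x + unitv j + unitv i) <= M.
  by apply: hu; apply: box_le (box_unit2 _ _ _); clear; lra.
have := second_difference_le _ _ _ X1 X1 X2 _ _ _ (ltW L0) c1 c2 b1 b2
  (u x) (u (x + unitv i)) (u (x + unitv j)) (u (x + unitv j + unitv i)).
rewrite expr2 => H; have -> : diffu j (diffu i (fun y => A (u y))) x =
    A (u (x + unitv j + unitv i)) - A (u (x + unitv j)) - A (u (x + unitv i)) + A (u x).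
  by rewrite /diffu; ring.
apply: H => //.
- by apply: h1; apply: boxxx.
- by apply: h1; apply: boxxx.
- by rewrite (addrAC x); apply: h1; exact: boxDu.
- by have := h2 i j; rewrite /diffu; congr (`|_| <= _); ring.
Qed.

Lemma comp_diff3 (m M L : R) A A1 A2 A3 u x (X1 X2 X : R) : 0 <= X1 -> smooth_coeff m M L A A1 A2 A3 ->
  (forall y, box x (3 : R) y -> m <= u y <= M) ->
  (forall y i, box x (2 : R) y -> `|diffu i u y| <= X1) ->
  (forall y i j, box x (1 : R) y -> `|diffu j (diffu i u) y| <= X2) ->
  (forall i j k, `|diffu k (diffu j (diffu i u)) x| <= X) ->
  forall i j k, `|diffu k (diffu j (diffu i (fun y => A (u y)))) x| <=
    L * (X + 3 * X1 * X2 + X1 ^+ 3).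
Proof.
move=> X10 [L0 c1 c2 c3 b1 b2 b3] hu h1 h2 h3 i j k.
have hx : m <= u x <= M by apply: hu; apply: boxxx.
have hx1 l : m <= u (x + unitv l) <= M by apply: hu; apply: box_le (boxDu _ _); clear; lra.
have hx2 p l : m <= u (x + unitv p + unitv l) <= M.
  by apply: hu; apply: box_le (box_unit2 _ _ _); clear; lra.
have hx3 p l q : m <= u (x + unitv p + unitv l + unitv q) <= M.
  by apply: hu; exact: box_unit3.
have g0 l : `|diffu l u x| <= X1 by apply: h1; apply: boxxx.
have g1 l p : `|diffu l u (x + unitv p)| <= X1.
  by apply: h1; apply: box_le (boxDu _ _); clear; lra.
have g2 l p q : `|diffu l u (x + unitv p + unitv q)| <= X1 by apply: h1; exact: box_unit2.
have := third_difference_le _ _ _ X1 X2 X _ _ _ _ (ltW L0) X10 c1 c2 c3 b1 b2 b3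
  (u x) (u (x + unitv i)) (u (x + unitv j)) (u (x + unitv j + unitv i))
  (u (x + unitv k)) (u (x + unitv k + unitv i)) (u (x + unitv k + unitv j))
  (u (x + unitv k + unitv j + unitv i)).
move=> H; have -> : diffu k (diffu j (diffu i (fun y => A (u y)))) x =
    (A (u (x + unitv k + unitv j + unitv i)) - A (u (x + unitv k + unitv j)) -
     A (u (x + unitv k + unitv i)) + A (u (x + unitv k))) -
    (A (u (x + unitv j + unitv i)) - A (u (x + unitv j)) - A (u (x + unitv i)) + A (u x)).
  by rewrite /diffu; ring.
apply: H => //.
- split; [exact: g0|exact: g0| |exact: g1].
  by rewrite (addrAC x (unitv j)); exact: g1.
- split; [exact: g1|exact: g1| |exact: g2].
  by rewrite (addrAC _ (unitv j) (unitv i)); exact: g2.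
- exact: g0.
- by have := h2 x i j (boxxx _ _ ler01); rewrite /diffu; congr (`|_| <= _); ring.
- by have := h2 _ i j (boxDu x k); rewrite /diffu; congr (`|_| <= _); ring.
- by have := h2 x i k (boxxx _ _ ler01); rewrite /diffu; congr (`|_| <= _); ring.
- by have := h2 x j k (boxxx _ _ ler01); rewrite /diffu; congr (`|_| <= _); ring.
- by have := h3 i j k; rewrite /diffu; congr (`|_| <= _); ring.
Qed.

End LatticeComposition.

(** * Interior estimates for the scheme *)

Ltac posR := repeat match goal with
  | |- is_true (0 < ?x) => assumption
  | |- is_true (0 < ?x) => is_var x; unfold x
  | |- is_true (0 < _ * _) => apply: mulr_gt0
  | |- is_true (0 < _ + _) => apply: addr_gt0
  | |- is_true (0 < _ ^+ _) => apply: exprn_gt0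
  | |- is_true (0 < _^-1) => rewrite invr_gt0
  | |- is_true (0 < Num.min _ _) => rewrite lt_min; apply/andP; split
  | |- is_true (0 < 1) => exact: ltr01
  | |- is_true (0 < _%:R) => rewrite ltr0n; exact: isT
  end.

Lemma small_square {R : realType} (c d : R) : 0 <= c -> 0 < d -> exists2 w : R, 0 < w <= 1 & c * w ^+ 2 <= d.
Proof.
move=> c0 d0; have d1 : 0 < d / (c + d) by rewrite divr_gt0// ltr_wpDl.
have cd : 0 < c + d by rewrite ltr_wpDl.
have dcd : d / (c + d) <= 1 by rewrite ler_pdivrMr// mul1r lerDr.
exists (d / (c + d)); first by rewrite d1.
have E : d / (c + d) * (c + d) = d by rewrite divfK// gt_eqF.
have := mulr_ge0 c0 (mulr_ge0 (ltW d1) (ltac:(by rewrite subr_ge0) : 0 <= 1 - d / (c + d))).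
have := mulr_gt0 d1 d0; move: E; set w := d / (c + d); clear; lra.
Qed.

(** Here [s] is [r^(-2)] and [X] the Hessian size. Since [X >= D s], the powers below 4 cost a
    factor [1 / D] each, and the quartic term is small because [s] is. *)
Lemma quadratic_absorb {R : realType} (c1 N eta D s X : R) : 0 < c1 -> 0 < N -> 0 < X -> 0 < s -> 1 <= D ->
  c1 + 2 * N <= eta / 2 * D -> 2 * N ^+ 2 * s <= eta / 2 -> D * s <= X ->
  (c1 * s * X ^+ 2 + 2 * (N * X ^+ 3) + 2 * (N ^+ 2 * X ^+ 4)) * s <= eta * X ^+ 4.
Proof.
move=> c10 N0 X0 s0 D1 De hN XD.
have D0 : 0 < D by apply: lt_le_trans D1.
have X4 : 0 < X ^+ 4 by posR.
have i3 := ler_wpM2r (ltW D0) (ler_wpM2r (ltW X4) hN).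
have i2 := ler_wpM2l (ltac:(apply: ltW; posR) : 0 <= 2 * N * X ^+ 3) XD.
have i1 := ler_wpM2l (ltac:(apply: ltW; posR) : 0 <= c1 * X ^+ 2)
  (sqr_le _ _ (ltac:(apply: ltW; posR) : 0 <= D * s) XD).
have i1' := ler_wpM2l (ltac:(apply: ltW; posR) : 0 <= c1 * s ^+ 2 * X ^+ 2 * D) D1.
have i4 := ler_wpM2r (ltW X4) De.
rewrite -(ler_pM2r D0); move: i1 i1' i2 i3 i4; clear; lra.
Qed.

Section InteriorEstimates.
Context {R : realType} {n : nat}.
Local Notation I := ('rV[int]_n).
Implicit Types (u : nat -> I -> R) (x y c : I).

(** The spatial radius is doubled against [cyl], so that for [r >= 8] neighbours up to distance 5 of
    a site of [cyl] still belong to it. *)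
Definition bigcyl c (K : nat) (r : R) x (k : nat) : Prop :=
  [/\ box c (2 * r) x, K%:R - r ^+ 2 <= k%:R & (k <= K)%N].

Lemma bigcyl_self c K (r : R) : 0 <= r -> bigcyl c K r c K.
Proof.
move=> r0; split=> //; first by apply: boxxx; rewrite mulr_ge0.
by rewrite gerBl sqr_ge0.
Qed.

Lemma bigcyl_near c K (r s : R) x y k : 8 <= r -> s <= 5 -> cyl c K r x k -> box x s y -> bigcyl c K r y k.
Proof.
move=> r8 s5 [h1 h2 h3] h; split=> //.
by apply: box_trile h1 h; move: r8 s5; clear; lra.
Qed.

Lemma bigcyl_sub c K (r : R) x k y l : 0 < r -> bigcyl c K (r / 4) x k -> bigcyl x k (r / 4) y l ->
  bigcyl c K r y l.
Proof.
move=> r0 [h1 h2 h3] [d1 d2 d3]; split; last exact: leq_trans h3.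
- by apply: box_trile h1 d1; move: r0; clear; lra.
- have r2 : 0 < r ^+ 2 by rewrite exprn_gt0.
  by rewrite expr_div_n in h2 d2; move: h2 d2 r2; clear; lra.
Qed.

Record scheme_on (a0 La m M : R) (A A1 A2 A3 : R -> R) u c (K : nat) (r : R) : Prop := SchemeOn {
  _ : smooth_coeff m M La A A1 A2 A3;
  _ : forall s : R, m <= s <= M -> a0 <= A s;
  _ : forall k x, u k.+1 x = avg (A (u k x)) (u k) x;
  _ : forall k x, 0 <= A (u k x) /\ 8 * n%:R * A (u k x) <= 1;
  _ : forall x k, bigcyl c K r x k -> m <= u k x <= M;
  _ : r ^+ 2 <= K%:R }.

Lemma scheme_on_sub a0 La m M A A1 A2 A3 u c K (r : R) x k : 0 < r ->
  scheme_on a0 La m M A A1 A2 A3 u c K r -> bigcyl c K (r / 4) x k ->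
  scheme_on a0 La m M A A1 A2 A3 u x k (r / 4).
Proof.
move=> r0 [h1 h2 h3 h4 h5 h6] hx; split=> // [y l hy|].
  by apply: h5; exact: bigcyl_sub hx hy.
case: hx => _ h _; move: h h6; rewrite expr_div_n.
have r2 : 0 < r ^+ 2 by rewrite exprn_gt0.
by move: r2; clear; lra.
Qed.

Lemma grad2_crude (f : I -> R) x (N w : R) : (forall y, box x (1 : R) y -> N <= f y <= N + w) ->
  grad2 f x <= n%:R * w ^+ 2.
Proof.
move=> h; apply: le_trans (sum_sqr_const _ (w ^+ 2) _) _; last by rewrite card_ord.
move=> i; apply: sqr_le_norm; rewrite /diffu ler_norml.
have /andP[a1 a2] := h _ (boxDu x i); have /andP[b1 b2] := h _ (boxxx x _ ler01).
by apply/andP; split; move: a1 a2 b1 b2; clear; lra.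
Qed.

(** On the unit lattice a further difference at most doubles the size. This is the origin of the
    crude bound [4 n B] in [bernstein_hyp]. *)
Lemma hess2_crude (f : I -> R) x (X : R) : (forall y, box x (1 : R) y -> grad2 f y <= X) ->
  hess2 f x <= 4 * n%:R * X.
Proof.
move=> h; rewrite /hess2 /grad2 exchange_big /=.
have -> : 4 * n%:R * X = \sum_(j < n) (4 * X) by rewrite sumr_const card_ord -mulr_natl; ring.
apply: ler_sum => j _.
apply: (@le_trans _ _ (\sum_i (2 * diffu i f (x + unitv j) ^+ 2 + 2 * diffu i f x ^+ 2))).
  apply: ler_sum => i _; rewrite {1}/diffu -/(diffu i f).
  have := sqr_ge0 (diffu i f (x + unitv j) + diffu i f x); clear; lra.
rewrite big_split /= -!mulr_sumr.
have := h _ (boxDu x j); have := h _ (boxxx x _ ler01); rewrite /grad2; clear; lra.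
Qed.

Lemma third2_crude (f : I -> R) x (X : R) : (forall y, box x (1 : R) y -> hess2 f y <= X) ->
  third2 f x <= 4 * n%:R * X.
Proof.
move=> h.
have E y : hess2 f y = \sum_i grad2 (diffu i f) y by [].
have -> : third2 f x = \sum_i \sum_j grad2 (diffu i (diffu j f)) x.
  by rewrite /third2 /hess2; apply: eq_bigr => i _; apply: eq_bigr => j _; congr (grad2 _ x); apply/funext => y; exact: diffuC.
have -> : 4 * n%:R * X = \sum_(j < n) (4 * X) by rewrite sumr_const card_ord -mulr_natl; ring.
have E2 : \sum_i \sum_j grad2 (diffu i (diffu j f)) x = \sum_k \sum_i \sum_j diffu k (diffu i (diffu j f)) x ^+ 2.
  rewrite [RHS]exchange_big /=; apply: eq_bigr => i _; rewrite [RHS]exchange_big /=.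
  by apply: eq_bigr => j _.
rewrite E2; apply: ler_sum => k _.
apply: (@le_trans _ _ (\sum_i \sum_j (2 * diffu i (diffu j f) (x + unitv k) ^+ 2 + 2 * diffu i (diffu j f) x ^+ 2))).
  apply: ler_sum => i _; apply: ler_sum => j _; rewrite {1}/diffu -/(diffu i (diffu j f)).
  have := sqr_ge0 (diffu i (diffu j f) (x + unitv k) + diffu i (diffu j f) x); clear; lra.
have E3 y : \sum_i \sum_j diffu i (diffu j f) y ^+ 2 = hess2 f y by rewrite exchange_big.
have -> : \sum_i \sum_j (2 * diffu i (diffu j f) (x + unitv k) ^+ 2 + 2 * diffu i (diffu j f) x ^+ 2) =
    2 * hess2 f (x + unitv k) + 2 * hess2 f x.
  rewrite -!E3 !mulr_sumr -big_split /=; apply: eq_bigr => i _.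
  by rewrite big_split /= !mulr_sumr.
have := h _ (boxDu x k); have := h _ (boxxx x _ ler01); clear; lra.
Qed.

Lemma sum_gam_hess2 (f : I -> R) x : hess2 f x <= \sum_i gam (diffu i f) x.
Proof. by apply: ler_sum => i _; exact: grad2_gam. Qed.

Lemma sum_gam_third2 (f : I -> R) x : third2 f x <= \sum_i \sum_j gam (diffu j (diffu i f)) x.
Proof. by apply: ler_sum => i _; exact: sum_gam_hess2. Qed.

Lemma lip_smallE (a0 La X : R) : lip_small (n := n) a0 La X = lip_small (n := n) a0 La 1 * X ^+ 2.
Proof. by rewrite /lip_small mulr1 exprMn mulrA. Qed.

(** Bernstein with [G] the squared gradient and [H = (u - N1)^2 <= w^2]. The coefficient contributes
    an error of order [G^2], and the admissible factor in front of [S^2] is of order [1 / w^2], so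
    the estimate closes for small oscillation [w]. *)
Lemma gradient_bound (a0 La : R) : (0 < n)%N -> 0 < a0 -> 0 < La ->
  exists w Q : R, [/\ 0 < w, 0 < Q &
  forall m M A A1 A2 A3 u c K (r N1 N2 : R),
  scheme_on a0 La m M A A1 A2 A3 u c K r -> 8 <= r -> N2 - N1 <= w ->
  (forall x k, bigcyl c K r x k -> N1 <= u k x <= N2) ->
  grad2 (u K) c <= (Q / r) ^+ 2].
Proof.
move=> n0 a00 La0.
have nR : 0 < n%:R :> R by rewrite ltr0n.
set l := lip_small (n := n) a0 La 1.
have l0 : 0 < l by exact: lip_small_gt0.
have d0 : 0 < Num.min (a0 ^+ 2) a0 by rewrite lt_min exprn_gt0.
have c0 : 0 <= 8 * l * (4 * 64 * 80) + 16 * l * n%:R.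
  by rewrite addr_ge0// !mulr_ge0 ?ltW.
have [w /andP[w0 w1] hw] := small_square _ _ c0 d0.
move: hw; rewrite le_min => /andP[hw1 hw2].
have w2 : 0 < w ^+ 2 by rewrite exprn_gt0.
have hwa : 8 * l * (4 * 64 * 80) * w ^+ 2 <= a0 ^+ 2.
  by have := mulr_gt0 (mulr_gt0 l0 nR) w2; move: hw1; clear; lra.
have hwb : 16 * l * n%:R * w ^+ 2 <= a0.
  by have := mulr_gt0 l0 w2; move: hw2; clear; lra.
pose z := 40 * 40 * w ^+ 2 / (a0 / 4).
have z0 : 0 < z by rewrite divr_gt0// ?mulr_gt0// divr_gt0.
exists w, (Num.sqrt (16 * z)); split=> //; first by rewrite sqrtr_gt0 mulr_gt0.
move=> m M A A1 A2 A3 u c K r N1 N2 hyp r8 NN hN.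
have r0 : 0 < r by apply: lt_le_trans r8.
case: (hyp) => sc aA uS cfl uin rK.
have cfl2 k x : 2 * n%:R * A (u k x) <= 1 by case: (cfl k x) => + + ; clear; lra.
have cfl4 k x : 4 * n%:R * A (u k x) <= 1 by case: (cfl k x) => + + ; clear; lra.
have a01 : a0 / 4 * n%:R <= 1.
  have [_ h] := cfl K c; have h2 := aA _ (uin _ _ (bigcyl_self c K r (ltW r0))).
  have := ler_wpM2l (ltW nR) h2; have := mulr_gt0 nR a00; move: h; clear; lra.
have r2 : 0 < r ^+ 2 by rewrite exprn_gt0.
rewrite expr_div_n sqr_sqrtr; last by rewrite mulr_ge0// ltW.
rewrite ler_pdivlMr//.
apply: (bernstein_bound (fun k x => A (u k x)) (fun k => grad2 (u k)) (fun k x => (u k x - N1) ^+ 2)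
  c K r (w ^+ 2) 0 (a0 / 4) (z / r ^+ 2) z).
have near x k y (s : R) : s <= 5 -> cyl c K r x k -> box x s y -> N1 <= u k y <= N1 + w.
  move=> s5 hx hy; have := hN _ _ (bigcyl_near _ _ _ _ _ _ _ r8 s5 hx hy).
  by move: NN => + /andP[]; clear => *; apply/andP; split; lra.
have le15 : (1 : R) <= 5 by clear; lra.
have le05 : (0 : R) <= 5 by clear; lra.
split => //.
- by rewrite divr_gt0.
- move=> x k hx; split; apply/andP; split; rewrite ?grad2_ge0 ?sqr_ge0//.
    apply: le_trans (grad2_crude _ _ N1 w _) _; first by move=> y; exact: near.
    by have := mulr_gt0 nR w2; clear; lra.
  have /andP[h1 h2] := near _ _ _ _ le05 hx (boxxx x _ (lexx 0)).
  by apply: sqr_le; move: h1 h2; clear; lra.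
- move=> x k hx kK; have [b0 b1] := cfl k x.
  have -> : u k.+1 x - N1 = avg (A (u k x)) (fun y => u k y - N1) x.
    by rewrite avgB avg_cst uS.
  apply: le_trans (avg_sqr _ _ _ b0 (cfl4 k x)) _; rewrite addr0 lerB//.
  have h1 : a0 <= A (u k x).
    by apply: aA; apply: uin; apply: bigcyl_near r8 le05 hx (boxxx x _ (lexx 0)).
  have g1 := grad2_gam (fun y => u k y - N1) x.
  have gE : grad2 (fun y => u k y - N1) x = grad2 (u k) x.
    by apply: eq_bigr => i _; rewrite /diffu; congr (_ ^+ 2); ring.
  rewrite gE in g1; have := grad2_ge0 (u k) x.
  have := ler_pM (ltW a00) (grad2_ge0 (u k) x) h1 g1.
  have := mulr_ge0 (ltW a00) (grad2_ge0 (u k) x).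
  by clear; lra.
- move=> x k S hx kK Sge hS; have [b0 b1] := cfl k x.
  have h1 : a0 <= A (u k x).
    by apply: aA; apply: uin; apply: bigcyl_near r8 le05 hx (boxxx x _ (lexx 0)).
  have S0 : 0 < S by apply: lt_le_trans Sge; rewrite divr_gt0.
  (* The crude bound [n w^2] on the squared gradient keeps the commutators of [level1] absorbable
     even when [S] is large. *)
  pose T := Num.min S (n%:R * w ^+ 2).
  have T0 : 0 < T by rewrite lt_min S0 mulr_gt0.
  have TS : T <= S by rewrite ge_min lexx.
  have Tw : T <= n%:R * w ^+ 2 by rewrite ge_min lexx orbT.
  have X2 : Num.sqrt T ^+ 2 = T by rewrite sqr_sqrtr// ltW.
  have X0 : 0 < Num.sqrt T by rewrite sqrtr_gt0.
  have gT y : box x (1 : R) y -> grad2 (u k) y <= Num.sqrt T ^+ 2.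
    move=> hy; rewrite X2 le_min; apply/andP; split.
      by apply: hS; apply: box_le hy; clear; lra.
    apply: grad2_crude => v hv; apply: (near x k v 2) => //; first by clear; lra.
    by apply: box_trile hy hv; clear; lra.
  have -> : u k.+1 = avgf (fun y => A (u k y)) (u k) by apply/funext => y; rewrite uS.
  have sm : lip_small (n := n) a0 La (Num.sqrt T) <= a0 / 16.
    rewrite lip_smallE X2 -/l; have := ler_wpM2l (ltW l0) Tw; move: hwb; clear; lra.
  apply: le_trans (level1 (fun y => A (u k y)) (u k) x a0 La (Num.sqrt T) n0 a00 h1 b1 La0 X0 gT _ sm) _.
    apply: (comp_diff1 m M La A A1 A2 A3) => // y; last first.
      by apply: grad2_le; [exact: ltW|apply: gT; exact: boxxx].
    by move=> hy; apply: uin; apply: bigcyl_near r8 _ hx hy; clear; lra.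
  rewrite lip_smallE X2 -/l.
  have G0 : 0 <= a0 / 4 * \sum_i gam (diffu i (u k)) x.
    apply: mulr_ge0; first by rewrite divr_ge0// ltW.
    by apply: sumr_ge0 => i _; exact: gam_ge0.
  have T2 : T ^+ 2 <= S ^+ 2 by apply: sqr_le; first exact: ltW.
  have q : 8 * (l * T) / a0 * T <= a0 / 4 / (64 * (80 * w ^+ 2)) * S ^+ 2.
    rewrite -[leLHS](_ : 8 * l * T ^+ 2 / a0 = _); last by ring.
    rewrite ler_pdivrMr//.
    rewrite -[leRHS](_ : a0 ^+ 2 * S ^+ 2 / (4 * 64 * 80 * w ^+ 2) = _); last first.
      by field; rewrite gt_eqF.
    rewrite ler_pdivlMr ?mulr_gt0//.
    have := ler_pM (ltac:(rewrite !mulr_ge0// ltW//) : 0 <= 8 * l * (4 * 64 * 80) * w ^+ 2) (sqr_ge0 T) hwa T2.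
    by clear; lra.
  by move: q G0; clear; lra.
- by rewrite -/z divfK// gt_eqF.
- by rewrite mulr0 !mul0r ltW.
Qed.

(** Now [H] is the squared gradient, of order [r^(-2)], so the admissible factor in front of [S^2]
    is of order [r^2]. The self-interaction of the Hessian is of order [S^2] without such a factor
    and is absorbed for large [r], that is, for a fine mesh. *)
Lemma hessian_bound (a0 La Q1 : R) : (0 < n)%N -> 0 < a0 -> 0 < La -> 0 < Q1 ->
  exists Q rs : R, [/\ 0 < Q, 8 <= rs &
  forall m M A A1 A2 A3 u c K (r : R),
  scheme_on a0 La m M A A1 A2 A3 u c K r -> rs <= r ->
  (forall x k, bigcyl c K r x k -> grad2 (u k) x <= (Q1 / r) ^+ 2) ->
  hess2 (u K) c <= (Q / r ^+ 2) ^+ 2].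
Proof.
move=> n0 a00 La0 Q10.
have nR : 0 < n%:R :> R by rewrite ltr0n.
set l := lip_small (n := n) a0 La 1.
have l0 : 0 < l by exact: lip_small_gt0.
have q2 : 0 < Q1 ^+ 2 by rewrite exprn_gt0.
pose N := 2 * n%:R ^+ 2 * La.
have N0 : 0 < N by rewrite !mulr_gt0// exprn_gt0.
pose eta := a0 / 4 / (64 * (80 * Q1 ^+ 2)).
have eta0 : 0 < eta by rewrite !divr_gt0// !mulr_gt0.
pose c1 := 8 * l * Q1 ^+ 2 / a0.
have c10 : 0 < c1 by rewrite divr_gt0// !mulr_gt0.
pose D := 1 + Q1 ^+ 2 + (c1 + 2 * N) / (eta / 2).
have D3 : 0 < (c1 + 2 * N) / (eta / 2) by posR.
have D1 : 1 <= D by move: q2 D3; rewrite /D; clear; lra.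
have DQ : Q1 ^+ 2 <= D by move: q2 D3; rewrite /D; clear; lra.
have De : c1 + 2 * N <= eta / 2 * D.
  have E : (c1 + 2 * N) / (eta / 2) * (eta / 2) = c1 + 2 * N by rewrite divfK// gt_eqF// divr_gt0.
  have := mulr_gt0 eta0 q2; move: E eta0; rewrite /D; clear; lra.
pose kc := 8 * l * Q1 ^+ 4 / a0.
have kc0 : 0 < kc by rewrite divr_gt0// !mulr_gt0// exprn_gt0.
pose z := 40 * 40 * Q1 ^+ 2 / (a0 / 4) + D ^+ 2 + 8 * kc / (a0 / 4).
have z1 : 0 < 40 * 40 * Q1 ^+ 2 / (a0 / 4) by rewrite divr_gt0// ?mulr_gt0// divr_gt0.
have z2 : 0 < 8 * kc / (a0 / 4) by posR.
have z3 : 0 < D ^+ 2 by rewrite exprn_gt0//; move: D1; clear; lra.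
have z0 : 0 < z by rewrite !addr_gt0.
have [e0 /andP[e00 e01] he0] := small_square (2 * N ^+ 2 + l * Q1 ^+ 2 * (16 * eta / (2 * a0))) (eta / 2)
  ltac:(apply: ltW; posR) ltac:(posR).
have e02 : 0 < e0 ^+ 2 by rewrite exprn_gt0.
have heA : 2 * N ^+ 2 * e0 ^+ 2 <= eta / 2.
  apply: le_trans he0; rewrite ler_wpM2r ?sqr_ge0// lerDl.
  by apply: ltW; posR.
have heB : l * Q1 ^+ 2 * e0 ^+ 2 <= a0 / 16.
  have h : l * Q1 ^+ 2 * (16 * eta / (2 * a0)) * e0 ^+ 2 <= eta / 2.
    apply: le_trans he0; rewrite ler_wpM2r ?sqr_ge0// lerDr.
    by rewrite mulr_ge0 ?sqr_ge0.
  have h2 : l * Q1 ^+ 2 * e0 ^+ 2 * (8 * eta / a0) <= a0 / 16 * (8 * eta / a0).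
    rewrite -[leRHS](_ : eta / 2 = _); last by field; rewrite gt_eqF.
    by apply: le_trans h; rewrite le_eqVlt; apply/orP; left; apply/eqP; field; rewrite gt_eqF.
  by rewrite -(ler_pM2r (_ : 0 < 8 * eta / a0))// divr_gt0// mulr_gt0.
have rs8 : 8 <= 8 + e0^-1 by rewrite lerDl invr_ge0 ltW.
exists (Num.sqrt (16 * z)), (8 + e0^-1); split=> //; first by rewrite sqrtr_gt0 mulr_gt0.
move=> m M A A1 A2 A3 u c K r hyp rsr hG1.
have r8 : 8 <= r by apply: le_trans rsr.
have r0 : 0 < r by apply: lt_le_trans r8.
case: (hyp) => sc aA uS cfl uin rK.
have r2 : 0 < r ^+ 2 by rewrite exprn_gt0.
have near x k y (s : R) : s <= 5 -> cyl c K r x k -> box x s y -> grad2 (u k) y <= (Q1 / r) ^+ 2.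
  by move=> s5 hx hy; apply: hG1; exact: bigcyl_near r8 s5 hx hy.
pose e := r^-1; have ep : 0 < e by rewrite invr_gt0.
have ee0 : e <= e0.
  rewrite /e -[e0]invrK lef_pV2 ?posrE ?invr_gt0//.
  by apply: le_trans rsr; rewrite lerDr.
have re : r ^+ 2 * e ^+ 2 = 1 by rewrite -exprMn mulfV ?gt_eqF// expr1n.
have e2 : 0 < e ^+ 2 by rewrite exprn_gt0.
have ee2 : e ^+ 2 <= e0 ^+ 2 by apply: sqr_le => //; exact: ltW.
have heA' : 2 * N ^+ 2 * e ^+ 2 <= eta / 2.
  by apply: le_trans heA; rewrite ler_wpM2l// mulr_ge0// sqr_ge0.
have heB' : l * (Q1 * e) ^+ 2 <= a0 / 16.
  by apply: le_trans heB; rewrite exprMn mulrA ler_wpM2l// mulr_ge0 ?sqr_ge0// ltW.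
rewrite -/e in near.
have X10 : 0 < Q1 * e by rewrite mulr_gt0.
have X12 : 0 < (Q1 * e) ^+ 2 by rewrite exprn_gt0.
have le15 : (1 : R) <= 5 by clear; lra.
have le05 : (0 : R) <= 5 by clear; lra.
have a01 : a0 / 4 * n%:R <= 1.
  have [_ h] := cfl K c; have h2 := aA _ (uin _ _ (bigcyl_self c K r (ltW r0))).
  have := ler_wpM2l (ltW nR) h2; have := mulr_gt0 nR a00; move: h; clear; lra.
rewrite expr_div_n sqr_sqrtr; last by rewrite mulr_ge0// ltW.
rewrite -exprM -[leRHS](_ : 16 * (z * e ^+ 2) / r ^+ 2 = _); last first.
  by rewrite /e; field; rewrite gt_eqF.
rewrite ler_pdivlMr//.
apply: (bernstein_bound (fun k x => A (u k x)) (fun k => hess2 (u k)) (fun k => grad2 (u k))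
  c K r ((Q1 * e) ^+ 2) (kc * e ^+ 4) (a0 / 4) ((D * e ^+ 2) ^+ 2) (z * e ^+ 2)).
have uE k : u k.+1 = avgf (fun y => A (u k y)) (u k) by apply/funext => y; rewrite uS.
have uin' x k y (s : R) : s <= 5 -> cyl c K r x k -> box x s y -> m <= u k y <= M.
  by move=> s5 hx hy; apply: uin; apply: bigcyl_near r8 s5 hx hy.
have aA' x k : cyl c K r x k -> a0 <= A (u k x).
  by move=> hx; apply: aA; apply: (uin' x k x 0 le05 hx (boxxx x _ (lexx 0))).
have sm : lip_small (n := n) a0 La (Q1 * e) <= a0 / 16 by rewrite lip_smallE.
have d1 x k y i (s : R) : s <= 5 -> cyl c K r x k -> box x s y -> `|diffu i (u k) y| <= Q1 * e.
  by move=> s5 hx hy; apply: grad2_le; [exact: ltW|exact: near s5 hx hy].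
have dA1 x k : cyl c K r x k -> forall i, `|diffu i (fun y => A (u k y)) x| <= La * (Q1 * e).
  move=> hx; apply: (comp_diff1 m M La A A1 A2 A3) => //.
    by move=> y hy; apply: uin' hx hy; clear; lra.
  by move=> i; apply: d1 le05 hx (boxxx x _ (lexx 0)).
split => //.
- by rewrite divr_gt0.
- by rewrite mulr_ge0 ?exprn_ge0// ltW.
- move=> x k hx; split; apply/andP; split; rewrite ?hess2_ge0 ?grad2_ge0//.
    apply: hess2_crude => y hy; exact: near hy.
  by apply: near le05 hx (boxxx x _ (lexx 0)).
- move=> x k hx kK; have [b0 b1] := cfl k x; rewrite uE.
  have gT y : box x (1 : R) y -> grad2 (u k) y <= (Q1 * e) ^+ 2 by exact: near.
  apply: le_trans (level1 (fun y => A (u k y)) (u k) x a0 La (Q1 * e) n0 a00 (aA' _ _ hx) b1 La0 X10 gT (dA1 _ _ hx) sm) _.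
  rewrite lip_smallE -/l.
  have -> : 8 * (l * (Q1 * e) ^+ 2) / a0 * (Q1 * e) ^+ 2 = kc * e ^+ 4.
    by rewrite /kc; field; rewrite gt_eqF.
  have := ler_wpM2l (ltW a00) (sum_gam_hess2 (u k) x).
  by clear; lra.
- move=> x k S hx kK Sge hS; have [b0 b1] := cfl k x; rewrite uE.
  have S0 : 0 < S.
    by apply: lt_le_trans Sge; rewrite exprn_gt0// mulr_gt0//; move: D1; clear; lra.
  set X := Num.sqrt S.
  have X2 : X ^+ 2 = S by rewrite /X sqr_sqrtr// ltW.
  have X0 : 0 < X by rewrite sqrtr_gt0.
  have De0 : 0 <= D * e ^+ 2 by rewrite mulr_ge0 ?(ltW e2)//; move: D1; clear; lra.
  have XD : D * e ^+ 2 <= X.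
    by rewrite -(@ler_pXn2r _ 2) ?nnegrE ?(ltW X0)// X2.
  have Q1X : (Q1 * e) ^+ 2 <= X.
    by apply: le_trans XD; rewrite exprMn ler_wpM2r// ltW.
  have hX y : box x (4 : R) y -> hess2 (u k) y <= X ^+ 2 by rewrite X2; exact: hS.
  apply: le_trans (level2 (fun y => A (u k y)) (u k) x a0 La (Q1 * e) X _ n0 a00 (aA' _ _ hx) b1 La0 X10 (ltW X0) hX (dA1 _ _ hx) _ sm erefl) _.
    apply: (comp_diff2 m M La A A1 A2 A3) => //.
    + by move=> y hy; apply: uin' hx hy; clear; lra.
    + by move=> y i hy; exact: d1 hx hy.
    + by apply: hess2_le; [exact: ltW|apply: hX; apply: boxxx].
  set Y := n%:R ^+ 2 * La * (X + (Q1 * e) ^+ 2) * X.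
  have YN : Y <= N * X ^+ 2.
    have := ler_wpM2l (ltac:(rewrite !mulr_ge0 ?sqr_ge0 ?ltW//) : 0 <= n%:R ^+ 2 * La * X) Q1X.
    by rewrite /Y /N; clear; lra.
  have Y0 : 0 <= Y by rewrite !mulr_ge0 ?addr_ge0 ?sqr_ge0// ltW.
  have Y2 : Y ^+ 2 <= N ^+ 2 * X ^+ 4.
    by apply: le_trans (sqr_le _ _ Y0 YN) _; rewrite exprMn -exprM.
  have XY : X * Y <= N * X ^+ 3.
    by apply: le_trans (ler_wpM2l (ltW X0) YN) _; rewrite [X ^+ 3]exprS; clear; lra.
  have G0 : 0 <= a0 / 4 * \sum_i \sum_j gam (diffu j (diffu i (u k))) x.
    apply: mulr_ge0; first by rewrite divr_ge0// ltW.
    by apply: sumr_ge0 => i _; apply: sumr_ge0 => j _; exact: gam_ge0.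
  rewrite lip_smallE -/l.
  have t1 : 8 * (l * (Q1 * e) ^+ 2) / a0 * X ^+ 2 = c1 * e ^+ 2 * X ^+ 2.
    by rewrite /c1; field; rewrite gt_eqF.
  have goal : (c1 * e ^+ 2 * X ^+ 2 + 2 * (N * X ^+ 3) + 2 * (N ^+ 2 * X ^+ 4)) * e ^+ 2 <= eta * X ^+ 4.
    exact: (quadratic_absorb c1 N eta D (e ^+ 2) X c10 N0 X0 e2 D1 De heA' XD).
  have goal2 : c1 * e ^+ 2 * X ^+ 2 + 2 * (N * X ^+ 3) + 2 * (N ^+ 2 * X ^+ 4) <=
      a0 / 4 / (64 * (80 * (Q1 * e) ^+ 2)) * S ^+ 2.
    have -> : a0 / 4 / (64 * (80 * (Q1 * e) ^+ 2)) * S ^+ 2 = eta * X ^+ 4 / e ^+ 2.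
      by rewrite -X2 -exprM /eta; field; rewrite !gt_eqF.
    by rewrite ler_pdivlMr.
  by rewrite t1; move: goal2 XY Y2 G0; clear; lra.
- have -> : 40 * 40 * (Q1 * e) ^+ 2 / (a0 / 4) = 40 * 40 * Q1 ^+ 2 / (a0 / 4) * e ^+ 2.
    by field; rewrite gt_eqF.
  by rewrite ler_wpM2r ?(ltW e2)//; move: z1 z2 z3; rewrite /z; clear; lra.
- have -> : (D * e ^+ 2) ^+ 2 * r ^+ 2 = D ^+ 2 * e ^+ 2 * (r ^+ 2 * e ^+ 2) by ring.
  rewrite re mulr1.
  by rewrite ler_wpM2r ?(ltW e2)//; move: z1 z2 z3; rewrite /z; clear; lra.
- have -> : 8 * (kc * e ^+ 4) * r ^+ 2 / (a0 / 4) = 8 * kc / (a0 / 4) * e ^+ 2 * (r ^+ 2 * e ^+ 2).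
    by field; rewrite gt_eqF.
  rewrite re mulr1.
  by rewrite ler_wpM2r ?(ltW e2)//; move: z1 z2 z3; rewrite /z; clear; lra.
Qed.

(** The errors at this level are at most quadratic in the size [X] of the third differences, that
    is, linear in [G = X^2]. The threshold [X >= D r^(-3)] alone makes them fit under the admissible
    quartic term. *)
Lemma third_bound (a0 La Q1 Q2 : R) : (0 < n)%N -> 0 < a0 -> 0 < La -> 0 < Q1 -> 0 < Q2 ->
  exists Q rs : R, [/\ 0 < Q, 8 <= rs &
  forall m M A A1 A2 A3 u c K (r : R),
  scheme_on a0 La m M A A1 A2 A3 u c K r -> rs <= r ->
  (forall x k, bigcyl c K r x k -> grad2 (u k) x <= (Q1 / r) ^+ 2) ->
  (forall x k, bigcyl c K r x k -> hess2 (u k) x <= (Q2 / r ^+ 2) ^+ 2) ->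
  third2 (u K) c <= (Q / r ^+ 3) ^+ 2].
Proof.
move=> n0 a00 La0 Q10 Q20.
have nR : 0 < n%:R :> R by rewrite ltr0n.
set l := lip_small (n := n) a0 La 1.
have l0 : 0 < l by exact: lip_small_gt0.
pose N := n%:R ^+ 3 * La * (3 * (Q2 + Q1 ^+ 2) + 2 * Q2).
have N0 : 0 < N by posR.
pose c' := 8 * l * Q1 ^+ 2 / a0.
have c'0 : 0 < c' by posR.
pose c1 := c' + 2 * N + 2 * N ^+ 2.
have c10 : 0 < c1 by posR.
pose eta := a0 / 4 / (64 * (80 * Q2 ^+ 2)).
have eta0 : 0 < eta by posR.
pose P := 3 * Q1 * Q2 + Q1 ^+ 3.
have P0 : 0 < P by posR.
pose D := 1 + P + c1 / eta.
have D3 : 0 < c1 / eta by posR.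
have D1 : 1 <= D by move: P0 D3; rewrite /D; clear; lra.
have D0 : 0 < D by apply: lt_le_trans D1.
have DP : P <= D by move: D3; rewrite /D; clear; lra.
have De : c1 <= eta * D.
  have E : c1 / eta * eta = c1 by rewrite divfK// gt_eqF.
  have := mulr_gt0 eta0 P0; move: E eta0; rewrite /D; clear; lra.
pose N2 := n%:R ^+ 2 * La * (Q2 + Q1 ^+ 2) * Q2.
have N20 : 0 < N2 by posR.
pose kc := c' * Q2 ^+ 2 + 2 * (Q2 * N2) + 2 * N2 ^+ 2.
have kc0 : 0 < kc by posR.
pose z := 40 * 40 * Q2 ^+ 2 / (a0 / 4) + D ^+ 2 + 8 * kc / (a0 / 4).
have z1 : 0 < 40 * 40 * Q2 ^+ 2 / (a0 / 4) by posR.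
have z2 : 0 < 8 * kc / (a0 / 4) by posR.
have z3 : 0 < D ^+ 2 by posR.
have z0 : 0 < z by rewrite !addr_gt0.
have [e0 /andP[e00 e01] he0] := small_square (l * Q1 ^+ 2) (a0 / 16)
  ltac:(apply: ltW; posR) ltac:(posR).
have rs8 : 8 <= 8 + e0^-1 by rewrite lerDl invr_ge0 ltW.
exists (Num.sqrt (16 * z)), (8 + e0^-1); split=> //; first by rewrite sqrtr_gt0 mulr_gt0.
move=> m M A A1 A2 A3 u c K r hyp rsr hG1 hG2.
have r8 : 8 <= r by apply: le_trans rsr.
have r0 : 0 < r by apply: lt_le_trans r8.
case: (hyp) => sc aA uS cfl uin rK.
have r2 : 0 < r ^+ 2 by rewrite exprn_gt0.
pose e := r^-1; have ep : 0 < e by rewrite invr_gt0.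
have near x k y (s : R) : s <= 5 -> cyl c K r x k -> box x s y -> grad2 (u k) y <= (Q1 * e) ^+ 2.
  by move=> s5 hx hy; apply: hG1; exact: bigcyl_near r8 s5 hx hy.
have near2 x k y (s : R) : s <= 5 -> cyl c K r x k -> box x s y -> hess2 (u k) y <= (Q2 * e ^+ 2) ^+ 2.
  by move=> s5 hx hy; rewrite /e exprVn; apply: hG2; exact: bigcyl_near r8 s5 hx hy.
have ee0 : e <= e0.
  rewrite /e -[e0]invrK lef_pV2 ?posrE ?invr_gt0//.
  by apply: le_trans rsr; rewrite lerDr.
have e1 : e <= 1 by apply: le_trans e01.
have re : r ^+ 2 * e ^+ 2 = 1 by rewrite -exprMn mulfV ?gt_eqF// expr1n.
have e2 : 0 < e ^+ 2 by rewrite exprn_gt0.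
have e21 : e ^+ 2 <= 1 by rewrite exprn_ile1// ltW.
have ee2 : e ^+ 2 <= e0 ^+ 2 by apply: sqr_le => //; exact: ltW.
have heB' : l * (Q1 * e) ^+ 2 <= a0 / 16.
  by apply: le_trans he0; rewrite exprMn mulrA ler_wpM2l// mulr_ge0 ?sqr_ge0// ltW.
have X10 : 0 < Q1 * e by rewrite mulr_gt0.
have X12 : 0 < (Q1 * e) ^+ 2 by rewrite exprn_gt0.
have X20 : 0 < Q2 * e ^+ 2 by rewrite mulr_gt0.
have le15 : (1 : R) <= 5 by clear; lra.
have le05 : (0 : R) <= 5 by clear; lra.
have le45 : (4 : R) <= 5 by clear; lra.
have a01 : a0 / 4 * n%:R <= 1.
  have [_ h] := cfl K c; have h2 := aA _ (uin _ _ (bigcyl_self c K r (ltW r0))).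
  have := ler_wpM2l (ltW nR) h2; have := mulr_gt0 nR a00; move: h; clear; lra.
rewrite expr_div_n sqr_sqrtr; last by rewrite mulr_ge0// ltW.
rewrite -exprM -[leRHS](_ : 16 * (z * e ^+ 4) / r ^+ 2 = _); last first.
  by rewrite /e; field; rewrite gt_eqF.
rewrite ler_pdivlMr//.
apply: (bernstein_bound (fun k x => A (u k x)) (fun k => third2 (u k)) (fun k => hess2 (u k))
  c K r ((Q2 * e ^+ 2) ^+ 2) (kc * e ^+ 6) (a0 / 4) ((D * e ^+ 3) ^+ 2) (z * e ^+ 4)).
have uE k : u k.+1 = avgf (fun y => A (u k y)) (u k) by apply/funext => y; rewrite uS.
have uin' x k y (s : R) : s <= 5 -> cyl c K r x k -> box x s y -> m <= u k y <= M.
  by move=> s5 hx hy; apply: uin; apply: bigcyl_near r8 s5 hx hy.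
have aA' x k : cyl c K r x k -> a0 <= A (u k x).
  by move=> hx; apply: aA; apply: (uin' x k x 0 le05 hx (boxxx x _ (lexx 0))).
have sm : lip_small (n := n) a0 La (Q1 * e) <= a0 / 16 by rewrite lip_smallE.
have d1 x k y i (s : R) : s <= 5 -> cyl c K r x k -> box x s y -> `|diffu i (u k) y| <= Q1 * e.
  by move=> s5 hx hy; apply: grad2_le; [exact: ltW|exact: near s5 hx hy].
have d2 x k y i j (s : R) : s <= 5 -> cyl c K r x k -> box x s y -> `|diffu j (diffu i (u k)) y| <= Q2 * e ^+ 2.
  by move=> s5 hx hy; apply: hess2_le; [exact: ltW|exact: near2 s5 hx hy].
have dA1 x k : cyl c K r x k -> forall i, `|diffu i (fun y => A (u k y)) x| <= La * (Q1 * e).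
  move=> hx; apply: (comp_diff1 m M La A A1 A2 A3) => //.
    by move=> y hy; apply: uin' hx hy; clear; lra.
  by move=> i; apply: d1 le05 hx (boxxx x _ (lexx 0)).
have dA2 x k : cyl c K r x k -> forall i j, `|diffu j (diffu i (fun y => A (u k y))) x| <= La * (Q2 * e ^+ 2 + (Q1 * e) ^+ 2).
  move=> hx; apply: (comp_diff2 m M La A A1 A2 A3) => //.
  - by move=> y hy; apply: uin' hx hy; clear; lra.
  - by move=> y i hy; exact: d1 hx hy.
  - by move=> i j; apply: d2 le05 hx (boxxx x _ (lexx 0)).
split => //.
- by rewrite divr_gt0.
- by posR.
- by apply: ltW; posR.
- move=> x k hx; split; apply/andP; split; rewrite ?hess2_ge0 ?third2_ge0//.
    apply: third2_crude => y hy; exact: near2 hx hy.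
  by apply: near2 le05 hx (boxxx x _ (lexx 0)).
- move=> x k hx kK; have [b0 b1] := cfl k x; rewrite uE.
  have gT y : box x (4 : R) y -> hess2 (u k) y <= (Q2 * e ^+ 2) ^+ 2 by exact: near2.
  apply: le_trans (level2 (fun y => A (u k y)) (u k) x a0 La (Q1 * e) (Q2 * e ^+ 2) _ n0 a00 (aA' _ _ hx) b1 La0 X10 (ltW X20) gT (dA1 _ _ hx) (dA2 _ _ hx) sm erefl) _.
  rewrite lip_smallE -/l.
  have -> : n%:R ^+ 2 * La * (Q2 * e ^+ 2 + (Q1 * e) ^+ 2) * (Q2 * e ^+ 2) = N2 * e ^+ 4.
    by rewrite /N2; ring.
  have -> : 8 * (l * (Q1 * e) ^+ 2) / a0 * (Q2 * e ^+ 2) ^+ 2 = c' * Q2 ^+ 2 * e ^+ 6.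
    by rewrite /c'; field; rewrite gt_eqF.
  have h1 := ler_wpM2l (ltW a00) (sum_gam_third2 (u k) x).
  have h2 := ler_wpM2l (ltac:(apply: ltW; posR) : 0 <= N2 ^+ 2 * e ^+ 6) e21.
  by move: h1 h2; rewrite /kc; clear; lra.
- move=> x k S hx kK Sge hS; have [b0 b1] := cfl k x; rewrite uE.
  have S0 : 0 < S by apply: lt_le_trans Sge; posR.
  set X := Num.sqrt S.
  have X2 : X ^+ 2 = S by rewrite /X sqr_sqrtr// ltW.
  have X0 : 0 < X by rewrite sqrtr_gt0.
  have De0 : 0 < D * e ^+ 3 by posR.
  have XD : D * e ^+ 3 <= X.
    by rewrite -(@ler_pXn2r _ 2) ?nnegrE ?(ltW X0) ?(ltW De0)// X2.
  have e30 : 0 < e ^+ 3 by posR.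
  have PX : P * e ^+ 3 <= X.
    by apply: le_trans XD; rewrite ler_wpM2r// ltW.
  have hX y : box x (4 : R) y -> third2 (u k) y <= X ^+ 2 by rewrite X2; exact: hS.
  have gT y : box x (4 : R) y -> hess2 (u k) y <= (Q2 * e ^+ 2) ^+ 2 by exact: near2.
  apply: le_trans (level3 (fun y => A (u k y)) (u k) x a0 La (Q1 * e) (Q2 * e ^+ 2) X _ n0 a00 (aA' _ _ hx) b1 La0 X10 (ltW X20) (ltW X0) gT hX (dA1 _ _ hx) (dA2 _ _ hx) _ sm erefl) _.
    apply: (comp_diff3 m M La A A1 A2 A3) => //.
    + exact: ltW.
    + by move=> y hy; apply: uin' hx hy; clear; lra.
    + by move=> y i hy; apply: d1 hx hy; clear; lra.
    + by move=> y i j hy; exact: d2 hx hy.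
    + by apply: third2_le; [exact: ltW|apply: hX; apply: boxxx].
  set Y := n%:R ^+ 3 * La * _.
  have YN : Y <= N * e ^+ 2 * X.
    have := ler_wpM2l (ltac:(apply: ltW; posR) : 0 <= n%:R ^+ 3 * La * (Q2 * e ^+ 2)) PX.
    by rewrite /Y /N /P; clear; lra.
  have Y0 : 0 <= Y by apply: ltW; rewrite /Y; posR.
  have Y2 : Y ^+ 2 <= N ^+ 2 * e ^+ 2 * X ^+ 2.
    apply: le_trans (sqr_le _ _ Y0 YN) _.
    have := ler_wpM2l (ltac:(apply: ltW; posR) : 0 <= N ^+ 2 * e ^+ 2 * X ^+ 2) e21; clear; lra.
  have XY : X * Y <= N * e ^+ 2 * X ^+ 2.
    by apply: le_trans (ler_wpM2l (ltW X0) YN) _; clear; lra.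
  have G0 : 0 <= a0 / 4 * \sum_i \sum_j \sum_l gam (diffu l (diffu j (diffu i (u k)))) x.
    apply: mulr_ge0; first by rewrite divr_ge0// ltW.
    by apply: sumr_ge0 => i _; apply: sumr_ge0 => j _; apply: sumr_ge0 => q _; exact: gam_ge0.
  rewrite lip_smallE -/l.
  have -> : 8 * (l * (Q1 * e) ^+ 2) / a0 * X ^+ 2 = c' * e ^+ 2 * X ^+ 2.
    by rewrite /c'; field; rewrite gt_eqF.
  have goal : c1 * e ^+ 2 * X ^+ 2 <= a0 / 4 / (64 * (80 * (Q2 * e ^+ 2) ^+ 2)) * S ^+ 2.
    have -> : a0 / 4 / (64 * (80 * (Q2 * e ^+ 2) ^+ 2)) * S ^+ 2 = eta * X ^+ 4 / e ^+ 4.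
      by rewrite -X2 -exprM /eta; field; rewrite !gt_eqF.
    rewrite ler_pdivlMr; last by posR.
    have i1 := ler_wpM2l (ltac:(apply: ltW; posR) : 0 <= eta * X ^+ 2) (sqr_le _ _ (ltW De0) XD).
    have i2 := ler_wpM2r (ltac:(apply: ltW; posR) : 0 <= e ^+ 6 * X ^+ 2) De.
    have i3 := ler_wpM2l (ltac:(apply: ltW; posR) : 0 <= eta * D * e ^+ 6 * X ^+ 2) D1.
    by move: i1 i2 i3; clear; lra.
  by move: goal XY Y2 G0; rewrite /c1; clear; lra.
- have -> : 40 * 40 * (Q2 * e ^+ 2) ^+ 2 / (a0 / 4) = 40 * 40 * Q2 ^+ 2 / (a0 / 4) * e ^+ 4.
    by field; rewrite gt_eqF.
  by rewrite ler_wpM2r ?exprn_ge0 ?(ltW ep)//; move: z1 z2 z3; rewrite /z; clear; lra.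
- have -> : (D * e ^+ 3) ^+ 2 * r ^+ 2 = D ^+ 2 * e ^+ 4 * (r ^+ 2 * e ^+ 2) by ring.
  rewrite re mulr1.
  by rewrite ler_wpM2r ?exprn_ge0 ?(ltW ep)//; move: z1 z2 z3; rewrite /z; clear; lra.
- have -> : 8 * (kc * e ^+ 6) * r ^+ 2 / (a0 / 4) = 8 * kc / (a0 / 4) * e ^+ 4 * (r ^+ 2 * e ^+ 2).
    by field; rewrite gt_eqF.
  rewrite re mulr1.
  by rewrite ler_wpM2r ?exprn_ge0 ?(ltW ep)//; move: z1 z2 z3; rewrite /z; clear; lra.
Qed.

Lemma bigcyl_le c K (r s : R) x k : 0 <= r -> r <= s -> bigcyl c K r x k -> bigcyl c K s x k.
Proof.
move=> r0 rs [h1 h2 h3]; split=> //.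
  by apply: box_le h1; move: rs; clear; lra.
by apply: le_trans h2; rewrite lerB// sqr_le.
Qed.

Lemma scheme_on_le a0 La m M A A1 A2 A3 u c K (r s : R) : 0 <= r -> r <= s ->
  scheme_on a0 La m M A A1 A2 A3 u c K s -> scheme_on a0 La m M A A1 A2 A3 u c K r.
Proof.
move=> r0 rs [h1 h2 h3 h4 h5 h6]; split=> //.
  by move=> x k hx; apply: h5; exact: bigcyl_le hx.
by apply: le_trans h6; exact: sqr_le.
Qed.

(** [osc_small] shrinks the cylinder until the gradient estimate applies; each further order is
    obtained on a quarter of the previous cylinder, or on the same one when only its centre is
    needed. All constants depend on [a0], [La], [W] and [n], not on the mesh. *)
Lemma interior_estimates (a0 La W : R) : (0 < n)%N -> 0 < a0 -> 0 < La ->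
  exists w Q rs : R, [/\ 0 < w, 0 < Q, 1 <= rs &
  forall m M A A1 A2 A3 u c K k0 (r C1 : R),
  scheme_on a0 La m M A A1 A2 A3 u c K r -> M - m <= W -> rs <= r ->
  r ^+ 2 <= K%:R - k0%:R -> 0 <= C1 -> C1 * r ^+ 2 <= w ->
  (forall k x, (k0 <= k)%N -> u k x - C1 <= u k.+1 x) ->
  [/\ grad2 (u K) c <= (Q / r) ^+ 2, hess2 (u K) c <= (Q / r ^+ 2) ^+ 2 &
      third2 (u K) c <= (Q / r ^+ 3) ^+ 2]].
Proof.
move=> n0 a00 La0.
have [w [Q1 [w0 Q10 bnd1]]] := gradient_bound a0 La n0 a00 La0.
have [q [rs0 [/andP[q0 q1] rs01 osc]]] := osc_small n0 a0 W w a00 w0.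
pose R1 := Q1 / 4.
have R10 : 0 < R1 by posR.
have [Q2 [rs2 [Q20 rs28 bnd2]]] := hessian_bound a0 La R1 n0 a00 La0 R10.
have [Q3 [rs3 [Q30 rs38 bnd3]]] := third_bound a0 La R1 Q2 n0 a00 La0 R10 Q20.
have rs20 : 0 < rs2 by apply: lt_le_trans rs28.
have rs30 : 0 < rs3 by apply: lt_le_trans rs38.
pose G1 := Q1 * 4 / q; pose G2 := Q2 * (16 * 16) / q ^+ 2; pose G3 := Q3 * (16 * 16 * 16) / q ^+ 3.
have G10 : 0 < G1 by posR.
have G20 : 0 < G2 by posR.
have G30 : 0 < G3 by posR.
have G0 : 0 < 16 * (rs2 + rs3) / q by posR.
exists (w / 16), (G1 + G2 + G3), (rs0 + 16 * (rs2 + rs3) / q); split.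
- by posR.
- by rewrite !addr_gt0.
- by rewrite ler_wpDr// ltW.
move=> m M A A1 A2 A3 u c K k0 r C1 hyp MW rsr rK C10 C1r BC.
have r00 : rs0 <= r by apply: le_trans rsr; rewrite lerDl ltW.
have r0 : 0 < r by apply: lt_le_trans r00; apply: lt_le_trans rs01.
have qr : 16 * (rs2 + rs3) <= q * r.
  rewrite [q * r]mulrC -ler_pdivrMr//; apply: le_trans rsr; rewrite lerDr.
  by apply: le_trans rs01.
have rho0 : 0 < q * r by posR.
have rhor : q * r <= r by rewrite ler_piMl// ltW.
case: (hyp) => sc aA uS cfl uin rKK.
have sol : lattice_solution u (fun k x => A (u k x)) C1 k0 by split.
have hu k x : box c (2 * r) x -> K%:R - r ^+ 2 <= k%:R -> (k <= K)%N ->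
    a0 <= A (u k x) /\ m <= u k x <= M.
  move=> h1 h2 h3; have h : m <= u k x <= M by apply: uin; split.
  by split=> //; exact: aA.
have [N1 [N2 [NN hN]]] := osc u (fun k x => A (u k x)) c K k0 r m M C1 r00 rK sol hu C10 MW C1r.
have [rho rhoE] : exists rho, q * r = rho by exists (q * r).
rewrite rhoE in rho0 rhor hN qr.
have hyp1 : scheme_on a0 La m M A A1 A2 A3 u c K rho by exact: (scheme_on_le _ _ _ _ _ _ _ _ _ _ _ _ _ (ltW rho0) rhor hyp).
have hN' x k : bigcyl c K rho x k -> N1 <= u k x <= N2 by move=> [h1 h2 h3]; exact: hN.
have r1 : 16 * rs2 <= rho by move: qr rs30; clear; lra.
have r2 : 16 * rs3 <= rho by move: qr rs20; clear; lra.
have E16 : rho / 16 = rho / 4 / 4 by field.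
have p4 : 0 < rho / 4 by posR.
have p16 : 0 < rho / 16 by posR.
have l16 : rho / 16 <= rho / 4 by move: rho0; clear; lra.
have hyp4 : scheme_on a0 La m M A A1 A2 A3 u c K (rho / 4).
  by apply: scheme_on_le hyp1; [exact: ltW|move: rho0; clear; lra].
have g1 x k : bigcyl c K (rho / 4) x k -> grad2 (u k) x <= (Q1 / (rho / 4)) ^+ 2.
  move=> hx; apply: (bnd1 m M A A1 A2 A3 u x k (rho / 4) N1 N2) => //.
  - by apply: scheme_on_sub hx.
  - by move: r1 rs28; clear; lra.
  by move=> y l hy; apply: hN'; apply: bigcyl_sub hx hy.
have R1E : Q1 / (rho / 4) = R1 / (rho / 16) by rewrite /R1; field; rewrite gt_eqF.
have g2 x k : bigcyl c K (rho / 16) x k -> hess2 (u k) x <= (Q2 / (rho / 16) ^+ 2) ^+ 2.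
  move=> hx; apply: (bnd2 m M A A1 A2 A3 u x k (rho / 16)).
  - by rewrite E16 in hx *; exact: scheme_on_sub hx.
  - by move: r1 rs20; clear; lra.
  move=> y l hy; rewrite -R1E; apply: g1.
  by rewrite E16 in hx hy; exact: bigcyl_sub hx hy.
have le (G E : R) : 0 < G -> 0 < E -> G <= G1 + G2 + G3 -> (G / E) ^+ 2 <= ((G1 + G2 + G3) / E) ^+ 2.
  move=> G_ E_ GG; apply: sqr_le; first by apply: ltW; posR.
  by rewrite ler_wpM2r// invr_ge0 ltW.
have selfc s : 0 < s -> bigcyl c K s c K by move=> s0; apply: bigcyl_self; exact: ltW.
split.
- apply: le_trans (g1 c K (selfc _ p4)) _.
  have -> : Q1 / (rho / 4) = G1 / r by rewrite /G1 -rhoE; field; rewrite !gt_eqF.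
  by apply: le => //; move: G20 G30; clear; lra.
- apply: le_trans (g2 c K (selfc _ p16)) _.
  have -> : Q2 / (rho / 16) ^+ 2 = G2 / r ^+ 2 by rewrite /G2 -rhoE; field; rewrite !gt_eqF.
  by apply: le => //; [posR|move: G10 G30; clear; lra].
- apply: le_trans (bnd3 m M A A1 A2 A3 u c K (rho / 16) _ _ _ _) _.
  + by apply: scheme_on_le hyp4 => //; exact: ltW.
  + by move: r2 rs30; clear; lra.
  + move=> y l hy; rewrite -R1E; apply: g1.
    by apply: bigcyl_le l16 hy; exact: ltW.
  + exact: g2.
  have -> : Q3 / (rho / 16) ^+ 3 = G3 / r ^+ 3 by rewrite /G3 -rhoE; field; rewrite !gt_eqF.
  by apply: le => //; [posR|move: G10 G20; clear; lra].
Qed.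

End InteriorEstimates.

Lemma powR_bound {R : realType} (q m M s : R) : 0 < m -> m <= s <= M ->
  s `^ q <= expR (`|q| * (`|ln m| + `|ln M|)).
Proof.
move=> m0 /andP[ms sM]; have s0 : 0 < s by apply: lt_le_trans ms.
have M0 : 0 < M by apply: lt_le_trans sM.
rewrite /powR gt_eqF// ler_expR; apply: le_trans (ler_norm _) _.
rewrite normrM ler_wpM2l//.
have h1 : ln m <= ln s by rewrite ler_ln ?posrE.
have h2 : ln s <= ln M by rewrite ler_ln ?posrE.
have := ler_norm (ln M); have := lerNnormlW (lexx `|ln m|).
rewrite ler_norml => h3 h4; apply/andP; split.
  by have := normr_ge0 (ln M); move: h1 h3; clear; lra.
by have := normr_ge0 (ln m); move: h2 h4; clear; lra.
Qed.

Lemma is_derive_scale {R : realType} (f : R -> R) (k d s : R) :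
  is_derive s 1 f d -> is_derive s 1 (fun t => k * f t) (k * d).
Proof. by move=> df; exact: is_deriveZ. Qed.

Lemma smooth_power {R : realType} (p theta m M : R) : 0 < m -> 0 < theta ->
  exists L A1 A2 A3, 0 < L /\ smooth_coeff m M L (fun s => theta * s `^ p) A1 A2 A3.
Proof.
move=> m0 th0.
pose E (q : R) := expR (`|q| * (`|ln m| + `|ln M|)) : R.
have E0 q : 0 < E q by rewrite expR_gt0.
have ps s : m <= s <= M -> 0 < s by move=> /andP[h _]; exact: lt_le_trans h.
have bd q s : m <= s <= M -> `|s `^ q| <= E q.
  by move=> hs; rewrite ger0_norm ?powR_ge0//; exact: powR_bound.
pose L := theta * (`|p| * E (p - 1)) + theta * (`|p| * (`|p - 1| * E (p - 1 - 1))) +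
  theta * (`|p| * (`|p - 1| * (`|p - 1 - 1| * E (p - 1 - 1 - 1)))).
pose L1 := theta * (`|p| * E (p - 1)).
pose L2 := theta * (`|p| * (`|p - 1| * E (p - 1 - 1))).
pose L3 := theta * (`|p| * (`|p - 1| * (`|p - 1 - 1| * E (p - 1 - 1 - 1)))).
have L10 : 0 <= L1 by rewrite !mulr_ge0 ?normr_ge0// ltW.
have L20 : 0 <= L2 by rewrite !mulr_ge0 ?normr_ge0// ltW.
have L30 : 0 <= L3 by rewrite !mulr_ge0 ?normr_ge0// ltW.
exists (1 + L1 + L2 + L3), (fun s => theta * (p * s `^ (p - 1))),
  (fun s => theta * (p * ((p - 1) * s `^ (p - 1 - 1)))),
  (fun s => theta * (p * ((p - 1) * ((p - 1 - 1) * s `^ (p - 1 - 1 - 1))))).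
have L0 : 0 < 1 + L1 + L2 + L3 by move: L10 L20 L30; clear; lra.
have nth : `|theta| = theta by rewrite ger0_norm// ltW.
split; first exact: L0.
split; first exact: L0.
- by move=> s hs; apply: is_derive_scale; apply: is_derive1_powR; exact: ps hs.
- by move=> s hs; do 2 apply: is_derive_scale; apply: is_derive1_powR; exact: ps hs.
- by move=> s hs; do 3 apply: is_derive_scale; apply: is_derive1_powR; exact: ps hs.
- move=> s hs; apply: (@le_trans _ _ L1); last by move: L20 L30; clear; lra.
  rewrite !normrM nth; apply: ler_wpM2l; first exact: ltW.
  by apply: ler_wpM2l; [exact: normr_ge0|exact: bd].
- move=> s hs; apply: (@le_trans _ _ L2); last by move: L10 L30; clear; lra.
  rewrite !normrM nth; apply: ler_wpM2l; first exact: ltW.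
  by do 2 (apply: ler_wpM2l; first exact: normr_ge0); exact: bd.
- move=> s hs; apply: (@le_trans _ _ L3); last by move: L10 L20; clear; lra.
  rewrite !normrM nth; apply: ler_wpM2l; first exact: ltW.
  by do 3 (apply: ler_wpM2l; first exact: normr_ge0); exact: bd.
Qed.

(** * The scheme on a mesh of size [h]: bounds uniform in [h] *)

Section Mesh.
Context {R : realType} {n : nat}.
Local Notation I := ('rV[int]_n).
Implicit Types (c : I).

Definition mesh (h : R) (x : I) : 'rV[R]_n := \row_i (h * (x 0 i)%:~R).

(* Time step [theta h^2]; the factors [h^2] cancel against the difference Laplacian. *)
Fixpoint scheme (p theta h : R) (u0 : 'rV[R]_n -> R) (k : nat) : I -> R :=
  if k is j.+1 then avgf (fun x => theta * scheme p theta h u0 j x `^ p) (scheme p theta h u0 j)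
  else fun x => u0 (mesh h x).

Record datum (p theta M : R) (u0 : 'rV[R]_n -> R) : Prop := Datum {
  _ : (0 < n)%N; _ : 1 <= p; _ : 0 < theta; _ : 8 * n%:R * p * theta * M `^ p <= 1; _ : 0 < M;
  _ : continuous u0; _ : forall v, 0 < u0 v <= M }.

Lemma lattice_sup_norm (X : R) : 0 <= X -> compact [set v : 'rV[R]_n | forall i, `|v 0 i| <= X].
Proof.
move=> X0; rewrite [X in compact X](_ : _ = [set v : 'rV[R]_n | forall i, `[- X, X]%classic (v ord0 i)]).
  by apply: (@rV_compact _ n (fun=> `[- X, X]%classic)) => i; exact: segment_compact.
apply/seteqP; split => v /= h i; first by rewrite in_itv /= -ler_norml; exact: h.
by have := h i; rewrite in_itv /= -ler_norml.
Qed.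

Lemma pos_on_cube (u0 : 'rV[R]_n -> R) (X : R) : 0 <= X -> continuous u0 -> (forall v, 0 < u0 v) ->
  exists2 m : R, 0 < m & forall v : 'rV[R]_n, (forall i, `|v 0 i| <= X) -> m <= u0 v.
Proof.
move=> X0 cu pu.
have [|c _ hc] := EVT_min_rV _ (lattice_sup_norm X X0) (continuous_subspaceT cu).
  by exists 0 => i /=; rewrite mxE normr0.
by exists (u0 c) => // v hv; apply: hc; rewrite inE.
Qed.

Lemma box0E (h X : R) (x : I) : 0 < h -> box 0 (X / h) x <-> forall i, `|mesh h x 0 i| <= X.
Proof.
move=> h0; split=> H i; have := H i;
  by rewrite /crd !mxE subr0 normrM (gtr0_norm h0) ler_pdivlMr// mulrC.
Qed.

(** [scheme_positive] in lattice units: the loss per step is [c h^2], the number of steps at most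
    [T / (theta h^2)], and the product [(1 - c h^2)^k >= expR (- (2 c T / theta))] no longer depends
    on [h]. *)
Lemma scheme_lower_bound (p theta M : R) (u0 : 'rV[R]_n -> R) (X T : R) : datum p theta M u0 -> 0 < X -> 0 <= T ->
  exists m h0 : R, [/\ 0 < m, 0 < h0 & forall (h : R) k (x : I), 0 < h -> h <= h0 ->
    box 0 (X / h) x -> theta * h ^+ 2 * k%:R <= T -> m <= scheme p theta h u0 k x].
Proof.
move=> [n0 p1 th0 cfl M0 cu uM] X0 T0.
have nR : 0 < n%:R :> R by rewrite ltr0n.
have up v : 0 < u0 v by case/andP: (uM v).
(* On the cube of half side [X] this leaves [rho^2 - |x|^2 >= rho^2 / 2]; the summand 1 gives
   [rho / h >= 1] for [h <= 1]. *)
pose rho2 := 2 * n%:R * X ^+ 2 + 1; pose rho := Num.sqrt rho2.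
have q2 : 0 < rho2 by posR.
have rho0 : 0 < rho by rewrite sqrtr_gt0.
have rhoE : rho ^+ 2 = rho2 by rewrite sqr_sqrtr// ltW.
have [m0 m00 hm0] := pos_on_cube u0 rho (ltW rho0) cu up.
have m0M : m0 <= M.
  apply: le_trans (hm0 0 _) _; first by move=> i; rewrite mxE normr0 ltW.
  by case/andP: (uM 0).
pose c := 2 * n%:R * theta * 2 `^ p * m0 `^ p / rho ^+ 2.
have c0 : 0 < c.
  have a0 : 0 < 2 `^ p :> R by rewrite powR_gt0.
  have a1 : 0 < m0 `^ p by rewrite powR_gt0.
  by posR.
have [h0 /andP[h00 h01] hh0] := small_square c (2^-1) (ltW c0) ltac:(posR).
pose m := m0 / 2 * expR (- (2 * (c * T / theta))).
exists m, h0; split=> //.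
  by rewrite mulr_gt0 ?expR_gt0// divr_gt0.
move=> h k x hp hh bx kT.
have rh1 : 1 <= rho / h.
  rewrite ler_pdivlMr// mul1r; apply: le_trans hh _; apply: le_trans h01 _.
  rewrite -[1]sqrtr1 ler_wsqrtr// /rho2 lerDr; apply: ltW; posR.
have h20 : 0 < h ^+ 2 by posR.
have kE : 2 * n%:R * theta * 2 `^ p * m0 `^ p / (rho / h) ^+ 2 = c * h ^+ 2.
  by rewrite /c; field; rewrite !gt_eqF.
have kap1 : c * h ^+ 2 <= 2^-1.
  by apply: le_trans hh0; apply: ler_wpM2l; [exact: ltW|apply: sqr_le => //; exact: ltW].
have uS k' (y : I) : scheme p theta h u0 k'.+1 y = avg (theta * scheme p theta h u0 k' y `^ p) (scheme p theta h u0 k') y by [].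
have uM0 (y : I) : 0 < scheme p theta h u0 0 y <= M by exact: uM.
have low := scheme_positive p theta M (scheme p theta h u0) p1 th0 cfl uS uM0 0 m0 (rho / h) (c * h ^+ 2) m00 rh1 m0M.
have base (y : I) : m0 / (rho / h) ^+ 2 * Num.max ((rho / h) ^+ 2 - sqd 0 y) 0 <= scheme p theta h u0 0 y.
  have [qy|qy] := leP ((rho / h) ^+ 2 - sqd 0 y) 0; first by rewrite mulr0 ltW//= up.
  apply: (@le_trans _ _ m0).
    rewrite mulrAC ler_pdivrMr; last by posR.
    by rewrite ler_wpM2l ?(ltW m00)// gerBl sqd_ge0.
  apply: hm0; apply/(box0E h rho y hp); apply: sqd_box; first by rewrite divr_ge0// ltW.
  by move: qy; clear; lra.
have := low (ltac:(by rewrite kE)) (ltac:(move: kap1; clear; lra)) base k x.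
apply: le_trans.
have sq : sqd 0 x <= n%:R * (X / h) ^+ 2.
  by apply: box_sqd => //; rewrite divr_ge0// ltW.
have h1 : (rho / h) ^+ 2 / 2 <= Num.max ((rho / h) ^+ 2 - sqd 0 x) 0.
  rewrite le_max; apply/orP; left.
  have h4 : (rho / h) ^+ 2 = 2 * (n%:R * (X / h) ^+ 2) + (h ^+ 2)^-1.
    by rewrite expr_div_n rhoE /rho2; field; rewrite gt_eqF.
  have : 0 < (h ^+ 2)^-1 by rewrite invr_gt0.
  by rewrite h4; move: sq; clear; lra.
have h2 : expR (- (2 * (c * T / theta))) <= (1 - c * h ^+ 2) ^+ k.
  have ch0 : 0 <= c * h ^+ 2 by apply: ltW; posR.
  apply: (@le_trans _ _ (expR (- (2 * (c * h ^+ 2))) ^+ k)).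
    rewrite -expRM_natr ler_expR.
    have -> : - (2 * (c * h ^+ 2)) * k%:R = - (2 * (c * (theta * h ^+ 2 * k%:R) / theta)).
      by field; rewrite gt_eqF.
    rewrite lerN2 ler_wpM2l// ler_wpM2r ?invr_ge0 ?(ltW th0)//.
    by rewrite ler_wpM2l// ltW.
  apply: lerXn2r; rewrite ?nnegrE ?expR_ge0//; first by move: kap1; clear; lra.
  exact: expRN2_le.
have mr : 0 < m0 / (rho / h) ^+ 2 by posR.
have -> : m = m0 / (rho / h) ^+ 2 * expR (- (2 * (c * T / theta))) * ((rho / h) ^+ 2 / 2).
  by rewrite /m; field; rewrite !gt_eqF.
apply: ler_pM => //.
- by rewrite mulr_ge0 ?expR_ge0// ltW.
- by apply: ltW; posR.
- by rewrite ler_wpM2l// ltW.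
Qed.

Lemma schemeS (p theta h : R) u0 k x : scheme p theta h u0 k.+1 x =
  avg (theta * scheme p theta h u0 k x `^ p) (scheme p theta h u0 k) x.
Proof. by []. Qed.

Lemma scheme_interior (p theta M : R) (u0 : 'rV[R]_n -> R) (X T0 T1 : R) :
  datum p theta M u0 -> 0 < X -> 0 < T0 -> T0 <= T1 ->
  exists C h0 : R, [/\ 0 < C, 0 < h0 & forall (h : R) k (x : I), 0 < h -> h <= h0 ->
    box 0 (X / h) x -> T0 <= theta * h ^+ 2 * k%:R <= T1 ->
    [/\ grad2 (scheme p theta h u0 k) x <= (C * h) ^+ 2,
        hess2 (scheme p theta h u0 k) x <= (C * h ^+ 2) ^+ 2 &
        third2 (scheme p theta h u0 k) x <= (C * h ^+ 3) ^+ 2]].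
Proof.
move=> dat X0 T00 T01; case: (dat) => n0 p1 th0 cfl M0 cu uM.
have X20 : 0 < X + 2 by posR.
have [m [h1 [m0 h10 low]]] := scheme_lower_bound _ _ _ _ (X + 2) T1 dat X20 (le_trans (ltW T00) T01).
have [L [A1 [A2 [A3 [L0 smc]]]]] := smooth_power p theta m M m0 th0.
have mp : 0 < m `^ p by rewrite powR_gt0.
pose a0 := theta * m `^ p.
have a00 : 0 < a0 by posR.
have [w [Q [rs [w0 Q0 rs1 est]]]] := interior_estimates a0 L M n0 a00 L0.
have rs0 : 0 < rs by apply: lt_le_trans rs1.
pose c := 2 * theta / T0 + 4 * M * theta / (T0 * w).
have c1 : 0 < 2 * theta / T0 by posR.
have c2 : 0 < 4 * M * theta / (T0 * w) by posR.
have [rho /andP[rho0 rho1] hrho] := small_square c 1 (ltW (addr_gt0 c1 c2)) ltr01.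
have rho2 : 0 < rho ^+ 2 by posR.
have hr1 : 2 * theta * rho ^+ 2 <= T0.
  have : 2 * theta / T0 * rho ^+ 2 <= 1.
    by apply: le_trans hrho; rewrite ler_wpM2r ?(ltW rho2)// lerDl ltW.
  by rewrite mulrAC ler_pdivrMr// mul1r.
have hr2 : 4 * M * theta * rho ^+ 2 <= T0 * w.
  have : 4 * M * theta / (T0 * w) * rho ^+ 2 <= 1.
    by apply: le_trans hrho; rewrite ler_wpM2r ?(ltW rho2)// lerDr ltW.
  by rewrite mulrAC ler_pdivrMr ?mul1r//; posR.
have [e /andP[e0 e1] he] := small_square (2 * theta / T0) 1 (ltW c1) ltr01.
have he' : 2 * theta * e ^+ 2 <= T0 by move: he; rewrite mulrAC ler_pdivrMr// mul1r.
pose G1 := Q / rho; pose G2 := Q / rho ^+ 2; pose G3 := Q / rho ^+ 3.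
have G10 : 0 < G1 by posR.
have G20 : 0 < G2 by posR.
have G30 : 0 < G3 by posR.
exists (G1 + G2 + G3), (Num.min h1 (Num.min (rho / rs) e)); split.
- by rewrite !addr_gt0.
- by rewrite !lt_min h10 e0 divr_gt0.
move=> h K x h0; rewrite !le_min => /and3P[hh1 hhr hhe] bx /andP[K0 K1].
have h20 : 0 < h ^+ 2 by posR.
have hK2 : 2 <= K%:R :> R.
  have : theta * h ^+ 2 * 2 <= theta * h ^+ 2 * K%:R.
    apply: le_trans K0; apply: le_trans he'.
    have := ler_wpM2l (ltW th0) (sqr_le _ _ (ltW h0) hhe); clear; lra.
  by rewrite ler_pM2l//; posR.
have K2 : (2 <= K)%N by rewrite -(ler_nat R).
(* Benilan-Crandall is used from half the elapsed time on: there [C1 = M / k0] is of order [h^2], so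
   with [r = rho / h] the product [C1 r^2] is of order [rho^2], below [w] by the choice of [rho]. *)
pose k0 := K./2.
have k0K : K%:R / 4 <= k0%:R :> R.
  have : (K <= 4 * k0)%N by rewrite /k0; move: K2; clear; lia.
  by rewrite -(ler_nat R) natrM; clear; lra.
have k0K' : k0%:R <= K%:R / 2 :> R.
  have : (2 * k0 <= K)%N by rewrite /k0; clear; lia.
  by rewrite -(ler_nat R) natrM; clear; lra.
have k00 : 0 < k0%:R :> R by move: k0K hK2; clear; lra.
pose r := rho / h; have r0 : 0 < r by posR.
have r2E : r ^+ 2 * h ^+ 2 = rho ^+ 2 by rewrite /r -exprMn divfK// gt_eqF.
have rK2 : r ^+ 2 <= K%:R / 2.
  have th2 : 0 < 2 * theta * h ^+ 2 by posR.
  rewrite -(ler_pM2l th2); move: hr1 K0 r2E; clear => h1 h2 E.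
  have -> : 2 * theta * h ^+ 2 * r ^+ 2 = 2 * theta * (r ^+ 2 * h ^+ 2) by ring.
  by rewrite E; lra.
pose u := scheme p theta h u0.
have uS k y : u k.+1 y = avg (theta * u k y `^ p) (u k) y by [].
have u0M (y : I) : 0 < u 0 y <= M by exact: uM.
have bnds := scheme_bounds p theta M u p1 th0 cfl uS u0M.
have cour := scheme_courant p theta M u p1 th0 cfl uS u0M.
have bc := scheme_BC_abs p theta M u p1 th0 cfl uS u0M.
have son : scheme_on a0 L m M (fun s => theta * s `^ p) A1 A2 A3 u x K r.
  split => //.
  - move=> s /andP[ms _]; rewrite /a0 ler_wpM2l ?(ltW th0)//; apply: powR_mono => //; last exact: ltW.
    by apply: le_trans p1.
  - move=> y k [b1 _ kK]; apply/andP; split; last by case/andP: (bnds k y).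
    apply: low => //.
      have -> : (X + 2) / h = X / h + 2 / h by rewrite mulrDl.
      apply: box_trile bx b1; rewrite /r lerD2l mulrA ler_wpM2r ?invr_ge0 ?(ltW h0)//.
      by move: rho1; clear; lra.
    apply: le_trans K1; rewrite ler_wpM2l//; last by rewrite ler_nat.
    by apply: ltW; posR.
  - by apply: le_trans rK2 _; move: hK2; clear; lra.
have C1r : M / k0%:R * r ^+ 2 <= w.
  rewrite mulrAC ler_pdivrMr//.
  apply: (@le_trans _ _ (w * (K%:R / 4))); last by rewrite ler_wpM2l// ltW.
  have th2 : 0 < 4 * theta * h ^+ 2 by posR.
  rewrite -(ler_pM2l th2).
  have -> : 4 * theta * h ^+ 2 * (M * r ^+ 2) = 4 * M * theta * (r ^+ 2 * h ^+ 2) by ring.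
  rewrite r2E; apply: le_trans hr2 _.
  have := ler_wpM2r (ltW w0) K0; clear; lra.
have rsr : rs <= r by rewrite /r ler_pdivlMr// mulrC -ler_pdivlMr.
have BC k y : (k0 <= k)%N -> u k y - M / k0%:R <= u k.+1 y.
  move=> kk; have kp0 : (0 < k0)%N by rewrite -(ltr_nat R).
  have kp : (0 < k)%N by apply: leq_trans kk.
  apply: le_trans (bc k y kp); rewrite lerB// ler_wpM2l ?(ltW M0)//.
  by rewrite lef_pV2 ?ler_nat// posrE ltr0n.
have [] := est m M (fun s => theta * s `^ p) A1 A2 A3 u x K k0 r (M / k0%:R) son _ rsr _ _ C1r BC.
- by rewrite gerBl ltW.
- by move: rK2 k0K'; clear; lra.
- by rewrite divr_ge0 ?(ltW M0)// ltW.
have cmp (G E H : R) : 0 <= G -> 0 <= E -> G <= G1 + G2 + G3 -> H <= (G * E) ^+ 2 -> H <= ((G1 + G2 + G3) * E) ^+ 2.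
  move=> G0 E0 GG; move/le_trans; apply; apply: sqr_le; first exact: mulr_ge0.
  exact: ler_wpM2r.
move=> e1' e2' e3'; split.
- apply: (cmp G1); [exact: ltW|exact: ltW|by move: G20 G30; clear; lra|].
  by have -> : G1 * h = Q / r by rewrite /G1 /r; field; rewrite !gt_eqF.
- apply: (cmp G2); [exact: ltW|exact: ltW|by move: G10 G30; clear; lra|].
  by have -> : G2 * h ^+ 2 = Q / r ^+ 2 by rewrite /G2 /r; field; rewrite !gt_eqF.
- apply: (cmp G3); [exact: ltW|by apply: ltW; posR|by move: G10 G20; clear; lra|].
  by have -> : G3 * h ^+ 3 = Q / r ^+ 3 by rewrite /G3 /r; field; rewrite !gt_eqF.
Qed.

End Mesh.

(** * Limits along vanishing mesh size *)

Section GridLimits.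
Context {R : realType} {n : nat}.
Local Notation I := ('rV[int]_n).
Local Notation V := ('rV[R]_n).
Implicit Types (F : set_system R) (f : R -> nat -> I -> R) (a t : R) (x : V) (Y Z : I) (i j : 'I_n).

Definition near_pt (theta d : R) x (t h : R) (l : nat) Y :=
  `|theta * h ^+ 2 * l%:R - t| <= d /\ forall i, `|mesh h Y 0 i - x 0 i| <= d.

(* Values of a family of grid functions at all space-time grid points close to
   [(x, t)], as the mesh size tends to 0 along [F]. *)
Definition gridfilter F (theta : R) x (t : R) : set_system (R * nat * I) :=
  [set S | exists2 d : R, 0 < d &
     F [set h | forall l Y, near_pt theta d x t h l Y -> S (h, l, Y)]].

Definition unc f : R * nat * I -> R := fun z => f z.1.1 z.1.2 z.2.

Lemma gridfilter_filter F theta x t : ProperFilter F -> Filter (gridfilter F theta x t).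
Proof.
move=> FF; split.
- by exists 1 => //; apply: filterE.
- move=> P Q [d d0 hP] [e e0 hQ]; exists (Num.min d e); first by rewrite lt_min d0.
  apply: filterS2 hP hQ => h hP hQ l Y [h1 h2]; split.
    apply: hP; split=> [|i]; first by apply: le_trans h1 _; rewrite ge_min lexx.
    by apply: le_trans (h2 i) _; rewrite ge_min lexx.
  apply: hQ; split=> [|i]; first by apply: le_trans h1 _; rewrite ge_min lexx orbT.
  by apply: le_trans (h2 i) _; rewrite ge_min lexx orbT.
- move=> P Q PQ [d d0 hP]; exists d => //.
  by apply: filterS hP => h hP l Y hY; apply: PQ; exact: hP.
Qed.

Definition flo (h : R) x : I := \row_i Num.floor (x 0 i / h).
Definition tidx (theta h t : R) : nat := Num.truncn (t / (theta * h ^+ 2)).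

Lemma flo_near (h : R) x i : 0 < h -> `|mesh h (flo h x) 0 i - x 0 i| <= h.
Proof.
move=> h0; rewrite !mxE; have := floor_itv (x 0 i / h).
rewrite ler_pdivlMr// intrD ltr_pdivrMr// => /andP[a b].
by rewrite ler_norml; apply/andP; split; move: a b; rewrite mulrDl; clear; lra.
Qed.

Lemma tidx_near (theta h t : R) : 0 < theta -> 0 < h -> 0 <= t ->
  theta * h ^+ 2 * (tidx theta h t)%:R <= t < theta * h ^+ 2 * (tidx theta h t)%:R + theta * h ^+ 2.
Proof.
move=> th0 h0 t0; have q : 0 < theta * h ^+ 2 by posR.
have := truncn_itv (divr_ge0 t0 (ltW q)); rewrite -/(tidx theta h t).
rewrite ler_pdivlMr// ltr_pdivrMr// -(natr1 (tidx _ _ _)) => /andP[a b].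
by apply/andP; split; move: a b; rewrite ?mulrDl; clear; lra.
Qed.

Lemma near_pt_idx (theta d h t : R) x : 0 < theta -> 0 < h -> 0 <= t -> h <= d -> theta * h ^+ 2 <= d ->
  near_pt theta d x t h (tidx theta h t) (flo h x).
Proof.
move=> th0 h0 t0 hd thd; split=> [|i]; last by apply: le_trans (flo_near _ _ _ h0) hd.
have /andP[a b] := tidx_near _ _ _ th0 h0 t0.
by rewrite ler_norml; apply/andP; split; move: a b thd h0 hd; clear; lra.
Qed.

Lemma small_mesh F (theta d : R) : ProperFilter F -> 0^'+ `<=` F -> 0 < theta -> 0 < d ->
  F [set h | 0 < h /\ h <= d /\ theta * h ^+ 2 <= d].
Proof.
move=> FF F0 th0 d0.
have [e /andP[e0 e1] he] := small_square theta d (ltW th0) d0.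
have h1 : F [set h | 0 < h] by apply: F0; exact: nbhs_right_gt.
have h2 : F [set h | h <= Num.min e d].
  by apply: F0; apply: nbhs_right_le; rewrite lt_min e0.
apply: filterS2 h1 h2 => h hp; rewrite /= le_min => /andP[he' hd']; do 2 split => //.
by apply: le_trans he; rewrite ler_wpM2l ?(ltW th0)//; apply: sqr_le => //; exact: ltW.
Qed.

Lemma gridfilter_proper F theta x t : ProperFilter F -> 0^'+ `<=` F -> 0 < theta -> 0 <= t ->
  ProperFilter (gridfilter F theta x t).
Proof.
move=> FF F0 th0 t0; apply: Build_ProperFilter; last exact: gridfilter_filter.
move=> [d d0 hd]; apply: (@filter_not_empty _ F).
apply: filterS2 hd (small_mesh F theta d FF F0 th0 d0) => h H [hp [h1 h2]].
by apply: (H (tidx theta h t) (flo h x)); exact: near_pt_idx.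
Qed.

Lemma sample_grid F theta x t (l : R -> nat) (Y : R -> I) : ProperFilter F ->
  (forall d : R, 0 < d -> F [set h | near_pt theta d x t h (l h) (Y h)]) ->
  forall S, gridfilter F theta x t S -> F [set h | S (h, l h, Y h)].
Proof.
move=> FF H S [d d0 hS].
by apply: filterS2 (H d d0) hS => h h1 h2; exact: h2.
Qed.

Lemma sample_limit F theta x t (l : R -> nat) (Y : R -> I) f a : ProperFilter F ->
  (forall d : R, 0 < d -> F [set h | near_pt theta d x t h (l h) (Y h)]) ->
  unc f @ gridfilter F theta x t --> a -> (fun h => f h (l h) (Y h)) @ F --> a.
Proof. by move=> FF H fa; move=> S /fa; exact: (sample_grid _ _ _ _ _ _ FF H). Qed.

(** Compactness of a segment in its ultrafilter form. It replaces the extraction of subsequences,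
    and one [F] works for all points and all difference quotients. *)
Lemma bounded_ultra_cvg F (s : R -> R) (C : R) : UltraFilter F -> F [set h | `|s h| <= C] ->
  exists a : R, s @ F --> a.
Proof.
move=> FU FC.
have cpt := @segment_compact R (- C) C; rewrite compact_ultra in cpt.
have FsU : UltraFilter (s @ F).
  split; first exact: fmap_proper_filter.
  move=> H HH sub; apply/seteqP; split; last exact: sub.
  move=> A HA; case: (in_ultra_setVsetC (s @^-1` A) FU) => // nA.
  have HnA : H (~` A) by apply: sub.
  by exfalso; apply: (@filter_not_empty _ H); rewrite -(setICr A); exact: filterI.
have [|a [_ ha]] := cpt _ FsU.
  rewrite /fmap /=; apply: filterS FC => h Ch.
  by rewrite /preimage /= in_itv /= -ler_norml; exact: Ch.
by exists a.
Qed.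

Lemma grid_limP F theta x t f a : ProperFilter F ->
  unc f @ gridfilter F theta x t --> a <->
  forall eta : R, 0 < eta -> exists2 d : R, 0 < d &
    F [set h | forall l Y, near_pt theta d x t h l Y -> `|a - f h l Y| <= eta].
Proof.
move=> FF; have GF := gridfilter_filter F theta x t FF.
split=> [/cvgrPdist_le H eta eta0|H].
  by have [d d0 h] := H _ eta0; exists d.
apply/cvgrPdist_le => eta eta0; have [d d0 h] := H _ eta0; by exists d.
Qed.

Definition cube (X : R) x := forall i, `|x 0 i| <= X.

Lemma meshDu (h : R) Y i j : mesh h (Y + unitv j) 0 i = mesh h Y 0 i + h * (i == j)%:R.
Proof. by rewrite !mxE intrD mulrDr eqxx /= ; case: (i == j). Qed.

Lemma cube_near (X d : R) x (h : R) Y : cube X x -> (forall i, `|mesh h Y 0 i - x 0 i| <= d) ->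
  cube (X + d) (mesh h Y).
Proof.
move=> hx hd i; have -> : mesh h Y 0 i = x 0 i + (mesh h Y 0 i - x 0 i) by ring.
by apply: le_trans (ler_normD _ _) _; exact: lerD.
Qed.

Lemma cube_exists x : exists2 X : R, 0 < X & cube X x.
Proof.
exists (1 + \sum_i `|x 0 i|); first by rewrite ltr_wpDr// sumr_ge0.
move=> i; rewrite (bigD1 i)//= addrCA lerDl addr_ge0// sumr_ge0//.
Qed.

Lemma space_lip (h X X' s D : R) (g : I -> R) Y Z : 0 < h -> 0 <= D ->
  (forall z j, cube X (mesh h z) -> `|diffu j g z| <= D * h) -> cube X' (mesh h Y) -> X' + s <= X ->
  (forall i, `|mesh h Z 0 i - mesh h Y 0 i| <= s) -> `|g Z - g Y| <= n%:R * D * s.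
Proof.
move=> h0 D0 hg hY Xs hZ.
have boxE z : box Y (s / h) z <-> forall i, `|mesh h z 0 i - mesh h Y 0 i| <= s.
  split=> H i; have := H i; rewrite /crd !mxE intrB -mulrBr normrM (gtr0_norm h0).
    by rewrite ler_pdivlMr// mulrC.
  by rewrite ler_pdivlMr// mulrC.
have hZ' : box Y (s / h) Z by apply/boxE.
apply: le_trans (lattice_path_box g (D * h) (s / h) Y _ Z hZ') _.
  move=> z j /boxE hz _; apply: hg => i; apply: le_trans Xs.
  exact: (cube_near _ _ _ _ _ hY hz).
apply: le_trans (ler_wpM2l (mulr_ge0 D0 (ltW h0)) (sum_crd_le Y Z (s / h) hZ')) _.
by rewrite le_eqVlt; apply/orP; left; apply/eqP; field; rewrite gt_eqF.
Qed.

(* Local bounds on [f] and its difference quotients, and local equicontinuity in time, both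
   uniform in the mesh size [h] and away from the initial time. *)
Definition famB (theta : R) f := forall X T0 T1 : R, 0 < X -> 0 < T0 -> T0 <= T1 ->
  exists C h0 : R, [/\ 0 < C, 0 < h0 & forall h k Y, 0 < h -> h <= h0 -> cube X (mesh h Y) ->
    T0 <= theta * h ^+ 2 * k%:R <= T1 -> `|f h k Y| <= C /\ forall j, `|diffu j (f h k) Y| <= C * h].

Definition famT (theta : R) f := forall X T0 T1 eta : R, 0 < X -> 0 < T0 -> T0 <= T1 -> 0 < eta ->
  exists d h0 : R, [/\ 0 < d, 0 < h0 & forall h k l Y, 0 < h -> h <= h0 -> cube X (mesh h Y) ->
    T0 <= theta * h ^+ 2 * k%:R <= T1 -> T0 <= theta * h ^+ 2 * l%:R <= T1 ->
    `|theta * h ^+ 2 * k%:R - theta * h ^+ 2 * l%:R| <= d -> `|f h k Y - f h l Y| <= eta].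

(** The limit is first taken along one chosen grid point per mesh size; equicontinuity in time and
    the Lipschitz bound in space then extend the convergence to all grid points near [(x, t)]. *)
Lemma fam_cvg F (theta : R) f x t : UltraFilter F -> 0^'+ `<=` F -> 0 < theta -> 0 < t ->
  famB theta f -> famT theta f -> exists a : R, unc f @ gridfilter F theta x t --> a.
Proof.
move=> FU F0 th0 t0 fB fT; have FF : ProperFilter F by exact: ultra_proper.
have [X X0 hX] := cube_exists x.
have X20 : 0 < X + 4 by posR.
have t20 : 0 < t / 2 by posR.
have t22 : t / 2 <= 2 * t by move: t0; clear; lra.
have [C [h0 [C0 h00 hC]]] := fB (X + 4) (t / 2) (2 * t) X20 t20 t22.
have tin (d h : R) l : d <= t / 2 -> `|theta * h ^+ 2 * l%:R - t| <= d -> t / 2 <= theta * h ^+ 2 * l%:R <= 2 * t.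
  move=> dt; rewrite ler_norml => /andP[a b]; apply/andP; split; move: a b dt t0; clear; lra.
have sm (d : R) : 0 < d -> F [set h | 0 < h /\ near_pt theta d x t h (tidx theta h t) (flo h x)].
  move=> d0; apply: filterS (small_mesh F theta d FF F0 th0 d0) => h [hp [h1 h2]].
  by split=> //; apply: near_pt_idx => //; exact: ltW.
pose s h := f h (tidx theta h t) (flo h x).
pose d1 := Num.min (Num.min h0 1) (t / 2).
have d10 : 0 < d1 by rewrite !lt_min h00 ltr01.
have [a ha] : exists a : R, s @ F --> a.
  apply: (bounded_ultra_cvg F s C FU).
  apply: filterS2 (sm d1 d10) (small_mesh F theta d1 FF F0 th0 d10) => h [hp [h1 h2]] [_ [h3 _]].
  move: h3; rewrite !le_min => /andP[/andP[hh0 hh1] _].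
  apply: (proj1 (hC h _ _ hp hh0 _ _)).
    move=> i; apply: le_trans (cube_near _ _ _ _ _ hX h2 i) _.
    rewrite lerD2l; apply: (@le_trans _ _ 1); last by clear; lra.
    by rewrite !ge_min lexx orbT.
  by apply: tin h1; rewrite ge_min lexx orbT.
exists a; apply/grid_limP => eta eta0.
have eta3 : 0 < eta / 3 by posR.
have [d2 [h2 [d20 h20 hT]]] := fT (X + 4) (t / 2) (2 * t) (eta / 3) X20 t20 t22 eta3.
have nC : 0 < 6 * (n%:R * C + 1) by apply: mulr_gt0 => //; rewrite ltr_wpDl// mulr_ge0// ltW.
pose d := Num.min (Num.min d1 (d2 / 2)) (Num.min h2 (eta / (6 * (n%:R * C + 1)))).
have d0 : 0 < d by posR.
have : d <= d by []. 
rewrite {2}/d !le_min => /andP[/andP[/andP[/andP[dh0 d11] d1t] dd2] /andP[dh2 de]].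
exists d => //.
have /cvgrPdist_le/(_ _ eta3) ha' := ha.
apply: filterS3 (sm d d0) (small_mesh F theta d FF F0 th0 d0) ha' => h [hp [n1 n2]] [_ [hd _]] as_ l Y [m1 m2].
have hh0 : h <= h0 by exact: le_trans hd dh0.
have hh2 : h <= h2 by exact: le_trans dh2.
have i1 := tin _ _ _ d1t n1; have i2 := tin _ _ _ d1t m1.
have cY : cube (X + d) (mesh h (flo h x)) by exact: cube_near hX n2.
have cY2 : cube (X + 4) (mesh h (flo h x)).
  by move=> i; apply: le_trans (cY i) _; rewrite lerD2l; move: d11; clear; lra.
have e1 : `|f h (tidx theta h t) (flo h x) - f h l (flo h x)| <= eta / 3.
  apply: hT => //; have -> : theta * h ^+ 2 * (tidx theta h t)%:R - theta * h ^+ 2 * l%:R =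
    (theta * h ^+ 2 * (tidx theta h t)%:R - t) - (theta * h ^+ 2 * l%:R - t) by ring.
  apply: le_trans (ler_normB _ _) _; apply: le_trans (lerD n1 m1) _.
  by move: dd2; clear; lra.
have e2 : `|f h l Y - f h l (flo h x)| <= eta / 3.
  have Xd : X + d + 2 * d <= X + 4 by move: d11; clear; lra.
  have step z j : cube (X + 4) (mesh h z) -> `|diffu j (f h l) z| <= C * h.
    by move=> hz; have [_] := hC h l z hp hh0 hz i2; exact.
  have dist i : `|mesh h Y 0 i - mesh h (flo h x) 0 i| <= 2 * d.
    have -> : mesh h Y 0 i - mesh h (flo h x) 0 i = (mesh h Y 0 i - x 0 i) - (mesh h (flo h x) 0 i - x 0 i) by ring.
    apply: le_trans (ler_normB _ _) _; apply: le_trans (lerD (m2 i) (n2 i)) _.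
    by clear; lra.
  apply: le_trans (space_lip h (X + 4) (X + d) (2 * d) C _ _ _ hp (ltW C0) step cY Xd dist) _.
  move: de; rewrite ler_pdivlMr// => de.
  have : 0 <= d by exact: ltW.
  by move: de; clear; lra.
have -> : a - f h l Y = (a - s h) + (f h (tidx theta h t) (flo h x) - f h l (flo h x)) - (f h l Y - f h l (flo h x)).
  by rewrite /s; ring.
apply: le_trans (ler_normB _ _) _; apply: le_trans (lerD (ler_normD _ _) e2) _.
by move: (lerD as_ e1); clear; lra.
Qed.

Lemma increment_path (N : nat) (g : nat -> R) (c e : R) :
  (forall j : nat, (j < N)%N -> `|g j.+1 - g j - c| <= e) -> `|g N - g 0%N - N%:R * c| <= N%:R * e.
Proof.
elim: N => [|N IH] h; first by rewrite !mul0r subrr subr0 normr0.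
have h1 := h N (ltnSn N); have h2 := IH (fun (j : nat) jN => h j (ltnW jN)).
have -> : g N.+1 - g 0%N - N.+1%:R * c = (g N - g 0%N - N%:R * c) + (g N.+1 - g N - c).
  by rewrite -(natr1 N); ring.
by apply: le_trans (ler_normD _ _) _; rewrite -(natr1 N) mulrDl mul1r; exact: lerD.
Qed.

Lemma meshDn (h : R) Y i j (N : nat) : mesh h (Y + unitv j *+ N) 0 i = mesh h Y 0 i + N%:R * h * (i == j)%:R.
Proof.
elim: N => [|N IH]; first by rewrite mulr0n addr0 !mul0r addr0.
by rewrite mulrSr addrA meshDu IH -(natr1 N); ring.
Qed.

Definition Dq i f : R -> nat -> I -> R := fun h k Y => diffu i (f h k) Y / h.

Lemma Dq_increment (h : R) f k Y i (N : nat) (c e : R) : 0 < h ->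
  (forall j : nat, (j < N)%N -> `|c - Dq i f h k (Y + unitv i *+ j)| <= e) ->
  `|f h k (Y + unitv i *+ N) - f h k Y - N%:R * h * c| <= N%:R * h * e.
Proof.
move=> h0 H; have := increment_path N (fun j : nat => f h k (Y + unitv i *+ j)) (h * c) (h * e).
rewrite mulr0n addr0 !mulrA; apply => j jN.
have -> : f h k (Y + unitv i *+ j.+1) - f h k (Y + unitv i *+ j) - h * c =
    - (h * (c - Dq i f h k (Y + unitv i *+ j))).
  by rewrite /Dq /diffu mulrSr addrA; field; rewrite gt_eqF.
by rewrite normrN normrM gtr0_norm// ler_pM2l//; exact: H.
Qed.

(** Interpolation between space and time: up to its own Lipschitz error, a difference quotient is
    the increment of [f] over a macroscopic length [N h] between [sg] and [2 sg], divided by that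
    length. The time modulus of [f] for the tolerance [eta sg / 4] then suffices. *)
Lemma famT_Dq theta f i : famB theta (Dq i f) -> famT theta f -> famT theta (Dq i f).
Proof.
move=> fB fT X T0 T1 eta X0 T00 T01 eta0.
have X20 : 0 < X + 2 by posR.
have [C [h0 [C0 h00 hC]]] := fB (X + 2) T0 T1 X20 T00 T01.
have nC : 0 < 8 * (n%:R * C + 1) by apply: mulr_gt0 => //; rewrite ltr_wpDl// mulr_ge0// ltW.
pose sg := Num.min (2^-1) (eta / (8 * (n%:R * C + 1))).
have sg0 : 0 < sg by rewrite lt_min divr_gt0// invr_gt0 ltr0n.
have sg1 : sg <= 2^-1 by rewrite ge_min lexx.
have sge : 8 * (n%:R * C + 1) * sg <= eta.
  by rewrite mulrC -ler_pdivlMr// ge_min lexx orbT.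
have e'0 : 0 < eta * sg / 4 by posR.
have [d [h1 [d0 h10 hT]]] := fT (X + 2) T0 T1 (eta * sg / 4) X20 T00 T01 e'0.
exists d, (Num.min (Num.min h0 h1) sg); split=> //; first by posR.
move=> h k l Y hp; rewrite (le_min _ _ sg) => /andP[+ hs]; rewrite le_min => /andP[hh0 hh1] cY kt lt kl.
pose N := (Num.truncn (sg / h)).+1.
have q0 : 0 <= sg / h by apply: ltW; posR.
have /andP[t1 t2] := truncn_itv q0.
have Nh1 : sg <= N%:R * h by rewrite -ler_pdivrMr// ltW.
have Nh2 : N%:R * h <= 2 * sg.
  rewrite /N -natr1 mulrDl mul1r; move: t1; rewrite ler_pdivlMr//; move: hs; clear; lra.
have cY2 : cube (X + 2) (mesh h Y) by move=> j; apply: le_trans (cY j) _; clear; lra.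
have Nh0 : 0 < N%:R * h by apply: lt_le_trans Nh1.
have shN (j : nat) : (j <= N)%N -> forall i', `|mesh h (Y + unitv i *+ j) 0 i' - mesh h Y 0 i'| <= 2 * sg.
  move=> jN i'; rewrite meshDn addrAC subrr add0r ger0_norm; last by rewrite !mulr_ge0// ltW.
  apply: le_trans Nh2; have jn : j%:R <= N%:R :> R by rewrite ler_nat.
  have := ler_wpM2r (ltW hp) jn; case: (i' == i); rewrite ?mulr1// mulr0 => _; exact: ltW.
have Xs : X + 2 * sg <= X + 2 by move: sg1; clear; lra.
have inc q : T0 <= theta * h ^+ 2 * q%:R <= T1 ->
    `|f h q (Y + unitv i *+ N) - f h q Y - N%:R * h * Dq i f h q Y| <= N%:R * h * (n%:R * C * (2 * sg)).
  move=> qt; apply: Dq_increment => // j jN; rewrite distrC.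
  apply: (space_lip h (X + 2) X (2 * sg) C _ _ _ hp (ltW C0)) => //; last exact: shN (ltnW jN).
  by move=> z j' hz; have [_] := hC h q z hp hh0 hz qt; exact.
have cYN : cube (X + 2) (mesh h (Y + unitv i *+ N)).
  move=> j; apply: le_trans Xs; apply: cube_near cY _ j; exact: shN.
have A1 := inc k kt; have A2 := inc l lt.
have B1 := hT h k l Y hp hh1 cY2 kt lt kl; have B2 := hT h k l _ hp hh1 cYN kt lt kl.
rewrite -(ler_pM2l Nh0) -{1}(gtr0_norm Nh0) -normrM.
have -> : N%:R * h * (Dq i f h k Y - Dq i f h l Y) =
    (f h l (Y + unitv i *+ N) - f h l Y - N%:R * h * Dq i f h l Y) -
    (f h k (Y + unitv i *+ N) - f h k Y - N%:R * h * Dq i f h k Y) +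
    (f h k (Y + unitv i *+ N) - f h l (Y + unitv i *+ N)) - (f h k Y - f h l Y) by ring.
apply: le_trans (ler_normB _ _) _; apply: le_trans (lerD (ler_normD _ _) B1) _.
apply: le_trans (lerD (lerD (ler_normB _ _) B2) (lexx _)) _.
have i1 := ler_wpM2l (ltW Nh0) sge.
have i2 := ler_wpM2r (ltW eta0) Nh1.
have i3 := mulr_gt0 Nh0 sg0.
by move: A1 A2 i1 i2 i3; clear; lra.
Qed.

(** Grid points close to [(x', t')] are also close to [(x, t)], so a limit over all nearby grid
    points is continuous in its base point. *)
Lemma grid_continuous F theta f x t a : ProperFilter F -> 0^'+ `<=` F -> 0 < theta ->
  unc f @ gridfilter F theta x t --> a ->
  forall eta : R, 0 < eta -> exists2 d : R, 0 < d & forall x' t' (b : R), 0 <= t' ->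
    (forall i, `|x' 0 i - x 0 i| <= d) -> `|t' - t| <= d ->
    unc f @ gridfilter F theta x' t' --> b -> `|b - a| <= eta.
Proof.
move=> FF F0 th0 /(grid_limP _ _ _ _ _ _ FF) H eta eta0; have [d d0 hd] := H eta eta0.
exists (d / 2); first by posR.
move=> x' t' b t'0 hx ht fb.
have GF := gridfilter_proper F theta x' t' FF F0 th0 t'0.
have nb : `|a - unc f z| @[z --> gridfilter F theta x' t'] --> `|a - b|.
  by apply: cvg_norm; apply: cvgB => //; exact: cvg_cst.
rewrite distrC; apply: (cvgr_to_le nb); exists (d / 2); first by posR.
apply: filterS hd => h hd l Y [h1 h2]; apply: hd; split=> [|i].
  have -> : theta * h ^+ 2 * l%:R - t = (theta * h ^+ 2 * l%:R - t') + (t' - t) by ring.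
  by apply: le_trans (ler_normD _ _) _; move: (lerD h1 ht); clear; lra.
have -> : mesh h Y 0 i - x 0 i = (mesh h Y 0 i - x' 0 i) + (x' 0 i - x 0 i) by ring.
by apply: le_trans (ler_normD _ _) _; move: (lerD (h2 i) (hx i)); clear; lra.
Qed.

Lemma truncn_mesh_cvg F (r c : R) : ProperFilter F -> 0^'+ `<=` F -> 0 <= r -> 0 < c ->
  forall k : nat, (0 < k)%N -> (fun h => (Num.truncn (r / (c * h ^+ k)))%:R * (c * h ^+ k)) @ F --> r.
Proof.
move=> FF F0 r0 c0 k k0; apply/cvgrPdist_le => e e0.
have [e1 /andP[e10 e11] he] := small_square c e (ltW c0) e0.
have e2 : 0 < Num.min 1 (e / c) by rewrite lt_min ltr01 divr_gt0.
have h1 : F [set h | 0 < h] by apply: F0; exact: nbhs_right_gt.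
have h2 : F [set h | h <= Num.min 1 (e / c)] by apply: F0; exact: nbhs_right_le.
apply: filterS2 h1 h2 => h hp; rewrite /= le_min => /andP[hh1 hhe].
have ch : 0 < c * h ^+ k by posR.
have cle : c * h ^+ k <= e.
  have : h ^+ k <= h by rewrite -{2}[h]expr1; apply: ler_wiXn2l => //; exact: ltW.
  move/(ler_wpM2l (ltW c0)) => /le_trans; apply; rewrite mulrC -ler_pdivlMr//.
have := truncn_itv (divr_ge0 r0 (ltW ch)); rewrite ler_pdivlMr// ltr_pdivrMr// => /andP[a b].
rewrite ger0_norm; first by move: b cle; rewrite -natr1 mulrDl mul1r; clear; lra.
by rewrite subr_ge0.
Qed.

(** The increment of the limit is the limit of sums of [N h] quotients times the step, all of them
    close to [g]. Both endpoints vary because the derivative is needed from either side. *)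
Lemma space_increment F theta f x t i g : ProperFilter F -> 0^'+ `<=` F -> 0 < theta -> 0 <= t ->
  unc (Dq i f) @ gridfilter F theta x t --> g ->
  forall eta : R, 0 < eta -> exists2 d : R, 0 < d & forall s1 s2 (a b : R),
    `|s1| <= d -> `|s2| <= d -> s1 <= s2 ->
    unc f @ gridfilter F theta (x + s1 *: delta_mx 0 i) t --> a ->
    unc f @ gridfilter F theta (x + s2 *: delta_mx 0 i) t --> b ->
    `|b - a - (s2 - s1) * g| <= (s2 - s1) * eta.
Proof.
move=> FF F0 th0 t0 /(grid_limP _ _ _ _ _ _ FF) H eta eta0; have [d d0 hd] := H eta eta0.
exists (d / 2); first by posR.
move=> s1 s2 a b hs1 hs2 s12 fa fb.
pose N (h : R) := Num.truncn ((s2 - s1) / (1 * h ^+ 1)).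
pose Y h := flo h (x + s1 *: delta_mx 0 i).
pose l h := tidx theta h t.
have s0 : 0 <= s2 - s1 by rewrite subr_ge0.
have Nh h : 0 < h -> (N h)%:R * h <= s2 - s1 < (N h)%:R * h + h.
  move=> h0; have h1 : 0 < 1 * h ^+ 1 by rewrite mul1r expr1.
  have := truncn_itv (divr_ge0 s0 (ltW h1)); rewrite -/(N h) mul1r expr1.
  by rewrite ler_pdivlMr// ltr_pdivrMr// -natr1 mulrDl mul1r.
have Ncvg : (fun h => (N h)%:R * h) @ F --> s2 - s1.
  have -> : (fun h => (N h)%:R * h) = (fun h => (N h)%:R * (1 * h ^+ 1)).
    by apply/funext => h; rewrite mul1r expr1.
  exact: (truncn_mesh_cvg F (s2 - s1) 1 FF F0 s0 ltr01 1 isT).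
have xE i' s : (x + s *: delta_mx 0 i) 0 i' = x 0 i' + s * (i' == i)%:R by rewrite !mxE eqxx.
have sm e : 0 < e -> F [set h | 0 < h /\ h <= e /\ theta * h ^+ 2 <= e] by exact: small_mesh.
have c1 : (fun h => f h (l h) (Y h)) @ F --> a.
  apply: sample_limit fa => e e0; apply: filterS (sm e e0) => h [h1 [h2 h3]].
  exact: near_pt_idx.
have c2 : (fun h => f h (l h) (Y h + unitv i *+ N h)) @ F --> b.
  apply: sample_limit fb => e e0; have e20 : 0 < e / 2 by posR.
  apply: filterS (sm _ e20) => h [h1 [h2 h3]].
  have [q1 q2] := near_pt_idx theta (e / 2) h t (x + s1 *: delta_mx 0 i) th0 h1 t0 h2 h3.
  split=> [|i']; first by apply: le_trans q1 _; move: e0; clear; lra.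
  have := q2 i'; rewrite -/(Y h) meshDn !xE; set m := mesh _ _ _ _; have := Nh h h1.
  case: (i' == i); rewrite ?mulr1 ?mulr0 ?addr0.
    move=> /andP[n1 n2]; rewrite !ler_norml => /andP[n3 n4].
    by apply/andP; split; move: n1 n2 n3 n4 h2 e0; clear; lra.
  by move=> _ /le_trans; apply; move: e0; clear; lra.
have c3 : (fun h => `|f h (l h) (Y h + unitv i *+ N h) - f h (l h) (Y h) - (N h)%:R * h * g| - (N h)%:R * h * eta) @ F
     --> `|b - a - (s2 - s1) * g| - (s2 - s1) * eta.
  apply: cvgB; last by apply: cvgM => //; exact: cvg_cst.
  apply: cvg_norm; apply: cvgB; first exact: cvgB.
  by apply: cvgM => //; exact: cvg_cst.
rewrite -subr_le0; apply: (cvgr_to_le c3).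
have d20 : 0 < d / 2 by posR.
apply: filterS2 (sm _ d20) hd => h [h1 [h2 h3]] hd; rewrite subr_le0.
apply: Dq_increment => // j jN; apply: hd.
have [q1 q2] := near_pt_idx theta (d / 2) h t (x + s1 *: delta_mx 0 i) th0 h1 t0 h2 h3.
split=> [|i']; first by apply: le_trans q1 _; move: d0; clear; lra.
have := flo_near h (x + s1 *: delta_mx 0 i) i' h1; rewrite meshDn -/(Y h) !xE.
set m := mesh _ _ _ _; have /andP[n1 n2] := Nh h h1.
have jN' : j%:R * h <= (N h)%:R * h by rewrite ler_pM2r// ler_nat ltnW.
have j0 : 0 <= j%:R * h by rewrite mulr_ge0// ltW.
move: hs1 hs2; rewrite !ler_norml => /andP[a1 a2] /andP[b1 b2].
case: (i' == i); rewrite ?mulr1 ?mulr0 ?addr0 => /andP[n3 n4]; apply/andP; split;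
  move: n1 n2 n3 n4 h2 a1 a2 b1 b2 jN' j0 d0; clear; lra.
Qed.

(** The same telescoping in time: [w] is the exact time quotient of [f], so its limit [g] becomes
    the time derivative. *)
Lemma time_increment F theta f w x t g : ProperFilter F -> 0^'+ `<=` F -> 0 < theta ->
  (forall h k Y, 0 < h -> f h k.+1 Y - f h k Y = theta * h ^+ 2 * w h k Y) ->
  unc w @ gridfilter F theta x t --> g ->
  forall eta : R, 0 < eta -> exists2 d : R, 0 < d & forall t1 t2 (a b : R),
    `|t1 - t| <= d -> `|t2 - t| <= d -> 0 <= t1 -> t1 <= t2 ->
    unc f @ gridfilter F theta x t1 --> a -> unc f @ gridfilter F theta x t2 --> b ->
    `|b - a - (t2 - t1) * g| <= (t2 - t1) * eta.
Proof.
move=> FF F0 th0 fw /(grid_limP _ _ _ _ _ _ FF) H eta eta0; have [d d0 hd] := H eta eta0.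
exists (d / 2); first by posR.
move=> t1 t2 a b ht1 ht2 t10 t12 fa fb.
pose N (h : R) := Num.truncn ((t2 - t1) / (theta * h ^+ 2)).
pose Y h := flo h x.
pose l h := tidx theta h t1.
have s0 : 0 <= t2 - t1 by rewrite subr_ge0.
have Nh h : 0 < h -> (N h)%:R * (theta * h ^+ 2) <= t2 - t1 < (N h)%:R * (theta * h ^+ 2) + theta * h ^+ 2.
  move=> h0; have h1 : 0 < theta * h ^+ 2 by posR.
  have := truncn_itv (divr_ge0 s0 (ltW h1)); rewrite -/(N h).
  by rewrite ler_pdivlMr// ltr_pdivrMr// -natr1 mulrDl mul1r.
have Ncvg : (fun h => (N h)%:R * (theta * h ^+ 2)) @ F --> t2 - t1.
  exact: (truncn_mesh_cvg F (t2 - t1) theta FF F0 s0 th0 2 isT).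
have sm e : 0 < e -> F [set h | 0 < h /\ h <= e /\ theta * h ^+ 2 <= e] by exact: small_mesh.
have c1 : (fun h => f h (l h) (Y h)) @ F --> a.
  apply: sample_limit fa => e e0; apply: filterS (sm e e0) => h [h1 [h2 h3]].
  exact: near_pt_idx.
have c2 : (fun h => f h (l h + N h)%N (Y h)) @ F --> b.
  apply: sample_limit fb => e e0; have e20 : 0 < e / 2 by posR.
  apply: filterS (sm _ e20) => h [h1 [h2 h3]].
  have [q1 q2] := near_pt_idx theta (e / 2) h t1 x th0 h1 t10 h2 h3.
  split=> [|i']; last by apply: le_trans (q2 i') _; move: e0; clear; lra.
  move: q1; rewrite -/(l h) natrD mulrDr [theta * _ * (N h)%:R]mulrC; have /andP[n1 n2] := Nh h h1.
  rewrite !ler_norml => /andP[n3 n4].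
  by apply/andP; split; move: n1 n2 n3 n4 h3 e0; clear; lra.
have c3 : (fun h => `|f h (l h + N h)%N (Y h) - f h (l h) (Y h) - (N h)%:R * (theta * h ^+ 2) * g| - (N h)%:R * (theta * h ^+ 2) * eta) @ F
     --> `|b - a - (t2 - t1) * g| - (t2 - t1) * eta.
  apply: cvgB; last by apply: cvgM => //; exact: cvg_cst.
  apply: cvg_norm; apply: cvgB; first exact: cvgB.
  by apply: cvgM => //; exact: cvg_cst.
rewrite -subr_le0; apply: (cvgr_to_le c3).
have d20 : 0 < d / 2 by posR.
apply: filterS2 (sm _ d20) hd => h [h1 [h2 h3]] hd; rewrite subr_le0.
have thh : 0 < theta * h ^+ 2 by posR.
have [q qE] : exists q, theta * h ^+ 2 = q by exists (theta * h ^+ 2).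
rewrite qE in thh *.
have := increment_path (N h) (fun j : nat => f h (l h + j)%N (Y h)) (q * g) (q * eta).
rewrite addn0 !mulrA; apply => j jN.
rewrite addnS fw// qE -mulrBr normrM gtr0_norm// ler_pM2l// distrC; apply: hd; rewrite -qE in thh.
have [q1 q2] := near_pt_idx theta (d / 2) h t1 x th0 h1 t10 h2 h3.
split=> [|i']; last by apply: le_trans (q2 i') _; move: d0; clear; lra.
have /andP[n1 n2] := Nh h h1.
have jN' : j%:R * (theta * h ^+ 2) <= (N h)%:R * (theta * h ^+ 2) by rewrite ler_pM2r// ler_nat ltnW.
have j0 : 0 <= j%:R * (theta * h ^+ 2) by rewrite mulr_ge0// ltW.
have /andP[m1 m2] := tidx_near theta h t1 th0 h1 t10.
rewrite natrD mulrDr [theta * _ * j%:R]mulrC -/(l h).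
move: ht1 ht2; rewrite !ler_norml => /andP[a1 a2] /andP[b1 b2].
apply/andP; split; move: n1 n2 m1 m2 h3 a1 a2 b1 b2 jN' j0 d0; rewrite -/(l h); clear; lra.
Qed.

Lemma grid_shift F theta f x t a i : ProperFilter F -> 0^'+ `<=` F -> 0 < theta ->
  unc f @ gridfilter F theta x t --> a ->
  unc (fun h k Y => f h k (Y - unitv i)) @ gridfilter F theta x t --> a.
Proof.
move=> FF F0 th0 /(grid_limP _ _ _ _ _ _ FF) H; apply/(grid_limP _ _ _ _ _ _ FF) => eta eta0.
have [d d0 hd] := H eta eta0; have d20 : 0 < d / 2 by posR.
exists (d / 2) => //; apply: filterS2 (small_mesh F theta _ FF F0 th0 d20) hd => h [h1 [h2 _]] hd l Y [q1 q2].
apply: hd; split=> [|i']; first by apply: le_trans q1 _; move: d0; clear; lra.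
have E : mesh h Y 0 i' = mesh h (Y - unitv i) 0 i' + h * (i' == i)%:R by rewrite -meshDu subrK.
have := q2 i'; rewrite E !ler_norml; set m := mesh _ _ _ _.
by case: (i' == i); rewrite ?mulr1 ?mulr0 ?addr0 => /andP[a1 a2]; apply/andP; split; move: a1 a2 h1 h2 d0; clear; lra.
Qed.

End GridLimits.

Lemma is_derive_increment {R : realType} {W : normedModType R} (f : W -> R) (x e : W) (g : R) :
  (forall eta : R, 0 < eta -> exists2 d : R, 0 < d &
     forall s : R, `|s| <= d -> `|f (x + s *: e) - f x - s * g| <= `|s| * eta) ->
  is_derive x e f g.
Proof.
move=> H.
have L : h^-1 *: ((f \o shift x) (h *: e) - f x) @[h --> 0^'] --> g.
  apply/cvgrPdist_le => eta eta0; have [d d0 hd] := H eta eta0.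
  have : \forall s \near 0^', `|s| <= d /\ s != 0 :> R.
    near=> s; split; last by near: s; exact: nbhs_dnbhs_neq.
    near: s; exact: dnbhs0_le.
  apply: filterS => s [sd s0] /=.
  have s0' : 0 < `|s| by rewrite normr_gt0.
  rewrite [s *: e + x]addrC -(ler_pM2l s0') -normrM.
  have -> : s * (g - s^-1 *: (f (x + s *: e) - f x)) = - (f (x + s *: e) - f x - s * g).
    by rewrite /GRing.scale /=; field.
  by rewrite normrN; exact: hd.
apply: DeriveDef; first by apply/cvg_ex; exists g.
exact: cvg_lim.
Unshelve. all: by end_near.
Qed.

(** * Derivatives, initial values and spatial decay of grid limits *)

Section Pointwise.
Context {R : realType} {n : nat}.
Local Notation I := ('rV[int]_n).
Local Notation V := ('rV[R]_n).

Lemma continuous_on_eps (D : set (V * R)) (u : V -> R -> R) :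
  (forall x t, D (x, t) -> forall eta : R, 0 < eta -> exists2 d : R, 0 < d &
     forall x' t', D (x', t') -> (forall i, `|x' 0 i - x 0 i| <= d) -> `|t' - t| <= d ->
       `|u x' t' - u x t| <= eta) -> continuous_on D u.
Proof.
move=> H; apply/subspace_continuousP => -[x t] Dx; apply/cvgrPdist_le => eta eta0.
have [d d0 hd] := H x t Dx eta eta0.
rewrite near_withinE; apply/nbhs_ballP; exists d => //= -[x' t'] [[_ bx] bt] Dz.
rewrite /from_subspace /= distrC; apply: hd => //.
  by move=> i; rewrite distrC ltW//; exact: bx.
by rewrite distrC ltW//; exact: bt.
Qed.

Lemma grid_derivative F theta (f : R -> nat -> I -> R) (v : V -> R) (x : V) (t g : R) i :
  ProperFilter F -> 0^'+ `<=` F -> 0 < theta -> 0 <= t ->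
  (forall y, unc f @ gridfilter F theta y t --> v y) ->
  unc (Dq i f) @ gridfilter F theta x t --> g -> is_derive x (delta_mx 0 i) v g.
Proof.
move=> FF F0 th0 t0 fv fg; apply: is_derive_increment => eta eta0.
have [d d0 hd] := space_increment F theta f x t i g FF F0 th0 t0 fg eta eta0.
exists d => // s sd; have z0 : `|0 : R| <= d by rewrite normr0 ltW.
have [s0|s0] := leP 0 s.
  have := hd 0 s _ _ z0 sd s0 (fv _) (fv _).
  by rewrite scale0r addr0 subr0 (ger0_norm s0).
have := hd s 0 _ _ sd z0 (ltW s0) (fv _) (fv _).
rewrite scale0r addr0 sub0r (ltr0_norm s0); apply: le_trans.
by rewrite -normrN le_eqVlt; apply/orP; left; apply/eqP; congr `|_|; ring.
Qed.

Lemma grid_time_derivative F theta (f w : R -> nat -> I -> R) (v : R -> R) (x : V) (t g : R) :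
  ProperFilter F -> 0^'+ `<=` F -> 0 < theta -> 0 < t ->
  (forall h k Y, 0 < h -> f h k.+1 Y - f h k Y = theta * h ^+ 2 * w h k Y) ->
  (forall s, 0 <= s -> unc f @ gridfilter F theta x s --> v s) ->
  unc w @ gridfilter F theta x t --> g -> is_derive t 1 v g.
Proof.
move=> FF F0 th0 t0 fw fv fg; apply: is_derive_increment => eta eta0.
have [d d0 hd] := time_increment F theta f w x t g FF F0 th0 fw fg eta eta0.
exists (Num.min d t); first by posR.
move=> s; rewrite le_min => /andP[sd st]; have z0 : `|t - t| <= d by rewrite subrr normr0 ltW.
have sd' : `|t + s *: 1 - t| <= d by rewrite addrAC subrr add0r /GRing.scale /= mulr1.
have ts0 : 0 <= t + s *: 1 by move: st; rewrite /GRing.scale /= mulr1 ler_norml => /andP[+ _]; clear; lra.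
have E : s *: 1 = s :> R by rewrite /GRing.scale /= mulr1.
have [s0|s0] := leP 0 s.
  have := hd t (t + s *: 1) _ _ z0 sd' (ltW t0) _ (fv _ (ltW t0)) (fv _ ts0).
  rewrite E; have -> : t + s - t = s by ring.
  by rewrite lerDl (ger0_norm s0); apply.
have := hd (t + s *: 1) t _ _ sd' z0 ts0 _ (fv _ ts0) (fv _ (ltW t0)).
rewrite E gerDl => /(_ (ltW s0)); have -> : t - (t + s) = - s by ring.
rewrite (ltr0_norm s0); apply: le_trans.
by rewrite -normrN le_eqVlt; apply/orP; left; apply/eqP; congr `|_|; ring.
Qed.

Lemma cvg_finsum (T : Type) (G : set_system T) (FF : Filter G) (J : finType) (f : J -> T -> R) (a : J -> R) :
  (forall j, f j @ G --> a j) -> (fun z => \sum_j f j z) @ G --> \sum_j a j.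
Proof.
move=> H; rewrite (_ : (fun z => _) = \sum_j f j); last first.
  by apply/funext => z; rewrite fct_sumE.
elim/big_ind2: _ => //; first exact: cvg_cst.
by move=> *; exact: cvgD.
Qed.

Section SchemeFamilies.
Variables (p theta M : R) (u0 : V -> R).
Local Notation U := (scheme p theta ^~ u0 : R -> nat -> I -> R).

Lemma scheme_range : datum p theta M u0 -> forall h k (Y : I), 0 < scheme p theta h u0 k Y <= M.
Proof.
move=> [n0 p1 th0 cfl M0 cu uM] h; apply: (scheme_bounds p theta M (scheme p theta h u0)) => //.
by move=> x; exact: uM.
Qed.

Lemma cubeE (h X : R) (Y : I) : 0 < h -> cube X (mesh h Y) <-> box 0 (X / h) Y.
Proof. by move=> h0; split=> [H|/box0E H]; [apply/box0E|exact: H]. Qed.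

Lemma scheme_interior_cube (X T0 T1 : R) : datum p theta M u0 -> 0 < X -> 0 < T0 -> T0 <= T1 ->
  exists C h0 : R, [/\ 0 < C, 0 < h0 & forall (h : R) k (Y : I), 0 < h -> h <= h0 ->
    cube X (mesh h Y) -> T0 <= theta * h ^+ 2 * k%:R <= T1 ->
    [/\ forall i, `|diffu i (scheme p theta h u0 k) Y| <= C * h,
        forall i j, `|diffu j (diffu i (scheme p theta h u0 k)) Y| <= C * h ^+ 2 &
        forall i j l, `|diffu l (diffu j (diffu i (scheme p theta h u0 k))) Y| <= C * h ^+ 3]].
Proof.
move=> dat X0 T00 T01; have [C [h0 [C0 h00 H]]] := scheme_interior _ _ _ _ _ _ _ dat X0 T00 T01.
exists C, h0; split=> // h k Y hp hh /(cubeE _ _ _ hp) hY kt; have [g1 g2 g3] := H h k Y hp hh hY kt.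
split; [apply: grad2_le g1|apply: hess2_le g2|apply: third2_le g3]; apply: ltW; posR.
Qed.

Lemma famB_scheme : datum p theta M u0 -> famB theta (scheme p theta ^~ u0 : R -> nat -> I -> R).
Proof.
move=> dat X T0 T1 X0 T00 T01; have [C [h0 [C0 h00 H]]] := scheme_interior_cube _ _ _ dat X0 T00 T01.
case: (dat) => _ _ _ _ M0 _ _.
exists (C + M), h0; split=> //; first exact: addr_gt0.
move=> h k Y hp hh hY kt; have [g1 _ _] := H h k Y hp hh hY kt.
have /andP[b1 b2] := scheme_range dat h k Y; split.
  by rewrite gtr0_norm//; apply: le_trans b2 _; rewrite lerDr ltW.
by move=> i; apply: le_trans (g1 i) _; rewrite ler_pM2r// lerDl ltW.
Qed.

Lemma diffu_Dq i j (f : R -> nat -> I -> R) h k Y : diffu j (Dq i f h k) Y = diffu j (diffu i (f h k)) Y / h.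
Proof. by rewrite /diffu /Dq /diffu; ring. Qed.

Lemma famB_scheme1 i : datum p theta M u0 -> famB theta (Dq i (scheme p theta ^~ u0 : R -> nat -> I -> R)).
Proof.
move=> dat X T0 T1 X0 T00 T01; have [C [h0 [C0 h00 H]]] := scheme_interior_cube _ _ _ dat X0 T00 T01.
exists C, h0; split=> // h k Y hp hh hY kt; have [g1 g2 _] := H h k Y hp hh hY kt.
have ih : `|h^-1| = h^-1 by rewrite gtr0_norm// invr_gt0.
split; first by rewrite normrM ih ler_pdivrMr.
move=> j; rewrite diffu_Dq normrM ih ler_pdivrMr// -mulrA -expr2.
exact: g2.
Qed.

Lemma famB_scheme2 i j : datum p theta M u0 ->
  famB theta (Dq j (Dq i (scheme p theta ^~ u0 : R -> nat -> I -> R))).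
Proof.
move=> dat X T0 T1 X0 T00 T01; have [C [h0 [C0 h00 H]]] := scheme_interior_cube _ _ _ dat X0 T00 T01.
exists C, h0; split=> // h k Y hp hh hY kt; have [_ g2 g3] := H h k Y hp hh hY kt.
have ih : `|h^-1| = h^-1 by rewrite gtr0_norm// invr_gt0.
split.
  rewrite -[X in `|X|]/(diffu j (Dq i (scheme p theta ^~ u0 : R -> nat -> I -> R) h k) Y / h).
  by rewrite diffu_Dq !normrM ih !ler_pdivrMr// -mulrA -expr2; exact: g2.
move=> l; rewrite diffu_Dq.
have -> : diffu j (Dq i (scheme p theta ^~ u0) h k) = (fun Z => diffu j (diffu i (scheme p theta h u0 k)) Z / h).
  by apply/funext => Z; rewrite diffu_Dq.
have -> : diffu l (fun Z => diffu j (diffu i (scheme p theta h u0 k)) Z / h) Y =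
   diffu l (diffu j (diffu i (scheme p theta h u0 k))) Y / h by rewrite /diffu; ring.
rewrite !normrM ih !ler_pdivrMr//.
by have -> : C * h * h * h = C * h ^+ 3 by ring.
Qed.

(** One step changes the scheme by at most [theta M^p n C h^2], because second differences are of
    order [h^2]. It is therefore Lipschitz in time away from time 0. *)
Lemma famT_scheme : datum p theta M u0 -> famT theta (scheme p theta ^~ u0 : R -> nat -> I -> R).
Proof.
move=> dat X T0 T1 eta X0 T00 T01 eta0; case: (dat) => n0 p1 th0 cfl M0 cu uM.
have X1 : 0 < X + 1 by posR.
have [C [h0 [C0 h00 H]]] := scheme_interior_cube _ _ _ dat X1 T00 T01.
have nR : 0 < n%:R :> R by rewrite ltr0n.
have Mp : 0 < M `^ p by rewrite powR_gt0.
pose B := M `^ p * (n%:R * C).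
have B0 : 0 < B by posR.
exists (eta / B), (Num.min h0 1); split; [posR|posR|].
have main h k N Y : 0 < h -> h <= Num.min h0 1 -> cube X (mesh h Y) -> T0 <= theta * h ^+ 2 * k%:R ->
   theta * h ^+ 2 * (k + N)%:R <= T1 ->
   `|scheme p theta h u0 (k + N) Y - scheme p theta h u0 k Y| <= N%:R * (theta * h ^+ 2 * B).
  move=> hp; rewrite le_min => /andP[hh0 hh1] hY kt; have hh : 0 < theta * h ^+ 2 by posR.
  elim: N => [|N IH] Nt; first by rewrite addn0 subrr normr0 mul0r.
  have tN : theta * h ^+ 2 * (k + N)%:R <= theta * h ^+ 2 * (k + N.+1)%:R.
    by rewrite ler_pM2l// ler_nat leq_add2l.
  have := IH (le_trans tN Nt); set a := scheme p theta h u0 (k + N) Y => IHN.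
  have st : `|scheme p theta h u0 (k + N.+1) Y - a| <= theta * h ^+ 2 * B.
    rewrite addnS schemeS /avg -/a addrAC subrr add0r normrM.
    have /andP[a0 aM] := scheme_range dat h (k + N) Y; rewrite -/a in a0 aM.
    rewrite ger0_norm; last by rewrite mulr_ge0 ?powR_ge0// ltW.
    have -> : theta * h ^+ 2 * B = (theta * M `^ p) * (n%:R * (C * h ^+ 2)) by rewrite /B; ring.
    apply: ler_pM => //; first by rewrite mulr_ge0 ?powR_ge0// ltW.
      rewrite ler_wpM2l ?(ltW th0)//; apply: powR_mono => //; last exact: ltW.
      by apply: le_trans p1.
    apply: lap_le_hess => i.
    have kN : T0 <= theta * h ^+ 2 * (k + N)%:R <= T1.
      apply/andP; split; last exact: le_trans Nt.
      by apply: le_trans kt _; rewrite ler_pM2l// ler_nat leq_addr.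
    have cY : cube (X + 1) (mesh h (Y - unitv i)).
      move=> j; have := hY j; have E : mesh h Y 0 j = mesh h (Y - unitv i) 0 j + h * (j == i)%:R by rewrite -meshDu subrK.
      rewrite E !ler_norml; case: (j == i); rewrite ?mulr1 ?mulr0 ?addr0 => /andP[e1 e2];
      by apply/andP; split; move: e1 e2 hp hh1; clear; lra.
    by have [_ g2 _] := H h (k + N)%N (Y - unitv i) hp hh0 cY kN; exact: g2.
  have -> : scheme p theta h u0 (k + N.+1) Y - scheme p theta h u0 k Y =
    (scheme p theta h u0 (k + N.+1) Y - a) + (a - scheme p theta h u0 k Y) by ring.
  apply: le_trans (ler_normD _ _) _; rewrite -(natr1 N) mulrDl mul1r addrC.
  exact: lerD.
have main2 h k l Y : 0 < h -> h <= Num.min h0 1 -> cube X (mesh h Y) -> (k <= l)%N ->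
   T0 <= theta * h ^+ 2 * k%:R -> theta * h ^+ 2 * l%:R <= T1 ->
   theta * h ^+ 2 * l%:R - theta * h ^+ 2 * k%:R <= eta / B ->
   `|scheme p theta h u0 l Y - scheme p theta h u0 k Y| <= eta.
  move=> hp hh hY kl kt lt; rewrite ler_pdivlMr// => le.
  have := main h k (l - k)%N Y hp hh hY kt; rewrite subnKC// => /(_ lt) /le_trans; apply.
  by apply: le_trans le; rewrite natrB//; clear; lra.
move=> h k l Y hp hh hY /andP[k1 k2] /andP[l1 l2]; rewrite ler_norml => /andP[d1 d2].
case: (leqP k l) => kl.
  by rewrite distrC; apply: main2 => //; move: d1; clear; lra.
by apply: main2 => //; exact: ltnW.
Qed.

End SchemeFamilies.

Lemma gap_sqr (h d : R) (x : V) (c Y : I) i : `|mesh h c 0 i - x 0 i| <= d ->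
  (mesh h Y 0 i - x 0 i) ^+ 2 <= 2 * d ^+ 2 + 2 * h ^+ 2 * crd Y c i ^+ 2.
Proof.
move=> hd; have -> : mesh h Y 0 i - x 0 i = h * crd Y c i + (mesh h c 0 i - x 0 i).
  by rewrite /crd !mxE intrB; ring.
have := sqr_le_norm _ _ hd; have := sqr_ge0 (h * crd Y c i - (mesh h c 0 i - x 0 i)).
by clear; lra.
Qed.

(** With [A = M / r^2] the datum lies within [eta / 2 + A |v - x|^2] of [u0 x] everywhere: inside
    radius [r] by continuity, outside by boundedness. [scheme_upper] and [scheme_lower] propagate
    these paraboloids, which rise by a multiple of [t] only. *)
Lemma grid_initial (p theta M : R) (u0 : V -> R) F (x : V) : datum p theta M u0 -> ProperFilter F -> 0^'+ `<=` F ->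
  unc (scheme p theta ^~ u0 : R -> nat -> I -> R) @ gridfilter F theta x 0 --> u0 x.
Proof.
move=> dat FF F0; case: (dat) => n0 p1 th0 cfl M0 cu uM.
apply/(grid_limP _ _ _ _ _ _ FF) => eta eta0.
have eta2 : 0 < eta / 2 by posR.
have /cvgrPdist_le/(_ _ eta2)/nbhs_ballP[r /= r0 hr] := cu x.
pose A := M / r ^+ 2.
have A0 : 0 < A by posR.
have bound v : `|u0 v - u0 x| <= eta / 2 + A * \sum_i (v 0 i - x 0 i) ^+ 2.
  have S0 : 0 <= \sum_i (v 0 i - x 0 i) ^+ 2 by apply: sumr_ge0 => i _; exact: sqr_ge0.
  have [/forallP H|/forallPn[i hi]] := boolP [forall i, `|x 0 i - v 0 i| < r].
    rewrite distrC; apply: le_trans (hr v _) _; last by rewrite lerDl mulr_ge0// ltW.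
    by split=> // j i; rewrite ord1; exact: H.
  rewrite -leNgt in hi.
  apply: (@le_trans _ _ M).
    have /andP[a1 a2] := uM v; have /andP[b1 b2] := uM x.
    by rewrite ler_norml; apply/andP; split; move: a1 a2 b1 b2; clear; lra.
  have h1 : r ^+ 2 <= \sum_i (v 0 i - x 0 i) ^+ 2.
    apply: (@le_trans _ _ ((v 0 i - x 0 i) ^+ 2)).
      by rewrite -[leRHS]real_normK ?num_real// distrC; apply: sqr_le => //; exact: ltW.
    by rewrite (bigD1 i)//= lerDl; apply: sumr_ge0 => j _; exact: sqr_ge0.
  have r20 : 0 < r ^+ 2 by posR.
  have := ler_wpM2l (ltW A0) h1; rewrite /A divfK ?gt_eqF//.
  by move: eta2; clear; lra.
pose cst := 2 * A * n%:R + 2 * A / theta.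
have nR : 0 < n%:R :> R by rewrite ltr0n.
have cst1 : 0 < 2 * A * n%:R by posR.
have cst2 : 0 < 2 * A / theta by posR.
have cst0 : 0 < cst by apply: addr_gt0.
pose d := Num.min 1 (eta / 2 / cst).
have d0 : 0 < d by rewrite /d; posR.
have dle : d <= d by []. 
move: dle; rewrite {2}/d le_min => /andP[d1 de].
have dc : cst * d <= eta / 2 by rewrite mulrC -ler_pdivlMr.
exists d => //; have hp0 : F [set h | 0 < h] by apply: F0; exact: nbhs_right_gt.
apply: filterS hp0 => h hp k c [hk hc].
have thk : theta * h ^+ 2 * k%:R <= d by move: hk; rewrite subr0 ler_norml => /andP[_].
have bnd (Y : I) : `|u0 (mesh h Y) - u0 x| <= eta / 2 + 2 * A * n%:R * d ^+ 2 + 2 * A * h ^+ 2 * sqd c Y.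
  apply: le_trans (bound (mesh h Y)) _; rewrite -addrA lerD2l.
  have -> : 2 * A * n%:R * d ^+ 2 + 2 * A * h ^+ 2 * sqd c Y = A * \sum_(i < n) (2 * d ^+ 2 + 2 * h ^+ 2 * crd Y c i ^+ 2).
    by rewrite big_split /= sumr_const card_ord -mulr_sumr -/(sqd c Y) -[X in A * (X + _)]mulr_natl; ring.
  rewrite ler_wpM2l ?(ltW A0)//; apply: ler_sum => i _; exact: gap_sqr.
have A2 : 0 <= 2 * A * h ^+ 2 by apply: ltW; posR.
have uS k' (y : I) : scheme p theta h u0 k'.+1 y = avg (theta * scheme p theta h u0 k' y `^ p) (scheme p theta h u0 k') y by [].
have uM0 (y : I) : 0 < scheme p theta h u0 0 y <= M by exact: uM.
have up := scheme_upper p theta M _ p1 th0 cfl uS uM0 c (u0 x + (eta / 2 + 2 * A * n%:R * d ^+ 2)) _ A2.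
have lo := scheme_lower p theta M _ p1 th0 cfl uS uM0 c (u0 x - (eta / 2 + 2 * A * n%:R * d ^+ 2)) _ A2.
have h1 (y : I) : scheme p theta h u0 0 y <= u0 x + (eta / 2 + 2 * A * n%:R * d ^+ 2) + 2 * A * h ^+ 2 * sqd c y.
  by have := bnd y; rewrite /= ler_norml => /andP[_]; clear; lra.
have h2 (y : I) : u0 x - (eta / 2 + 2 * A * n%:R * d ^+ 2) - 2 * A * h ^+ 2 * sqd c y <= scheme p theta h u0 0 y.
  by have := bnd y; rewrite /= ler_norml => /andP[+ _]; clear; lra.
have := up h1 k c; have := lo h2 k c; rewrite sqdxx mulr0 addr0 subr0.
have kk : 2 * A * h ^+ 2 * k%:R <= 2 * A / theta * d.
  have := ler_wpM2l (ltW cst2) thk; have -> : 2 * A / theta * (theta * h ^+ 2 * k%:R) = 2 * A * h ^+ 2 * k%:R.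
    by field; rewrite gt_eqF.
  by [].
have dd : 2 * A * n%:R * d ^+ 2 <= 2 * A * n%:R * d.
  by rewrite ler_wpM2l ?(ltW cst1)// expr2 ler_piMl// ltW.
move: dc kk dd; rewrite /cst => dc kk dd lo' up'.
by rewrite ler_norml; apply/andP; split; move: dc kk dd lo' up'; clear; lra.
Qed.

(** Sites where the datum may exceed [eta] are at distance at least [s = 1 + q] in the direction
    [i], so a paraboloid of opening [M / s^2] covers them. Over the time [T + 1] it rises by at most
    [eta q / s^2 <= eta]. *)
Lemma grid_decay (p theta M : R) (u0 : V -> R) F (x : V) (t eta X T : R) (l : R) i : datum p theta M u0 -> ProperFilter F -> 0^'+ `<=` F ->
  (forall v : V, X <= `|v 0 i| -> u0 v <= eta) -> 0 < eta -> 0 <= t -> t <= T ->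
  X + 2 + M * (T + 1) / (theta * eta) <= `|x 0 i| ->
  unc (scheme p theta ^~ u0 : R -> nat -> I -> R) @ gridfilter F theta x t --> l -> l <= 2 * eta.
Proof.
move=> dat FF F0 hX eta0 t0 tT xX; case: (dat) => n0 p1 th0 cfl M0 cu uM.
set q := M * (T + 1) / (theta * eta) in xX.
have T1 : 0 < T + 1 by move: t0 tT; clear; lra.
have q0 : 0 < q by rewrite /q; posR.
have GF := gridfilter_proper F theta x t FF F0 th0 t0.
move=> ul; apply: (cvgr_to_le ul); exists 1; first exact: ltr01.
have hp0 : F [set h | 0 < h] by apply: F0; exact: nbhs_right_gt.
apply: filterS hp0 => h hp k c [hk hc].
have thk : theta * h ^+ 2 * k%:R <= T + 1.
  by move: hk; rewrite ler_norml => /andP[_]; move: tT; clear; lra.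
pose s := 1 + q.
have s0 : 0 < s by rewrite /s; posR.
have bnd (Y : I) : scheme p theta h u0 0 Y <= eta + M * h ^+ 2 / s ^+ 2 * sqd c Y.
  have S0 : 0 <= M * h ^+ 2 / s ^+ 2 * sqd c Y by rewrite mulr_ge0 ?sqd_ge0//; apply: ltW; posR.
  have [hY|hY] := leP X `|mesh h Y 0 i|.
    by apply: le_trans (hX _ hY) _; rewrite lerDl.
  have /andP[_ uYM] := uM (mesh h Y); apply: le_trans uYM _.
  have cs : s <= `|h * crd Y c i|.
    have -> : h * crd Y c i = - ((x 0 i - mesh h Y 0 i) + (mesh h c 0 i - x 0 i)).
      by rewrite /crd !mxE intrB; ring.
    rewrite normrN; apply: le_trans (lerB_normD _ _).
    have := lerB_normD (x 0 i) (- mesh h Y 0 i); rewrite normrN.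
    by move: (hc i) hY xX; rewrite /s; clear; lra.
  have s2 : s ^+ 2 <= h ^+ 2 * sqd c Y.
    apply: le_trans (sqr_le _ _ (ltW s0) cs) _.
    by rewrite real_normK ?num_real// exprMn ler_wpM2l ?sqr_ge0//; exact: crd_sqd.
  have := ler_wpM2l (ltac:(apply: ltW; posR) : 0 <= M / s ^+ 2) s2.
  have s20 : 0 < s ^+ 2 by posR.
  rewrite divfK ?gt_eqF//.
  by move: eta0; clear; lra.
have uS k' (y : I) : scheme p theta h u0 k'.+1 y = avg (theta * scheme p theta h u0 k' y `^ p) (scheme p theta h u0 k') y by [].
have uM0 (y : I) : 0 < scheme p theta h u0 0 y <= M by exact: uM.
have A2 : 0 <= M * h ^+ 2 / s ^+ 2 by apply: ltW; posR.
have := scheme_upper p theta M _ p1 th0 cfl uS uM0 c eta _ A2 bnd k c.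
rewrite sqdxx mulr0 addr0 => /le_trans; apply.
rewrite mulr2n mulrDl mul1r lerD2l.
have -> : M * h ^+ 2 / s ^+ 2 * k%:R = M / theta * (theta * h ^+ 2 * k%:R) / s ^+ 2.
  by field; rewrite !gt_eqF.
rewrite ler_pdivrMr; last by posR.
apply: le_trans (ler_wpM2l _ thk) _; first by apply: ltW; posR.
have -> : M / theta * (T + 1) = eta * q by rewrite /q; field; rewrite !gt_eqF.
rewrite ler_pM2l// /s; have := sqr_ge0 q; move: q0; clear; lra.
Qed.

End Pointwise.

(** * Existence of a decaying solution *)

Section Existence.
Context {R : realType} {n : nat}.
Local Notation I := ('rV[int]_n).
Local Notation V := ('rV[R]_n).

Lemma powR_continuous (p x : R) : 0 < x -> {for x, continuous (fun s : R => s `^ p)}.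
Proof.
move=> x0; have [d _] := is_derive1_powR p x0.
by apply: differentiable_continuous; apply/derivable1_diffP.
Qed.

Lemma grid_rhs F (theta p : R) (f : R -> nat -> I -> R) (x : V) (t v : R) (g : 'I_n -> R) :
  ProperFilter F -> 0^'+ `<=` F -> 0 < theta -> 0 < v ->
  unc f @ gridfilter F theta x t --> v ->
  (forall i, unc (Dq i (Dq i f)) @ gridfilter F theta x t --> g i) ->
  unc (fun h k Y => f h k Y `^ p * \sum_i Dq i (Dq i f) h k (Y - unitv i)) @ gridfilter F theta x t
    --> v `^ p * \sum_i g i.
Proof.
move=> FF F0 th0 v0 fv fg; have GF := gridfilter_filter F theta x t FF.
apply: (@cvgM _ _ _ _ (fun z => unc f z `^ p) (fun z => \sum_i unc (fun h k Y => Dq i (Dq i f) h k (Y - unitv i)) z)).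
  exact: (cvg_comp _ _ fv (powR_continuous p v v0)).
by apply: cvg_finsum => i; exact: grid_shift.
Qed.

Lemma scheme_step (p theta : R) (u0 : V -> R) h k Y : 0 < h ->
  scheme p theta h u0 k.+1 Y - scheme p theta h u0 k Y = theta * h ^+ 2 *
    (scheme p theta h u0 k Y `^ p *
     \sum_i Dq i (Dq i (scheme p theta ^~ u0 : R -> nat -> I -> R)) h k (Y - unitv i)).
Proof.
move=> h0; have e i : Dq i (Dq i (scheme p theta ^~ u0 : R -> nat -> I -> R)) h k (Y - unitv i) =
    (diffu i (scheme p theta h u0 k) Y - diffu i (scheme p theta h u0 k) (Y - unitv i)) / h ^+ 2.
  by rewrite {1}/Dq {1}/diffu /Dq subrK; field; rewrite gt_eqF.
rewrite (eq_bigr _ (fun i _ => e i)) -mulr_suml -lap_diffu_back schemeS /avg.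
by field; rewrite gt_eqF.
Qed.

(** Third differences serve only as Lipschitz bounds for the second quotients, and time
    equicontinuity passes from [U] to its quotients by [famT_Dq], so higher differences in time are
    never estimated. *)
Theorem solution_exists (p M : R) (u0 : V -> R) : (0 < n)%N -> 1 <= p -> 0 < M ->
  continuous u0 -> (forall x, 0 < u0 x <= M) ->
  (forall eta : R, 0 < eta -> exists X : R, forall (v : V) i, X <= `|v 0 i| -> u0 v <= eta) ->
  exists v : V -> R -> R, [/\ positive_classical_solution p u0 +oo%E v,
    forall (x : V) (t : R), 0 <= t -> v x t <= M &
    forall eta T : R, 0 < eta -> 0 <= T -> exists X : R, forall (x : V) (t : R) i,
      0 <= t -> t <= T -> X <= `|x 0 i| -> v x t <= eta].
Proof.
move=> n0 p1 M0 cu uM dec.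
have nR : 0 < n%:R :> R by rewrite ltr0n.
have p0 : 0 < p by apply: lt_le_trans p1.
have Mp : 0 < M `^ p by rewrite powR_gt0.
pose theta := (8 * n%:R * p * M `^ p)^-1.
have th0 : 0 < theta by rewrite /theta; posR.
have dat : datum p theta M u0.
  split => //; rewrite -mulrA [theta * _]mulrC mulrA /theta mulfV// gt_eqF//; posR.
have [F [FU F0]] := @ultraFilterLemma R _ (at_right_proper_filter (0 : R)).
have FF : ProperFilter F by exact: ultra_proper.
pose U : R -> nat -> I -> R := scheme p theta ^~ u0.
(* [lim] takes a default value where nothing converges; [LP] restores convergence to [L f x t]
   wherever some limit is known. *)
pose L (f : R -> nat -> I -> R) (x : V) (t : R) : R := lim (unc f @ gridfilter F theta x t).
have LP f (x : V) (t a : R) : 0 <= t -> unc f @ gridfilter F theta x t --> a -> unc f @ gridfilter F theta x t --> L f x t.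
  move=> t0 fa; have GF := gridfilter_proper F theta x t FF F0 th0 t0.
  by rewrite /L (cvg_lim _ fa).
have cU (x : V) (t : R) : 0 <= t -> unc U @ gridfilter F theta x t --> L U x t.
  rewrite le_eqVlt => /predU1P[<-|t0]; first by apply: LP => //; exact: grid_initial dat FF F0.
  have [a ha] := fam_cvg F theta U x t FU F0 th0 t0 (famB_scheme _ _ _ _ dat) (famT_scheme _ _ _ _ dat).
  by apply: LP ha; exact: ltW.
have T1 i : famT theta (Dq i U) by apply: famT_Dq; [exact: famB_scheme1 dat|exact: famT_scheme dat].
have T2 i j : famT theta (Dq j (Dq i U)) by apply: famT_Dq; [exact: famB_scheme2 dat|exact: T1].
have c1 i (x : V) (t : R) : 0 < t -> unc (Dq i U) @ gridfilter F theta x t --> L (Dq i U) x t.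
  move=> t0; have [a ha] := fam_cvg F theta _ x t FU F0 th0 t0 (famB_scheme1 _ _ _ _ i dat) (T1 i).
  by apply: LP ha; exact: ltW.
have c2 i j (x : V) (t : R) : 0 < t -> unc (Dq j (Dq i U)) @ gridfilter F theta x t --> L (Dq j (Dq i U)) x t.
  move=> t0; have [a ha] := fam_cvg F theta _ x t FU F0 th0 t0 (famB_scheme2 _ _ _ _ i j dat) (T2 i j).
  by apply: LP ha; exact: ltW.
pose v := L U.
have v0E x : v x 0 = u0 x.
  have GF := gridfilter_proper F theta x 0 FF F0 th0 (lexx 0).
  by rewrite /v /L (cvg_lim _ (grid_initial _ _ _ _ F x dat FF F0)).
have vpos (x : V) (t : R) : 0 <= t -> 0 < v x t.
  rewrite le_eqVlt => /predU1P[<-|t0]; first by rewrite v0E; case/andP: (uM x).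
  have GF := gridfilter_proper F theta x t FF F0 th0 (ltW t0).
  have [X X0 hX] := cube_exists x.
  have X10 : 0 < X + 1 by posR.
  have t10 : 0 <= t + 1 by apply: ltW; posR.
  have [m [h0 [m0 h00 low]]] := scheme_lower_bound _ _ _ _ (X + 1) (t + 1) dat X10 t10.
  apply: lt_le_trans m0 _; apply: (cvgr_to_ge (cU x t (ltW t0))).
  exists 1; first exact: ltr01.
  have hp0 : F [set h | 0 < h] by apply: F0; exact: nbhs_right_gt.
  have hp1 : F [set h | h <= h0] by apply: F0; exact: nbhs_right_le.
  apply: filterS2 hp0 hp1 => h hp hh k Y [k1 k2]; apply: low => //.
    apply/cubeE => //; exact: cube_near hX k2.
  by move: k1; rewrite /= ler_norml => /andP[_]; clear; lra.
have d1 i (x : V) (t : R) : 0 < t -> is_derive x (delta_mx 0 i) (v ^~ t) (L (Dq i U) x t).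
  move=> t0; apply: (grid_derivative F theta U _ x t _ i FF F0 th0 (ltW t0)); last exact: c1.
  by move=> y; apply: cU; exact: ltW.
have d2 i j (x : V) (t : R) : 0 < t -> is_derive x (delta_mx 0 j) (L (Dq i U) ^~ t) (L (Dq j (Dq i U)) x t).
  move=> t0; apply: (grid_derivative F theta (Dq i U) _ x t _ j FF F0 th0 (ltW t0)); last exact: c2.
  by move=> y; exact: c1.
have sd1 i (x : V) (t : R) : 0 < t -> space_deriv i v x t = L (Dq i U) x t.
  by move=> t0; exact: (@derive_val _ _ _ _ _ _ _ (d1 i x t t0)).
have sd1f i (t : R) : 0 < t -> space_deriv i v ^~ t = L (Dq i U) ^~ t.
  by move=> t0; apply/funext => x; exact: sd1.
have sd2 i j (x : V) (t : R) : 0 < t -> space_deriv j (space_deriv i v) x t = L (Dq j (Dq i U)) x t.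
  by move=> t0; rewrite /space_deriv -/(space_deriv i v) sd1f//; have [_ ->] := d2 i j x t t0.
(* By [scheme_step] this discrete right-hand side is the time quotient itself, so its convergence
   yields differentiability in time and the equation at once. *)
pose W : R -> nat -> I -> R := fun h k Y => U h k Y `^ p * \sum_i Dq i (Dq i U) h k (Y - unitv i).
have cW (x : V) (t : R) : 0 < t -> unc W @ gridfilter F theta x t --> v x t `^ p * laplacian v x t.
  move=> t0; rewrite /laplacian; under eq_bigr do rewrite sd2//.
  apply: grid_rhs => //; [exact: vpos (ltW t0)|exact: cU (ltW t0)|by move=> i; exact: c2].
have dt (x : V) (t : R) : 0 < t -> is_derive t 1 (v x) (v x t `^ p * laplacian v x t).
  move=> t0; apply: (grid_time_derivative F theta U W (v x) x t _ FF F0 th0 t0); last exact: cW.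
    by move=> h k Y h0; exact: scheme_step.
  by move=> s s0; exact: cU.
have td (x : V) (t : R) : 0 < t -> time_deriv v x t = v x t `^ p * laplacian v x t.
  by move=> t0; rewrite /time_deriv derive1E; have [_ ->] := dt x t t0.
have cont (f : R -> nat -> I -> R) (D : set (V * R)) (g : V -> R -> R) :
    (forall x t, D (x, t) -> 0 <= t /\ unc f @ gridfilter F theta x t --> g x t) -> continuous_on D g.
  move=> H; apply: continuous_on_eps => x t Dx eta eta0.
  have [t0 fg] := H x t Dx; have [d d0 hd] := grid_continuous F theta f x t _ FF F0 th0 fg eta eta0.
  by exists d => // x' t' Dx' hx ht; have [t'0 fg'] := H _ _ Dx'; exact: hd fg'.
exists v; split.
- split.
  + by move=> x t t0 _; exact: vpos.
  + by apply: (cont U) => x t [/= t0 _]; split=> //; exact: cU.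
  + split.
    * move=> x t [/= t0 _]; split; first by have [] := dt x t t0.
        by move=> i; have [] := d1 i x t t0.
      by move=> i j; rewrite (sd1f i t t0); exact: (@ex_derive _ _ _ _ _ _ _ (d2 i j x t t0)).
    * by apply: (cont U) => x t [/= t0 _]; split; [exact: ltW|exact: cU (ltW t0)].
    * by apply: (cont W) => x t [/= t0 _]; split; [exact: ltW|rewrite td//; exact: cW].
    * by move=> i; apply: (cont (Dq i U)) => x t [/= t0 _]; split; [exact: ltW|rewrite sd1//; exact: c1].
    * by move=> i j; apply: (cont (Dq j (Dq i U))) => x t [/= t0 _]; split; [exact: ltW|rewrite sd2//; exact: c2].
  + by move=> x t t0 _; exact: td.
  + exact: v0E.
- move=> x t t0; have GF := gridfilter_proper F theta x t FF F0 th0 t0.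
  apply: (cvgr_to_le (cU x t t0)); apply: filterE => -[[h k] Y]; rewrite /unc /=.
  by have /andP[] := scheme_range _ _ _ _ dat h k Y.
- move=> eta T eta0 T0; have eta2 : 0 < eta / 2 by posR.
  have [X hX] := dec _ eta2.
  exists (X + 2 + M * (T + 1) / (theta * (eta / 2))) => x t i t0 tT xi.
  have := grid_decay _ _ _ _ F x t (eta / 2) X T _ i dat FF F0 (fun v => hX v i) eta2 t0 tT xi (cU x t t0).
  by rewrite -/(v x t); clear; lra.
Qed.

End Existence.

(** * Comparison *)

Section ExtremumTests.
Context {R : realType}.
Implicit Types (f g : R -> R).

Lemma is_derive_sub f g (s a b : R) : is_derive s 1 f a -> is_derive s 1 g b ->
  is_derive s 1 (fun t => f t - g t) (a - b).
Proof. by move=> df dg; exact: is_deriveB. Qed.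

Lemma is_derive_near {W : normedModType R} (f : W -> R) (x e : W) (g : R) : is_derive x e f g ->
  forall eta : R, 0 < eta -> exists2 d : R, 0 < d &
     forall s : R, `|s| <= d -> `|f (x + s *: e) - f x - s * g| <= `|s| * eta.
Proof.
move=> [df dv] eta eta0.
have L : h^-1 *: ((f \o shift x) (h *: e) - f x) @[h --> 0^'] --> g.
  by rewrite -dv; exact: df.
have /cvgrPdist_le/(_ _ eta0)/nbhs_ballP[d /= d0 hd] := L.
exists (d / 2); first by posR.
move=> s sd; have [->|s0] := eqVneq s 0.
  by rewrite scale0r addr0 subrr mul0r subrr normr0 mul0r.
have bs : ball (0 : R) d s.
  by rewrite /ball /= sub0r normrN; apply: le_lt_trans sd _; move: d0; clear; lra.
have := hd s bs s0; rewrite /= [s *: e + x]addrC => H.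
have s0' : 0 < `|s| by rewrite normr_gt0.
have -> : f (x + s *: e) - f x - s * g = - (s * (g - s^-1 *: (f (x + s *: e) - f x))).
  by rewrite /GRing.scale /=; field.
by rewrite normrN normrM ler_pM2l.
Qed.

(** One-sided, because the maximum over a space-time cylinder may be attained at the final time. *)
Lemma left_max_derivative f (t g d : R) : is_derive t 1 f g -> 0 < d ->
  (forall s, t - d <= s -> s <= t -> f s <= f t) -> 0 <= g.
Proof.
move=> df d0 H; rewrite leNgt; apply/negP => g0.
have eta0 : 0 < - g / 2 by rewrite divr_gt0// oppr_gt0.
have [e e0 he] := is_derive_near f t 1 g df _ eta0.
pose s := Num.min d e; have s0 : 0 < s by rewrite /s; posR.
have sd : s <= d by rewrite ge_min lexx.
have se : s <= e by rewrite ge_min lexx orbT.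
have := he (- s); rewrite normrN gtr0_norm// => /(_ se); rewrite /GRing.scale /= mulr1 ler_norml => /andP[h1 h2].
have := H (t - s) _ _; rewrite lerD2l lerN2 => /(_ sd); rewrite gerBl => /(_ (ltW s0)).
have := mulr_gt0 s0 eta0; move: h1 h2; clear; lra.
Qed.

Lemma max_derivative f (t g d : R) : is_derive t 1 f g -> 0 < d ->
  (forall s, `|s - t| <= d -> f s <= f t) -> g = 0.
Proof.
move=> df d0 H; apply/eqP; rewrite eq_le; apply/andP; split; last first.
  apply: (left_max_derivative f t g d df d0) => s h1 h2; apply: H.
  by rewrite ler_norml; apply/andP; split; move: h1 h2 d0; clear; lra.
have df' : is_derive (- t) 1 (fun s => f (- s)) (- g).
  have := @is_derive1_comp R f (fun s => - s) (- t) g (-1).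
  rewrite opprK mulrN1; apply => //.
rewrite -oppr_ge0; apply: (left_max_derivative _ _ _ d df' d0) => s h1 h2; rewrite opprK; apply: H.
by rewrite ler_norml; apply/andP; split; move: h1 h2 d0; clear; lra.
Qed.

(** If [f2] were positive, [f1] would vanish at 0 and be positive just after it, and [f] would
    increase to the right of 0 by the mean value theorem. *)
Lemma max_second_derivative f f1 (f2 d : R) : 0 < d ->
  (forall s : R, `|s| <= d -> is_derive s 1 f (f1 s)) -> is_derive (0 : R) 1 f1 f2 ->
  (forall s : R, `|s| <= d -> f s <= f 0) -> f2 <= 0.
Proof.
move=> d0 df df1 H; rewrite leNgt; apply/negP => g0.
have z0 : `|0 : R| <= d by rewrite normr0 ltW.
have f10 : f1 0 = 0.
  by apply: (max_derivative f 0 _ d (df 0 z0) d0) => s; rewrite subr0; exact: H.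
have eta0 : 0 < f2 / 2 by posR.
have [e e0 he] := is_derive_near f1 0 1 f2 df1 _ eta0.
pose s := Num.min d e; have s0 : 0 < s by rewrite /s; posR.
have sd : s <= d by rewrite ge_min lexx.
have se : s <= e by rewrite ge_min lexx orbT.
have nd (r : R) : 0 <= r -> r <= s -> `|r| <= d.
  by move=> r0 rs; rewrite ger0_norm//; exact: le_trans sd.
have hd (x : R) : x \in `]0, s[%R -> is_derive x 1 f (f1 x).
  by rewrite in_itv /= => /andP[x0 xs]; apply: df; apply: nd; exact: ltW.
have hc : {within `[0, s], continuous f}.
  apply: derivable_within_continuous => x; rewrite in_itv /= => /andP[x0 xs].
  by have [] := df x (nd x x0 xs).
have [c] := @MVT _ f f1 0 s s0 hd hc.
rewrite in_itv /= => /andP[c0 cs]; rewrite subr0 => E.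
have ce : `|c| <= e by rewrite gtr0_norm//; apply: le_trans se; exact: ltW.
have := he c ce; rewrite f10 add0r subr0 (gtr0_norm c0) /GRing.scale /= mulr1 ler_norml => /andP[h1 _].
have fc : 0 < f1 c by have := mulr_gt0 c0 eta0; move: h1; clear; lra.
have := H s (nd s (ltW s0) (lexx s)).
have := mulr_gt0 fc s0; move: E; clear; lra.
Qed.

End ExtremumTests.

(** * Testing the Laplacian with functions of the squared distance to the origin *)

Section RadialTests.
Context {R : realType} {n : nat}.
Local Notation V := ('rV[R]_n).
Implicit Types (x : V) (i : 'I_n).

Definition sqn x : R := \sum_i x 0 i ^+ 2.

Lemma sqn_line x i (s : R) : sqn (x + s *: delta_mx 0 i) = sqn x + s * (2 * x 0 i + s).
Proof.
rewrite /sqn [in LHS](bigD1 i)//= [in RHS](bigD1 i)//= !mxE !eqxx mulr1.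
have -> : \sum_(j | j != i) (x + s *: delta_mx 0 i) 0 j ^+ 2 = \sum_(j | j != i) x 0 j ^+ 2.
  by apply: eq_bigr => j ji; rewrite !mxE (negbTE ji) andbF mulr0 addr0.
ring.
Qed.

Lemma is_derive_along (f : V -> R) x i (s g : R) : is_derive (x + s *: delta_mx 0 i) (delta_mx 0 i) f g ->
  is_derive s 1 (fun r => f (x + r *: delta_mx 0 i)) g.
Proof.
move=> df; apply: is_derive_increment => eta eta0.
have [d d0 hd] := is_derive_near _ _ _ _ df eta eta0.
exists d => // r rd; have := hd r rd.
have -> : r *: (1 : R) = r by rewrite /GRing.scale /= mulr1.
by rewrite scalerDl addrA.
Qed.

Lemma is_derive_radial (phi : R -> R) (g : R) x i (s : R) :
  is_derive (sqn (x + s *: delta_mx 0 i)) 1 phi g ->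
  is_derive s 1 (fun r => phi (sqn (x + r *: delta_mx 0 i))) (g * (2 * x 0 i + s * 2)).
Proof.
move=> dphi; apply: (@is_derive1_comp R phi (fun r => sqn (x + r *: delta_mx 0 i))) => //.
have -> : (fun r => sqn (x + r *: delta_mx 0 i)) = (fun r => sqn x + r * (2 * x 0 i + r)).
  by apply/funext => r; exact: sqn_line.
apply: is_derive_increment => eta eta0; exists eta => // r hr.
rewrite /GRing.scale /= mulr1.
have -> : sqn x + (s + r) * (2 * x 0 i + (s + r)) - (sqn x + s * (2 * x 0 i + s)) - r * (2 * x 0 i + s * 2) = r * r by ring.
by rewrite normrM ler_wpM2l.
Qed.

Lemma is_derive_radial2 (phi1 : R -> R) (g : R) x i :
  is_derive (sqn x) 1 phi1 g ->
  is_derive (0 : R) 1 (fun r => phi1 (sqn (x + r *: delta_mx 0 i)) * (2 * x 0 i + r * 2))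
    (4 * x 0 i ^+ 2 * g + 2 * phi1 (sqn x)).
Proof.
move=> dphi.
have x0 : x + 0 *: delta_mx 0 i = x by rewrite scale0r addr0.
have d1 : is_derive (0 : R) 1 (fun r => phi1 (sqn (x + r *: delta_mx 0 i))) (g * (2 * x 0 i + 0 * 2)).
  by apply: is_derive_radial; rewrite x0.
have d2 : is_derive (0 : R) 1 (fun r => 2 * x 0 i + r * 2) 2 by exact: is_derive_line.
apply: (is_derive_eq (is_deriveM d1 d2)); rewrite x0 /GRing.scale /=; ring.
Qed.

(* [sg = 1] at a maximum and [sg = -1] at a minimum of [v - phi (|x|^2)]. *)
Lemma radial_laplacian_test (v : V -> R -> R) (phi phi1 : R -> R) (phi2 d sg : R) x (t : R) :
  (forall y i, derivable (v ^~ t) y (delta_mx 0 i)) ->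
  (forall i, derivable (space_deriv i v ^~ t) x (delta_mx 0 i)) -> 0 < d ->
  (forall q, `|q - sqn x| <= d -> is_derive q 1 phi (phi1 q)) -> is_derive (sqn x) 1 phi1 phi2 ->
  (forall y, `|sqn y - sqn x| <= d -> sg * (v y t - phi (sqn y)) <= sg * (v x t - phi (sqn x))) ->
  sg * laplacian v x t <= sg * (4 * sqn x * phi2 + 2 * n%:R * phi1 (sqn x)).
Proof.
move=> dv dv2 d0 dphi dphi1 H.
have -> : 4 * sqn x * phi2 + 2 * n%:R * phi1 (sqn x) =
    \sum_i (4 * x 0 i ^+ 2 * phi2 + 2 * phi1 (sqn x)).
  by rewrite big_split /= -mulr_suml -mulr_sumr sumr_const card_ord -/(sqn x) -[X in _ + X = _]mulrA mulr_natl; ring.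
rewrite /laplacian !mulr_sumr; apply: ler_sum => i _.
have xb : 0 < 2 * `|x 0 i| + 1 by rewrite ltr_wpDl// mulr_ge0.
pose e := Num.min 1 (d / (2 * `|x 0 i| + 1)).
have e0 : 0 < e by rewrite lt_min ltr01 divr_gt0.
have near (s : R) : `|s| <= e -> `|sqn (x + s *: delta_mx 0 i) - sqn x| <= d.
  rewrite le_min => /andP[s1]; rewrite ler_pdivlMr// => sd.
  rewrite sqn_line addrAC subrr add0r normrM; apply: le_trans sd; rewrite ler_wpM2l//.
  by apply: le_trans (ler_normD _ _) _; rewrite normrM (ger0_norm (ltac:(by []) : 0 <= 2 :> R)) lerD2l.
have x0 : x + 0 *: delta_mx 0 i = x by rewrite scale0r addr0.
pose f (s : R) := sg * (v (x + s *: delta_mx 0 i) t - phi (sqn (x + s *: delta_mx 0 i))).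
pose f1 (s : R) := sg * (space_deriv i v (x + s *: delta_mx 0 i) t - phi1 (sqn (x + s *: delta_mx 0 i)) * (2 * x 0 i + s * 2)).
have D1 (s : R) : `|s| <= e -> is_derive s 1 f (f1 s).
  move=> se; apply: is_derive_scale.
  apply: (is_derive_sub (fun s => v (x + s *: delta_mx 0 i) t) (fun s => phi (sqn (x + s *: delta_mx 0 i)))).
    by apply: (is_derive_along (v ^~ t)); apply: DeriveDef.
  by apply: is_derive_radial; apply: dphi; exact: near.
have D2 : is_derive (0 : R) 1 f1 (sg * (space_deriv i (space_deriv i v) x t - (4 * x 0 i ^+ 2 * phi2 + 2 * phi1 (sqn x)))).
  apply: is_derive_scale.
  apply: (is_derive_sub (fun s => space_deriv i v (x + s *: delta_mx 0 i) t)
    (fun s => phi1 (sqn (x + s *: delta_mx 0 i)) * (2 * x 0 i + s * 2))).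
    by apply: (is_derive_along (space_deriv i v ^~ t)); rewrite x0; apply: DeriveDef.
  exact: is_derive_radial2.
have := max_second_derivative f f1 _ e e0 D1 D2.
rewrite mulrBr subr_le0; apply => s se; rewrite /f x0; apply: H; exact: near.
Qed.

End RadialTests.

(** * Comparison with barriers from above and from below *)

Section Comparison.
Context {R : realType} {n : nat}.
Local Notation V := ('rV[R]_n).
Implicit Types (x : V) (v u : V -> R -> R).

Lemma solution_facts (p : R) (u0 : V -> R) v : positive_classical_solution p u0 +oo%E v ->
  [/\ forall x t, 0 <= t -> 0 < v x t,
      forall x (t : R), 0 < t -> is_derive t 1 (v x) (v x t `^ p * laplacian v x t),
      forall x t i, 0 < t -> derivable (v ^~ t) x (delta_mx 0 i),
      forall x t i, 0 < t -> derivable (space_deriv i v ^~ t) x (delta_mx 0 i) &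
      {within [set z : V * R | 0 <= z.2], continuous (fun z => v z.1 z.2)} /\ forall x, v x 0 = u0 x].
Proof.
move=> [pos cont [der _ _ _ _] eq init]; split.
- by move=> x t t0; apply: pos => //; exact: ltry.
- move=> x t t0; have Dt : open_start +oo%E (x, t) by split=> //; exact: ltry.
  have [dt _ _] := der x t Dt; apply: DeriveDef => //.
  by rewrite -eq ?ltry// /time_deriv derive1E.
- by move=> x t i t0; have [|_ h _] := der x t; [split=> //; exact: ltry|exact: h].
- by move=> x t i t0; have [|_ _ h] := der x t; [split=> //; exact: ltry|exact: h].
- split=> //; apply: continuous_subspaceW cont => z /= z0; split=> //; exact: ltry.
Qed.

Lemma cylinder_max (f : V * R -> R) (X T : R) : 0 <= X -> 0 <= T ->
  {within [set z : V * R | 0 <= z.2], continuous f} ->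
  exists x t, [/\ cube X x, 0 <= t <= T & forall y s, cube X y -> 0 <= s <= T -> f (y, s) <= f (x, t)].
Proof.
move=> X0 T0 cf.
pose K : set (V * R) := [set v : V | forall i, `|v 0 i| <= X] `*` `[0, T]%classic.
have cK : compact K by apply: compact_setX; [exact: lattice_sup_norm|exact: segment_compact].
have cfK : {within K, continuous f}.
  by apply: continuous_subspaceW cf => -[y s] [_ /=]; rewrite in_itv /= => /andP[].
have [|[x t]] := compact_EVT_max _ cK cfK.
  by exists (0, 0); split=> [i|] /=; rewrite ?mxE ?normr0// in_itv /= lexx.
rewrite inE => -[/= cx]; rewrite in_itv /= => ht H; exists x, t; split=> // y s cy hs.
by apply: H; rewrite inE; split=> //=; rewrite in_itv.
Qed.

Lemma powR_lipschitz (p M a b : R) : 1 <= p -> 0 < a -> a <= b -> b <= M ->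
  b `^ p - a `^ p <= p * M `^ (p - 1) * (b - a).
Proof.
move=> p1 a0 ab bM.
have c1 : c1_on a b (fun s => s `^ p) (fun s => p * s `^ (p - 1)).
  by move=> s /andP[as_ _]; apply: is_derive1_powR; exact: lt_le_trans as_.
have bn : bnd_on a b (p * M `^ (p - 1)) (fun s => p * s `^ (p - 1)).
  move=> s /andP[as_ sb]; rewrite normrM !ger0_norm ?powR_ge0//; last by apply: le_trans p1.
  rewrite ler_wpM2l//; first by apply: le_trans p1.
  apply: powR_mono; [by rewrite subr_ge0|by apply: le_trans as_; exact: ltW|by apply: le_trans bM].
have := lipschitz_on _ _ _ _ _ c1 bn a b; rewrite !lexx ab => /(_ isT isT).
rewrite [`|b - a|]ger0_norm ?subr_ge0//; apply: le_trans; exact: ler_norm.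
Qed.

(* [W] is touched from above at [(q, t)] by smooth functions [phi] of [q = |x|^2] and
   [psi] of [t] that satisfy the supersolution inequality there. *)
Record upper_jet (p D : R) (W : R -> R -> R) (q t : R) : Prop := UpperJet {
  _ : exists (phi phi1 psi : R -> R) (phi2 psi1 d : R),
    [/\ 0 < d /\ phi q = W q t /\ psi t = W q t,
        forall q', `|q' - q| <= d -> is_derive q' 1 phi (phi1 q') /\ W q' t <= phi q',
        is_derive q 1 phi1 phi2,
        is_derive t 1 psi psi1 /\ (forall t', t - d <= t' -> t' <= t -> W q t' <= psi t') &
        4 * q * phi2 + 2 * n%:R * phi1 q <= D /\
        W q t `^ p * (4 * q * phi2 + 2 * n%:R * phi1 q) <= psi1] }.

Lemma is_derive_expR_scale (L t : R) : is_derive t 1 (fun s => expR (- (L * s))) (- L * expR (- (L * t))).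
Proof.
have := @is_derive1_comp R expR (fun s => - (L * s)) t (expR (- (L * t))) (- L).
rewrite [_ * - L]mulrC; apply.
have -> : (fun s => - (L * s)) = (fun s : R => 0 + s * (- L)) by apply/funext => s; ring.
exact: is_derive_line.
Qed.

(* At a positive maximum of [(v - W) e^(-Lam t)] one has v > W, so the wrong sign of
   [v^p - W^p] where [Delta W > 0] is absorbed by [Lam (v - W)]. *)
Lemma comparison (p Mx D T : R) (u0 : V -> R) v (W : R -> R -> R) :
  1 <= p -> 0 < Mx -> 0 <= D -> 0 <= T -> positive_classical_solution p u0 +oo%E v ->
  (forall x t, 0 <= t -> v x t <= Mx) ->
  (forall eta : R, 0 < eta -> exists X : R, forall x t i, 0 <= t -> t <= T -> X <= `|x 0 i| -> v x t <= eta) ->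
  (forall q t, 0 <= q -> 0 <= t -> 0 < W q t) ->
  {within [set z : V * R | 0 <= z.2], continuous (fun z => W (sqn z.1) z.2)} ->
  (forall x, u0 x <= W (sqn x) 0) ->
  (forall q t, 0 <= q -> 0 < t -> t <= T -> upper_jet p D W q t) ->
  forall x t, 0 <= t -> t <= T -> v x t <= W (sqn x) t.
Proof.
move=> p1 M0 D0 T0 sol vM dec Wpos cW init jet x1 t1 t10 t1T.
have [vpos vt dv dv2 [cv v0]] := solution_facts _ _ _ sol.
have sq0 (y : V) : 0 <= sqn y by apply: sumr_ge0 => i _; exact: sqr_ge0.
rewrite leNgt; apply/negP => bad.
(* A Lipschitz constant of [s^p] up to [Mx], times the bound [D] on the Laplacian of the barrier,
   plus 1 for strictness. *)
pose Lam := p * Mx `^ (p - 1) * D + 1.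
have pM : 0 <= p * Mx `^ (p - 1) by rewrite mulr_ge0 ?powR_ge0//; exact: le_trans p1.
have Lam0 : 0 < Lam by rewrite ltr_wpDl// mulr_ge0.
pose z (y : V) (s : R) := (v y s - W (sqn y) s) * expR (- (Lam * s)).
have z1 : 0 < z x1 t1 by rewrite mulr_gt0 ?expR_gt0// subr_gt0.
(* Far out [v] is below half the assumed positive excess, so the maximum over a large compact
   cylinder is a global one. This is where decay at infinity enters. *)
have [X1 hX1] := dec (z x1 t1 / 2) (ltac:(by rewrite divr_gt0)).
have [X2 X20 hX2] := cube_exists x1.
pose X := X2 + `|X1|.
have X0 : 0 <= X by rewrite addr_ge0// ltW.
have cz : {within [set z : V * R | 0 <= z.2], continuous (fun y => z y.1 y.2)}.
  move=> y; apply: (@cvgM _ _ _ _ (fun y => v y.1 y.2 - W (sqn y.1) y.2)).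
    by apply: cvgB; [exact: cv|exact: cW].
  have ce : continuous (fun y : V * R => expR (- (Lam * y.2))).
    move=> w; apply: (continuous_comp (f := fun y : V * R => - (Lam * y.2))); last exact: continuous_expR.
    by apply: cvgN; apply: cvgM; [exact: cvg_cst|exact: cvg_snd].
  exact: (continuous_subspaceT ce).
have [x [t [cx /andP[t0 tT] mx]]] := cylinder_max _ X T X0 T0 cz.
have zmax : z x1 t1 <= z x t.
  apply: mx; last by rewrite t10.
  by move=> i; apply: le_trans (hX2 i) _; rewrite lerDl.
have glob y s : 0 <= s -> s <= T -> z y s <= z x t.
  move=> s0 sT; have [/forallP cy|/forallPn[i]] := boolP [forall i, `|y 0 i| <= X].
    by apply: mx; rewrite ?s0.
  rewrite -ltNge => yi; have vy : v y s <= z x1 t1 / 2.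
    apply: hX1 (ltW _) => //; last by apply: le_lt_trans yi; rewrite /X; have := ler_norm X1; move: X20; clear; lra.
  have Wy := Wpos _ _ (sq0 y) s0; have vp := vpos y s s0.
  have e1 : expR (- (Lam * s)) <= 1.
    by rewrite -expR0 ler_expR oppr_le0 mulr_ge0// ltW.
  apply: le_trans zmax; rewrite [z y s]/z.
  apply: (@le_trans _ _ (v y s * expR (- (Lam * s)))).
    by rewrite ler_wpM2r ?expR_ge0//; move: Wy; clear; lra.
  apply: (@le_trans _ _ (v y s)); first by rewrite ler_piMr// ltW.
  by apply: le_trans vy _; move: z1; clear; lra.
have zp : 0 < z x t by exact: lt_le_trans zmax.
have dpos : 0 < v x t - W (sqn x) t by move: zp; rewrite /z pmulr_lgt0// expR_gt0.
have tp : 0 < t.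
  rewrite lt_neqAle t0 andbT eq_sym; apply/eqP => tz.
  by move: dpos; rewrite tz v0; have := init x; clear; lra.
have [[phi [phi1 [psi [phi2 [psi1 [d [[d0 [pq pt]] dphi dphi1 [dpsi hpsi] [lD sup]]]]]]]]] := jet (sqn x) t (sq0 x) tp tT.
have lap : laplacian v x t <= 4 * sqn x * phi2 + 2 * n%:R * phi1 (sqn x).
  have := radial_laplacian_test v phi phi1 phi2 d 1 x t (fun y i => dv y t i tp) (fun i => dv2 x t i tp) d0
    (fun q hq => proj1 (dphi q hq)) dphi1.
  rewrite !mul1r; apply => y hy; rewrite !mul1r pq.
  have := glob y t t0 tT; rewrite /z ler_pM2r ?expR_gt0//.
  by have [_] := dphi _ hy; clear; lra.
set lp := 4 * sqn x * phi2 + _ in lap lD sup.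
have dder : 0 <= (v x t `^ p * laplacian v x t - psi1) * expR (- (Lam * t)) +
    (v x t - psi t) * (- Lam * expR (- (Lam * t))).
  pose dd := Num.min d t; have dd0 : 0 < dd by rewrite /dd; posR.
  have D1 := is_derive_sub _ _ _ _ _ (vt x t tp) dpsi.
  have D2 := is_derive_expR_scale Lam t.
  apply: (left_max_derivative (fun s => (v x s - psi s) * expR (- (Lam * s))) t _ dd _ dd0).
    by apply: (is_derive_eq (is_deriveM D1 D2)); rewrite /GRing.scale /=; ring.
  move=> s s1 s2; rewrite pt; have ddd : dd <= d by rewrite ge_min lexx.
  have ddt : dd <= t by rewrite ge_min lexx orbT.
  have s0 : 0 <= s by move: s1 ddt; clear; lra.
  have hW := hpsi s (ltac:(move: s1 ddd; clear; lra)) s2.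
  apply: le_trans (glob x s s0 (le_trans s2 tT)); rewrite ler_wpM2r ?expR_ge0//.
  by move: hW; clear; lra.
have Wp := Wpos _ _ (sq0 x) t0.
set w := W (sqn x) t in dpos Wp sup pt *; set vv := v x t in dpos dder *.
have e0 : 0 < expR (- (Lam * t)) by rewrite expR_gt0.
rewrite pt in dder.
have dd : Lam * (vv - w) <= vv `^ p * laplacian v x t - psi1.
  rewrite -(ler_pM2r e0); move: dder; clear; lra.
have vp0 : 0 <= vv `^ p by exact: powR_ge0.
have h1 := ler_wpM2l vp0 lap.
have lip := powR_lipschitz p Mx w vv p1 Wp (ltac:(move: dpos; clear; lra)) (vM x t t0).
have mono : w `^ p <= vv `^ p.
  by apply: powR_mono; [exact: le_trans p1|exact: ltW|move: dpos; clear; lra].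
have h2 : (vv `^ p - w `^ p) * lp <= p * Mx `^ (p - 1) * (vv - w) * D.
  apply: (@le_trans _ _ ((vv `^ p - w `^ p) * D)); first by rewrite ler_wpM2l// subr_ge0.
  by rewrite ler_wpM2r.
move: dd h1 sup h2; rewrite /Lam; move: dpos; clear; lra.
Qed.

Lemma continuous_sqn_fst : continuous (fun y : V * R => sqn y.1).
Proof.
move=> w; apply: (@cvg_finsum R _ (nbhs w) _ _ (fun i (y : V * R) => y.1 0 i ^+ 2) (fun i => w.1 0 i ^+ 2)) => i.
have ci : (fun y : V * R => y.1 0 i) @ w --> w.1 0 i.
  apply: (continuous_comp (f := fst) (g := fun v : V => v 0 i)); first exact: cvg_fst.
  exact: coord_continuous.
by rewrite expr2; apply: cvgM.
Qed.

(* Subsolution [del e^(-K t) (rho^2 - |x|^2)] supported in a ball: at a negative minimum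
   of the difference [u] lies below it, so [u^p] is controlled. *)
Lemma lower_paraboloid (p del rho2 K T : R) (u0 : V -> R) u :
  1 <= p -> 0 < del -> 0 < rho2 -> 0 <= T -> 2 * n%:R * del * (del * rho2) `^ (p - 1) < K ->
  positive_classical_solution p u0 +oo%E u ->
  (forall x, del * (rho2 - sqn x) <= u0 x) ->
  forall x t, 0 <= t -> t <= T -> del * expR (- (K * t)) * (rho2 - sqn x) <= u x t.
Proof.
move=> p1 del0 rho0 T0 hK sol init x1 t1 t10 t1T.
have [vpos vt dv dv2 [cv v0]] := solution_facts _ _ _ sol.
have sq0 y : 0 <= sqn (y : V) by apply: sumr_ge0 => i _; exact: sqr_ge0.
have K0 : 0 < K by apply: le_lt_trans hK; rewrite !mulr_ge0 ?powR_ge0// ltW.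
rewrite leNgt; apply/negP => bad.
pose ph (y : V) (s : R) := del * expR (- (K * s)) * (rho2 - sqn y).
pose z (y : V) (s : R) := ph y s - u y s.
have z1 : 0 < z x1 t1 by rewrite subr_gt0.
have [X2 X20 hX2] := cube_exists x1.
(* The cube contains the given point and every [y] with [|y|^2 <= 2 rho2], in particular a
   neighbourhood of the ball where the paraboloid is positive, so a positive maximum is local in
   space. *)
pose X := X2 + rho2 + 1.
have X0 : 0 <= X by rewrite !addr_ge0// ltW.
have cz : {within [set z : V * R | 0 <= z.2], continuous (fun y => z y.1 y.2)}.
  move=> y; apply: cvgB; last exact: cv.
  have ce : continuous (fun y : V * R => ph y.1 y.2).
    move=> w; apply: cvgM.
      apply: cvgM; first exact: cvg_cst.
      apply: (continuous_comp (f := fun y : V * R => - (K * y.2))); last exact: continuous_expR.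
      by apply: cvgN; apply: cvgM; [exact: cvg_cst|exact: cvg_snd].
    by apply: cvgB; [exact: cvg_cst|exact: continuous_sqn_fst].
  exact: (continuous_subspaceT ce).
have [x [t [cx /andP[t0 tT] mx]]] := cylinder_max _ X T X0 T0 cz.
have zmax : z x1 t1 <= z x t.
  apply: mx; last by rewrite t10.
  by move=> i; apply: le_trans (hX2 i) _; rewrite /X -addrA lerDl addr_ge0// ltW.
have zp : 0 < z x t by exact: lt_le_trans zmax.
have up := vpos x t t0.
have e0 s : 0 < expR (- (K * s)) by rewrite expR_gt0.
have php : 0 < ph x t by move: zp up; rewrite /z; clear; lra.
have qr : sqn x < rho2.
  move: php; rewrite /ph pmulr_rgt0 ?subr_gt0// mulr_gt0//.
have tp : 0 < t.
  rewrite lt_neqAle t0 andbT eq_sym; apply/eqP => tz.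
  by move: zp; rewrite /z /ph tz v0 mulr0 oppr0 expR0 mulr1; have := init x; clear; lra.
pose b := del * expR (- (K * t)).
have b0 : 0 < b by rewrite mulr_gt0.
pose d := rho2 - sqn x; have d0 : 0 < d by rewrite subr_gt0.
have cubeq (y : V) : sqn y <= rho2 + rho2 -> cube X y.
  move=> yq i; have h1 : y 0 i ^+ 2 <= 2 * rho2.
    apply: (@le_trans _ _ (sqn y)); last by move: yq; clear; lra.
    by rewrite /sqn (bigD1 i)//= lerDl; apply: sumr_ge0 => j _; exact: sqr_ge0.
  rewrite -(@ler_pXn2r _ 2) ?nnegrE// real_normK ?num_real//; apply: le_trans h1 _.
  by rewrite /X; have := mulr_gt0 rho0 X20; have := sqr_ge0 X2; have := sqr_ge0 rho2; move: rho0 X20; clear; lra.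
pose phi (q : R) := b * (rho2 - q).
have dphi (q : R) : is_derive q 1 phi (- b).
  have -> : phi = (fun q => b * rho2 + q * (- b)) by apply/funext => r; rewrite /phi; ring.
  exact: is_derive_line.
have lap : - laplacian u x t <= 2 * n%:R * b.
  have := radial_laplacian_test u phi (fun=> - b) 0 d (-1) x t (fun y i => dv y t i tp) (fun i => dv2 x t i tp) d0
    (fun q _ => dphi q) (is_derive_cst _ _ _).
  rewrite mulr0 add0r !mulN1r mulrN opprK; apply => y hy; rewrite !mulN1r !opprB.
  apply: (mx y t); last by rewrite t0.
  apply: cubeq; move: hy; rewrite ler_norml => /andP[_]; rewrite /d; move: rho0; clear; lra.
have dder : 0 <= - K * ph x t - u x t `^ p * laplacian u x t.
  have D1 : is_derive t 1 (fun s => ph x s) (- K * ph x t).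
    have -> : (fun s => ph x s) = (fun s => (del * (rho2 - sqn x)) * expR (- (K * s))).
      by apply/funext => s; rewrite /ph; ring.
    have -> : - K * ph x t = (del * (rho2 - sqn x)) * (- K * expR (- (K * t))) by rewrite /ph; ring.
    by apply: is_derive_scale; exact: is_derive_expR_scale.
  have D2 := is_derive_sub _ _ _ _ _ D1 (vt x t tp).
  apply: (left_max_derivative _ t _ t D2 tp) => s s1 s2.
  have s0 : 0 <= s by move: s1; clear; lra.
  by apply: (mx x s) => //; rewrite s0 (le_trans s2).
set ut := u x t in up dder.
have uph : ut <= ph x t by move: zp; rewrite /z -/ut; clear; lra.
have phle : ph x t <= del * rho2.
  rewrite /ph -mulrA ler_wpM2l ?(ltW del0)//.
  apply: (@le_trans _ _ (1 * rho2)); last by rewrite mul1r.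
  apply: ler_pM => //; [by rewrite subr_ge0 ltW| |by have := sq0 x; clear; lra].
  by rewrite -expR0 ler_expR oppr_le0 mulr_ge0// ltW.
have up0 : 0 <= ut `^ p by exact: powR_ge0.
have h1 := ler_wpM2l up0 lap.
have h2 : ut `^ p <= ph x t * (del * rho2) `^ (p - 1).
  have -> : ut `^ p = ut * ut `^ (p - 1) by rewrite mulr_powRB1// ?ltW//; exact: lt_le_trans p1.
  apply: ler_pM => //; [exact: ltW|exact: powR_ge0|].
  by apply: powR_mono; [rewrite subr_ge0|exact: ltW|exact: le_trans phle].
have bdel : b <= del.
  by rewrite /b ler_piMr ?(ltW del0)// -expR0 ler_expR oppr_le0 mulr_ge0// ltW.
have nb : 0 <= 2 * n%:R * b by rewrite !mulr_ge0// ltW.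
have h3 := ler_wpM2l nb h2.
have h4 : 2 * n%:R * b * (ph x t * (del * rho2) `^ (p - 1)) <= ph x t * (2 * n%:R * del * (del * rho2) `^ (p - 1)).
  have -> : 2 * n%:R * b * (ph x t * (del * rho2) `^ (p - 1)) = ph x t * (2 * n%:R * b * (del * rho2) `^ (p - 1)) by ring.
  by rewrite ler_pM2l// ler_wpM2r ?powR_ge0// ler_wpM2l// mulr_ge0.
have h5 : ph x t * (2 * n%:R * del * (del * rho2) `^ (p - 1)) < ph x t * K by rewrite ltr_pM2l.
by move: dder h1 h3 h4 h5; clear; lra.
Qed.

End Comparison.

(** * The self-similar barrier *)

Section Barrier.
Context {R : realType}.

(** [kap (p s + 1) = 1] makes [P^(p s + 1)] affine in time, as the scaling of the equation dictates.
    The equation for [kap L] is the supersolution inequality in the outer region, the next condition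
    the one for the inner profile. The last says that the slope in [q] drops across the corner,
    which is therefore concave. *)
Record barrier_data (p s A dl b L kap : R) : Prop := BarrierData {
  _ : 1 < p; _ : 0 < s; _ : 0 < A; _ : 0 < dl <= 1; _ : 0 < b; _ : 0 < L; _ : 0 < kap;
  _ : kap * (p * s + 1) = 1;
  _ : kap * L = 8 * A `^ p * (s + 1) * dl `^ (- (p * s)) / dl;
  _ : kap * L * (s + 1) <= 2 * (b * (b / (s + 1)) `^ (p - 1));
  _ : b < s * A * dl `^ (- s - 1) }.

(** As [dl] tends to 0, [kap L] is of order [dl^(- p s - 1)]. The inner condition then forces [b] to
    be of order at least [dl^(- s - 1/p)], while the corner allows orders below [dl^(- s - 1)]. For
    [p > 1] these are compatible once [dl^(p - 1) = e^2] is small; [b^p = B] is equality in the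
    inner condition. *)
Lemma barrier_data_exists (p s A : R) : 1 < p -> 0 < s -> 0 < A ->
  exists dl b L kap, barrier_data p s A dl b L kap.
Proof.
move=> p1 s0 A0; have p0 : 0 < p by apply: lt_trans p1.
have pm : 0 < p - 1 by rewrite subr_gt0.
have s1 : 0 < s + 1 by posR.
have c0 : 0 < 4 * (s + 1) `^ (p + 1) by rewrite mulr_gt0// powR_gt0.
have d0 : 0 < s `^ p / 2 by rewrite divr_gt0// powR_gt0.
have [e /andP[e0 e1] he] := small_square _ _ (ltW c0) d0.
pose dl := (e ^+ 2) `^ (p - 1)^-1.
have e2 : 0 < e ^+ 2 by posR.
have dl0 : 0 < dl by rewrite powR_gt0.
have dl1 : dl <= 1.
  have <- : 1 `^ (p - 1)^-1 = 1 :> R by rewrite powR1.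
  apply: powR_mono; [by rewrite invr_ge0 ltW|exact: ltW|].
  by rewrite exprn_ile1// ltW.
have dlp : dl `^ (p - 1) = e ^+ 2.
  by rewrite /dl -powRrM mulVf ?gt_eqF// powRr1// ltW.
pose kap := (p * s + 1)^-1; have kap0 : 0 < kap by rewrite /kap; posR.
have Ap : 0 < A `^ p by rewrite powR_gt0.
have dps : 0 < dl `^ (- (p * s)) by rewrite powR_gt0.
pose L := 8 * A `^ p * (s + 1) * dl `^ (- (p * s)) / dl / kap.
pose B := 4 * A `^ p * (s + 1) `^ (p + 1) * dl `^ (- (p * s)) / dl.
have sp1 : 0 < (s + 1) `^ (p + 1) by rewrite powR_gt0.
have B0 : 0 < B by rewrite /B; posR.
pose b := B `^ p^-1.
have b0 : 0 < b by rewrite powR_gt0.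
have bp : b `^ p = B by rewrite /b -powRrM mulVf ?gt_eqF// powRr1// ltW.
exists dl, b, L, kap; split => //.
- by rewrite dl0.
- by rewrite /L; posR.
- by rewrite /kap mulVf// gt_eqF//; posR.
- by rewrite /L; field; rewrite !gt_eqF.
- rewrite powRM ?invr_ge0 ?(ltW b0) ?(ltW s1)//.
  have -> : b * (b `^ (p - 1) * (s + 1)^-1 `^ (p - 1)) = b `^ p * (s + 1)^-1 `^ (p - 1).
    by rewrite mulrA mulr_powRB1// ltW.
  have -> : (s + 1)^-1 `^ (p - 1) = ((s + 1) `^ (p - 1))^-1.
    by rewrite -powR_inv1 ?(ltW s1)// -powRrM mulN1r powRN.
  have q0 : 0 < (s + 1) `^ (p - 1) by rewrite powR_gt0.
  have -> : b `^ p * ((s + 1) `^ (p - 1))^-1 = 4 * A `^ p * (s + 1) ^+ 2 * dl `^ (- (p * s)) / dl.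
    have -> : b `^ p = 4 * A `^ p * ((s + 1) `^ (p - 1) * (s + 1) ^+ 2) * dl `^ (- (p * s)) / dl.
      rewrite bp /B -powR_mulrn ?(ltW s1)// -powRD; last by rewrite (gt_eqF s1) implybT.
      by have -> : p - 1 + 2 = p + 1 by ring.
    by field; rewrite !gt_eqF.
  rewrite le_eqVlt; apply/orP; left; apply/eqP; rewrite /L; field; rewrite !gt_eqF//.
- have sA : 0 <= s * A * dl `^ (- s - 1) by rewrite !mulr_ge0 ?powR_ge0// ltW.
  have H : b `^ p < (s * A * dl `^ (- s - 1)) `^ p.
    have sA' : 0 <= s * A by rewrite mulr_ge0// ltW.
    rewrite bp (powRM p sA' (powR_ge0 _ _)) (powRM p (ltW s0) (ltW A0)).
    rewrite -powRrM.
    have -> : (- s - 1) * p = - (p * s) + (- p) by ring.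
    rewrite powRD; last by rewrite (gt_eqF dl0) implybT.
    have -> : dl `^ (- p) = (dl * e ^+ 2)^-1.
      rewrite -dlp powRN; congr (_^-1); rewrite mulr_powRB1// ltW//.
    rewrite /B -subr_gt0.
    have -> : s `^ p * A `^ p * (dl `^ (- (p * s)) * (dl * e ^+ 2)^-1) -
       4 * A `^ p * (s + 1) `^ (p + 1) * dl `^ (- (p * s)) / dl =
       (s `^ p - 4 * (s + 1) `^ (p + 1) * e ^+ 2) * (A `^ p * dl `^ (- (p * s)) / (dl * e ^+ 2)).
      by field; rewrite !gt_eqF.
    apply: mulr_gt0; last by posR.
    have sp : 0 < s `^ p by rewrite powR_gt0.
    by move: he sp; clear; lra.
  rewrite ltNge; apply/negP => h; move: H; rewrite ltNge; apply/negP; rewrite negbK.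
  by apply: powR_mono => //; exact: ltW.
Qed.

(* [P] is the square of the length scale [rho (t)]; with [s = gamma / 2] the barrier is
   [rho^(- gamma)] times a profile of [q / rho^2], where [q] stands for [|x|^2]. *)
Definition bP (L kap t : R) := (L * (t + L^-1)) `^ kap.

Definition bW (s A dl b L kap q t : R) : R :=
  let P := bP L kap t in
  if q <= (1 + dl) * P then (A * dl `^ (- s) + b * (1 + dl)) * P `^ (- s) - b * q * P `^ (- s - 1)
  else A * (q - P) `^ (- s).

Implicit Types (p s A dl b L kap q t r : R).

Lemma bP_base p s A dl b L kap t : barrier_data p s A dl b L kap -> 0 <= t -> 1 <= L * (t + L^-1).
Proof.
case=> _ _ _ _ _ L0 _ _ _ _ _ t0; rewrite mulrDr mulfV ?gt_eqF// lerDr.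
by rewrite mulr_ge0// ltW.
Qed.

Lemma bP_ge1 p s A dl b L kap t : barrier_data p s A dl b L kap -> 0 <= t -> 1 <= bP L kap t.
Proof.
move=> data t0; case: (data) => _ _ _ _ _ _ k0 _ _ _ _.
have <- : 1 `^ kap = 1 :> R by rewrite powR1.
apply: powR_mono; [exact: ltW|exact: ler01|exact: bP_base data t0].
Qed.

Lemma bP_powR L kap t r : bP L kap t `^ r = (L * (t + L^-1)) `^ (kap * r).
Proof. by rewrite /bP powRrM. Qed.

Lemma bP_mono p s A dl b L kap t t' : barrier_data p s A dl b L kap ->
  0 <= t -> t <= t' -> bP L kap t <= bP L kap t'.
Proof.
move=> data t0 tt; case: (data) => _ _ _ _ _ L0 k0 _ _ _ _.
apply: powR_mono; [exact: ltW|by apply: le_trans (bP_base _ _ _ _ _ _ _ _ data t0)|].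
by rewrite ler_pM2l// lerD2r.
Qed.

Lemma is_derive_bP p s A dl b L kap (t r : R) : barrier_data p s A dl b L kap -> 0 <= t ->
  is_derive t 1 (fun t' => bP L kap t' `^ r) (r * kap / (t + L^-1) * bP L kap t `^ r).
Proof.
move=> data t0; case: (data) => _ _ _ _ _ L0 k0 _ _ _ _.
have -> : (fun t' => bP L kap t' `^ r) = (fun z : R => z `^ (kap * r)) \o (fun t' => 1 + t' * L).
  by apply/funext => t'; rewrite bP_powR /= mulrDr mulfV ?gt_eqF//; congr (_ `^ _); ring.
have B1 := bP_base _ _ _ _ _ _ _ _ data t0.
have B0 : 0 < L * (t + L^-1) by apply: lt_le_trans B1.
have E : 1 + t * L = L * (t + L^-1) by rewrite mulrDr mulfV ?gt_eqF//; ring.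
have D1 : is_derive (1 + t * L) 1 (fun z : R => z `^ (kap * r)) ((kap * r) * (L * (t + L^-1)) `^ (kap * r - 1)).
  by rewrite E; apply: is_derive1_powR.
have := @is_derive1_comp R _ (fun t' => 1 + t' * L) t _ L D1 (is_derive_line _ _ _).
move=> H; apply: (is_derive_eq H).
rewrite bP_powR powRB; last by rewrite (gt_eqF B0) implybT.
rewrite powRr1 ?(ltW B0)//.
have tL : 0 < t + L^-1 by rewrite ltr_wpDl// invr_gt0.
move: {E D1 H B1 B0} (t + L^-1) tL => T T0.
by field; rewrite !gt_eqF.
Qed.

Lemma bP_power p s A dl b L kap t : barrier_data p s A dl b L kap -> 0 <= t ->
  bP L kap t `^ (p * s) * bP L kap t = L * (t + L^-1).
Proof.
move=> data t0; case: (data) => _ _ _ _ _ L0 k0 kE _ _ _.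
have P1 := bP_ge1 _ _ _ _ _ _ _ _ data t0.
have P0 : 0 < bP L kap t by apply: lt_le_trans P1.
rewrite -{2}[bP L kap t]powRr1 ?(ltW P0)// -powRD; last by rewrite (gt_eqF P0) implybT.
rewrite bP_powR kE powRr1//.
by apply: le_trans (bP_base _ _ _ _ _ _ _ _ data t0).
Qed.

Lemma bW_inner (s A dl b L kap q t : R) : q <= (1 + dl) * bP L kap t -> bW s A dl b L kap q t =
  (A * dl `^ (- s) + b * (1 + dl)) * bP L kap t `^ (- s) - b * q * bP L kap t `^ (- s - 1).
Proof. by rewrite /bW => ->. Qed.

Lemma bW_outer (s A dl b L kap q t : R) : (1 + dl) * bP L kap t < q -> bW s A dl b L kap q t =
  A * (q - bP L kap t) `^ (- s).
Proof. by rewrite ltNge /bW => /negbTE ->. Qed.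

Lemma bP_shift (L kap t s : R) : 0 < bP L kap t ->
  bP L kap t `^ (- s - 1) = bP L kap t `^ (- s) / bP L kap t.
Proof. by move=> P0; rewrite powRB ?powRr1 ?(ltW P0)// (gt_eqF P0) implybT. Qed.

Lemma bW_factor (s A dl b L kap q t : R) : 0 < bP L kap t -> q <= (1 + dl) * bP L kap t -> bW s A dl b L kap q t =
  (A * dl `^ (- s) + b * (1 + dl - q / bP L kap t)) * bP L kap t `^ (- s).
Proof. by move=> P0 h; rewrite bW_inner// bP_shift//; field; rewrite gt_eqF. Qed.

(* Beyond the corner [|x|^2 = (1 + dl) P] the inner branch stays above the outer one for a
   while, so the inner branch touches [W] from above at the corner. *)
Lemma bW_corner p s A dl b L kap : barrier_data p s A dl b L kap ->
  exists2 e : R, 0 < e & forall q t, 0 <= t -> q <= (1 + dl + e) * bP L kap t -> bW s A dl b L kap q t <=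
    (A * dl `^ (- s) + b * (1 + dl)) * bP L kap t `^ (- s) - b * q * bP L kap t `^ (- s - 1).
Proof.
move=> data; case: (data) => p1 s0 A0 /andP[dl0 dl1] b0 L0 k0 kE kL hb corner.
have D1 : is_derive dl 1 (fun r => A * r `^ (- s)) (A * (- s * dl `^ (- s - 1))).
  by apply: is_derive_scale; apply: is_derive1_powR.
pose g := s * A * dl `^ (- s - 1) - b.
have g0 : 0 < g by rewrite subr_gt0.
have [e e0 he] := is_derive_near _ _ _ _ D1 g g0.
exists e => // q t t0 qe.
have P1 := bP_ge1 _ _ _ _ _ _ _ _ data t0.
have P0 : 0 < bP L kap t by apply: lt_le_trans P1.
have [qc|qc] := leP q ((1 + dl) * bP L kap t); first by rewrite bW_inner.
rewrite bW_outer// bP_shift//; set PP := bP L kap t in P0 qe qc *.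
pose r := q / PP - (1 + dl).
have r0 : 0 < r by rewrite subr_gt0 ltr_pdivlMr.
have re : r <= e by rewrite /r lerBlDl ler_pdivrMr.
have := he r; rewrite (gtr0_norm r0) => /(_ re); rewrite /GRing.scale /= mulr1 ler_norml => /andP[_ h].
have qE : q - PP = PP * (dl + r) by rewrite /r; field; rewrite gt_eqF.
have dr : 0 < dl + r by posR.
rewrite qE powRM ?(ltW P0) ?(ltW dr)//.
have X0 : 0 < PP `^ (- s) by rewrite powR_gt0.
have -> : (A * dl `^ (- s) + b * (1 + dl)) * PP `^ (- s) - b * q * (PP `^ (- s) / PP) =
   PP `^ (- s) * (A * dl `^ (- s) - b * r) by rewrite /r; field; rewrite gt_eqF.
rewrite mulrCA ler_pM2l//; move: h; rewrite /g; clear; lra.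
Qed.

(** [y] is the inner profile, [W = y P^(- s)]. Where [(s + 1) y] is at most the central value, the
    barrier does not decrease in time. Elsewhere [y >= b / (s + 1)] bounds [y^(p-1)] below, and the
    inner condition of [barrier_data] applies. *)
Lemma bW_inner_rate p s A dl b L kap (y N : R) : barrier_data p s A dl b L kap -> 1 <= N -> 0 < y ->
  kap * L * ((s + 1) * y - (A * dl `^ (- s) + b * (1 + dl))) <= 2 * N * b * y `^ p.
Proof.
move=> data N1 y0; case: (data) => p1 s0 A0 /andP[dl0 dl1] b0 L0 k0 kE kL hb corner.
have q0 : 0 < dl `^ (- s) by rewrite powR_gt0.
have ab : b <= A * dl `^ (- s) + b * (1 + dl).
  by have := mulr_gt0 A0 q0; have := mulr_gt0 b0 dl0; clear; lra.
set a := A * dl `^ (- s) + b * (1 + dl) in ab *.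
have yp : 0 < y `^ p by rewrite powR_gt0.
have kL0 : 0 < kap * L by posR.
have rhs0 : 0 < 2 * N * b * y `^ p by have N0 : 0 < N := lt_le_trans ltr01 N1; posR.
have s1 : 0 < s + 1 by posR.
have [ya|ya] := leP ((s + 1) * y) a.
  apply: le_trans (ltW rhs0); rewrite mulr_ge0_le0 ?(ltW kL0)// subr_le0//.
have yb : b / (s + 1) <= y.
  by rewrite ler_pdivrMr// mulrC; apply: le_trans ab _; exact: ltW.
have h1 : (b / (s + 1)) `^ (p - 1) <= y `^ (p - 1).
  by apply: powR_mono => //; [rewrite subr_ge0 ltW|rewrite divr_ge0 ?ltW].
have h2 : kap * L * (s + 1) <= 2 * (b * y `^ (p - 1)).
  by apply: le_trans hb _; rewrite ler_wpM2l// ler_wpM2l// ltW.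
have h3 := ler_wpM2r (ltW y0) h2.
have h4 : y `^ p = y * y `^ (p - 1) by rewrite mulr_powRB1 ?(ltW y0)//; exact: lt_trans p1.
have h5 := ler_wpM2r (ltac:(rewrite mulr_ge0 ?(ltW yp)// ltW//) : 0 <= b * y `^ p) N1.
have a0 : 0 < a by apply: lt_le_trans ab.
have h6 := mulr_gt0 kL0 a0.
by move: h3 h5 h6; rewrite h4; clear; lra.
Qed.

Lemma is_derive_shifted (k c r q : R) : 0 < q - c ->
  is_derive q 1 (fun z => k * (z - c) `^ r) (k * (r * (q - c) `^ (r - 1))).
Proof.
move=> qc; apply: is_derive_scale.
have D1 := is_derive1_powR r qc.
have E : (fun z : R => - c + z * 1) q = q - c by rewrite mulr1 addrC.
rewrite -E in D1.
have := @is_derive1_comp R _ (fun z => - c + z * 1) q _ 1 D1 (is_derive_line _ _ _).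
rewrite mulr1 E => H.
by have -> : (fun z => (z - c) `^ r) = (powR (R := R)) ^~ r \o (fun z => - c + z * 1)
  by apply/funext => z /=; rewrite mulr1 addrC.
Qed.

(** Up to the corner the affine branch touches from above; its Laplacian is negative and
    [bW_inner_rate] bounds the decay in time. Outside, with [E = q - P >= dl P], the Laplacian is at
    most [8 / dl A s (s + 1) E^(- s - 1)] and [W^p] at most [A^p (dl P)^(- p s)], whereas the time
    derivative is [A s E^(- s - 1) kap L P^(- p s)]: this is the equation for [kap L]. *)
Lemma bW_jet (n : nat) p s A dl b L kap : (0 < n)%N -> barrier_data p s A dl b L kap ->
  exists2 D : R, 0 <= D & forall q t, 0 <= q -> 0 < t -> upper_jet (n := n) p D (bW s A dl b L kap) q t.
Proof.
move=> n0 data; case: (data) => p1 s0 A0 /andP[dl0 dl1] b0 L0 k0 kE kL hb corner.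
have p0 : 0 < p by apply: lt_trans p1.
have nR : 1 <= n%:R :> R by rewrite ler1n.
have [e e0 hcorner] := bW_corner _ _ _ _ _ _ _ data.
have X0 r : 0 < dl `^ r by rewrite powR_gt0.
have s1 : 0 < s + 1 by posR.
pose D := 8 / dl * A * s * (s + 1) * dl `^ (- s - 1).
have D0 : 0 <= D by have := X0 (- s - 1) => x0; apply: ltW; rewrite /D; posR.
exists D => // q t q0 t0.
have tL : 0 < t + L^-1 by rewrite ltr_wpDl ?(ltW t0)// invr_gt0.
have P1 := bP_ge1 _ _ _ _ _ _ _ _ data (ltW t0).
have P0 : 0 < bP L kap t by apply: lt_le_trans P1.
have Ppow := bP_power _ _ _ _ _ _ _ _ data (ltW t0).
have Pder r := is_derive_bP _ _ _ _ _ _ _ t r data (ltW t0).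
set P := bP L kap t in P1 P0 Ppow *.
have Y0 r : 0 < P `^ r by rewrite powR_gt0.
have Pps : P `^ (- (p * s)) * (L * (t + L^-1)) = P.
  by rewrite -Ppow mulrA powRN mulVf ?mul1r// gt_eqF.
set a := A * dl `^ (- s) + b * (1 + dl) in hcorner.
have [qc|qc] := leP q ((1 + dl) * P); split.
  pose cst := a * P `^ (- s).
  exists (fun z => cst + z * (- (b * P `^ (- s - 1)))), (fun=> - (b * P `^ (- s - 1))),
    (fun t' => a * bP L kap t' `^ (- s) - b * q * bP L kap t' `^ (- s - 1)), 0,
    (a * (- s * kap / (t + L^-1) * P `^ (- s)) - b * q * ((- s - 1) * kap / (t + L^-1) * P `^ (- s - 1))).
  have Dp := Pder 1.
  have [d1 d10 hd1] := is_derive_near _ _ _ _ Dp 1 ltr01.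
  have Pc : {for t, continuous (fun t' => bP L kap t' `^ 1)}.
    by apply: differentiable_continuous; apply/derivable1_diffP; case: Dp.
  have pe : 0 < P * e / (1 + dl + e) by posR.
  have /cvgrPdist_le/(_ _ pe)/nbhs_ballP[d2 /= d20 hd2] := Pc.
  (* For [q'] near [q], and at earlier times, where [P] is slightly smaller, the argument stays
     within the margin [e] that [bW_corner] allows beyond the corner. *)
  pose d := Num.min (Num.min (e * P) t) (d2 / 2).
  have d0 : 0 < d by rewrite /d; posR.
  have : d <= d by []. 
  rewrite {2}/d !le_min => /andP[/andP[de dt] dd2].
  exists d; split.
  - by split=> //; split; rewrite bW_inner// -/P -/a /cst; ring.
  - move=> q' hq'; split; first exact: is_derive_line.
    have -> : cst + q' * - (b * P `^ (- s - 1)) = a * P `^ (- s) - b * q' * P `^ (- s - 1) by rewrite /cst; ring.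
    apply: hcorner; first exact: ltW.
    move: hq'; rewrite ler_norml => /andP[_]; move: qc de; rewrite -/P; clear; lra.
  - exact: is_derive_cst.
  - split.
      by apply: is_derive_sub; apply: is_derive_scale.
    move=> t' t1 t2; have t'0 : 0 <= t' by move: t1 dt; clear; lra.
    apply: hcorner => //.
    have := hd2 t'; rewrite /ball /= !powRr1 ?(ltW P0)//; last first.
      by apply: le_trans (bP_ge1 _ _ _ _ _ _ _ _ data t'0).
    move=> /(_ _); have -> : `|t - t'| < d2.
      by rewrite ger0_norm ?subr_ge0//; move: t1 dd2 d20; clear; lra.
    rewrite -/P => /(_ isT); rewrite ler_norml => /andP[_ hP].
    have : P - P * e / (1 + dl + e) <= bP L kap t' by move: hP; clear; lra.
    have ce : 0 < 1 + dl + e by posR.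
    move/(ler_wpM2l (ltW ce)); apply: le_trans; rewrite mulrBr.
    have -> : (1 + dl + e) * (P * e / (1 + dl + e)) = P * e by field; rewrite gt_eqF.
    by move: qc; clear; lra.
  - rewrite mulr0 add0r; split.
      apply: (@le_trans _ _ 0) => //; rewrite mulrN oppr_le0.
      by rewrite !mulr_ge0 ?powR_ge0// ltW.
    rewrite (bW_factor _ _ _ _ _ _ _ _ P0 qc) -/P.
    pose y := A * dl `^ (- s) + b * (1 + dl - q / P).
    have y0 : 0 < y.
      apply: ltr_pwDl; first exact: mulr_gt0.
      by rewrite mulr_ge0 ?(ltW b0)// subr_ge0 ler_pdivrMr.
    have := bW_inner_rate _ _ _ _ _ _ _ y n%:R data nR y0; rewrite -/a => rate.
    rewrite -/y powRM ?powR_ge0 ?(ltW y0)// -powRrM.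
    have -> : - s * p = - (p * s) by ring.
    rewrite (bP_shift _ _ _ _ P0) -/P.
    pose Z := P `^ (- (p * s)) * P `^ (- s) / P.
    have Z0 : 0 < Z by have z1 := Y0 (- (p * s)); have z2 := Y0 (- s); rewrite /Z; posR.
    have EL : y `^ p * P `^ (- (p * s)) * (2 * n%:R * - (b * (P `^ (- s) / P))) = - (2 * n%:R * b * y `^ p) * Z.
      by rewrite /Z; field; rewrite gt_eqF.
    have ER : a * (- s * kap / (t + L^-1) * P `^ (- s)) - b * q * ((- s - 1) * kap / (t + L^-1) * (P `^ (- s) / P)) =
       - (kap * L * ((s + 1) * y - a)) * Z.
      have -> : y = a - b * q / P by rewrite /y /a; ring.
      have -> : Z = P `^ (- s) / (L * (t + L^-1)).
        have wE : P `^ (- (p * s)) = P / (L * (t + L^-1)).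
          by rewrite -[X in X / _]Pps mulfK// gt_eqF// mulr_gt0.
        rewrite /Z wE; move: {Pder Ppow Pps wE} (t + L^-1) tL => T T0.
        by field; rewrite !gt_eqF.
      move: {Pder Ppow Pps} (t + L^-1) tL => T T0.
      by field; rewrite !gt_eqF.
    by rewrite EL ER ler_pM2r// lerN2.
have Eq : 0 < q - P by rewrite subr_gt0; apply: le_lt_trans qc; rewrite mulrDl mul1r lerDl mulr_ge0// ltW.
have dE : dl * P <= q - P by move: qc; clear; lra.
pose d := Num.min ((q - (1 + dl) * P) / 2) t.
have d0 : 0 < d by rewrite /d lt_min t0 andbT divr_gt0// subr_gt0.
have : d <= d by []. 
rewrite {2}/d le_min => /andP[dq dt].
exists (fun z => A * (z - P) `^ (- s)), (fun z => A * (- s * (z - P) `^ (- s - 1))),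
  (fun t' => A * (q - bP L kap t') `^ (- s)), (A * (- s) * ((- s - 1) * (q - P) `^ (- s - 1 - 1))),
  (A * (- s * (q - P) `^ (- s - 1) * (- (kap / (t + L^-1) * P)))), d; split.
- by split=> //; rewrite bW_outer.
- move=> q'; rewrite ler_norml => /andP[h _].
  have qq : (1 + dl) * P < q' by move: h dq qc; clear; lra.
  have q'P : 0 < q' - P by rewrite subr_gt0; apply: le_lt_trans qq; rewrite mulrDl mul1r lerDl mulr_ge0// ltW.
  by split; [exact: is_derive_shifted|rewrite bW_outer].
- have -> : (fun z => A * (- s * (z - P) `^ (- s - 1))) = (fun z => A * (- s) * (z - P) `^ (- s - 1)).
    by apply/funext => z; rewrite mulrA.
  exact: is_derive_shifted.
- split.
    apply: is_derive_scale.
    have D1 := is_derive1_powR (- s) Eq.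
    have Dq : is_derive t 1 (fun t' => q - bP L kap t') (- (kap / (t + L^-1) * P)).
      rewrite -[X in is_derive _ _ _ X]sub0r; apply: (is_derive_sub (fun=> q) (fun t' => bP L kap t') t 0).
      have := Pder 1; rewrite mul1r powRr1 ?(ltW P0)//.
      have pw : (fun t' => 1 + t' * 0) = (fun t' => 1 + t' * 0 : R) by [].
      move=> H; apply: is_derive_increment => eta eta0.
      have [d' d'0 hd'] := is_derive_near _ _ _ _ H eta eta0.
      exists (Num.min d' t); first by posR.
      move=> r; rewrite le_min => /andP[rd rt]; have := hd' r rd.
      rewrite !powRr1 ?(ltW P0)//.
      apply: le_trans ler01 _; apply: bP_ge1 data _.
      by move: rt; rewrite ler_norml /GRing.scale /= mulr1 => /andP[+ _]; clear; lra.
    exact: (@is_derive1_comp R _ (fun t' => q - bP L kap t') t _ _ D1 Dq).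
  move=> t' t1 t2; have t'0 : 0 <= t' by move: t1 dt; clear; lra.
  rewrite bW_outer//; apply: le_lt_trans qc; rewrite ler_pM2l; last by posR.
  exact: (bP_mono _ _ _ _ _ _ _ _ _ data).
- pose E := q - P.
  (* From [q = E + P], [P <= E / dl] and [dl <= 1]. *)
  have qE : q <= 2 * E / dl.
    rewrite ler_pdivlMr//; have := mulr_ge0 (ltW dl0) (ltW P0); move: dE dl1 Eq; rewrite /E; clear => h1 h2 h3 h4.
    by have := ler_wpM2r (ltW h3) h2; lra.
  have E1 : 0 < E `^ (- s - 1) by rewrite powR_gt0.
  have Es : E `^ (- s - 1 - 1) = E `^ (- s - 1) / E.
    by rewrite powRB ?powRr1 ?(ltW Eq)// (gt_eqF Eq) implybT.
  have lap : 4 * q * (A * - s * ((- s - 1) * E `^ (- s - 1 - 1))) + 2 * n%:R * (A * (- s * E `^ (- s - 1))) <=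
      8 / dl * A * s * (s + 1) * E `^ (- s - 1).
    have h1 : 0 <= 2 * n%:R * (A * (s * E `^ (- s - 1))).
      by rewrite !mulr_ge0 ?(ltW A0) ?(ltW s0) ?(ltW E1).
    have h2 := ler_wpM2l (ltac:(apply: ltW; posR) : 0 <= 4 * (A * s * (s + 1)) * (E `^ (- s - 1) / E)) qE.
    have h3 : 4 * (A * s * (s + 1)) * (E `^ (- s - 1) / E) * (2 * E / dl) = 8 / dl * A * s * (s + 1) * E `^ (- s - 1).
      by field; rewrite !gt_eqF.
    by rewrite Es; move: h1 h2; rewrite h3; clear; lra.
  have dlE : dl * P <= E by [].
  have dE1 : dl <= E by apply: le_trans dlE; rewrite ler_peMr// ltW.
  have anti r z z' : 0 <= r -> 0 < z -> z <= z' -> z' `^ (- r) <= z `^ (- r).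
    move=> r0 z0 zz; rewrite !powRN lef_pV2 ?posrE ?powR_gt0//; last exact: lt_le_trans zz.
    by apply: powR_mono => //; exact: ltW.
  split; rewrite -/E.
    apply: le_trans lap _; rewrite /D ler_wpM2l//; first by apply: ltW; posR.
    by rewrite -!opprD; apply: anti => //; apply: ltW.
  rewrite bW_outer// -/P -/E powRM ?powR_ge0 ?(ltW A0)// -powRrM.
  have -> : - s * p = - (p * s) by ring.
  apply: le_trans (ler_wpM2l _ lap) _; first by rewrite mulr_ge0 ?powR_ge0.
  have h1 : E `^ (- (p * s)) <= dl `^ (- (p * s)) * P `^ (- (p * s)).
    rewrite -powRM ?(ltW dl0) ?(ltW P0)//; apply: anti => //; first by apply: ltW; posR.
    by posR.
  have c0 : 0 <= A `^ p * (8 / dl * A * s * (s + 1) * E `^ (- s - 1)).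
    have Ap : 0 < A `^ p by rewrite powR_gt0.
    by apply: ltW; posR.
  have h2 := ler_wpM2l c0 h1.
  apply: le_trans (_ : A `^ p * (8 / dl * A * s * (s + 1) * E `^ (- s - 1)) * (dl `^ (- (p * s)) * P `^ (- (p * s))) <= _).
    by apply: le_trans h2; rewrite le_eqVlt; apply/orP; left; apply/eqP; ring.
  have -> : A * (- s * E `^ (- s - 1) * - (kap / (t + L^-1) * P)) = A * s * E `^ (- s - 1) * (kap * L) * P `^ (- (p * s)).
    rewrite -{1}Pps; move: {Pder Ppow Pps} (t + L^-1) tL => T T0.
    by field; rewrite !gt_eqF.
  by rewrite kL le_eqVlt; apply/orP; left; apply/eqP; field; rewrite gt_eqF.
Qed.

Lemma powR_anti (r z z' : R) : 0 <= r -> 0 < z -> z <= z' -> z' `^ (- r) <= z `^ (- r).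
Proof.
move=> r0 z0 zz; rewrite !powRN lef_pV2 ?posrE ?powR_gt0//; last exact: lt_le_trans zz.
by apply: powR_mono => //; exact: ltW.
Qed.

Lemma bW_gt0 p s A dl b L kap q t : barrier_data p s A dl b L kap -> 0 <= q -> 0 <= t ->
  0 < bW s A dl b L kap q t.
Proof.
move=> data q0 t0; case: (data) => p1 s0 A0 /andP[dl0 dl1] b0 L0 k0 kE kL hb corner.
have P1 := bP_ge1 _ _ _ _ _ _ _ _ data t0.
have P0 : 0 < bP L kap t by apply: lt_le_trans P1.
have [qc|qc] := leP q ((1 + dl) * bP L kap t).
  rewrite bW_factor//; apply: mulr_gt0; last by rewrite powR_gt0.
  apply: ltr_pwDl; first by rewrite mulr_gt0// powR_gt0.
  by rewrite mulr_ge0 ?(ltW b0)// subr_ge0 ler_pdivrMr.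
rewrite bW_outer// mulr_gt0// powR_gt0// subr_gt0.
by apply: le_lt_trans qc; rewrite mulrDl mul1r lerDl mulr_ge0// ltW.
Qed.

Lemma bW_continuous (n : nat) p s A dl b L kap : barrier_data p s A dl b L kap ->
  {within [set z : 'rV[R]_n * R | 0 <= z.2], continuous (fun z => bW s A dl b L kap (sqn z.1) z.2)}.
Proof.
move=> data; case: (data) => p1 s0 A0 /andP[dl0 dl1] b0 L0 k0 kE kL hb corner.
(* The positive part of the distance to the corner, written as [(r + |r|) / 2]; with it both
   branches become one formula [g] built from continuous pieces. The exponent 1 lets the continuity
   of powers of [bP] be reused. *)
pose m (z : 'rV[R]_n * R) := ((1 + dl) * bP L kap z.2 `^ 1 - sqn z.1 + `|(1 + dl) * bP L kap z.2 `^ 1 - sqn z.1|) / 2.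
pose g z := b * m z * bP L kap z.2 `^ (- s - 1) + A * (sqn z.1 + m z - bP L kap z.2 `^ 1) `^ (- s).
have mE z : 0 <= z.2 -> m z = Num.max ((1 + dl) * bP L kap z.2 - sqn z.1) 0.
  move=> z0; have P1 := bP_ge1 _ _ _ _ _ _ _ _ data z0.
  rewrite /m powRr1 ?(le_trans ler01 P1)//; set r := _ - sqn _.
  by have [r0|r0] := leP r 0; [rewrite ler0_norm//; ring|rewrite gtr0_norm//; field].
have gE z : 0 <= z.2 -> bW s A dl b L kap (sqn z.1) z.2 = g z.
  move=> z0; have P1 := bP_ge1 _ _ _ _ _ _ _ _ data z0.
  have P0 : 0 < bP L kap z.2 by apply: lt_le_trans P1.
  rewrite /g mE// powRr1 ?(ltW P0)//.
  have [qc|qc] := leP (sqn z.1) ((1 + dl) * bP L kap z.2).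
    rewrite bW_factor// max_l ?subr_ge0// bP_shift//.
    have -> : sqn z.1 + ((1 + dl) * bP L kap z.2 - sqn z.1) - bP L kap z.2 = dl * bP L kap z.2 by ring.
    by rewrite powRM ?(ltW dl0) ?(ltW P0)//; field; rewrite gt_eqF.
  by rewrite bW_outer// max_r ?subr_le0 1?ltW// mulr0 mul0r add0r addr0.
apply/subspace_continuousP => z /= z0; apply/cvgrPdist_le => eta eta0.
have cP r : (fun z' : 'rV[R]_n * R => bP L kap z'.2 `^ r) @ z --> bP L kap z.2 `^ r.
  apply: (continuous_comp (f := snd) (g := fun t => bP L kap t `^ r)); first exact: cvg_snd.
  apply: differentiable_continuous; apply/derivable1_diffP.
  by have [] := is_derive_bP _ _ _ _ _ _ _ z.2 r data z0.
have cq : (fun z' : 'rV[R]_n * R => sqn z'.1) @ z --> sqn z.1 by exact: continuous_sqn_fst.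
have cr : (fun z' : 'rV[R]_n * R => (1 + dl) * bP L kap z'.2 `^ 1 - sqn z'.1) @ z --> (1 + dl) * bP L kap z.2 `^ 1 - sqn z.1.
  by apply: cvgB => //; apply: cvgM; [exact: cvg_cst|exact: cP].
have cm : m @ z --> m z.
  by apply: cvgM; [apply: cvgD => //; exact: cvg_norm|exact: cvg_cst].
have Epos : 0 < sqn z.1 + m z - bP L kap z.2 `^ 1.
  have P1 := bP_ge1 _ _ _ _ _ _ _ _ data z0.
  have P0 : 0 < bP L kap z.2 by apply: lt_le_trans P1.
  rewrite mE// powRr1 ?(ltW P0)//; have := mulr_gt0 dl0 P0.
  have : (1 + dl) * bP L kap z.2 - sqn z.1 <= Num.max ((1 + dl) * bP L kap z.2 - sqn z.1) 0 by rewrite le_max lexx.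
  clear; lra.
have cg : g @ z --> g z.
  apply: cvgD.
    by apply: cvgM; [apply: cvgM => //; exact: cvg_cst|exact: cP].
  apply: cvgM; first exact: cvg_cst.
  have cE : (fun z' : 'rV[R]_n * R => sqn z'.1 + m z' - bP L kap z'.2 `^ 1) @ z --> sqn z.1 + m z - bP L kap z.2 `^ 1.
    by apply: cvgB; [exact: cvgD|exact: cP].
  exact: (cvg_comp _ _ cE (powR_continuous (- s) _ Epos)).
have /cvgrPdist_le/(_ _ eta0) cg' := cg.
rewrite near_withinE; apply: filterS cg' => z' h z'0.
by rewrite /from_subspace /= !gE.
Qed.

(** [P >= (L t)^kap] gives the bound in time. For the bound in [q], the inner region has [q <= 2 P]
    and the outer one [q - P >= dl / 2 q]. *)
Lemma bW_upper p s A dl b L kap : barrier_data p s A dl b L kap ->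
  exists2 C : R, 0 < C & forall q t, 0 <= q -> 0 < t ->
    bW s A dl b L kap q t <= C * t `^ (- (kap * s)) /\
    (0 < q -> bW s A dl b L kap q t <= C * q `^ (- s)).
Proof.
move=> data; case: (data) => p1 s0 A0 /andP[dl0 dl1] b0 L0 k0 kE kL hb corner.
have X0 (y r : R) : 0 < y -> 0 < y `^ r by move=> y0; rewrite powR_gt0.
pose a := A * dl `^ (- s) + b * (1 + dl).
have ds0 := X0 _ (- s) dl0.
have a0 : 0 < a by rewrite /a; posR.
have Ls := X0 _ (- (kap * s)) L0.
have d2 : 0 < dl / 2 by posR.
have d2s := X0 _ (- s) d2.
pose C1 := a * L `^ (- (kap * s)); pose C2 := a * 2 `^ s + A * (dl / 2) `^ (- s).
have t2 : 0 < 2 `^ s :> R by apply: X0.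
have C10 : 0 < C1 by rewrite /C1; posR.
have C20 : 0 < C2 by rewrite /C2; posR.
exists (C1 + C2); first by posR.
move=> q t q0 t0.
have P1 := bP_ge1 _ _ _ _ _ _ _ _ data (ltW t0).
have P0 : 0 < bP L kap t by apply: lt_le_trans P1.
set P := bP L kap t in P1 P0 *.
have outer : (1 + dl) * P < q -> dl * P <= q - P /\ 0 < q - P.
  move=> qc; have h : dl * P <= q - P by move: qc; clear; lra.
  by split=> //; apply: lt_le_trans h; exact: mulr_gt0.
have Wa : bW s A dl b L kap q t <= a * P `^ (- s).
  have [qc|qc] := leP q ((1 + dl) * P).
    by rewrite bW_inner// gerBl mulr_ge0 ?powR_ge0// mulr_ge0// ltW.
  have [h1 h2] := outer qc; rewrite bW_outer//.
  apply: (@le_trans _ _ (A * (dl `^ (- s) * P `^ (- s)))).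
    rewrite -powRM ?(ltW dl0) ?(ltW P0)// ler_wpM2l ?(ltW A0)//.
    by apply: powR_anti => //; [exact: ltW|exact: mulr_gt0].
  by rewrite mulrA ler_wpM2r ?powR_ge0// /a lerDl mulr_ge0 ?(ltW b0)// addr_ge0// ltW.
split.
  apply: le_trans Wa _; apply: (@le_trans _ _ (C1 * t `^ (- (kap * s)))); last first.
    by rewrite ler_wpM2r ?powR_ge0// lerDl ltW.
  rewrite /C1 -mulrA ler_wpM2l ?(ltW a0)// -powRM ?(ltW L0) ?(ltW t0)//.
  rewrite /P bP_powR mulrN; apply: powR_anti; [by rewrite mulr_ge0// ltW|exact: mulr_gt0|].
  by rewrite ler_pM2l// lerDl invr_ge0 ltW.
move=> qp; apply: (@le_trans _ _ (C2 * q `^ (- s))); last first.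
  by rewrite ler_wpM2r ?powR_ge0// lerDr ltW.
have [qc|qc] := leP q ((1 + dl) * P).
  apply: le_trans Wa _; apply: (@le_trans _ _ (a * 2 `^ s * q `^ (- s))); last first.
    by rewrite ler_wpM2r ?powR_ge0// lerDl ltW// mulr_gt0.
  rewrite -mulrA ler_wpM2l ?(ltW a0)//.
  have -> : 2 `^ s * q `^ (- s) = (q / 2) `^ (- s).
    have -> : 2 `^ s = 2^-1 `^ (- s) :> R by rewrite -powR_inv1// -powRrM mulN1r opprK.
    by rewrite mulrC powRM// ltW.
  apply: powR_anti; [exact: ltW|by rewrite divr_gt0|].
  rewrite ler_pdivrMr//; apply: le_trans qc _.
  by have := ler_wpM2r (ltW P0) dl1; clear; lra.
have [h1 h2] := outer qc; rewrite bW_outer//.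
apply: (@le_trans _ _ (A * (dl / 2) `^ (- s) * q `^ (- s))); last first.
  by rewrite ler_wpM2r ?powR_ge0// lerDr ltW// mulr_gt0.
rewrite -mulrA ler_wpM2l ?(ltW A0)// -powRM ?(ltW d2) ?(ltW qp)//.
apply: powR_anti; [exact: ltW|exact: mulr_gt0|].
have := ler_wpM2r (ltW h2) dl1; have := ler_wpM2l (ltW dl0) dl1.
by move: h1; rewrite -/P; have := mulr_gt0 dl0 P0; clear; lra.
Qed.

End Barrier.

(** * Pointwise upper bound *)

Section UpperDecay.
Context {R : realType} {n : nat}.
Local Notation V := ('rV[R]_n).

Lemma euclidean_normE (x : V) : euclidean_norm x ^+ 2 = sqn x.
Proof. by rewrite /euclidean_norm sqr_sqrtr// sumr_ge0// => i _; exact: sqr_ge0. Qed.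

Lemma euclidean_norm_ge0 (x : V) : 0 <= euclidean_norm x.
Proof. exact: sqrtr_ge0. Qed.

Lemma coord_le_euclidean (x : V) i : `|x 0 i| <= euclidean_norm x.
Proof.
rewrite -(@ler_pXn2r _ 2) ?nnegrE ?sqrtr_ge0// real_normK ?num_real// euclidean_normE.
by rewrite /sqn (bigD1 i)//= lerDl; apply: sumr_ge0 => j _; exact: sqr_ge0.
Qed.

Theorem upper_decay (p gamma C1 : R) (u0 : V -> R) (u : V -> R -> R) : (0 < n)%N -> 1 < p ->
  continuous u0 -> (forall x, 0 < u0 x) -> minimal_solution p u0 u -> 0 < gamma -> 0 < C1 ->
  (forall x, u0 x <= C1 * (1 + euclidean_norm x) `^ (- gamma)) ->
  exists2 C : R, 0 < C & forall x t, 0 < t ->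
    u x t <= C * t `^ (- (gamma / (p * gamma + 2))) /\
    (0 < sqn x -> u x t <= C * euclidean_norm x `^ (- gamma)).
Proof.
move=> n0 p1 cu upos [usol umin] g0 C10 hu.
have p1' := ltW p1.
have anti (z z' : R) : 0 < z -> z <= z' -> z' `^ (- gamma) <= z `^ (- gamma).
  by apply: powR_anti; exact: ltW.
have u0M x : 0 < u0 x <= C1.
  rewrite upos; apply: le_trans (hu x) _; rewrite ger_pMr//.
  have one : 1 `^ (- gamma) = 1 :> R by rewrite powR1.
  rewrite -[leRHS]one; by apply: anti => //; rewrite lerDl; exact: euclidean_norm_ge0.
have dec (eta : R) : 0 < eta -> exists X : R, forall (v : V) i, X <= `|v 0 i| -> u0 v <= eta.
  move=> eta0; pose z := eta / C1; have z0 : 0 < z by rewrite /z; posR.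
  exists (z `^ (- gamma^-1)) => v i hX; apply: le_trans (hu v) _.
  rewrite mulrC -ler_pdivlMr// -/z.
  have zz : (z `^ (- gamma^-1)) `^ (- gamma) = z.
    by rewrite -powRrM mulrNN mulVf ?gt_eqF// powRr1// ltW.
  rewrite -zz; apply: anti; first by rewrite powR_gt0.
  by apply: le_trans hX _; apply: le_trans (coord_le_euclidean v i) _; rewrite lerDr.
have [v [vsol vM vdec]] := solution_exists p C1 u0 n0 p1' C10 cu u0M dec.
have s0 : 0 < gamma / 2 by posR.
have [dl [b [L [kap data]]]] := barrier_data_exists p (gamma / 2) C1 p1 s0 C10.
have [D D0 jet] := bW_jet n _ _ _ _ _ _ _ n0 data.
have [C C0 hC] := bW_upper _ _ _ _ _ _ _ data.
have sq0 (y : V) : 0 <= sqn y by apply: sumr_ge0 => i _; exact: sqr_ge0.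
case: (data) => _ _ _ /andP[dl0 dl1] b0 L0 k0 kE kL hb corner.
have P01 : bP L kap 0 = 1 by rewrite /bP add0r mulfV ?gt_eqF// powR1.
have init x : u0 x <= bW (gamma / 2) C1 dl b L kap (sqn x) 0.
  have [qc|qc] := leP (sqn x) ((1 + dl) * bP L kap 0).
    rewrite bW_factor //; last by rewrite P01.
    rewrite !P01 powR1 mulr1 divr1; rewrite P01 mulr1 in qc.
    have /andP[_ h] := u0M x; apply: le_trans h _.
    have d1 : 1 <= dl `^ (- (gamma / 2)).
      have one : 1 `^ (- (gamma / 2)) = 1 :> R by rewrite powR1.
      by rewrite -[leLHS]one; apply: powR_anti => //; exact: ltW.
    have h1 := ler_wpM2l (ltW C10) d1.
    have h2 : 0 <= b * (1 + dl - sqn x) by rewrite mulr_ge0 ?(ltW b0)// subr_ge0.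
    by move: h1 h2; clear; lra.
  rewrite bW_outer// P01; rewrite P01 mulr1 in qc.
  have q1 : 0 < sqn x - 1 by move: qc dl0; clear; lra.
  apply: le_trans (hu x) _; rewrite ler_wpM2l ?(ltW C10)//.
  have e0 := euclidean_norm_ge0 x.
  have e1 : 0 <= 1 + euclidean_norm x by apply: addr_ge0.
  have -> : (1 + euclidean_norm x) `^ (- gamma) = ((1 + euclidean_norm x) ^+ 2) `^ (- (gamma / 2)).
    by rewrite -powR_mulrn// -powRrM; congr (_ `^ _); field.
  apply: powR_anti => //; first exact: ltW.
  by rewrite -euclidean_normE; move: e0; clear; lra.
have cmp x t : 0 < t -> u x t <= bW (gamma / 2) C1 dl b L kap (sqn x) t.
  move=> t0; apply: (@le_trans _ _ (v x t)).
    by apply: (umin +oo%E v) => //; exact: ltry.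
  apply: (comparison p C1 D t u0 v (bW (gamma / 2) C1 dl b L kap)) => //; try exact: ltW.
  - by move=> eta eta0; exact: vdec (ltW t0).
  - by move=> q s q0 s1; exact: bW_gt0 data q0 s1.
  - exact: bW_continuous data.
  - by move=> q s q0 s1 _; exact: jet.
have kg : kap * (gamma / 2) = gamma / (p * gamma + 2).
  have q0 : 0 < p * gamma + 2 by have p0 : 0 < p := lt_trans ltr01 p1; posR.
  apply: (@mulIf _ (p * gamma + 2)); first by rewrite gt_eqF.
  rewrite divfK ?gt_eqF//.
  have -> : kap * (gamma / 2) * (p * gamma + 2) = kap * (p * (gamma / 2) + 1) * gamma by field.
  by rewrite kE mul1r.
exists C => // x t t0; have [h1 h2] := hC (sqn x) t (sq0 x) t0; split.
  by rewrite -kg; exact: le_trans (cmp x t t0) h1.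
move=> q0; apply: le_trans (cmp x t t0) _; apply: le_trans (h2 q0) _.
rewrite -euclidean_normE -powR_mulrn ?euclidean_norm_ge0// -powRrM.
by have -> : 2 * - (gamma / 2) = - gamma by field.
Qed.

End UpperDecay.

(** * Pointwise lower bound *)

Section LowerDecay.
Context {R : realType} {n : nat}.
Local Notation V := ('rV[R]_n).

Theorem lower_decay (p gamma C0 : R) (u0 : V -> R) (u : V -> R -> R) : (0 < n)%N -> 1 <= p ->
  (forall x, 0 < u0 x) -> positive_classical_solution p u0 +oo%E u -> 0 < gamma -> 0 < C0 ->
  (forall x, C0 * (1 + euclidean_norm x) `^ (- gamma) <= u0 x) ->
  exists2 c : R, 0 < c & forall x t, 1 < t -> sqn x <= (t `^ (p * gamma + 2)^-1) ^+ 2 ->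
    c * t `^ (- (gamma / (p * gamma + 2))) <= u x t.
Proof.
move=> n0 p1 upos usol g0 C00 hu.
have nR : 0 < n%:R :> R by rewrite ltr0n.
have p0 : 0 < p by apply: lt_le_trans p1.
have q0 : 0 < p * gamma + 2 by posR.
have C0p : 0 < C0 `^ p by rewrite powR_gt0.
pose kk := 4 * n%:R * C0 `^ p.
have three : 0 < 3 `^ (- gamma) :> R by rewrite powR_gt0.
exists (3 / 4 * C0 * 3 `^ (- gamma) * expR (- kk)).
  by rewrite mulr_gt0 ?expR_gt0//; posR.
move=> x t t1; set tb := t `^ _ => hx.
have t0 : 0 < t by apply: lt_trans t1.
have tb1 : 1 <= tb.
  have one : 1 `^ (p * gamma + 2)^-1 = 1 :> R by rewrite powR1.
  by rewrite -one /tb; apply: powR_mono; [rewrite invr_ge0 ltW|exact: ler01|exact: ltW].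
have tb0 : 0 < tb by apply: lt_le_trans tb1.
pose rho := 2 * tb; have rho0 : 0 < rho by rewrite /rho; posR.
have r2 : 0 < rho ^+ 2 by posR.
pose m := C0 * (1 + rho) `^ (- gamma).
have m0 : 0 < m by rewrite mulr_gt0// powR_gt0// addr_gt0.
pose del := m / rho ^+ 2; have del0 : 0 < del by rewrite /del; posR.
have dE : del * rho ^+ 2 = m by rewrite divfK// gt_eqF.
pose K := 4 * n%:R * del * m `^ (p - 1).
have mp : 0 < m `^ (p - 1) by rewrite powR_gt0.
have hK : 2 * n%:R * del * (del * rho ^+ 2) `^ (p - 1) < K.
  by rewrite dE /K; have := mulr_gt0 (mulr_gt0 nR del0) mp; clear; lra.
have sq0 (y : V) : 0 <= sqn y by apply: sumr_ge0 => i _; exact: sqr_ge0.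
have init y : del * (rho ^+ 2 - sqn y) <= u0 y.
  have [yr|yr] := leP (rho ^+ 2) (sqn y).
    apply: (@le_trans _ _ 0); last exact: ltW.
    by rewrite mulr_ge0_le0 ?(ltW del0)// subr_le0.
  apply: (@le_trans _ _ m).
    by rewrite -dE ler_wpM2l ?(ltW del0)// gerBl.
  apply: le_trans (hu y); rewrite ler_wpM2l ?(ltW C00)//; apply: powR_anti; first exact: ltW.
    by rewrite ltr_pwDl// euclidean_norm_ge0.
  rewrite lerD2l -(@ler_pXn2r _ 2) ?nnegrE ?euclidean_norm_ge0 ?(ltW rho0)// euclidean_normE.
  exact: ltW.
have low := lower_paraboloid p del (rho ^+ 2) K t u0 u p1 del0 r2 (ltW t0) hK usol init x t (ltW t0) (lexx t).
apply: le_trans low.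
(* [K t] is [4 n m^p t / rho^2]. As [m <= C0 tb^(- gamma)], [t = tb^(p gamma + 2)] and [rho = 2 tb],
   all powers of [tb] cancel. *)
have Kt : K * t <= kk.
  have E : K * t = 4 * n%:R * (m `^ p * (t / rho ^+ 2)).
    have -> : m `^ p = m * m `^ (p - 1) by rewrite mulr_powRB1// ltW.
    by rewrite /K /del; field; rewrite gt_eqF.
  rewrite E /kk ler_wpM2l ?mulr_ge0//.
  have mle : m <= C0 * tb `^ (- gamma).
    rewrite ler_wpM2l ?(ltW C00)//; apply: powR_anti => //; first exact: ltW.
    by rewrite /rho; move: tb0; clear; lra.
  have h1 : m `^ p <= C0 `^ p * tb `^ (- (p * gamma)).
    apply: (@le_trans _ _ ((C0 * tb `^ (- gamma)) `^ p)).
      by apply: powR_mono => //; exact: ltW.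
    rewrite (powRM p (ltW C00) (powR_ge0 _ _)) -powRrM.
    by have -> : - gamma * p = - (p * gamma) by ring.
  have h2 : t / rho ^+ 2 <= tb `^ (p * gamma).
    rewrite ler_pdivrMr//.
    have -> : t = tb `^ (p * gamma) * tb ^+ 2.
      rewrite -powR_mulrn ?(ltW tb0)// -powRD; last by rewrite (gt_eqF tb0) implybT.
      by rewrite /tb -powRrM mulVf ?gt_eqF// powRr1// ltW.
    rewrite ler_wpM2l ?powR_ge0// /rho; apply: sqr_le; first exact: ltW.
    by move: tb0; clear; lra.
  apply: le_trans (ler_pM (powR_ge0 _ _) _ h1 h2) _; first by rewrite divr_ge0 ?ltW.
  by rewrite -mulrA powRN mulVf ?mulr1// gt_eqF// powR_gt0.
have eK : expR (- kk) <= expR (- (K * t)) by rewrite ler_expR lerN2.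
have gap : 3 / 4 * rho ^+ 2 <= rho ^+ 2 - sqn x.
  by rewrite /rho; move: hx; clear; lra.
have mge : C0 * 3 `^ (- gamma) * t `^ (- (gamma / (p * gamma + 2))) <= m.
  rewrite -mulrA ler_wpM2l ?(ltW C00)//.
  have -> : t `^ (- (gamma / (p * gamma + 2))) = tb `^ (- gamma).
    by rewrite /tb -powRrM mulrN mulrC.
  rewrite -powRM ?(ltW tb0)//; apply: powR_anti; [exact: ltW|by rewrite addr_gt0|].
  by rewrite /rho; move: tb1; clear; lra.
have h1 := ler_wpM2l (ltW del0) gap.
have e0 : 0 < expR (- (K * t)) by rewrite expR_gt0.
have h2 : 3 / 4 * m * expR (- kk) <= del * (rho ^+ 2 - sqn x) * expR (- (K * t)).
  apply: ler_pM => //; [by apply: ltW; posR|].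
  by apply: le_trans h1; rewrite -dE; clear; lra.
have h3 := ler_wpM2r (expR_ge0 (- kk)) mge.
by move: h2 h3; clear; lra.
Qed.

End LowerDecay.

(** * Norms *)

(* Both integrals are suprema over the nonnegative simple functions below the integrand,
   whether or not it is measurable. *)
Lemma ge0_le_integralT d (T : measurableType d) (R : realType)
    (mu : {measure set T -> \bar R}) (f g : T -> \bar R) :
  (forall x, (0 <= f x)%E) -> (forall x, (f x <= g x)%E) ->
  (\int[mu]_x f x <= \int[mu]_x g x)%E.
Proof.
move=> f0 fg.
have g0 x : (0 <= g x)%E := le_trans (f0 x) (fg x).
rewrite (ge0_integralTE mu f0) (ge0_integralTE mu g0).
apply: ereal_sup_le => _ [h hf <-]; exists h => //= x.
exact: le_trans (hf x) (fg x).
Qed.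

Section LqNorms.
Context {R : realType} {n : nat}.
Implicit Types (d : R).

Definition tuple_cube d : set (n.-tuple (measurableTypeR R)) :=
  [set t | forall i, `[- d, d]%classic (tnth t i)].

Lemma measurable_tuple_cube d : measurable (tuple_cube d).
Proof.
rewrite (_ : tuple_cube d = \bigcap_(i in [set: 'I_n])
    ((fun t : n.-tuple (measurableTypeR R) => tnth t i) @^-1` `[- d, d]%classic)).
  apply: fin_bigcap_measurable => // i _.
  by rewrite -[X in measurable X]setTI; exact: measurable_tnth.
by apply/seteqP; split => t /= H i => [_|]; exact: H.
Qed.

Lemma lebesgue_tuple_cube d : 0 <= d ->
  lebesgue_tuple R n (tuple_cube d) = ((2 * d) ^+ n)%:E.
Proof.
move=> d0.
rewrite (@lebesgue_tuple_box R n (fun=> `[- d, d]%classic)); last first.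
  by move=> i; exact: measurable_itv.
transitivity (\prod_(i < n) (2 * d)%:E)%E.
  apply: eq_bigr => i _; rewrite lebesgue_measure_itv /= lte_fin.
  case: ltP => h; first by rewrite -EFinD; congr EFin; lra.
  by congr EFin; lra.
by rewrite prodEFin prodr_const card_ord.
Qed.

Lemma integral_cube (c d : R) : 0 <= c -> 0 <= d ->
  (\int[lebesgue_tuple R n]_x (c%:E * (\1_(tuple_cube d) x)%:E) =
   (c * (2 * d) ^+ n)%:E)%E.
Proof.
move=> c0 d0; rewrite ge0_integralZl_EFin //.
- rewrite integral_indic //; last exact: measurable_tuple_cube.
  rewrite EFinM -lebesgue_tuple_cube //; congr (_ * lebesgue_tuple R n _)%E.
  by apply/seteqP; split => [t [] //|t ht]; split.
- apply/measurable_realfun.measurable_EFinP.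
  exact: measurable_realfun.measurable_indic (measurable_tuple_cube d).
Qed.

Lemma Lq_norm_ge (q : \bar R) (phi : 'rV[R]_n -> R) (c d : R) :
  (0 < q)%E -> 0 < c -> 0 < d ->
  (forall x : 'rV[R]_n, (forall i, `|x 0 i| <= d) -> c <= phi x) ->
  ((c * (2 * d) `^ (dim_div n q))%:E <= Lq_norm q phi)%E.
Proof.
move=> q0 c0 d0 H.
have Hc (t : n.-tuple (measurableTypeR R)) : tuple_cube d t -> c <= phi (\row_i tnth t i).
  move=> ht; apply: H => i; rewrite mxE ler_norml.
  by have := ht i; rewrite /= in_itv.
have mup : (0 < lebesgue_tuple R n (tuple_cube d))%E.
  rewrite lebesgue_tuple_cube; last exact: ltW.
  by rewrite lte_fin; apply: exprn_gt0; lra.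
rewrite /Lq_norm unlock; case: q q0 => [r r0||//]; last first.
  move=> _ /=; rewrite powRr0 mulr1.
  have -> : (0 < lebesgue_tuple R n [set: n.-tuple (measurableTypeR R)])%E.
    apply: (lt_le_trans mup); apply: le_measure; rewrite ?inE //.
    exact: measurable_tuple_cube.
  set f := (abse \o _).
  rewrite leNgt; apply/negP => hlt.
  have [N [mN muN hN]] := ess_sup_inf.ess_sup_ge (lebesgue_tuple R n) f.
  (* If the essential supremum were below [c], the cube would lie in the null set where it is
     exceeded. *)
  have sub : tuple_cube d `<=` N.
    move=> t ht; apply: hN => /= hle.
    have : (c%:E <= ess_sup_inf.ess_sup (lebesgue_tuple R n) f)%E.
      apply: le_trans hle; rewrite /f /= lee_fin.
      exact: le_trans (Hc t ht) (ler_norm _).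
    by rewrite leNgt hlt.
  have : (lebesgue_tuple R n (tuple_cube d) <= lebesgue_tuple R n N)%E.
    by apply: le_measure => //; rewrite ?inE //; exact: measurable_tuple_cube.
  by rewrite muN leNgt mup.
have rp : 0 < r by [].
have ri : 0 <= r^-1 by rewrite invr_ge0 ltW.
have -> : (c * (2 * d) `^ (n%:R / r))%:E =
   ((c `^ r * (2 * d) ^+ n)%:E `^ r^-1)%E.
  have h : 0 <= (2 * d) ^+ n by apply: exprn_ge0; lra.
  rewrite poweR_EFin (powRM r^-1 (powR_ge0 c r) h).
  rewrite -powRrM mulfV ?gt_eqF // powRr1; last exact: ltW.
  by rewrite -powR_mulrn -?powRrM //; lra.
have I0 : (0 <= \int[lebesgue_tuple R n]_x
   (`|(phi (\row_i tnth x i))%:E| `^ r))%E.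
  by apply: integral_ge0 => x _; exact: poweR_ge0.
apply: gt0_ler_poweR => //.
- rewrite in_itv /= leey andbT lee_fin.
  by rewrite mulr_ge0 ?powR_ge0 //; apply: exprn_ge0; lra.
- by rewrite in_itv /= leey andbT.
rewrite -integral_cube; [|exact: powR_ge0|exact: ltW].
apply: ge0_le_integralT => x.
  by rewrite -EFinM lee_fin mulr_ge0 // powR_ge0.
rewrite indicE; case: (boolP (x \in tuple_cube d)) => hx.
  rewrite -EFinM mulr1 /= lee_fin.
  apply: ge0_ler_powR; rewrite ?nnegrE ?normr_ge0 //; [exact: ltW|exact: ltW|].
  by move: hx; rewrite inE => /Hc /le_trans -> //; exact: ler_norm.
by rewrite -EFinM mulr0; exact: poweR_ge0.
Qed.

(** [phi^r] is dominated by a sum of constants times indicators of full cubes of half side [s 2^k].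
    Full cubes, rather than the shells between them, keep each integral explicit; the series is
    geometric with ratio [2^(n - gamma r)], and [r > n / gamma] makes it converge. *)
Lemma Lq_norm_le (q : \bar R) (gamma : R) :
  0 < gamma -> ((n%:R / gamma)%:E < q)%E ->
  exists2 K : R, 0 < K & forall (phi : 'rV[R]_n -> R) (s C : R),
    0 < s -> 0 < C -> (forall x, 0 <= phi x) ->
    (forall x, phi x <= C * s `^ (- gamma)) ->
    (forall x, 0 < sqn x -> phi x <= C * euclidean_norm x `^ (- gamma)) ->
    (Lq_norm q phi <= (K * C * s `^ (- (gamma - dim_div n q)))%:E)%E.
Proof.
move=> g0; case: q => [r||//]; last first.
  move=> _; exists 1 => // phi s C s0 C0 p0 Hs _.
  rewrite /Lq_norm unlock mul1r /= subr0.
  have Cs0 : 0 <= C * s `^ (- gamma) by rewrite mulr_ge0 ?powR_ge0 ?ltW.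
  case: ifP => _; last by rewrite lee_fin.
  apply/ess_sup_inf.ess_supP; apply: aeW => t /=.
  by rewrite lee_fin ger0_norm.
rewrite lte_fin => hr.
have r0 : 0 < r by apply: le_lt_trans hr; rewrite divr_ge0 // ltW.
have e0 : n%:R - gamma * r < 0.
  by move: hr; rewrite ltr_pdivrMr // subr_lt0 mulrC.
pose th : R := 2 `^ (n%:R - gamma * r).
have th0 : 0 < th by apply: powR_gt0.
have th1 : th < 1.
  rewrite /th /powR; case: ifPn => [/eqP|_]; first by lra.
  by rewrite -[X in _ < X]expR0 ltr_expR nmulr_rlt0 // ln_gt0 //; lra.
pose K := 2 `^ gamma * (2 ^+ n / (1 - th)) `^ r^-1.
have h1 : 0 < 1 - th by lra.
exists K => [|phi s C s0 C0 p0 Hs Hx].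
  by rewrite /K mulr_gt0 ?powR_gt0 ?divr_gt0 ?exprn_gt0.
pose a k := (C * 2 `^ gamma * (s * 2 ^+ k) `^ (- gamma)) `^ r.
have sk0 k : 0 < s * 2 ^+ k by rewrite mulr_gt0 ?exprn_gt0.
have a0 k : 0 <= a k by exact: powR_ge0.
pose F k (t : n.-tuple (measurableTypeR R)) : \bar R :=
  ((a k)%:E * (\1_(tuple_cube (s * 2 ^+ k)) t)%:E)%E.
have F0 k t : (0 <= F k t)%E by rewrite /F -EFinM lee_fin mulr_ge0.
have dom t : (`|(phi (\row_i tnth t i))%:E| `^ r <= \sum_(0 <= k <oo) F k t)%E.
  set x := \row_i tnth t i.
  (* [k] is the least index whose cube contains the point. If [k > 0], some coordinate exceeds half
     the half side; this halving is the factor [2^gamma] in [a]. *)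
  have [k hk1 hk2] : exists2 k, tuple_cube (s * 2 ^+ k) t &
      phi x <= C * 2 `^ gamma * (s * 2 ^+ k) `^ (- gamma).
    have ex : exists k, [forall i, `|tnth t i| <= s * 2 ^+ k].
      pose M := \sum_i `|tnth t i| / s.
      have M0 : 0 <= M by apply: sumr_ge0 => i _; rewrite divr_ge0 // ltW.
      exists (Num.bound M); apply/forallP => i.
      rewrite mulrC -ler_pdivrMr //.
      apply: (@le_trans _ _ M).
        rewrite /M (bigD1 i) //= lerDl; apply: sumr_ge0 => j _.
        by rewrite divr_ge0 // ltW.
      apply: (le_trans (ltW (archi_boundP M0))).
      by rewrite -natrX ler_nat ltnW // ltn_expl.
    case: (ex_minnP ex) => -[|k] /forallP hk kmin.
      exists 0%N.
        by move=> i; rewrite /= in_itv /= -ler_norml; exact: hk.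
      rewrite expr0 mulr1; apply: (le_trans (Hs x)).
      rewrite ler_wpM2r ?powR_ge0 // ler_peMr //; first exact: ltW.
      by have := ler_powR (ler1n R 2) (ltW g0); rewrite powRr0.
    exists k.+1.
      by move=> i; rewrite /= in_itv /= -ler_norml; exact: hk.
    have : ~~ [forall i, `|tnth t i| <= s * 2 ^+ k].
      by apply/negP => /kmin; rewrite ltnn.
    rewrite negb_forall => /existsP [i]; rewrite -ltNge => hi.
    have hn : s * 2 ^+ k <= euclidean_norm x.
      apply: (le_trans (ltW hi)); have := coord_le_euclidean x i.
      by rewrite mxE.
    have xp : 0 < sqn x.
      by rewrite -euclidean_normE exprn_gt0 // (lt_le_trans _ hn).
    apply: (le_trans (Hx x xp)).
    have -> : C * 2 `^ gamma * (s * 2 ^+ k.+1) `^ (- gamma) =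
        C * (s * 2 ^+ k) `^ (- gamma).
      rewrite exprSr mulrA (powRM (- gamma) (ltW (sk0 k)) (ler0n R 2)).
      rewrite (powRN 2 gamma).
      have hp : 2 `^ gamma != 0 :> R by rewrite gt_eqF // powR_gt0.
      by field.
    rewrite ler_pM2l //; exact: powR_anti (ltW g0) (sk0 k) hn.
  apply: (@le_trans _ _ (F k t)).
    rewrite /F indicE mem_set // mule1 /= lee_fin ger0_norm //.
    apply: ge0_ler_powR; rewrite ?nnegrE //; first exact: ltW.
    exact: le_trans (p0 x) hk2.
  apply: (@le_trans _ _ (\sum_(0 <= i < k.+1) F i t)%E); last first.
    exact: nneseries_lim_ge.
  rewrite big_nat_recr //= leeDr //; exact: sume_ge0.
pose B := (C * 2 `^ gamma) `^ r * 2 ^+ n * s `^ (n%:R - gamma * r).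
have B0 : 0 <= B by rewrite /B !mulr_ge0 ?powR_ge0 ?exprn_ge0.
have aE k : a k * (2 * (s * 2 ^+ k)) ^+ n = B * th ^+ k.
  have h0 : 0 <= C * 2 `^ gamma by rewrite mulr_ge0 ?powR_ge0 ?ltW.
  rewrite /a (powRM r h0 (powR_ge0 _ _)) exprMn -powRrM.
  rewrite -(powR_mulrn n (ltW (sk0 k))) mulrACA -powRD; last first.
    by apply/implyP => _; rewrite gt_eqF.
  have -> : - gamma * r + n%:R = n%:R - gamma * r by ring.
  have k2 : 0 <= (2 : R) ^+ k by apply: exprn_ge0.
  rewrite (powRM _ (ltW s0) k2) -(powR_mulrn k (ler0n R 2)) -powRrM.
  rewrite (mulrC k%:R) powRrM (powR_mulrn k (ltW th0)) /B.
  by rewrite -/th; ring.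
have total : (\int[lebesgue_tuple R n]_t (`|(phi (\row_i tnth t i))%:E| `^ r)
    <= (B / (1 - th))%:E)%E.
  apply: (le_trans (ge0_le_integralT _ _ _ (lebesgue_tuple R n) _ _
    (fun t => poweR_ge0 _ _) dom)).
  rewrite integral_nneseries //; last first.
    move=> k; apply: emeasurable_funM => //.
    apply/measurable_realfun.measurable_EFinP.
    exact: measurable_realfun.measurable_indic (measurable_tuple_cube _).
  apply: lime_le.
    by apply: is_cvg_nneseries => k _ _; apply: integral_ge0 => t _.
  apply: nearW => m.
  rewrite (eq_bigr (fun k => (B * th ^+ k)%:E)); last first.
    by move=> k _; rewrite /F integral_cube ?aE // ltW.
  rewrite sumEFin lee_fin -mulr_sumr ler_wpM2l // big_mkord.
  rewrite -[leRHS]mul1r ler_pdivlMr //.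
  have := subrX1 th m; have := exprn_ge0 m (ltW th0).
  set S := \sum_(i < m) _; move: (th ^+ m) => y hy E.
  have -> : S * (1 - th) = - ((th - 1) * S) by ring.
  by rewrite -E; lra.
rewrite /Lq_norm unlock /=.
have -> : K * C * s `^ (- (gamma - n%:R / r)) = (B / (1 - th)) `^ r^-1.
  have -> : B / (1 - th) =
      (C * 2 `^ gamma) `^ r * (2 ^+ n / (1 - th)) * s `^ (n%:R - gamma * r).
    by rewrite /B; field; lra.
  have hA : 0 <= (C * 2 `^ gamma) `^ r by exact: powR_ge0.
  have hD : 0 <= 2 ^+ n / (1 - th) by rewrite divr_ge0 ?exprn_ge0 ?ltW.
  have hS : 0 <= s `^ (n%:R - gamma * r) by exact: powR_ge0.
  rewrite (powRM r^-1 (mulr_ge0 hA hD) hS) (powRM r^-1 hA hD) -!powRrM.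
  rewrite mulfV ?gt_eqF // powRr1; last by rewrite mulr_ge0 ?powR_ge0 ?ltW.
  have -> : (n%:R - gamma * r) / r = - (gamma - n%:R / r) by field; rewrite gt_eqF.
  by rewrite /K; ring.
rewrite -poweR_EFin; apply: gt0_ler_poweR => //.
- by rewrite invr_ge0 ltW.
- rewrite in_itv /= leey andbT.
  by apply: integral_ge0 => t _; rewrite lee_fin; exact: powR_ge0.
- by rewrite in_itv /= leey andbT lee_fin divr_ge0 // ltW.
Qed.

End LqNorms.

Theorem theorem1p6 (R : realType) (n : nat) (p : R) (u0 : 'rV[R]_n -> R)
    (u : 'rV[R]_n -> R -> R)
    (n_ge1 : (1 <= n)%N) (p_ge1 : 1 <= p)
    (u0_cont : continuous u0) (u0_bounded : (Lq_norm +oo u0 < +oo)%E)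
    (u0_pos : forall x, 0 < u0 x)
    (u_min : minimal_solution p u0 u) :
  (forall C0 gamma : R, 0 < C0 -> 0 < gamma ->
     (forall x, C0 * (1 + euclidean_norm x) `^ (- gamma) <= u0 x) ->
     forall q : \bar R, ((n%:R / gamma)%:E < q)%E ->
     exists2 C : R, 0 < C &
       forall t : R, 1 < t ->
         ((C * t `^ (- (gamma - dim_div n q) / (p * gamma + 2)))%:E
            <= Lq_norm q (u ^~ t))%E)
  /\
  (1 < p ->
   forall C1 gamma : R, 0 < gamma -> 0 < C1 ->
     (forall x, u0 x <= C1 * (1 + euclidean_norm x) `^ (- gamma)) ->
     forall q : \bar R, ((n%:R / gamma)%:E < q)%E ->
     exists2 C : R, 0 < C &
       forall t : R, 0 < t ->
         (Lq_norm q (u ^~ t)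
            <= (C * t `^ (- (gamma - dim_div n q) / (p * gamma + 2)))%:E)%E).

Proof.
have n0 : (0 < n)%N := n_ge1.
have num gamma : 0 < gamma -> 0 < p * gamma + 2.
  by move=> g0; rewrite ltr_wpDl // mulr_ge0 ?ltW // (lt_le_trans _ p_ge1).
split=> [C0 gamma C00 g0 hC q hq|p1 C1 gamma g0 C10 hC q hq].
  have d0 := num gamma g0.
  have q0 : (0 < q)%E.
    by apply: le_lt_trans hq; rewrite lee_fin divr_ge0 // ltW.
  have [c c0 hc] := @lower_decay R n p gamma C0 u0 u n0 p_ge1 u0_pos
    (proj1 u_min) g0 C00 hC.
  have nR : 0 < n%:R :> R by rewrite ltr0n.
  exists (c * (2 / n%:R) `^ dim_div n q); first by rewrite mulr_gt0 ?powR_gt0 ?divr_gt0.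
  move=> t t1; pose s := t `^ (p * gamma + 2)^-1.
  have t0 : 0 < t by lra.
  have s0 : 0 < s by apply: powR_gt0.
  have sE a : s `^ a = t `^ (a / (p * gamma + 2)).
    by rewrite -powRrM mulrC.
  have A0 : 0 < c * s `^ (- gamma) by rewrite mulr_gt0 ?powR_gt0.
  (* The cube of half side [s / n] lies in the Euclidean ball of radius [s] on which [lower_decay]
     holds. *)
  have D0 : 0 < s / n%:R by rewrite divr_gt0.
  have /= := @Lq_norm_ge R n q (u ^~ t) _ _ q0 A0 D0.
  have -> : c * s `^ (- gamma) * (2 * (s / n%:R)) `^ dim_div n q =
      c * (2 / n%:R) `^ dim_div n q * t `^ (- (gamma - dim_div n q) / (p * gamma + 2)).
    have -> : 2 * (s / n%:R) = (2 / n%:R) * s by ring.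
    rewrite powRM; [|by rewrite divr_ge0|exact: ltW].
    rewrite -sE opprB powRD; last by apply/implyP => _; rewrite gt_eqF.
    by ring.
  apply=> x hx; rewrite sE mulNr; apply: hc => //.
  apply: (@le_trans _ _ (\sum_(i < n) (s / n%:R) ^+ 2)).
    apply: ler_sum => i _; rewrite -real_normK ?num_real //.
    by rewrite lerXn2r ?nnegrE // ltW.
  rewrite sumr_const card_ord -[leLHS]mulr_natr expr_div_n -/s.
  have -> : s ^+ 2 / n%:R ^+ 2 * n%:R = s ^+ 2 / n%:R by field; rewrite gt_eqF.
  by rewrite ler_pdivrMr // ler_peMr ?sqr_ge0 // ler1n.
have d0 := num gamma g0.
have [C C0 hu] := @upper_decay R n p gamma C1 u0 u n0 p1 u0_cont u0_pos u_min g0 C10 hC.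
have [K K0 hK] := @Lq_norm_le R n q gamma g0 hq.
exists (K * C); first by rewrite mulr_gt0.
move=> t t0; pose s := t `^ (p * gamma + 2)^-1.
have s0 : 0 < s by apply: powR_gt0.
have sE a : s `^ a = t `^ (a / (p * gamma + 2)).
  by rewrite -powRrM mulrC.
rewrite -sE; apply: hK => //.
- move=> x; case: u_min => -[up _ _ _ _] _.
  by apply: ltW; apply: up; rewrite ?ltry // ltW.
- by move=> x; rewrite sE mulNr; case: (hu x t t0).
- by move=> x; case: (hu x t t0).
Qed.
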